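(* Let $\Omega\subseteq\mathbb{R}^2$ be a nonempty open set and let $f\in\mathcal{D}'(\Omega)$ be a real-valued distribution. For $k\in\mathbb{R}$ define $$\Lambda_1(k):=\{(x_0,(r,rs_0)): x_0\in\Omega,\ s_0\in(-2,2),\ r\in\mathbb{R}\setminus\{0\},\ |\mathcal{SH}_\psi f(a,s,t)|=\mathcal{O}(a^k)\text{ as }a\to0^+\text{ uniformly when }(s,t)\text{ is near }(s_0,x_0)\},$$ $$\Lambda_2(k):=\{(x_0,(rs_0,r)): x_0\in\Omega,\ s_0\in(-2,2),\ r\in\mathbb{R}\setminus\{0\},\ |\mathcal{SH}^{(v)}_\psi f(a,s,t)|=\mathcal{O}(a^k)\text{ as }a\to0^+\text{ uniformly when }(s,t)\text{ is near }(s_0,x_0)\},$$ and $\Lambda_j(\infty):=\big(\bigcap_{k\in\mathbb{N}}\Lambda_j(k)\big)^{\mathrm o}$ for $j=1,2$, where $E^{\mathrm o}$ denotes the interior of $E$. Then $$\Lambda_1(m+1+\epsilon)\cup\Lambda_2(m+1+\epsilon)\subseteq \mathrm{WF}_m(f)^c\qquad\text{for all } m\in\mathbb{R},\ \epsilon>0,$$ and $$\mathrm{WF}(f)^c=\Lambda_1(\infty)\cup\Lambda_2(\infty).$$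
   Context: Notation. $\mathcal{D}(\Omega)$ is the space of compactly supported $C^\infty$ functions on $\Omega$ and $\mathcal{D}'(\Omega)$ its dual. Complements and interiors are taken in $\Omega\times(\mathbb{R}^2\setminus\{0\})$. The Fourier transform is $\widehat f(\xi)=\int f(x)e^{-2\pi i x\cdot\xi}dx$, extended to tempered distributions. $\mathrm{Arg}(\xi)$ is the principal angle of $\xi\in\mathbb{R}^2\setminus\{0\}$, identified with a complex number. Shearlets. Fix $\psi_1,\psi_2$ with: (C1) $\psi_1\in L^2(\mathbb{R})$, $\int_0^\infty|\widehat{\psi_1}(a)|^2\frac{da}{a}=\int_0^\infty|\widehat{\psi_1}(-a)|^2\frac{da}{a}=1$, $\widehat{\psi_1}\in\mathcal{D}(\mathbb{R})$, $\operatorname{supp}\widehat{\psi_1}\subseteq[-2,-\frac12]\cup[\frac12,2]$; (C2) $\|\widehat{\psi_2}\|_{L^2}=1$, $\widehat{\psi_2}\in\mathcal{D}(\mathbb{R})$, $\operatorname{supp}\widehat{\psi_2}\subseteq[-1,1]$. Define $\psi\in L^2(\mathbb{R}^2)$ by $\widehat\psi(\xi_1,\xi_2)=\widehat{\psi_1}(\xi_1)\widehat{\psi_2}(\xi_2/\xi_1)$ for $\xi_1\ne0$. For $a>0$, $s\in\mathbb{R}$, $t\in\mathbb{R}^2$ let $M_{as}:=\begin{bmatrix}a&-\sqrt a\,s\\0&\sqrt a\end{bmatrix}$ and $\psi_{ast}:=a^{-3/4}\psi(M_{as}^{-1}(\cdot-t))$ (a Schwartz function). With $J(x,y):=(y,x)$,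 let $\psi^{(v)}_{ast}:=a^{-3/4}\psi(M_{as}^{-1}J(\cdot-t))$. The horizontal and vertical continuous shearlet transforms of a tempered distribution $f$ are $\mathcal{SH}_\psi f(a,s,t):=\langle f,\psi_{ast}\rangle$ and $\mathcal{SH}^{(v)}_\psi f(a,s,t):=\langle f,\psi^{(v)}_{ast}\rangle$, where $\langle\cdot,\cdot\rangle$ is the (sesquilinear) pairing extending the $L^2$ inner product, conjugate-linear in the second argument. If $f\in\mathcal{D}'(\Omega)$ cannot be regarded as a tempered distribution on $\mathbb{R}^2$, then in the shearlet transforms near $x_0$ it is understood to be replaced by $\varphi f$, where $\varphi\in\mathcal{D}(\Omega)$ takes value $1$ in a neighborhood of $x_0$. Decay. $|\mathcal{SH}_\psi f(a,s,t)|=\mathcal{O}(a^k)$ as $a\to0^+$ uniformly when $(s,t)$ is near $(s_0,x_0)$ means: there exist $r_0>0$ and $C>0$ such that $|\mathcal{SH}_\psi f(a,s,t)|\le Ca^k$ for all $a\in(0,r_0)$, $|s-s_0|<r_0$, $|t-x_0|<r_0$; similarly for $\mathcal{SH}^{(v)}_\psi$. Wavefront sets. A point $x_0\in\Omega$ is not in $\operatorname{sing\,supp}(f)$ if there is $\varphi\in\mathcal{D}(\Omega)$ with $\varphi=1$ near $x_0$ and $\varphi f\in C^\infty(\Omega)$. For $\xi_0\in\mathbb{R}^2\setminus\{0\}$, $0<\epsilon<\pi/2$ let $V_{\xi_0,\epsilon}:=\{(r\cos\theta,r\sin\theta): r>0,\ |\theta-\mathrm{Arg}(\xi_0)|<\epsilon\}$.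 The sets $\mathrm{WF}(f)$ and $\mathrm{WF}_m(f)$ consist of points $(x_0,\xi_0)$ with $x_0\in\operatorname{sing\,supp}(f)$, $\xi_0\in\mathbb{R}^2\setminus\{0\}$. For such a point: $(x_0,\xi_0)\notin\mathrm{WF}(f)$ iff there exist $\varphi\in\mathcal{D}(\Omega)$ with $\varphi=1$ near $x_0$ and $0<\epsilon<\pi/2$ with $\sup_{\xi\in V_{\xi_0,\epsilon}}(1+|\xi|)^N|\widehat{\varphi f}(\xi)|<\infty$ for all $N\in\mathbb{N}\cup\{0\}$; $(x_0,\xi_0)\notin\mathrm{WF}_m(f)$ iff there exist such $\varphi,\epsilon$ with $\int_{V_{\xi_0,\epsilon}}(1+|\xi|^2)^m|\widehat{\varphi f}(\xi)|^2d\xi<\infty$. *)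

(* Defs.v *)
From mathcomp Require Import all_boot all_order all_algebra.
From mathcomp Require Import all_classical all_reals all_analysis.
From mathcomp Require Import complex.
Set Implicit Arguments.
Unset Strict Implicit.
Unset Printing Implicit Defensive.
Import Order.TTheory GRing.Theory Num.Theory.
Import numFieldNormedType.Exports.
Local Open Scope classical_set_scope.
Local Open Scope ring_scope.
Local Open Scope complex_scope.

Notation plane R := (R * R)%type (only parsing).
Notation cabs := ComplexField.Normc.normc.

(* A functional is total on all functions plane R -> C; only its values on
   test (resp. Schwartz) functions are ever constrained. *)
Notation functional R := ((plane R -> R[i]) -> R[i]).

Section Smoothness.
Context {R : realType}.

(* Iterated directional derivatives of the real function h. *)
Definition dirD (V : normedModType R) (w : seq V) (h : V -> R) : V -> R :=
  foldr (fun v k => 'D_v k) h w.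

Definition cdirD (V : normedModType R) (w : seq V) (g : V -> R[i]) (x : V)
    : R[i] :=
  dirD w (fun y => complex.Re (g y)) x +i* dirD w (fun y => complex.Im (g y)) x.

(* C^infinity on the open set U: all iterated directional derivatives exist
   and are (Frechet) differentiable, hence continuous, on U. *)
Definition smooth_on (V : normedModType R) (U : set V) (g : V -> R[i]) :=
  forall (w : seq V) (x : V), U x ->
    differentiable (dirD w (fun y => complex.Re (g y))) x /\
    differentiable (dirD w (fun y => complex.Im (g y))) x.

Definition support_of (V : normedModType R) (g : V -> R[i]) : set V :=
  closure [set x | g x != 0].

(* D(U), each function being extended by 0 outside U. *)
Definition test_fun (V : normedModType R) (U : set V) (g : V -> R[i]) :=
  [/\ smooth_on setT g, compact (support_of g) & support_of g `<=` U].

Definition schwartz (V : normedModType R) (g : V -> R[i]) :=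
  smooth_on setT g /\
  forall (N : nat) (w : seq V), exists C : R, forall x : V,
    (1 + `|x|) ^+ N * cabs (cdirD w g x) <= C.

End Smoothness.

Section Fourier.
Context {R : realType}.

Definition Cint d (T : measurableType d) (mu : {measure set T -> \bar R})
    (D : set T) (g : T -> R[i]) : R[i] :=
  (\int[mu]_(x in D) complex.Re (g x)) +i*
  (\int[mu]_(x in D) complex.Im (g x)).

Definition expi (y : R) : R[i] := cos y +i* sin y.

Definition fourier d (T : measurableType d) (mu : {measure set T -> \bar R})
    (dot : T -> T -> R) (g : T -> R[i]) (xi : T) : R[i] :=
  Cint mu setT (fun x => g x * expi (- (2 * pi * dot x xi))).

Definition in_L2 d (T : measurableType d) (mu : {measure set T -> \bar R})
    (g : T -> R[i]) :=
  [/\ measurable_fun setT (fun x => complex.Re (g x)),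
      measurable_fun setT (fun x => complex.Im (g x)) &
      ('N[mu]_(2%:E)[(fun x => (cabs (g x))%:E)] < +oo)%E].

Definition leb1 : {measure set (measurableTypeR R) -> \bar R} :=
  @lebesgue_measure R.
Definition leb2 :
    {measure set (measurableTypeR R * measurableTypeR R) -> \bar R} :=
  (@lebesgue_measure R \x @lebesgue_measure R)%E.

Definition dot1 (x y : R) : R := x * y.
Definition dot2 (x y : plane R) : R := x.1 * y.1 + x.2 * y.2.
Definition enorm (x : plane R) : R := Num.sqrt (dot2 x x).

(* The Fourier transform of the tempered distribution u is (given by) the
   function F:  <u, eta^> = <F, eta> (bilinear pairings) for all Schwartz eta. *)
Definition fourier_is1 (u : (R -> R[i]) -> R[i]) (F : R -> R[i]) :=
  forall eta : R -> R[i], schwartz eta ->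
    u (fourier leb1 dot1 eta) = Cint leb1 setT (fun x => F x * eta x).

Definition fourier_is2 (u : functional R) (F : plane R -> R[i]) :=
  forall eta : plane R -> R[i], schwartz eta ->
    u (fourier leb2 dot2 eta) = Cint leb2 setT (fun x => F x * eta x).

Definition Ccontinuous (F : plane R -> R[i]) :=
  continuous (fun x => complex.Re (F x)) /\
  continuous (fun x => complex.Im (F x)).

End Fourier.

Section Distributions.
Context {R : realType}.
Implicit Types (Omega : set (plane R)) (u f : functional R).

Definition pderiv (i j : nat) : (plane R -> R[i]) -> plane R -> R[i] :=
  cdirD (nseq i ((1, 0) : plane R) ++ nseq j ((0, 1) : plane R)).

Definition linear_on (S : set (plane R -> R[i])) u :=
  forall (c : R[i]) (eta zeta : plane R -> R[i]), S eta -> S zeta ->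
    u (fun x => c * eta x + zeta x) = c * u eta + u zeta.

(* Continuity is expressed by seminorm estimates; "forall B, (... <= B) ->"
   says that u eta is at most C times the maximum of the suprema. *)
Definition is_distribution Omega u :=
  linear_on (test_fun Omega) u /\
  forall K : set (plane R), compact K -> K `<=` Omega ->
  exists (C : R) (N : nat), 0 <= C /\
    forall eta, test_fun Omega eta -> support_of eta `<=` K ->
    forall B : R,
      (forall i j x, (i + j <= N)%N -> cabs (pderiv i j eta x) <= B) ->
      cabs (u eta) <= C * B.

Definition tempered u :=
  linear_on (@schwartz R _) u /\
  exists (C : R) (N : nat), 0 <= C /\
    forall eta, schwartz eta ->
    forall B : R,
      (forall i j x, (i + j <= N)%N ->
         (1 + enorm x) ^+ N * cabs (pderiv i j eta x) <= B) ->
      cabs (u eta) <= C * B.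

Definition real_valued Omega u :=
  forall eta, test_fun Omega eta -> (forall x, complex.Im (eta x) = 0) ->
    complex.Im (u eta) = 0.

(* For phi in D(Omega) and f in D'(Omega), phi f is defined on every smooth
   function on the plane, and is in particular a tempered distribution. *)
Definition mul_dist (phi : plane R -> R[i]) f : functional R :=
  fun eta => f (fun x => phi x * eta x).

(* Sesquilinear pairing; u itself is linear in its argument. *)
Definition pairing u (eta : plane R -> R[i]) : R[i] := u (fun x => (eta x)^*).

Definition cutoff Omega (x0 : plane R) (phi : plane R -> R[i]) :=
  test_fun Omega phi /\ \forall x \near x0, phi x = 1.

Definition tempered_extension Omega f u :=
  tempered u /\ forall eta, test_fun Omega eta -> u eta = f eta.

(* F x0 is the tempered distribution that stands for f in the shearlet
   transforms near x0: one and the same tempered extension of f if f has any,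
   otherwise a localization phi f with phi = 1 near x0, phi depending on x0. *)
Definition shearlet_reading Omega f (F : plane R -> functional R) :=
  (exists2 u, tempered_extension Omega f u &
     forall x0, Omega x0 -> F x0 = u) \/
  (~ (exists u, tempered_extension Omega f u) /\
   forall x0, Omega x0 ->
     exists2 phi, cutoff Omega x0 phi & F x0 = mul_dist phi f).

End Distributions.

Section Wavefront.
Context {R : realType}.
Implicit Types (Omega : set (plane R)) (f : functional R).

Definition phase_space Omega : set (plane R * plane R) :=
  [set p | Omega p.1 /\ p.2 != 0].

Definition sing_supp Omega f : set (plane R) :=
  [set x0 | Omega x0 /\
    ~ exists2 phi, cutoff Omega x0 phi &
        exists2 g, smooth_on Omega g &
          forall eta, test_fun Omega eta ->
            mul_dist phi f eta = Cint leb2 Omega (fun x => g x * eta x)].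

(* Principal argument, in ]-pi, pi]. *)
Definition Arg (xi : plane R) : R :=
  if 0 <= xi.2 then acos (xi.1 / enorm xi) else - acos (xi.1 / enorm xi).

Definition cone (xi0 : plane R) (eps : R) : set (plane R) :=
  [set xi | exists r theta : R,
    [/\ 0 < r, `|theta - Arg xi0| < eps & xi = (r * cos theta, r * sin theta)]].

(* The pointwise values of the Fourier transform of phi f are those of the
   continuous function F that represents it. *)
Definition microlocally Omega f (P : set (plane R) -> (plane R -> R[i]) -> Prop)
    (x0 xi0 : plane R) :=
  exists (phi : plane R -> R[i]) (eps : R) (F : plane R -> R[i]),
    [/\ cutoff Omega x0 phi, 0 < eps < pi / 2, Ccontinuous F,
        fourier_is2 (mul_dist phi f) F & P (cone xi0 eps) F].

Definition rapid_decay (V : set (plane R)) (F : plane R -> R[i]) :=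
  forall N : nat, exists C : R, forall xi, V xi ->
    (1 + enorm xi) ^+ N * cabs (F xi) <= C.

Definition sobolev_decay (m : R) (V : set (plane R)) (F : plane R -> R[i]) :=
  (\int[leb2]_(xi in V)
     (((1 + enorm xi ^+ 2) `^ m * cabs (F xi) ^+ 2)%R)%:E < +oo)%E.

Definition WF Omega f : set (plane R * plane R) :=
  [set p | [/\ sing_supp Omega f p.1, p.2 != 0 &
               ~ microlocally Omega f rapid_decay p.1 p.2]].

Definition WFm (m : R) Omega f : set (plane R * plane R) :=
  [set p | [/\ sing_supp Omega f p.1, p.2 != 0 &
               ~ microlocally Omega f (sobolev_decay m) p.1 p.2]].

End Wavefront.

Section Shearlets.
Context {R : realType}.
Implicit Types (Omega : set (plane R)) (psi : plane R -> R[i]).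

(* psi1h, psi2h are the Fourier transforms of psi1, psi2; psi is the continuous
   representative of its L^2 class.  The value of x.2 / x.1 at x.1 = 0 plays no
   role, psi1h vanishing there. *)
Record shearlet_generator (psi1 psi1h psi2 psi2h : R -> R[i]) psi : Prop := {
  sg_psi1_L2 : in_L2 leb1 psi1 ;
  sg_psi1_fourier :
    fourier_is1 (fun eta => Cint leb1 setT (fun x => psi1 x * eta x)) psi1h ;
  sg_psi1h_test : test_fun setT psi1h ;
  sg_psi1h_supp : support_of psi1h `<=` `[-2, - 2^-1] `|` `[2^-1, 2] ;
  sg_psi1h_pos :
    (\int[leb1]_(a in `]0%R, +oo[) ((cabs (psi1h a) ^+ 2 / a)%R)%:E = 1)%E ;
  sg_psi1h_neg :
    (\int[leb1]_(a in `]0%R, +oo[) ((cabs (psi1h (- a)) ^+ 2 / a)%R)%:E = 1)%E ;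
  sg_psi2_L2 : in_L2 leb1 psi2 ;
  sg_psi2_fourier :
    fourier_is1 (fun eta => Cint leb1 setT (fun x => psi2 x * eta x)) psi2h ;
  sg_psi2h_test : test_fun setT psi2h ;
  sg_psi2h_supp : support_of psi2h `<=` `[-1, 1] ;
  sg_psi2h_norm : ('N[leb1]_(2%:E)[(fun x => (cabs (psi2h x))%:E)] = 1)%E ;
  sg_psi_L2 : in_L2 leb2 psi ;
  sg_psi_continuous : Ccontinuous psi ;
  sg_psi_fourier :
    fourier_is2 (fun eta => Cint leb2 setT (fun x => psi x * eta x))
                (fun xi => psi1h xi.1 * psi2h (xi.2 / xi.1))
}.

Definition Mas (a s : R) : 'M[R]_2 :=
  \matrix_(i < 2, j < 2)
    (if (i == 0) && (j == 0) then a
     else if (i == 0) && (j == 1) then - (Num.sqrt a * s)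
     else if (i == 1) && (j == 1) then Num.sqrt a else 0).

Definition mxapp (A : 'M[R]_2) (x : plane R) : plane R :=
  let v := A *m (\col_(i < 2) if i == 0 then x.1 else x.2) in (v 0 0, v 1 0).

Definition Jswap (x : plane R) : plane R := (x.2, x.1).

Definition psi_ast psi (a s : R) (t : plane R) : plane R -> R[i] := fun x =>
  (a `^ (- (3 / 4)))%:C * psi (mxapp (invmx (Mas a s)) (x - t)).

Definition psi_ast_v psi (a s : R) (t : plane R) : plane R -> R[i] := fun x =>
  (a `^ (- (3 / 4)))%:C * psi (mxapp (invmx (Mas a s)) (Jswap (x - t))).

Definition SH psi (u : functional R) (a s : R) (t : plane R) : R[i] :=
  pairing u (psi_ast psi a s t).

Definition SHv psi (u : functional R) (a s : R) (t : plane R) : R[i] :=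
  pairing u (psi_ast_v psi a s t).

(* T(a, s, t) = O(a^k) as a -> 0+, uniformly for (s, t) near (s0, x0). *)
Definition decays (T : R -> R -> plane R -> R[i]) (k s0 : R) (x0 : plane R) :=
  exists r0 C : R, [/\ 0 < r0, 0 < C &
    forall (a s : R) (t : plane R), 0 < a < r0 -> `|s - s0| < r0 ->
      enorm (t - x0) < r0 -> cabs (T a s t) <= C * a `^ k].

Definition Lambda1 psi Omega (F : plane R -> functional R) (k : R)
    : set (plane R * plane R) :=
  [set p | exists (x0 : plane R) (s0 r : R),
    [/\ Omega x0, -2 < s0 < 2, r != 0, p = (x0, (r, r * s0)) &
        decays (SH psi (F x0)) k s0 x0]].

Definition Lambda2 psi Omega (F : plane R -> functional R) (k : R)
    : set (plane R * plane R) :=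
  [set p | exists (x0 : plane R) (s0 r : R),
    [/\ Omega x0, -2 < s0 < 2, r != 0, p = (x0, (r * s0, r)) &
        decays (SHv psi (F x0)) k s0 x0]].

(* Every Lambda k to which this is applied lies in the phase space, which is
   open, so the ambient interior is the interior relative to it. *)
Definition Lambda_infty (Lambda : R -> set (plane R * plane R))
    : set (plane R * plane R) :=
  interior (\bigcap_(k in [set k : nat | (0 < k)%N]) Lambda k%:R).

End Shearlets.

(* Main.v *)
(* Near [x0] the distribution [f] may be replaced by [phi f], whose Fourier transform is the function
   [Phi f phi xi = f (phi * ew xi)] of polynomial growth. The shearlet transform then becomes an integral of
   [Phi] against the Fourier transform of a shearlet, which is supported where [|xi| ~ 1 / a] and the slope of
   [xi] is within [sqrt a] of [s]; replacing [f] by [phi f] costs [O (a ^ k)] for every [k].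

   If [Phi] decays rapidly in a cone, its opposite also does since [f] is real, and the shearlet transform is
   [O (a ^ k)] for every [k] and all slopes in a smaller cone. Conversely, let the transform be [O (a ^ k)] near
   [(s0, x0)]. By Plancherel in [t], after multiplication by a cut-off [tau], the functions
   [hpsihat (MT a s xi) * Phi f tau xi] are small in L^2, up to a commutator of relative size [sqrt a]. Summing
   over a grid of scales and slopes bounds the L^2 norm of [(1 + |xi|) ^ (p / 2) * Phi f tau] in a cone by the
   corresponding norm for [p - 1] in a larger cone, as long as [p < 2 k - 2]; iterating gives [p = 2 m] when
   [k > m + 1]. If this holds for all [k], uniformly by compactness, all these norms are finite and one more
   convolution turns them into rapid decay. *)

From HB Require Import structures.
Require Import Defs.
From mathcomp Require Import all_boot all_order all_algebra.
From mathcomp Require Import all_classical all_reals all_analysis.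
From mathcomp Require Import complex.
From mathcomp Require Import measurable_realfun ring lra.
Set Implicit Arguments.
Unset Strict Implicit.
Unset Printing Implicit Defensive.
Import Order.TTheory GRing.Theory Num.Theory.
Import numFieldNormedType.Exports.
Local Open Scope classical_set_scope.
Local Open Scope ring_scope.
Local Open Scope complex_scope.
Local Notation "z ^*" := (conjc z) : ring_scope.

(** * Complex-valued functions and integrals *)

Notation Re := complex.Re.
Notation Im := complex.Im.

Section ComplexBasics.
Context {R : realType}.
Implicit Types (z w : R[i]) (x y : R).

(** No reproducing formula is used. The converse rests on a lower bound: every frequency of a cone
    meets some [(a, s)] of a grid at which [hpsihat (MT b a s xi)] is bounded away from zero. The
    threshold [m + 1] is a count of powers of [a] at frequencies of size [1 / a]: [2 k] from the
    squared decay, [- p] from the weight, [- 3 / 2] from the squared normalization and [- 1 / 2]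
    from the number of slopes at mesh [sqrt a]; the sum [2 k - p - 2] must be positive at [p = 2 m].
    The commutator gains [sqrt a] in amplitude, hence one power of the frequency in the square,
    which fixes the step of the iteration. The radius in the decay condition may shrink as [k]
    grows. The interior in [Lambda_infty] provides one neighbourhood for all [k], and a compact box
    in it provides one constant for each [k]. A shearlet sees a frequency and its opposite at once,
    so its decay requires both cones; the converse treats each sign separately, [psi1h] being
    nonzero somewhere on each half-line. The exchange of a functional with a Fourier integral is
    proved once, for abstract functionals; it also yields the multiplication formula, hence
    inversion and Plancherel. *)

Lemma Re_add z w : Re (z + w) = Re z + Re w. Proof. by case: z; case: w. Qed.
Lemma Im_add z w : Im (z + w) = Im z + Im w. Proof. by case: z; case: w. Qed.
Lemma Re_opp z : Re (- z) = - Re z. Proof. by case: z. Qed.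
Lemma Im_opp z : Im (- z) = - Im z. Proof. by case: z. Qed.
Lemma Re_mul z w : Re (z * w) = Re z * Re w - Im z * Im w.
Proof. by case: z; case: w. Qed.
Lemma Im_mul z w : Im (z * w) = Re z * Im w + Im z * Re w.
Proof. by case: z; case: w. Qed.
Lemma Re_conj z : Re (z^*) = Re z. Proof. by case: z. Qed.
Lemma Im_conj z : Im (z^*) = - Im z. Proof. by case: z. Qed.
Lemma complex_ext z w : Re z = Re w -> Im z = Im w -> z = w.
Proof. by case: z; case: w => a b c d /= -> ->. Qed.

Definition reimE := (Re_add, Im_add, Re_opp, Im_opp, Re_mul, Im_mul, Re_conj,
  Im_conj).

Lemma conjcM z w : (z * w)^* = z^* * w^*.
Proof. by apply: complex_ext; rewrite !reimE; ring. Qed.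
Lemma conjcD z w : (z + w)^* = z^* + w^*.
Proof. by apply: complex_ext; rewrite !reimE; ring. Qed.
Lemma conjc_real x : (x%:C)^* = x%:C :> R[i].
Proof. by apply: complex_ext; rewrite /= ?oppr0. Qed.
Lemma conjc0 : 0^* = 0 :> R[i].
Proof. by apply: complex_ext; rewrite /= ?oppr0. Qed.
Lemma conjc1 : 1^* = 1 :> R[i].
Proof. by apply: complex_ext; rewrite /= ?oppr0. Qed.

Lemma cabs_ge0 z : 0 <= cabs z.
Proof. by case: z => a b /=; rewrite sqrtr_ge0. Qed.
Lemma cabsM z w : cabs (z * w) = cabs z * cabs w.
Proof. exact: ComplexField.Normc.normcM. Qed.
Lemma cabsD z w : cabs (z + w) <= cabs z + cabs w.
Proof. exact: le_normcD. Qed.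
Lemma cabsN z : cabs (- z) = cabs z. Proof. by case: z => a b /=; rewrite !sqrrN. Qed.
Lemma cabsB z w : cabs (z - w) <= cabs z + cabs w.
Proof. by rewrite (le_trans (cabsD _ _)) // cabsN. Qed.
Lemma cabsJ z : cabs (z^*) = cabs z.
Proof. by case: z => a b /=; rewrite sqrrN. Qed.
Lemma cabs0 : cabs (0 : R[i]) = 0. Proof. exact: ComplexField.Normc.normc0. Qed.
Lemma cabs1 : cabs (1 : R[i]) = 1. Proof. exact: ComplexField.Normc.normc1. Qed.
Lemma cabs_real x : cabs x%:C = `|x|.
Proof. by rewrite /= expr0n /= addr0 sqrtr_sqr. Qed.
Lemma cabs_eq0 z : cabs z = 0 -> z = 0.
Proof. exact: ComplexField.Normc.eq0_normc. Qed.
Lemma cabs_gt0 z : (0 < cabs z) = (z != 0).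
Proof.
rewrite lt_neqAle cabs_ge0 andbT eq_sym; congr (~~ _); apply/eqP/eqP.
  exact: cabs_eq0.
by move=> ->; rewrite cabs0.
Qed.
Lemma cabs_Re z : `|Re z| <= cabs z.
Proof. by case: z => a b /=; rewrite -sqrtr_sqr ler_sqrt ?lerDl ?sqr_ge0 // addr_ge0 ?sqr_ge0. Qed.
Lemma cabs_Im z : `|Im z| <= cabs z.
Proof. by case: z => a b /=; rewrite -sqrtr_sqr ler_sqrt ?lerDr ?sqr_ge0 // addr_ge0 ?sqr_ge0. Qed.
Lemma cabs_le z : cabs z <= `|Re z| + `|Im z|.
Proof.
case: z => a b /=.
rewrite -(ger0_norm (addr_ge0 (normr_ge0 a) (normr_ge0 b))) -sqrtr_sqr ler_sqrt ?sqr_ge0 //.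
rewrite sqrrD !real_normK ?num_real // -addrA lerD2l lerDr.
by rewrite mulrn_wge0 // mulr_ge0.
Qed.
Lemma cabs_sqr z : cabs z ^+ 2 = Re z ^+ 2 + Im z ^+ 2.
Proof. by case: z => a b /=; rewrite sqr_sqrtr // addr_ge0 ?sqr_ge0. Qed.
Lemma mulc_conj z : z * z^* = (cabs z ^+ 2)%:C.
Proof. by rewrite cabs_sqr; apply: complex_ext; rewrite !reimE /=; ring. Qed.

Lemma expiD x y : expi (x + y) = expi x * expi y.
Proof. by apply: complex_ext; rewrite !reimE /= ?cosD ?sinD; ring. Qed.
Lemma expi0 : expi 0 = 1 :> R[i]. Proof. by rewrite /expi cos0 sin0. Qed.
Lemma expiN x : expi (- x) = (expi x)^* :> R[i].
Proof. by rewrite /expi cosN sinN. Qed.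
Lemma cabs_expi x : cabs (expi x) = 1.
Proof. by rewrite /= cos2Dsin2 sqrtr1. Qed.

Lemma ge0_derive_incr (f df : R -> R) : (forall x, is_derive x 1 f (df x)) ->
  (forall x, 0 <= x -> 0 <= df x) -> forall x, 0 <= x -> f 0 <= f x.
Proof.
move=> dff df0 x x0.
have dv (u : R) : derivable f u 1 by case: (dff u).
apply: (@ger0_derive1_ndecr R f 0 x) => //.
- move=> u; rewrite in_itv /= => /andP[/ltW u0 _].
  by rewrite derive1E (@derive_val _ _ _ _ _ _ _ (dff u)) df0.
- apply: continuous_subspaceT => u.
  by apply: differentiable_continuous; apply/derivable1_diffP.
Qed.

Lemma sin_le_id x : 0 <= x -> sin x <= x.
Proof.
move=> x0; rewrite -subr_ge0.
have := @ge0_derive_incr (fun z : R => z - sin z) (fun z : R => 1 - cos z).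
by rewrite /= sin0 subr0; apply.
Qed.

(** The derivative of [cos x + x ^+ 2 / 2] is [x - sin x], nonnegative for [0 <= x]; evenness does
    the rest. *)
Lemma cos_ge1B x : 1 - x ^+ 2 / 2 <= cos x.
Proof.
suff H (y : R) : 0 <= y -> 1 - y ^+ 2 / 2 <= cos y.
  have [x0|x0] := leP 0 x; first exact: H.
  by rewrite -cosN -(sqrrN x); apply: H; rewrite oppr_ge0 ltW.
move=> y0; rewrite lerBlDr.
have := @ge0_derive_incr (fun z : R => cos z + 2^-1 *: z ^+ 2) (fun z : R => - sin z + z).
rewrite /= cos0 expr0n /= scaler0 addr0 /GRing.scale /= mulrC; apply => // u.
  apply: is_deriveD; apply: is_derive_eq.
  by rewrite /GRing.scale /=; field.
by move=> u0; have := sin_le_id u0; lra.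
Qed.

(** The square of the left side is [2 - 2 * cos x]. *)
Lemma cabs_expiB1 x : cabs (expi x - 1) <= `|x|.
Proof.
rewrite -ler_sqr ?nnegrE ?cabs_ge0 // cabs_sqr !reimE /= sqrrB oppr0 addr0.
have := cos2Dsin2 x; have := cos_ge1B x; rewrite real_normK ?num_real //; nra.
Qed.

End ComplexBasics.

(** * Integration of complex-valued functions *)

Section ComplexIntegral.
Context {R : realType} {d : measure_display} {T : measurableType d}.
Variable mu : {measure set T -> \bar R}.
Implicit Types (g h : T -> R[i]) (c : R[i]).

Definition cmeas g := measurable_fun setT (fun x => Re (g x)) /\
  measurable_fun setT (fun x => Im (g x)).

Definition cintable g := mu.-integrable setT (EFin \o (fun x => Re (g x))) /\
  mu.-integrable setT (EFin \o (fun x => Im (g x))).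

Lemma cmeasD g h : cmeas g -> cmeas h -> cmeas (fun x => g x + h x).
Proof.
move=> [g1 g2] [h1 h2]; split.
  by under eq_fun do rewrite Re_add; exact: measurable_funD.
by under eq_fun do rewrite Im_add; exact: measurable_funD.
Qed.

Lemma cmeasM g h : cmeas g -> cmeas h -> cmeas (fun x => g x * h x).
Proof.
move=> [g1 g2] [h1 h2]; split.
  by under eq_fun do rewrite Re_mul; apply: measurable_funB; exact: measurable_funM.
by under eq_fun do rewrite Im_mul; apply: measurable_funD; exact: measurable_funM.
Qed.

Lemma cmeas_cst c : cmeas (fun=> c).
Proof. by split; exact: measurable_cst. Qed.

Lemma cmeasN g : cmeas g -> cmeas (fun x => - g x).
Proof.
move=> [g1 g2]; split.
  by under eq_fun do rewrite Re_opp; exact: measurable_funN.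
by under eq_fun do rewrite Im_opp; exact: measurable_funN.
Qed.

Lemma cmeasJ g : cmeas g -> cmeas (fun x => (g x)^*).
Proof.
move=> [g1 g2]; split.
  by under eq_fun do rewrite Re_conj.
by under eq_fun do rewrite Im_conj; exact: measurable_funN.
Qed.

Lemma cmeas_real (f : T -> R) : measurable_fun setT f -> cmeas (fun x => (f x)%:C).
Proof. by move=> mf; split=> //=; exact: measurable_cst. Qed.

Lemma cmeas_cabs g : cmeas g -> measurable_fun setT (fun x => cabs (g x)).
Proof.
move=> [g1 g2].
rewrite (_ : (fun x => _) = (fun x => Num.sqrt (Re (g x) ^+ 2 + Im (g x) ^+ 2))); last first.
  by apply/funext => x; case: (g x).
apply: (measurableT_comp (continuous_measurable_fun (@sqrt_continuous R))).
by apply: measurable_funD; exact: measurable_funX.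
Qed.

Lemma le_integrable_real (f h : T -> R) : measurable_fun setT f ->
  mu.-integrable setT (EFin \o h) -> (forall x, `|f x| <= h x) ->
  mu.-integrable setT (EFin \o f).
Proof.
move=> mf ih fh; apply: le_integrable ih => //; first exact/measurable_EFinP.
by move=> x _ /=; rewrite lee_fin (le_trans (fh x)) // ler_norm.
Qed.

Lemma cintable_le g (h : T -> R) : cmeas g -> mu.-integrable setT (EFin \o h) ->
  (forall x, cabs (g x) <= h x) -> cintable g.
Proof.
move=> [g1 g2] ih gh; split; apply: le_integrable_real ih _ => // x.
  by rewrite (le_trans (cabs_Re _)).
by rewrite (le_trans (cabs_Im _)).
Qed.

Lemma cintable_cmeas g : cintable g -> cmeas g.
Proof. by move=> [/measurable_int/measurable_EFinP ? /measurable_int/measurable_EFinP ?]. Qed.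

Lemma cintable_cabs g : cintable g -> mu.-integrable setT (EFin \o (fun x => cabs (g x))).
Proof.
move=> ig; have [i1 i2] := ig.
have i1' := integrable_norm i1; have i2' := integrable_norm i2.
apply: le_integrable_real (integrableD _ i1' i2') _ => //.
  exact/cmeas_cabs/cintable_cmeas.
by move=> x /=; rewrite ger0_norm ?cabs_ge0 // cabs_le.
Qed.

Lemma cintableD g h : cintable g -> cintable h -> cintable (fun x => g x + h x).
Proof.
move=> [g1 g2] [h1 h2]; split.
  by under eq_fun do rewrite Re_add; exact: (integrableD _ g1 h1).
by under eq_fun do rewrite Im_add; exact: (integrableD _ g2 h2).
Qed.

Lemma cintableZ c g : cintable g -> cintable (fun x => c * g x).
Proof.
move=> [g1 g2]; split.
  under eq_fun do rewrite Re_mul; apply: (integrableB _ (integrableZl _ _ g1) (integrableZl _ _ g2)) => //.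
under eq_fun do rewrite Im_mul; apply: (integrableD _ (integrableZl _ _ g2) (integrableZl _ _ g1)) => //.
Qed.

Lemma CintD g h : cintable g -> cintable h ->
  Cint mu setT (fun x => g x + h x) = Cint mu setT g + Cint mu setT h.
Proof.
move=> [g1 g2] [h1 h2]; apply: complex_ext; rewrite !reimE /=.
  by under eq_Rintegral do rewrite Re_add; rewrite RintegralD.
by under eq_Rintegral do rewrite Im_add; rewrite RintegralD.
Qed.

Lemma CintZ c g : cintable g ->
  Cint mu setT (fun x => c * g x) = c * Cint mu setT g.
Proof.
move=> [g1 g2]; apply: complex_ext; rewrite !reimE /=.
  under eq_Rintegral do rewrite Re_mul.
  by rewrite RintegralB ?RintegralZl //; first [exact: (integrableZl measurableT _ g1)|exact: (integrableZl measurableT _ g2)].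
under eq_Rintegral do rewrite Im_mul.
by rewrite RintegralD ?RintegralZl //; first [exact: (integrableZl measurableT _ g1)|exact: (integrableZl measurableT _ g2)].
Qed.

Lemma CintB g h : cintable g -> cintable h ->
  Cint mu setT (fun x => g x - h x) = Cint mu setT g - Cint mu setT h.
Proof.
move=> ig ih; rewrite -[X in _ = _ + X]mulN1r -CintZ // -CintD //; last exact: cintableZ.
by congr Cint; apply/funext => x; rewrite mulN1r.
Qed.

Lemma CintJ g : cintable g -> Cint mu setT (fun x => (g x)^*) = (Cint mu setT g)^*.
Proof.
move=> [g1 g2]; apply: complex_ext; rewrite !reimE /=.
  by under eq_Rintegral do rewrite Re_conj.
under eq_Rintegral do rewrite Im_conj -mulN1r.
by rewrite RintegralZl // mulN1r.
Qed.

Lemma Cint_real (f : T -> R) : Cint mu setT (fun x => (f x)%:C) = (\int[mu]_x f x)%:C.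
Proof. by apply: complex_ext => //=; rewrite /Rintegral integral0. Qed.

Lemma Cint0 : Cint mu setT (fun=> 0) = 0.
Proof. by apply: complex_ext => /=; rewrite /Rintegral integral0. Qed.

(** Multiplication by the conjugate of the integral makes it real and nonnegative, so that the bound
    reduces to monotonicity of the real integral. *)
Lemma Cint_abs g : cintable g -> cabs (Cint mu setT g) <= \int[mu]_x cabs (g x).
Proof.
move=> ig; have [->|c0] := eqVneq (Cint mu setT g) 0.
  by rewrite cabs0; apply: Rintegral_ge0 => x _; exact: cabs_ge0.
have cp : 0 < cabs (Cint mu setT g) by rewrite cabs_gt0.
rewrite -(ler_pM2l cp) -expr2.
have -> : cabs (Cint mu setT g) ^+ 2 = Re (Cint mu setT (fun x => (Cint mu setT g)^* * g x)).
  by rewrite CintZ // mulrC mulc_conj.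
have := cintableZ (Cint mu setT g)^* ig; set k := (fun x => _ * _) => ik.
rewrite /= -RintegralZl //; last exact: cintable_cabs.
apply: le_Rintegral => //; first exact: ik.1.
  exact: (integrableZl measurableT _ (cintable_cabs ig)).
move=> x _; rewrite -[leRHS]/(cabs (Cint mu setT g) * cabs (g x)) -[X in X * _]cabsJ -cabsM.
exact: le_trans (ler_norm _) (cabs_Re _).
Qed.

Lemma Cint_abs_le g (h : T -> R) : cmeas g -> mu.-integrable setT (EFin \o h) ->
  (forall x, cabs (g x) <= h x) -> cabs (Cint mu setT g) <= \int[mu]_x h x.
Proof.
move=> mg ih gh; have ig := cintable_le mg ih gh.
rewrite (le_trans (Cint_abs ig)) //; apply: le_Rintegral => //.
exact: cintable_cabs.
Qed.

End ComplexIntegral.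

(** * Measurability, Fubini and dominating weights on the plane *)

Section PlaneMeasure.
Context {R : realType}.
Local Notation pl := (measurableTypeR R * measurableTypeR R)%type.

(** The sigma-algebra is the product one: an open set is the union of the countably many open
    rectangles with rational corners that it contains. *)
Lemma open_measurable_plane (U : set (R * R)) : open U -> measurable (U : set pl).
Proof.
move=> oU.
pose B (q : rat * rat * rat * rat) : set pl :=
  `]ratr q.1.1.1, ratr q.1.1.2[%classic `*` `]ratr q.1.2, ratr q.2[%classic.
have -> : U = \bigcup_(q in [set q | B q `<=` U]) B q.
  apply/seteqP; split => [p Up|p [q qU]]; last exact: qU.
  have : nbhs p U by exact: open_nbhs_nbhs.
  move=> [/= [A C]] /= [nA nC] AC.
  move: nA nC => /nbhs_ballP[e /= e0 eA] /nbhs_ballP[e' /= e'0 e'C].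
  have rt (x r : R) : 0 < r -> exists q1 q2 : rat, [/\ ratr q1 < x, x < ratr q2,
      x - r < ratr q1 & ratr q2 < x + r].
    move=> r0.
    have /rat_in_itvoo [q1] : x - r < x by rewrite ltrBlDr ltrDl.
    rewrite in_itv /= => /andP[a1 a2].
    have /rat_in_itvoo [q2] : x < x + r by rewrite ltrDl.
    rewrite in_itv /= => /andP[b1 b2].
    by exists q1, q2.
  have [q1 [q2 [h1 h2 h3 h4]]] := rt p.1 e e0.
  have [q3 [q4 [h5 h6 h7 h8]]] := rt p.2 e' e'0.
  exists (q1, q2, q3, q4) => /=; last by split; rewrite /= in_itv /= ?h1 ?h2 ?h5 ?h6.
  move=> [y1 y2] /= [/=]; rewrite !in_itv /= => /andP[k1 k2] /andP[k3 k4].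
  apply: AC; split => /=.
    by apply: eA; rewrite /ball /= ltr_distlC; apply/andP; split; lra.
  by apply: e'C; rewrite /ball /= ltr_distlC; apply/andP; split; lra.
rewrite bigcup_mkcond; apply: countable_bigcupT_measurable => [|q]; first exact: countableP.
case: ifPn => // _; apply: measurableX; exact: measurable_itv.
Qed.

Lemma continuous_measurable_plane (f : R * R -> R) : continuous f ->
  measurable_fun setT (f : pl -> R).
Proof.
move=> /continuousP cf; apply: (measurability _ (RGenOpens.measurableE R)).
move=> _ [_ [a [b ->] <-]]; rewrite setTI; apply: open_measurable_plane.
exact/cf/interval_open.
Qed.

Lemma cmeas_continuous (g : R * R -> R[i]) : Ccontinuous g -> cmeas (g : pl -> R[i]).
Proof. by move=> [c1 c2]; split; exact: continuous_measurable_plane. Qed.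

Lemma integrable_oneDsqrV :
  (@lebesgue_measure R).-integrable setT (EFin \o (fun x : R => (1 + x ^+ 2)^-1)).
Proof.
apply/integrableP; split.
  apply/measurable_EFinP; apply: continuous_measurable_fun.
  exact: continuous_oneDsqrV.
under eq_integral => x _.
  rewrite gee0_abs ?lee_fin ?invr_ge0 ?addr_ge0 ?sqr_ge0 //=.
  over.
rewrite (@ge0_symfun_integralT R (fun x : R => (1 + x ^+ 2)^-1)) /=.
- rewrite -set_itvcy.
  have := @integral0y_oneDsqr R; rewrite /oneDsqr /= => ->.
  by rewrite -EFinM ltry.
- by move=> x; rewrite invr_ge0 addr_ge0 ?sqr_ge0.
- exact: continuous_oneDsqrV.
- by move=> x /=; rewrite sqrrN.
Qed.

(** Reference weight: positive and integrable, with an inverse of polynomial growth, its product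
    [omega] dominates every rapidly decreasing function on the plane. *)
Definition omega1 (x : R) : R := (1 + x ^+ 2)^-1.
Definition omega (x : R * R) : R := omega1 x.1 * omega1 x.2.

Lemma omega1_ge0 x : 0 <= omega1 x.
Proof. by rewrite invr_ge0 addr_ge0 ?sqr_ge0. Qed.
Lemma omega1_gt0 x : 0 < omega1 x.
Proof. by rewrite invr_gt0 ltr_pwDl ?sqr_ge0. Qed.
Lemma omega_gt0 x : 0 < omega x.
Proof. by rewrite mulr_gt0 ?omega1_gt0. Qed.
Lemma omega_ge0 x : 0 <= omega x. Proof. exact/ltW/omega_gt0. Qed.

Lemma measurable_omega1 : measurable_fun setT (omega1 : measurableTypeR R -> R).
Proof. apply: continuous_measurable_fun; exact: continuous_oneDsqrV. Qed.

Lemma measurable_tensor (p q : R -> R) :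
  measurable_fun setT (p : measurableTypeR R -> R) ->
  measurable_fun setT (q : measurableTypeR R -> R) ->
  measurable_fun setT ((fun x => p x.1 * q x.2) : pl -> R).
Proof.
by move=> mp mq; apply: measurable_funM; apply: measurableT_comp.
Qed.

Lemma integrable_tensor (p q : R -> R) :
  (@leb1 R).-integrable setT (EFin \o p) -> (@leb1 R).-integrable setT (EFin \o q) ->
  (@leb2 R).-integrable setT (EFin \o (fun x : pl => p x.1 * q x.2)).
Proof.
move=> ip iq.
have mp := measurable_int _ ip; have mq := measurable_int _ iq.
apply/(@integrable12ltyP _ _ _ _ _ lebesgue_measure lebesgue_measure
  (EFin \o (fun x : pl => p x.1 * q x.2))).
  by apply/measurable_EFinP; apply: measurable_tensor; exact/measurable_EFinP.
have iq' := integrable_norm iq.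
have -> : (fun x : R => \int[lebesgue_measure]_y
    `|(EFin \o (fun x0 : pl => (p x0.1 * q x0.2)%R)) (x, y)|)%E =
    EFin \o (fun x : R => `|p x| * \int[leb1]_y `|q y|).
  apply/funext => x /=; rewrite EFinM /Rintegral fineK; last exact: integrable_fin_num.
  rewrite -integralZl //; apply: eq_integral => y _ /=.
  by rewrite normrM EFinM.
have ip' := integrable_norm ip.
have := integrable_lty measurableT (integrableZr measurableT (\int[leb1]_y `|q y|) ip').
by under eq_integral do rewrite /= -EFinM.
Qed.

(** The inner integral is a real number obtained by [fine]; integrability of every slice, and not
    only of almost every one, keeps it equal to the extended integral. *)
Lemma Rint_fubini (f : pl -> R) : (@leb2 R).-integrable setT (EFin \o f) ->
  (forall x, (@leb1 R).-integrable setT (EFin \o (fun y => f (x, y)))) ->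
  \int[leb2]_z f z = \int[leb1]_x \int[leb1]_y f (x, y).
Proof.
move=> i2 i1; rewrite {1}/Rintegral /leb2 -integral12_prod_meas1 //.
rewrite [in RHS]/Rintegral; congr fine; apply: eq_integral => x _.
by rewrite /fubini_F /Rintegral fineK //; exact: (integrable_fin_num measurableT (i1 x)).
Qed.

Lemma Rint_fubini_swap (f : pl -> R) : (@leb2 R).-integrable setT (EFin \o f) ->
  (forall y, (@leb1 R).-integrable setT (EFin \o (fun x => f (x, y)))) ->
  \int[leb2]_z f z = \int[leb1]_y \int[leb1]_x f (x, y).
Proof.
move=> i2 i1; rewrite {1}/Rintegral /leb2 -integral21_prod_meas1 //.
rewrite [in RHS]/Rintegral; congr fine; apply: eq_integral => x _.
by rewrite /fubini_G /Rintegral fineK //; exact: (integrable_fin_num measurableT (i1 x)).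
Qed.

Lemma Cint_fubini (g : pl -> R[i]) : cintable leb2 g ->
  (forall x, cintable leb1 (fun y => g (x, y))) ->
  Cint leb2 setT g = Cint leb1 setT (fun x => Cint leb1 setT (fun y => g (x, y))).
Proof.
move=> [g1 g2] h; apply: complex_ext => /=; rewrite Rint_fubini // => x.
  by case: (h x).
by case: (h x).
Qed.

Lemma Cint_fubini_swap (g : pl -> R[i]) : cintable leb2 g ->
  (forall y, cintable leb1 (fun x => g (x, y))) ->
  Cint leb2 setT g = Cint leb1 setT (fun y => Cint leb1 setT (fun x => g (x, y))).
Proof.
move=> [g1 g2] h; apply: complex_ext => /=; rewrite Rint_fubini_swap // => x.
  by case: (h x).
by case: (h x).
Qed.

Lemma integrable_omega1 : (@leb1 R).-integrable setT (EFin \o omega1).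
Proof. exact: integrable_oneDsqrV. Qed.

Lemma integrable_omega : (@leb2 R).-integrable setT (EFin \o (omega : pl -> R)).
Proof. exact: (integrable_tensor integrable_omega1 integrable_omega1). Qed.

Lemma measurable_omega : measurable_fun setT (omega : pl -> R).
Proof. by apply: measurable_tensor; exact: measurable_omega1. Qed.

Lemma norm_plane (x : R * R) : `|x| = Num.max `|x.1| `|x.2|. Proof. by []. Qed.
Lemma norm_fst (x : R * R) : `|x.1| <= `|x|.
Proof. by rewrite norm_plane le_max lexx. Qed.
Lemma norm_snd (x : R * R) : `|x.2| <= `|x|.
Proof. by rewrite norm_plane le_max lexx orbT. Qed.
Lemma norm_plane_le (x : R * R) (c : R) : (`|x| <= c) = (`|x.1| <= c) && (`|x.2| <= c).
Proof. by rewrite norm_plane ge_max. Qed.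
Lemma norm_plane_lt (x : R * R) (c : R) : (`|x| < c) = (`|x.1| < c) && (`|x.2| < c).
Proof. by rewrite norm_plane gt_max. Qed.
Lemma continuous_norm_plane : continuous (fun x : R * R => `|x|).
Proof. exact: norm_continuous. Qed.
Lemma jnorm_ge1 (x : R * R) : 1 <= 1 + `|x|. Proof. by rewrite lerDl. Qed.
Lemma jnorm_gt0 (x : R * R) : 0 < 1 + `|x|.
Proof. by rewrite (lt_le_trans ltr01) ?jnorm_ge1. Qed.

(** Each of the two factors is at most [(1 + |x|) ^+ 2]. This is the exponent 4 that recurs wherever
    powers of [1 + |x|] are traded for integrability. *)
Lemma omegaV_le (x : R * R) : (omega x)^-1 <= (1 + `|x|) ^+ 4.
Proof.
rewrite /omega /omega1 invfM !invrK.
have h (a b : R) : `|a| <= b -> 1 + a ^+ 2 <= (1 + b) ^+ 2.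
  move=> ab; rewrite -real_normK ?num_real // sqrrD expr1n mul1r -addrA lerD2l.
  rewrite -[leLHS]add0r lerD ?mulrn_wge0 ?(le_trans _ ab) //.
  by rewrite lerXn2r ?nnegrE ?(le_trans _ ab).
rewrite (_ : 4 = 2 + 2)%N // exprD ler_pM ?addr_ge0 ?sqr_ge0 //.
  by apply: h; exact: norm_fst.
by apply: h; exact: norm_snd.
Qed.

(** Decay without smoothness: enough for the Fourier transform to be smooth, and stable under
    multiplication by indicator functions, which the bisection argument requires. *)
Definition rapid (g : R * R -> R[i]) := cmeas (g : pl -> R[i]) /\
  forall n : nat, exists C : R, forall x, (1 + `|x|) ^+ n * cabs (g x) <= C.

Definition pgrowth (g : R * R -> R[i]) := cmeas (g : pl -> R[i]) /\
  exists (n : nat) (C : R), forall x, cabs (g x) <= C * (1 + `|x|) ^+ n.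

Lemma rapid_le g n : rapid g ->
  exists2 C, 0 <= C & forall x, (1 + `|x|) ^+ n * cabs (g x) <= C * omega x.
Proof.
move=> [mg /(_ (n + 4)%N)[C H]]; exists `|C| => // x.
rewrite -ler_pdivrMr ?omega_gt0 // mulrAC.
apply: le_trans (ler_norm C); apply: le_trans (H x).
by rewrite exprD ler_wpM2r ?cabs_ge0 // ler_wpM2l ?exprn_ge0 ?omegaV_le // ltW // jnorm_gt0.
Qed.

Lemma rapid_cintable g : rapid g -> cintable leb2 g.
Proof.
move=> rg; have [mg _] := rg; have [C C0 H] := rapid_le 0 rg.
refine (cintable_le (h := (fun x : pl => C * omega x)) mg _ _).
  exact: (integrableZl measurableT _ integrable_omega).
by move=> x; have := H x; rewrite expr0 mul1r.
Qed.

Lemma rapid_pgrowth g h : rapid g -> pgrowth h -> rapid (fun x => g x * h x).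
Proof.
move=> [mg Hg] [mh [n [C Hh]]]; split; first exact: cmeasM.
move=> k; have [D HD] := Hg (k + n)%N; exists (D * `|C|) => x.
rewrite cabsM mulrCA.
have h1 : cabs (h x) <= (1 + `|x|) ^+ n * `|C|.
  by rewrite (le_trans (Hh x)) // mulrC ler_wpM2l ?ler_norm // exprn_ge0 // ltW // jnorm_gt0.
apply: (@le_trans _ _ (cabs (g x) * ((1 + `|x|) ^+ k * ((1 + `|x|) ^+ n * `|C|)))).
  by rewrite ler_wpM2l ?cabs_ge0 // ler_wpM2l // exprn_ge0 // ltW // jnorm_gt0.
rewrite !mulrA ler_wpM2r // (le_trans _ (HD x)) // exprD -mulrA mulrC.
by rewrite -mulrA.
Qed.

Lemma rapid_bound g h : rapid g -> cmeas (h : pl -> R[i]) ->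
  (forall x, cabs (h x) <= cabs (g x)) -> rapid h.
Proof.
move=> [mg Hg] mh hg; split => // n; have [C HC] := Hg n; exists C => x.
by rewrite (le_trans _ (HC x)) // ler_wpM2l // exprn_ge0 // ltW // jnorm_gt0.
Qed.

Lemma rapidJ g : rapid g -> rapid (fun x => (g x)^*).
Proof.
move=> rg; apply: rapid_bound (rg) _ _; first exact: cmeasJ rg.1.
by move=> x; rewrite cabsJ.
Qed.

Lemma rapidD g h : rapid g -> rapid h -> rapid (fun x => g x + h x).
Proof.
move=> [mg Hg] [mh Hh]; split; first exact: cmeasD.
move=> n; have [C HC] := Hg n; have [D HD] := Hh n; exists (C + D) => x.
apply: le_trans (lerD (HC x) (HD x)); by rewrite -mulrDr ler_wpM2l ?cabsD.
Qed.

Lemma rapidZ c g : rapid g -> rapid (fun x => c * g x).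
Proof.
move=> [mg Hg]; split; first by apply: cmeasM => //; exact: cmeas_cst.
move=> n; have [C HC] := Hg n; exists (cabs c * C) => x.
by rewrite cabsM mulrCA ler_wpM2l ?cabs_ge0.
Qed.

Lemma pgrowth_bounded g C : cmeas (g : pl -> R[i]) -> (forall x, cabs (g x) <= C) -> pgrowth g.
Proof. by move=> mg H; split=> //; exists 0%N, C => x; rewrite expr0 mulr1. Qed.

Lemma pgrowth_rapid g : rapid g -> pgrowth g.
Proof.
move=> [mg /(_ 0%N)[C H]]; apply: (pgrowth_bounded mg (C := C)) => x.
by have := H x; rewrite expr0 mul1r.
Qed.

End PlaneMeasure.

(** * Smooth functions *)

Section SmoothCalculus.
Context {R : realType} {V : normedModType R}.
Implicit Types (U : set V) (h k : V -> R) (w : seq V) (n : nat).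

Lemma diff_eps h x : differentiable h x -> forall e : R, 0 < e ->
  \forall v \near (0 : V), `|h (v + x) - h x - 'd h x v| <= e * `|v|.
Proof.
move=> /diff_locally /eqaddoP H e e0; have := H e e0.
apply: filterS => v /=; rewrite /shift /= !fctE.
by rewrite opprD addrA.
Qed.

Lemma differentiable_eps h x (df : {linear V -> R}) : continuous df ->
  (forall e : R, 0 < e ->
    \forall v \near (0 : V), `|h (v + x) - h x - df v| <= e * `|v|) ->
  differentiable h x /\ 'd h x = df :> (V -> R).
Proof.
move=> cdf H.
have E : h \o shift x = cst (h x) + df +o_ (0 : V) id.
  apply/eqaddoP => e e0; have := H e e0; apply: filterS => v /=.
  by rewrite /shift /= !fctE opprD addrA.
have D : 'd h x = df :> (V -> R) by exact: diff_unique.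
by split => //; apply/diff_locallyP; rewrite D.
Qed.

Lemma near_eq_differentiable h k x : (\forall y \near x, h y = k y) ->
  differentiable h x -> differentiable k x.
Proof.
move=> hk dh; have hkx : h x = k x by exact: nbhs_singleton hk.
apply: (differentiable_eps (df := 'd h x) _ _).1; first exact: diff_continuous.
move=> e e0; have := diff_eps dh e0.
have hk0 : \forall v \near (0 : V), h (v + x) = k (v + x).
  have /= := hk; rewrite (near_shift 0 x) /=.
  by apply: filterS => v; rewrite /= subr0.
by apply: filterS2 hk0 => v /= <-; rewrite hkx.
Qed.

Lemma dirD_rcons w v h : dirD (rcons w v) h = dirD w ('D_v h).
Proof. by rewrite /dirD foldr_rcons. Qed.

(** Finite-order form of smoothness, so that closure under products, inverses and composition can be
    proved by induction on the order. *)
Definition smooth_upto n U h := forall w, (size w <= n)%N ->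
  forall x, U x -> differentiable (dirD w h) x.

(** [dirD] applies the last vector of a word first, which is why a derivative is split off on the
    right of the word. *)
Lemma smooth_uptoS n U h : smooth_upto n.+1 U h <->
  (forall x, U x -> differentiable h x) /\ (forall v, smooth_upto n U ('D_v h)).
Proof.
split=> [H|[H1 H2] w].
  split=> [x Ux|v w sw x Ux]; first exact: (H [::]).
  by rewrite -dirD_rcons; apply: H => //; rewrite size_rcons.
case/lastP: w => [_ x Ux|w v]; first exact: H1.
by rewrite size_rcons ltnS dirD_rcons => sw; exact: H2.
Qed.

Lemma smooth_upto0 U h : smooth_upto 0 U h <-> (forall x, U x -> differentiable h x).
Proof.
split=> [H x Ux|H w]; first exact: (H [::]).
by rewrite leqn0 size_eq0 => /eqP -> x Ux; exact: H.
Qed.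

Lemma smooth_upto_diff n U h x : smooth_upto n U h -> U x -> differentiable h x.
Proof. by move=> H Ux; exact: (H [::]). Qed.

Lemma smooth_upto_le n m U h : (m <= n)%N -> smooth_upto n U h -> smooth_upto m U h.
Proof. by move=> mn H w wm; apply: H; exact: leq_trans mn. Qed.

Lemma eq_dirD_on U h k w : open U -> (forall x, U x -> h x = k x) ->
  forall x, U x -> dirD w h x = dirD w k x.
Proof.
move=> oU; elim: w => [|v w IH] hk x Ux /=; first exact: hk.
apply: near_eq_derive; have := open_nbhs_nbhs (conj oU Ux).
by apply: filterS => y Uy; exact: IH.
Qed.

Lemma eq_smooth_upto n U h k : open U -> (forall x, U x -> h x = k x) ->
  smooth_upto n U h -> smooth_upto n U k.
Proof.
move=> oU hk H w sw x Ux; apply: near_eq_differentiable (H w sw x Ux).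
have := open_nbhs_nbhs (conj oU Ux).
by apply: filterS => y Uy; apply: (eq_dirD_on w oU hk).
Qed.

Lemma derive_diffE h x v : differentiable h x -> 'D_v h x = 'd h x v.
Proof. by move=> dh; rewrite deriveE. Qed.

Lemma deriveD_fun U h k v : (forall x, U x -> differentiable h x) ->
  (forall x, U x -> differentiable k x) ->
  forall x, U x -> 'D_v (fun y => h y + k y) x = 'D_v h x + 'D_v k x.
Proof. by move=> dh dk x Ux; rewrite deriveD //; apply: diff_derivable; auto. Qed.

Lemma deriveM_fun U h k v : (forall x, U x -> differentiable h x) ->
  (forall x, U x -> differentiable k x) ->
  forall x, U x -> 'D_v (fun y => h y * k y) x = 'D_v h x * k x + h x * 'D_v k x.
Proof.
move=> dh dk x Ux; rewrite deriveM; [|by apply: diff_derivable; auto..].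
by rewrite /GRing.scale /= addrC; congr (_ + _); rewrite mulrC.
Qed.

Lemma smooth_uptoD n U h k : open U -> smooth_upto n U h -> smooth_upto n U k ->
  smooth_upto n U (fun x => h x + k x).
Proof.
move=> oU; elim: n h k => [|n IH] h k.
  move=> /smooth_upto0 H /smooth_upto0 K; apply/smooth_upto0 => x Ux.
  by apply: differentiableD; auto.
move=> /smooth_uptoS[H1 H2] /smooth_uptoS[K1 K2]; apply/smooth_uptoS; split.
  by move=> x Ux; apply: differentiableD; auto.
move=> v; apply: (eq_smooth_upto oU (h := fun x => 'D_v h x + 'D_v k x)).
  by move=> x Ux; rewrite (deriveD_fun _ H1 K1).
exact: IH.
Qed.

Lemma smooth_uptoM n U h k : open U -> smooth_upto n U h -> smooth_upto n U k ->
  smooth_upto n U (fun x => h x * k x).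
Proof.
move=> oU; elim: n h k => [|n IH] h k.
  move=> /smooth_upto0 H /smooth_upto0 K; apply/smooth_upto0 => x Ux.
  by apply: differentiableM; auto.
move=> H K; have H' := smooth_upto_le (leqnSn n) H; have K' := smooth_upto_le (leqnSn n) K.
move: H K => /smooth_uptoS[H1 H2] /smooth_uptoS[K1 K2]; apply/smooth_uptoS; split.
  by move=> x Ux; apply: differentiableM; auto.
move=> v; apply: (eq_smooth_upto oU (h := fun x => 'D_v h x * k x + h x * 'D_v k x)).
  by move=> x Ux; rewrite (deriveM_fun _ H1 K1).
by apply: smooth_uptoD => //; apply: IH.
Qed.

Lemma derive_cst_fun c v : 'D_v (fun _ : V => c : R) = fun=> 0.
Proof. by apply/funext => x; rewrite derive_cst. Qed.

Lemma smooth_upto_cst n U (c : R) : smooth_upto n U (fun=> c).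
Proof.
elim: n c => [|n IH] c; first by apply/smooth_upto0 => x _; exact: differentiable_cst.
apply/smooth_uptoS; split=> [x _|v]; first exact: differentiable_cst.
by rewrite derive_cst_fun.
Qed.

Lemma smooth_uptoN n U h : open U -> smooth_upto n U h -> smooth_upto n U (fun x => - h x).
Proof.
move=> oU H; apply: (eq_smooth_upto oU (h := fun x => -1 * h x)).
  by move=> x _; rewrite mulN1r.
by apply: smooth_uptoM => //; exact: smooth_upto_cst.
Qed.

Lemma smooth_upto_linear n U (l : {linear V -> R}) : continuous l -> open U ->
  smooth_upto n U l.
Proof.
move=> cl oU.
have dl x : differentiable l x by exact: linear_differentiable.
case: n => [|n]; first by apply/smooth_upto0 => x _.
apply/smooth_uptoS; split=> // v.
apply: (eq_smooth_upto oU (h := fun=> l v)); last exact: smooth_upto_cst.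
by move=> x Ux; rewrite derive_diffE // diff_lin.
Qed.

Lemma differentiableV_fun U h : (forall x, U x -> differentiable h x) ->
  (forall x, U x -> h x != 0) -> forall x, U x -> differentiable (fun y => (h y)^-1) x.
Proof. by move=> dh h0 x Ux; apply: differentiableV; auto. Qed.

Lemma deriveV_fun U h v : (forall x, U x -> differentiable h x) ->
  (forall x, U x -> h x != 0) -> forall x, U x ->
  'D_v (fun y => (h y)^-1) x = - 'D_v h x * ((h x)^-1 * (h x)^-1).
Proof.
move=> dh h0 x Ux; rewrite deriveV; [|by auto|by apply: diff_derivable; auto].
by rewrite /GRing.scale /= -exprVn expr2; ring.
Qed.

Lemma smooth_uptoV n U h : open U -> (forall x, U x -> h x != 0) ->
  smooth_upto n U h -> smooth_upto n U (fun x => (h x)^-1).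
Proof.
move=> oU h0; elim: n h h0 => [|n IH] h h0.
  move=> /smooth_upto0 H; apply/smooth_upto0; exact: differentiableV_fun.
move=> H; have H' := smooth_upto_le (leqnSn n) H.
move: H => /smooth_uptoS[H1 H2]; apply/smooth_uptoS; split.
  exact: differentiableV_fun.
move=> v; apply: (eq_smooth_upto oU (h := fun x => - 'D_v h x * ((h x)^-1 * (h x)^-1))).
  by move=> x Ux; rewrite (deriveV_fun _ H1 h0).
apply: smooth_uptoM => //; first exact: smooth_uptoN.
by apply: smooth_uptoM => //; exact: IH.
Qed.

Lemma derive_comp1_fun U (g : R -> R) h v :
  (forall x, U x -> differentiable h x) -> (forall y, differentiable g y) ->
  forall x, U x -> 'D_v (fun y => g (h y)) x = 'D_1 g (h x) * 'D_v h x.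
Proof.
move=> dh dg x Ux; have := dh x Ux => dhx.
rewrite derive_diffE; last by apply: differentiable_comp.
rewrite diff_comp //= (derive_diffE (h := h)) // (deriveE (f := g)) //.
by rewrite -[in LHS](mulr1 ('d h x v)) -[_ * 1]/(_ *: (1 : R)) linearZ /= mulrC.
Qed.

Lemma derivable_diff1 (g : R -> R) y : derivable g y 1 -> differentiable g y.
Proof. by move=> /derivable1_diffP. Qed.

End SmoothCalculus.

Section SmoothComp.
Context {R : realType} {V : normedModType R}.
Implicit Types (U : set V) (h k : V -> R).

Lemma smooth_upto_comp n U (g : R -> R) h : open U ->
  smooth_upto n setT g -> smooth_upto n U h -> smooth_upto n U (fun x => g (h x)).
Proof.
move=> oU; elim: n g h => [|n IH] g h.
  move=> /smooth_upto0 G /smooth_upto0 H; apply/smooth_upto0 => x Ux.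
  by apply: differentiable_comp; [exact: H|exact: G].
move=> G H; have G' := smooth_upto_le (leqnSn n) G; have H' := smooth_upto_le (leqnSn n) H.
move: G H => /smooth_uptoS[G1 G2] /smooth_uptoS[H1 H2]; apply/smooth_uptoS; split.
  by move=> x Ux; apply: differentiable_comp; [exact: H1|exact: G1].
move=> v; apply: (eq_smooth_upto oU (h := fun x => 'D_1 g (h x) * 'D_v h x)).
  by move=> x Ux; rewrite (derive_comp1_fun _ H1) // => y; exact: G1.
by apply: smooth_uptoM => //; apply: (IH ('D_1 g) h) => //; exact: G2.
Qed.

(** Joint induction, each function being up to a factor the derivative of the other. *)
Lemma smooth_upto_sin n : smooth_upto n [set: R] (@sin R) /\ smooth_upto n [set: R] (@cos R).
Proof.
have ds (y : R) : differentiable (@sin R) y by apply: derivable_diff1; exact: derivable_sin.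
have dc (y : R) : differentiable (@cos R) y by apply: derivable_diff1; exact: derivable_cos.
have Ds (v y : R) : 'D_v (@sin R) y = v * cos y.
  rewrite derive_diffE // -{1}(mulr1 v) -[v * 1]/(v *: 1) linearZ /= -derive_diffE //.
  by rewrite derive_val.
have Dc (v y : R) : 'D_v (@cos R) y = (- v) * sin y.
  rewrite derive_diffE // -{1}(mulr1 v) -[v * 1]/(v *: 1) linearZ /= -derive_diffE //.
  by rewrite derive_val /GRing.scale /= mulrN mulNr.
elim: n => [|n [IH1 IH2]]; first by split; apply/smooth_upto0.
split; apply/smooth_uptoS; split=> // v.
  apply: (eq_smooth_upto openT (h := fun y => v * cos y)) => [x _|]; first by rewrite Ds.
  by apply: smooth_uptoM openT _ _ => //; exact: smooth_upto_cst.
apply: (eq_smooth_upto openT (h := fun y => - v * sin y)) => [x _|]; first by rewrite Dc.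
by apply: smooth_uptoM openT _ _ => //; exact: smooth_upto_cst.
Qed.

End SmoothComp.

(** * Smooth complex-valued functions and bounds on their derivatives *)

Section ComplexSmooth.
Context {R : realType} {V : normedModType R}.
Implicit Types (U : set V) (g h : V -> R[i]) (w : seq V).

Lemma smooth_onP U g : smooth_on U g <->
  forall n, smooth_upto n U (fun x => Re (g x)) /\ smooth_upto n U (fun x => Im (g x)).
Proof.
split=> [H n|H w x Ux].
  by split=> w _ x Ux; have [] := H w x Ux.
by have [H1 H2] := H (size w); split; [apply: H1|apply: H2].
Qed.

End ComplexSmooth.

Section ComplexSmoothTheory.
Context {R : realType} {V : normedModType R}.
Implicit Types (U : set V) (g h : V -> R[i]) (w : seq V).

Lemma eq_smooth_on U g h : open U -> (forall x, U x -> g x = h x) ->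
  smooth_on U g -> smooth_on U h.
Proof.
move=> oU gh /smooth_onP H; apply/smooth_onP => n; have [H1 H2] := H n.
by split; [apply: eq_smooth_upto H1|apply: eq_smooth_upto H2] => // x Ux; rewrite gh.
Qed.

Lemma smooth_on_sub U U' g : U `<=` U' -> smooth_on U' g -> smooth_on U g.
Proof. by move=> UU H w x Ux; apply: H; exact: UU. Qed.

Lemma smooth_on_cst U (c : R[i]) : smooth_on U (fun=> c).
Proof. by apply/smooth_onP => n; split; exact: smooth_upto_cst. Qed.

Lemma smooth_onD U g h : open U -> smooth_on U g -> smooth_on U h ->
  smooth_on U (fun x => g x + h x).
Proof.
move=> oU /smooth_onP G /smooth_onP H; apply/smooth_onP => n.
have [G1 G2] := G n; have [H1 H2] := H n; split.
  by under eq_fun do rewrite Re_add; exact: smooth_uptoD.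
by under eq_fun do rewrite Im_add; exact: smooth_uptoD.
Qed.

Lemma smooth_onM U g h : open U -> smooth_on U g -> smooth_on U h ->
  smooth_on U (fun x => g x * h x).
Proof.
move=> oU /smooth_onP G /smooth_onP H; apply/smooth_onP => n.
have [G1 G2] := G n; have [H1 H2] := H n; split.
  under eq_fun do rewrite Re_mul; apply: smooth_uptoD => //; first exact: smooth_uptoM.
  by apply: smooth_uptoN => //; exact: smooth_uptoM.
by under eq_fun do rewrite Im_mul; apply: smooth_uptoD => //; exact: smooth_uptoM.
Qed.

Lemma smooth_onJ U g : open U -> smooth_on U g -> smooth_on U (fun x => (g x)^*).
Proof.
move=> oU /smooth_onP G; apply/smooth_onP => n; have [G1 G2] := G n; split.
  by under eq_fun do rewrite Re_conj.
by under eq_fun do rewrite Im_conj; exact: smooth_uptoN.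
Qed.

Lemma smooth_on_comp U (g : R -> R[i]) (q : V -> R) : open U -> smooth_on setT g ->
  (forall n, smooth_upto n U q) -> smooth_on U (fun x => g (q x)).
Proof.
move=> oU /smooth_onP G Q; apply/smooth_onP => n; have [G1 G2] := G n.
split; [exact: (smooth_upto_comp (g := fun y => Re (g y)))|
        exact: (smooth_upto_comp (g := fun y => Im (g y)))].
Qed.

Lemma smooth_on_real U (q : V -> R) : (forall n, smooth_upto n U q) ->
  smooth_on U (fun x => (q x)%:C).
Proof. by move=> Q; apply/smooth_onP => n; split; [exact: Q|exact: smooth_upto_cst]. Qed.

Lemma smooth_on_expi U (q : V -> R) : open U -> (forall n, smooth_upto n U q) ->
  smooth_on U (fun x => expi (q x)).
Proof.
move=> oU Q; apply: (smooth_on_comp (g := @expi R)) => //.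
by apply/smooth_onP => n; have [] := @smooth_upto_sin R n.
Qed.

Definition cD (v : V) g : V -> R[i] := cdirD [:: v] g.

Lemma cdirD_nil g : cdirD [::] g = g.
Proof. by apply/funext => x; rewrite /cdirD /=; case: (g x). Qed.

Lemma cdirD_rcons w v g : cdirD (rcons w v) g = cdirD w (cD v g).
Proof. by apply/funext => x; rewrite /cdirD !dirD_rcons. Qed.

Lemma smooth_cD U v g : smooth_on U g -> smooth_on U (cD v g).
Proof.
move=> H w x Ux; have := H (rcons w v) x Ux; rewrite !dirD_rcons.
by [].
Qed.

Lemma smooth_cdirD U w g : smooth_on U g -> smooth_on U (cdirD w g).
Proof.
elim/last_ind: w g => [|w v IH] g H; first by rewrite cdirD_nil.
by rewrite cdirD_rcons; apply: IH; exact: smooth_cD.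
Qed.

Lemma eq_cdirD_on U g h w : open U -> (forall x, U x -> g x = h x) ->
  forall x, U x -> cdirD w g x = cdirD w h x.
Proof.
move=> oU gh x Ux; apply: complex_ext => /=.
  by apply: (eq_dirD_on w oU) => // y Uy; rewrite gh.
by apply: (eq_dirD_on w oU) => // y Uy; rewrite gh.
Qed.

Lemma smooth_on_diff U g x : smooth_on U g -> U x ->
  differentiable (fun y => Re (g y)) x /\ differentiable (fun y => Im (g y)) x.
Proof. by move=> H Ux; exact: (H [::]). Qed.

Lemma cDM U g h v x : smooth_on U g -> smooth_on U h -> U x ->
  cD v (fun y => g y * h y) x = cD v g x * h x + g x * cD v h x.
Proof.
move=> G H Ux.
have [G1 G2] : (forall x, U x -> differentiable (fun y => Re (g y)) x) /\
   (forall x, U x -> differentiable (fun y => Im (g y)) x).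
  by split=> y Uy; have [] := smooth_on_diff G Uy.
have [H1 H2] : (forall x, U x -> differentiable (fun y => Re (h y)) x) /\
   (forall x, U x -> differentiable (fun y => Im (h y)) x).
  by split=> y Uy; have [] := smooth_on_diff H Uy.
apply: complex_ext; rewrite !reimE /=.
  under [X in 'D_v X _]eq_fun do rewrite Re_mul.
  rewrite deriveB ?(deriveM_fun _ G1 H1) ?(deriveM_fun _ G2 H2) //; first by ring.
    by apply: diff_derivable; apply: differentiableM; auto.
  by apply: diff_derivable; apply: differentiableM; auto.
under [X in 'D_v X _]eq_fun do rewrite Im_mul.
rewrite deriveD ?(deriveM_fun _ G1 H2) ?(deriveM_fun _ G2 H1) //; first by ring.
  by apply: diff_derivable; apply: differentiableM; auto.
by apply: diff_derivable; apply: differentiableM; auto.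
Qed.

Lemma cDD U g h v x : smooth_on U g -> smooth_on U h -> U x ->
  cD v (fun y => g y + h y) x = cD v g x + cD v h x.
Proof.
move=> G H Ux; have [G1 G2] := smooth_on_diff G Ux; have [H1 H2] := smooth_on_diff H Ux.
apply: complex_ext; rewrite !reimE /=.
  by under [X in 'D_v X _]eq_fun do rewrite Re_add; rewrite deriveD //; exact: diff_derivable.
by under [X in 'D_v X _]eq_fun do rewrite Im_add; rewrite deriveD //; exact: diff_derivable.
Qed.

Lemma cD_cst v (c : R[i]) : cD v (fun=> c) = fun=> 0.
Proof. by apply/funext => x; rewrite /cD /cdirD /= !derive_cst. Qed.

Lemma cDJ U g v x : smooth_on U g -> U x -> cD v (fun y => (g y)^*) x = (cD v g x)^*.
Proof.
move=> G Ux; have [G1 G2] := smooth_on_diff G Ux.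
apply: complex_ext; rewrite !reimE /=.
  by under [X in 'D_v X _]eq_fun do rewrite Re_conj.
by under [X in 'D_v X _]eq_fun do rewrite Im_conj; rewrite deriveN //; exact: diff_derivable.
Qed.

Lemma cdirDD_on U w g h x : open U -> smooth_on U g -> smooth_on U h -> U x ->
  cdirD w (fun y => g y + h y) x = cdirD w g x + cdirD w h x.
Proof.
move=> oU + + Ux; elim/last_ind: w g h => [|w v IH] g h G H; first by rewrite !cdirD_nil.
rewrite !cdirD_rcons -IH; [|exact: smooth_cD..].
by apply: (eq_cdirD_on w oU) => // y Uy; rewrite (cDD v G H).
Qed.

Lemma cdirDD w g h : smooth_on setT g -> smooth_on setT h ->
  cdirD w (fun y => g y + h y) = (fun y => cdirD w g y + cdirD w h y).
Proof. by move=> G H; apply/funext => x; apply: (cdirDD_on w openT). Qed.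

Lemma cdirDZ w (c : R[i]) g : smooth_on setT g ->
  cdirD w (fun y => c * g y) = (fun y => c * cdirD w g y).
Proof.
elim/last_ind: w g => [|w v IH] g G; first by rewrite !cdirD_nil.
rewrite !cdirD_rcons -IH; last exact: smooth_cD.
congr cdirD; apply/funext => x; rewrite (cDM v (@smooth_on_cst setT c) G) //.
by rewrite cD_cst mul0r add0r.
Qed.

Lemma cdirDJ w g : smooth_on setT g ->
  cdirD w (fun y => (g y)^*) = (fun y => (cdirD w g y)^*).
Proof.
elim/last_ind: w g => [|w v IH] g G; first by rewrite !cdirD_nil.
rewrite !cdirD_rcons -IH; last exact: smooth_cD.
by congr cdirD; apply/funext => x; apply: (cDJ v G).
Qed.

Definition unit_word w := all (fun v => `|v| <= 1) w.

(** A pointwise C^n seminorm taken over all directions of norm at most 1 instead of coordinates, so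
    that it behaves well under linear changes of variable. *)
Definition derbound (n : nat) g x (A : R) := forall w, (size w <= n)%N ->
  unit_word w -> cabs (cdirD w g x) <= A.

Lemma derbound_ge0 n g x A : derbound n g x A -> 0 <= A.
Proof. by move=> /(_ [::] isT isT); apply: le_trans; exact: cabs_ge0. Qed.

(** Leibniz rule: each derivative doubles the number of terms, hence [2 ^+ n]. *)
Lemma derboundM U n g h x A B : open U -> smooth_on U g -> smooth_on U h -> U x ->
  derbound n g x A -> derbound n h x B ->
  derbound n (fun y => g y * h y) x (2 ^+ n * (A * B)).
Proof.
move=> oU + + Ux; elim: n g h A B => [|n IH] g h A B G H GA HB w.
  rewrite leqn0 size_eq0 => /eqP -> _; rewrite cdirD_nil expr0 mul1r cabsM.
  by rewrite ler_pM ?cabs_ge0 //; [have := GA [::]|have := HB [::]];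
    rewrite cdirD_nil; apply.
have A0 := derbound_ge0 GA; have B0 := derbound_ge0 HB.
have GA' : derbound n g x A by move=> w' sw; apply: GA; exact: ltnW.
have HB' : derbound n h x B by move=> w' sw; apply: HB; exact: ltnW.
case/lastP: w => [_ _|w v].
  rewrite cdirD_nil cabsM.
  have : cabs (g x) <= A by have := GA [::]; rewrite cdirD_nil; apply.
  have : cabs (h x) <= B by have := HB [::]; rewrite cdirD_nil; apply.
  move=> h1 h2; rewrite (le_trans (ler_pM _ _ h2 h1)) ?cabs_ge0 //.
  by rewrite ler_peMl ?mulr_ge0 // exprn_ege1 // ler1n.
rewrite size_rcons ltnS /unit_word all_rcons => sw /andP[v1 uw].
rewrite cdirD_rcons.
rewrite (eq_cdirD_on w oU (h := fun y => cD v g y * h y + g y * cD v h y)) //; last first.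
  by move=> y Uy; rewrite (cDM v G H).
rewrite (cdirDD_on w oU _ _ Ux); last 2 first.
  by apply: smooth_onM => //; exact: smooth_cD.
  by apply: smooth_onM => //; exact: smooth_cD.
rewrite (le_trans (cabsD _ _)) // exprS -mulrA mulr_natl mulr2n.
have vw w' : unit_word w' -> unit_word (rcons w' v) by rewrite /unit_word all_rcons v1.
apply: lerD.
  apply: IH => //; first exact: smooth_cD.
  by move=> w' sw' uw'; rewrite -cdirD_rcons; apply: GA; rewrite ?size_rcons ?vw.
apply: IH => //; first exact: smooth_cD.
by move=> w' sw' uw'; rewrite -cdirD_rcons; apply: HB; rewrite ?size_rcons ?vw.
Qed.

(** A derivative is homogeneous in each of its directions, so a vector of norm at most [K] costs one
    factor [K]. *)
Lemma derbound_dirD U n g x (A K : R) w : smooth_on U g -> open U -> U x -> 0 < K ->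
  derbound n g x A -> (size w <= n)%N -> all (fun v => `|v| <= K) w ->
  cabs (cdirD w g x) <= K ^+ size w * A.
Proof.
move=> G oU Ux K0 GA sw wK.
have K1 : K * K^-1 = 1 by rewrite mulfV // gt_eqF.
pose w1 := [seq K^-1 *: v | v <- w].
have -> : w = [seq K *: v | v <- w1].
  by rewrite -map_comp -[LHS]map_id; apply: eq_map => v /=; rewrite scalerA K1 scale1r.
have u1 : unit_word w1.
  rewrite /unit_word all_map; apply: sub_all wK => v /= vK.
  have -> : `|K^-1 *: v| = K^-1 * `|v| by rewrite normrZ ger0_norm // invr_ge0 ltW.
  by rewrite ler_pdivrMl // mulr1.
have s1 : size w1 = size w by rewrite size_map.
have -> : cdirD [seq K *: v | v <- w1] g x = (K ^+ size w1)%:C * cdirD w1 g x.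
  have gen (h : V -> R) (w' : seq V) : (forall w x, U x -> differentiable (dirD w h) x) ->
      forall x, U x -> dirD [seq K *: v | v <- w'] h x = K ^+ size w' * dirD w' h x.
    move=> Hh; elim: w' => [|v w' IH] y Uy /=; first by rewrite mul1r.
    have -> : 'D_(K *: v) (dirD [seq K *: v0 | v0 <- w'] h) y =
              'D_(K *: v) (fun z => K ^+ size w' *: dirD w' h z) y.
      apply: near_eq_derive; have := open_nbhs_nbhs (conj oU Uy).
      by apply: filterS => z Uz; rewrite IH.
    rewrite deriveZ; last by apply: diff_derivable; exact: Hh.
    rewrite deriveE; last exact: Hh.
    rewrite linearZ /= deriveE; last exact: Hh.
    by rewrite /GRing.scale /= exprS; ring.
  apply: complex_ext; rewrite !reimE /= mul0r ?subr0 ?addr0.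
    by apply: gen => // w' y Uy; have [] := G w' y Uy.
  by rewrite gen // => w' y Uy; have [] := G w' y Uy.
have Kn := exprn_ge0 (size w) (ltW K0).
rewrite cabsM cabs_real !size_map ger0_norm // ler_wpM2l //.
by apply: GA; rewrite ?s1 // size_map s1.
Qed.

End ComplexSmoothTheory.

(** * Derivatives under affine substitution *)

Section AffineComp.
Context {R : realType} {V W : normedModType R}.

(** The difference quotients of the two sides coincide, so this is an identity of limits, whether or
    not they exist. *)
Lemma derive_comp_affine (h : W -> R) (L : V -> W) (c : W) v :
  (forall (t : R) x y, L (t *: x + y) = t *: L x + L y) ->
  'D_v (fun x => h (L x + c)) = (fun x => 'D_(L v) h (L x + c)).
Proof.
move=> Ll; apply/funext => x; rewrite /derive.
rewrite (_ : (fun h0 : R => h0^-1 *: (((fun x0 : V => h (L x0 + c)) \o shift x)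
  (h0 *: v) - h (L x + c))) =
  (fun h0 : R => h0^-1 *: ((h \o shift (L x + c)) (h0 *: L v) - h (L x + c)))) //.
by apply/funext => t /=; rewrite Ll -addrA.
Qed.

Lemma dirD_comp_affine (h : W -> R) (L : V -> W) (c : W) w :
  (forall (t : R) x y, L (t *: x + y) = t *: L x + L y) ->
  dirD w (fun x => h (L x + c)) = (fun x => dirD (map L w) h (L x + c)).
Proof.
by move=> Ll; elim: w => [//|v w IH] /=; rewrite IH derive_comp_affine.
Qed.

Lemma cdirD_comp_affine (g : W -> R[i]) (L : V -> W) (c : W) w :
  (forall (t : R) x y, L (t *: x + y) = t *: L x + L y) ->
  cdirD w (fun x => g (L x + c)) = (fun x => cdirD (map L w) g (L x + c)).
Proof.
move=> Ll; apply/funext => x; rewrite /cdirD.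
by rewrite (dirD_comp_affine (fun y => Re (g y))) //
  (dirD_comp_affine (fun y => Im (g y))).
Qed.

Lemma smooth_comp_affine (g : W -> R[i]) (L : {linear V -> W}) (c : W) :
  continuous L -> smooth_on setT g -> smooth_on setT (fun x => g (L x + c)).
Proof.
move=> cL G w x _.
have Ll : forall (t : R) x y, L (t *: x + y) = t *: L x + L y by move=> *; exact: linearP.
rewrite (dirD_comp_affine (fun y => Re (g y))) // (dirD_comp_affine (fun y => Im (g y))) //.
have [G1 G2] := G (map L w) (L x + c) I.
have dA : differentiable (fun x => L x + c) x.
  by apply: differentiableD => //; exact: linear_differentiable.
by split; [exact: (differentiable_comp dA G1)|exact: (differentiable_comp dA G2)].
Qed.

End AffineComp.

(** * The Fourier transform of test functions and of compactly supported distributions *)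

Section PlaneDiff.
Context {R : realType}.
Local Notation P := (R * R)%type.
Implicit Types (g K : P -> R[i]) (v x xi : P) (w : seq P).

Definition linform (a b : R) (v : P) : R := v.1 * a + v.2 * b.

Lemma linform_linear a b : linear (linform a b).
Proof. by move=> t x y; rewrite /linform /= /GRing.scale /=; ring. Qed.

HB.instance Definition _ a b := GRing.isLinear.Build R P R _ (linform a b)
  (linform_linear a b).

Lemma continuous_fst2 : continuous (fun x : P => x.1).
Proof. by move=> x; exact: cvg_fst. Qed.
Lemma continuous_snd2 : continuous (fun x : P => x.2).
Proof. by move=> x; exact: cvg_snd. Qed.

Lemma continuous_linform a b : continuous (linform a b).
Proof.
move=> x; apply: cvgD.
  by apply: cvgM; [exact: continuous_fst2|exact: cvg_cst].
by apply: cvgM; [exact: continuous_snd2|exact: cvg_cst].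
Qed.

Lemma dot2E x y : dot2 x y = x.1 * y.1 + x.2 * y.2. Proof. by []. Qed.
Lemma dot2C x y : dot2 x y = dot2 y x. Proof. by rewrite !dot2E; ring. Qed.
Lemma dot2Dr x y z : dot2 x (y + z) = dot2 x y + dot2 x z.
Proof. by rewrite !dot2E /=; ring. Qed.
Lemma dot2Dl x y z : dot2 (y + z) x = dot2 y x + dot2 z x.
Proof. by rewrite !dot2E /=; ring. Qed.
Lemma dot2Nr x y : dot2 x (- y) = - dot2 x y.
Proof. by rewrite !dot2E /=; ring. Qed.
Lemma dot2Nl x y : dot2 (- x) y = - dot2 x y.
Proof. by rewrite !dot2E /=; ring. Qed.
Lemma dot2_le x y : `|dot2 x y| <= 2 * (`|x| * `|y|).
Proof.
rewrite dot2E (le_trans (ler_normD _ _)) // !normrM mulr_natl mulr2n.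
by rewrite lerD // ler_pM // ?norm_fst ?norm_snd.
Qed.
Lemma continuous_dot2 y : continuous (fun x => dot2 x y).
Proof. exact: continuous_linform. Qed.
Lemma continuous_dot2r y : continuous (fun x => dot2 y x).
Proof. by under eq_fun do rewrite dot2C; exact: continuous_dot2. Qed.

(** Differentiability from a quadratic remainder: the form in which derivatives of parameter
    integrals are obtained here. *)
Lemma differentiable_quad (h : P -> R) x a b C :
  (forall v, `|h (x + v) - h x - linform a b v| <= C * `|v| ^+ 2) ->
  differentiable h x /\ forall v, 'D_v h x = linform a b v.
Proof.
move=> H.
have [] := @differentiable_eps _ _ h x (linform a b) (@continuous_linform a b).
  move=> e e0.
  have C0 : 0 < 1 + `|C| by rewrite ltr_pwDl.
  apply/nbhs_ballP; exists (e / (1 + `|C|)); first by rewrite /= divr_gt0.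
  move=> v; rewrite -ball_normE /ball_ /= sub0r normrN => ve.
  rewrite [v + x]addrC (le_trans (H v)) // expr2 mulrA ler_wpM2r //.
  rewrite (le_trans (ler_norm _)) // normrM normr_id.
  rewrite (le_trans (y := (1 + `|C|) * `|v|)) ?ler_wpM2r ?lerDr //.
  by rewrite mulrC -ler_pdivlMr // ltW.
by move=> dh D; split => // v; rewrite deriveE // D.
Qed.

Lemma cdifferentiable_quad g x (A B : R[i]) C :
  (forall v, cabs (g (x + v) - g x - (v.1%:C * A + v.2%:C * B)) <= C * `|v| ^+ 2) ->
  [/\ differentiable (fun y => Re (g y)) x, differentiable (fun y => Im (g y)) x &
   forall v, cD v g x = v.1%:C * A + v.2%:C * B].
Proof.
move=> H.
have [d1 D1] : differentiable (fun y => Re (g y)) x /\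
    forall v, 'D_v (fun y => Re (g y)) x = linform (Re A) (Re B) v.
  apply: (differentiable_quad (C := C)) => v; apply: le_trans (H v).
  by apply: le_trans (cabs_Re _); rewrite !reimE /linform /= !mul0r !subr0.
have [d2 D2] : differentiable (fun y => Im (g y)) x /\
    forall v, 'D_v (fun y => Im (g y)) x = linform (Im A) (Im B) v.
  apply: (differentiable_quad (C := C)) => v; apply: le_trans (H v).
  by apply: le_trans (cabs_Im _); rewrite !reimE /linform /= !mul0r !addr0.
split => // v; apply: complex_ext; rewrite !reimE /= !mul0r ?subr0 ?addr0.
  exact: D1.
exact: D2.
Qed.

(** Second-order Taylor remainder of the exponential, to be used under the integral sign with
    [cdifferentiable_quad]. *)
Lemma cabs_expi2 (y : R) : cabs (expi y - 1 - (0 +i* y)) <= 2 * y ^+ 2.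
Proof.
have s2 (z : R) : 0 <= z -> z - sin z <= z ^+ 2.
  move=> z0; have := @ge0_derive_incr R (fun u : R => u ^+ 2 + (sin u - u))
    (fun u : R => 2 * u + (cos u - 1)).
  rewrite /= sin0 expr0n /= subr0 addr0 => H.
  suff : 0 <= z ^+ 2 + (sin z - z) by lra.
  apply: H => // [u|u u0].
    apply: is_deriveD; apply: is_derive_eq.
    by rewrite /GRing.scale /=; ring.
  have := cos_geN1 u; have := cos_ge1B u; case: (leP u 1) => ?; nra.
have sy : `|sin y - y| <= y ^+ 2.
  have [y0|y0] := leP 0 y.
    by rewrite distrC ger0_norm ?subr_ge0 ?sin_le_id // s2.
  have := s2 (- y); have := @sin_le_id R (- y); rewrite sinN sqrrN oppr_ge0 ltW // => /(_ isT) h1 /(_ isT) h2.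
  by rewrite ger0_norm; lra.
rewrite (le_trans (cabs_le _)) // !reimE /= !oppr0 !addr0.
have c1 : `|cos y - 1| <= y ^+ 2.
  rewrite ler0_norm ?subr_le0 ?cos_le1 //; have := cos_ge1B y; have := sqr_ge0 y; lra.
lra.
Qed.

Definition ew (xi x : P) : R[i] := expi (- (2 * pi * dot2 xi x)).

Lemma ewC xi x : ew xi x = ew x xi. Proof. by rewrite /ew dot2C. Qed.
Lemma ewDr xi x y : ew xi (x + y) = ew xi x * ew xi y.
Proof. by rewrite /ew -expiD dot2Dr; congr expi; ring. Qed.
Lemma cabs_ew xi x : cabs (ew xi x) = 1. Proof. exact: cabs_expi. Qed.
Lemma ewN xi x : ew xi (- x) = (ew xi x)^*.
Proof. by rewrite /ew dot2Nr -expiN; congr expi; ring. Qed.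

(** Symbol of the iterated derivative along [w], that is, the factor which this derivative produces
    on the character [ew xi]. *)
Definition mono w (xi : P) : R[i] := \prod_(v <- w) (0 +i* (- (2 * pi * dot2 xi v))).

Lemma mono_nil xi : mono [::] xi = 1. Proof. by rewrite /mono big_nil. Qed.
Lemma mono_cons v w xi : mono (v :: w) xi = (0 +i* (- (2 * pi * dot2 xi v))) * mono w xi.
Proof. by rewrite /mono big_cons. Qed.
Lemma mono_rcons v w xi : mono (rcons w v) xi = (0 +i* (- (2 * pi * dot2 xi v))) * mono w xi.
Proof. by rewrite /mono -cats1 big_cat /= big_cons big_nil mulr1 mulrC. Qed.
Lemma mono1 v xi : mono [:: v] xi = 0 +i* (- (2 * pi * dot2 xi v)).
Proof. by rewrite mono_cons mono_nil mulr1. Qed.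

Lemma cabs_imag (y : R) : cabs (0 +i* y) = `|y|.
Proof. by rewrite /= expr0n /= add0r sqrtr_sqr. Qed.

Lemma cabs_mono w xi : unit_word w -> cabs (mono w xi) <= (4 * pi * (1 + `|xi|)) ^+ size w.
Proof.
elim: w => [|v w IH]; first by rewrite mono_nil cabs1.
rewrite /unit_word /= => /andP[v1 /IH wu]; rewrite mono_cons cabsM exprS.
rewrite ler_pM ?cabs_ge0 // cabs_imag normrN normrM ger0_norm ?mulr_ge0 ?pi_ge0 //.
rewrite (_ : 4 * pi * _ = 2 * pi * (2 * (1 + `|xi|))); last by ring.
rewrite ler_wpM2l ?mulr_ge0 ?pi_ge0 // (le_trans (dot2_le _ _)) // ler_wpM2l //.
by rewrite (le_trans (ler_wpM2l _ v1)) // mulr1 lerDr.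
Qed.

Lemma Ccontinuous_mul g h : Ccontinuous g -> Ccontinuous h -> Ccontinuous (fun x => g x * h x).
Proof.
move=> [g1 g2] [h1 h2]; split=> x.
  under eq_fun do rewrite Re_mul; apply: cvgB; apply: cvgM;
    by first [exact: g1|exact: g2|exact: h1|exact: h2].
under eq_fun do rewrite Im_mul; apply: cvgD; apply: cvgM;
  by first [exact: g1|exact: g2|exact: h1|exact: h2].
Qed.

Lemma Ccontinuous_expi (q : P -> R) : continuous q -> Ccontinuous (fun x => expi (q x)).
Proof.
move=> cq; split => x /=; apply: continuous_comp; [exact: cq|exact: continuous_cos|
  exact: cq|exact: continuous_sin].
Qed.

Lemma Ccontinuous_cst c : @Ccontinuous R (fun=> c).
Proof. by split => x; exact: cvg_cst. Qed.

Lemma Ccontinuous_ew xi : Ccontinuous (ew xi).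
Proof.
apply: Ccontinuous_expi => x; apply: cvgN; apply: cvgM; first exact: cvg_cst.
exact: continuous_dot2r.
Qed.

Lemma Ccontinuous_mono w : Ccontinuous (mono w).
Proof.
elim: w => [|v w IH].
  have -> : mono [::] = fun=> 1 by apply/funext => x; rewrite mono_nil.
  exact: Ccontinuous_cst.
rewrite (_ : mono (v :: w) = fun x => (0 +i* (- (2 * pi * dot2 x v))) * mono w x); last first.
  by apply/funext => x; rewrite mono_cons.
apply: Ccontinuous_mul => //; split => x /=; first exact: cvg_cst.
by apply: cvgN; apply: cvgM; [exact: cvg_cst|exact: continuous_dot2].
Qed.

Lemma cmeas_ew xi : cmeas (ew xi : (measurableTypeR R * measurableTypeR R)%type -> R[i]).
Proof. apply: cmeas_continuous; exact: Ccontinuous_ew. Qed.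

Lemma pgrowth_ew xi : pgrowth (ew xi).
Proof. by apply: (pgrowth_bounded (C := 1) (cmeas_ew xi)) => x; rewrite cabs_ew. Qed.

Lemma cabs_mono_gen w xi : exists C, forall xi, cabs (mono w xi) <= C * (1 + `|xi|) ^+ size w.
Proof.
elim: w => [|v w [C IH]]; first by exists 1 => x; rewrite mono_nil cabs1 expr0 mulr1.
exists (4 * pi * `|v| * C) => x; rewrite mono_cons cabsM exprS.
rewrite (_ : 4 * pi * _ * _ * _ = (2 * pi * (2 * ((1 + `|x|) * `|v|))) * (C * (1 + `|x|) ^+ size w)); last by ring.
rewrite ler_pM ?cabs_ge0 // cabs_imag normrN normrM ger0_norm ?mulr_ge0 ?pi_ge0 //.
rewrite ler_wpM2l ?mulr_ge0 ?pi_ge0 // (le_trans (dot2_le _ _)) // ler_wpM2l //.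
by rewrite ler_wpM2r // lerDr.
Qed.

Lemma pgrowth_mono w : pgrowth (mono w).
Proof.
split; first by apply: cmeas_continuous; exact: Ccontinuous_mono.
by have [C H] := cabs_mono_gen w 0; exists (size w), C.
Qed.

Lemma rapid_mono w K : rapid K -> rapid (fun xi => mono w xi * K xi).
Proof.
move=> rK; under eq_fun do rewrite mulrC; apply: rapid_pgrowth => //; exact: pgrowth_mono.
Qed.

Lemma rapid_ew x K : rapid K -> rapid (fun xi => K xi * ew xi x).
Proof.
move=> rK; under eq_fun do rewrite ewC; apply: rapid_pgrowth => //; exact: pgrowth_ew.
Qed.

Lemma rapidB K K' : rapid K -> rapid K' -> rapid (fun x => K x - K' x).
Proof.
move=> rK rK'; have := rapidD rK (rapidZ (-1) rK').
by under eq_fun do rewrite mulN1r.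
Qed.

Lemma integrable_comega (c : R) (f : P -> R) : (forall x, f x = c * omega x) ->
  (@leb2 R).-integrable setT (EFin \o f).
Proof.
by move=> /funext ->; exact: (integrableZl measurableT c integrable_omega).
Qed.

Definition FT K : P -> R[i] := fourier leb2 dot2 K.

Lemma FTE K x : FT K x = Cint leb2 setT (fun xi => K xi * ew xi x). Proof. by []. Qed.

Lemma cintable_FT K x : rapid K -> cintable leb2 (fun xi => K xi * ew xi x).
Proof. by move=> rK; apply: rapid_cintable; exact: rapid_ew. Qed.

Lemma monoE2 v xi : mono [:: v] xi = v.1%:C * mono [:: (1, 0)] xi + v.2%:C * mono [:: (0, 1)] xi.
Proof. by rewrite !mono1; apply: complex_ext; rewrite !reimE !dot2E /=; ring. Qed.

Lemma FTD K K' : rapid K -> rapid K' -> FT (fun x => K x + K' x) = (fun x => FT K x + FT K' x).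
Proof.
move=> rK rK'; apply/funext => x; rewrite !FTE -CintD; [|exact: cintable_FT..].
by congr Cint; apply/funext => y; rewrite mulrDl.
Qed.

Lemma FTZ c K : rapid K -> FT (fun x => c * K x) = (fun x => c * FT K x).
Proof.
move=> rK; apply/funext => x; rewrite !FTE -CintZ; last exact: cintable_FT.
by congr Cint; apply/funext => y; rewrite mulrA.
Qed.

(** The quadratic remainder of the character is at most a multiple of [|xi| ^+ 2 * |v| ^+ 2], and
    [(1 + |xi|) ^+ 2 * |K|] has the integrable majorant [C * omega]; the integral therefore has a
    quadratic remainder as well. *)
Lemma FT_diff K x : rapid K ->
  [/\ differentiable (fun y => Re (FT K y)) x, differentiable (fun y => Im (FT K y)) x &
   forall v, cD v (FT K) x = FT (fun xi => mono [:: v] xi * K xi) x].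
Proof.
move=> rK; have r1 := rapid_mono [:: ((1, 0) : P)] rK; have r2 := rapid_mono [:: ((0, 1) : P)] rK.
have [C C0 HC] := rapid_le 2 rK.

have [] := @cdifferentiable_quad (FT K) x (FT (fun xi => mono [:: (1, 0)] xi * K xi) x)
   (FT (fun xi => mono [:: (0, 1)] xi * K xi) x)
   (\int[leb2]_x (2 * (4 * pi) ^+ 2 * C * omega x)); last first.
  move=> d1 d2 D; split=> // v; rewrite D.
  rewrite -[_%:C * FT _ x]/((fun x => v.1%:C * FT (fun xi => mono [:: (1, 0)] xi * K xi) x) x).
  rewrite -FTZ // -[v.2%:C * _]/((fun x => v.2%:C * FT (fun xi => mono [:: (0, 1)] xi * K xi) x) x).
  rewrite -FTZ // -[_ + _]/((fun x => _ + _) x) -FTD; [|exact: rapidZ..].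
  by congr (FT _ x); apply/funext => xi; rewrite (monoE2 v xi); ring.
move=> v; rewrite !FTE -!CintZ; [|exact: cintable_FT..].
rewrite -CintD; [|apply: cintableZ; exact: cintable_FT..].
rewrite -CintB; [|exact: cintable_FT..].
rewrite -CintB; last 2 first.
  by apply: rapid_cintable; apply: rapidB; exact: rapid_ew.
  by apply: rapid_cintable; apply: rapidD; apply: rapidZ; exact: rapid_ew.
rewrite mulrC -RintegralZl //; last exact: (integrableZl measurableT _ integrable_omega).
apply: Cint_abs_le.
- apply: cintable_cmeas; apply: rapid_cintable.
  apply: rapidB; first by apply: rapidB; exact: rapid_ew.
  by apply: rapidD; apply: rapidZ; exact: rapid_ew.
- by apply: (@integrable_comega (`|v| ^+ 2 * (2 * (4 * pi) ^+ 2 * C))) => xi; rewrite !mulrA.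
- move=> xi.
  have -> : K xi * ew xi (x + v) - K xi * ew xi x - (v.1%:C * (mono [:: (1, 0)] xi * K xi * ew xi x) +
      v.2%:C * (mono [:: (0, 1)] xi * K xi * ew xi x)) =
      K xi * ew xi x * (ew xi v - 1 - mono [:: v] xi).
    by rewrite (monoE2 v xi) ewDr; ring.
  rewrite mono1 !cabsM cabs_ew mulr1 /ew.
  rewrite (le_trans (ler_wpM2l (cabs_ge0 _) (cabs_expi2 _))) //.
  rewrite sqrrN.
  have h1 : (2 * pi * dot2 xi v) ^+ 2 <= (4 * pi) ^+ 2 * ((1 + `|xi|) ^+ 2 * `|v| ^+ 2).
    rewrite -!exprMn -real_normK ?num_real // lerXn2r ?nnegrE ?mulr_ge0 ?pi_ge0 ?addr_ge0 //.
    rewrite normrM ger0_norm ?mulr_ge0 ?pi_ge0 //.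
    rewrite (_ : 4 * pi * _ = 2 * pi * (2 * ((1 + `|xi|) * `|v|))); last by ring.
    rewrite ler_wpM2l ?mulr_ge0 ?pi_ge0 // (le_trans (dot2_le _ _)) // ler_wpM2l //.
    by rewrite ler_wpM2r // lerDr.
  rewrite (le_trans (ler_wpM2l (cabs_ge0 _) (ler_wpM2l _ h1))) //.
  rewrite (_ : cabs (K xi) * _ = `|v| ^+ 2 * (2 * (4 * pi) ^+ 2 * ((1 + `|xi|) ^+ 2 * cabs (K xi)))); last by ring.
  rewrite ler_wpM2l ?sqr_ge0 // -(mulrA (2 * (4 * pi) ^+ 2) C) ler_wpM2l ?mulr_ge0 ?sqr_ge0 ?pi_ge0 //.
Qed.

Lemma FT_smooth K : rapid K -> smooth_on setT (FT K) /\
  forall w, cdirD w (FT K) = FT (fun xi => mono w xi * K xi).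
Proof.
have H w K' : rapid K' -> cdirD w (FT K') = FT (fun xi => mono w xi * K' xi).
  elim/last_ind: w K' => [|w v IH] K' rK'.
    by rewrite cdirD_nil; congr FT; apply/funext => x; rewrite mono_nil mul1r.
  rewrite cdirD_rcons.
  have -> : cD v (FT K') = FT (fun xi => mono [:: v] xi * K' xi).
    by apply/funext => x; have [_ _ ->] := FT_diff x rK'.
  rewrite IH; last exact: rapid_mono.
  by congr FT; apply/funext => x; rewrite mono_rcons mono1; ring.
move=> rK; split; last by move=> w; exact: H.
move=> w x _.
have [d1 d2 _] := FT_diff x (rapid_mono w rK).
have E := H w K rK.
split.
  by rewrite (_ : dirD w _ = fun y => Re (FT (fun xi => mono w xi * K xi) y)) // -E.
by rewrite (_ : dirD w _ = fun y => Im (FT (fun xi => mono w xi * K xi) y)) // -E.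
Qed.

Lemma smooth_ew xi : smooth_on setT (ew xi) /\ forall w x, cdirD w (ew xi) x = mono w xi * ew xi x.
Proof.
have D (x : P) : [/\ differentiable (fun y => Re (ew xi y)) x,
   differentiable (fun y => Im (ew xi y)) x &
   forall v, cD v (ew xi) x = mono [:: v] xi * ew xi x].
  have [] := @cdifferentiable_quad (ew xi) x (mono [:: (1, 0)] xi * ew xi x)
      (mono [:: (0, 1)] xi * ew xi x) (2 * (4 * pi * `|xi|) ^+ 2); last first.
    by move=> d1 d2 E; split => // v; rewrite E (monoE2 v); ring.
  move=> v.
  have -> : ew xi (x + v) - ew xi x - (v.1%:C * (mono [:: (1, 0)] xi * ew xi x) +
    v.2%:C * (mono [:: (0, 1)] xi * ew xi x)) = ew xi x * (ew xi v - 1 - mono [:: v] xi).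
    by rewrite (monoE2 v) ewDr; ring.
  rewrite mono1 cabsM cabs_ew mul1r (le_trans (cabs_expi2 _)) // -[leRHS]mulrA ler_wpM2l //.
  rewrite sqrrN -exprMn -real_normK ?num_real // lerXn2r ?nnegrE ?mulr_ge0 ?pi_ge0 //.
  rewrite normrM ger0_norm ?mulr_ge0 ?pi_ge0 //.
  rewrite (_ : 4 * pi * _ * _ = 2 * pi * (2 * (`|xi| * `|v|))); last by ring.
  by rewrite ler_wpM2l ?mulr_ge0 ?pi_ge0 ?dot2_le.
have S : smooth_on setT (ew xi).
  apply: smooth_on_expi openT _ => n.
  rewrite (_ : (fun x => _) = fun x => -1 * (2 * pi * linform xi.1 xi.2 x)); last first.
    by apply/funext => x; rewrite /linform dot2E; ring.
  apply: smooth_uptoM openT _ _; first exact: smooth_upto_cst.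
  apply: smooth_uptoM openT _ _; first exact: smooth_upto_cst.
  apply: smooth_upto_linear openT; exact: continuous_linform.
split=> // w; elim/last_ind: w => [|w v IH] x; first by rewrite cdirD_nil mono_nil mul1r.
rewrite cdirD_rcons.
rewrite (_ : cD v (ew xi) = fun y => mono [:: v] xi * ew xi y); last first.
  by apply/funext => y; have [_ _ ->] := D y.
by rewrite cdirDZ // IH mono_rcons mono1 mulrA.
Qed.

End PlaneDiff.

Lemma integrable_scale {R : realType} {d} {T : measurableType d}
    (mu : {measure set T -> \bar R}) (c : R) (f : T -> R) :
  mu.-integrable setT (EFin \o f) -> mu.-integrable setT (EFin \o (fun x => c * f x)).
Proof. exact: (integrableZl measurableT c). Qed.

(** * Exchange of a compactly supported functional with a Fourier integral *)

Section CompactFunctional.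
Context {R : realType}.
Local Notation P := (R * R)%type.
Local Notation pl := (measurableTypeR R * measurableTypeR R)%type.
Implicit Types (g h K : P -> R[i]) (x xi : P) (w : seq P) (Q : set pl).

(** Abstract form of a compactly supported distribution of order at most [N], controlled by
    derivatives in the box of radius [rho]. It covers both [phi f] and integration against a
    compactly supported function. *)
Record compact_functional (L : (P -> R[i]) -> R[i]) (rho : R) (N : nat) (C : R) : Prop := {
  cf_linear : forall c g h, smooth_on setT g -> smooth_on setT h ->
    L (fun x => c * g x + h x) = c * L g + L h ;
  cf_ge0 : 0 <= C ;
  cf_rho : 0 <= rho ;
  cf_bound : forall g B, smooth_on setT g ->
    (forall x, `|x| <= rho -> derbound N g x B) -> cabs (L g) <= C * B }.

Variables (L : (P -> R[i]) -> R[i]) (rho : R) (N : nat) (C : R).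
Hypothesis LP : compact_functional L rho N C.

Lemma cf_add g h : smooth_on setT g -> smooth_on setT h ->
  L (fun x => g x + h x) = L g + L h.
Proof.
move=> sg sh; rewrite -[L g]mul1r -(cf_linear LP) //.
by congr L; apply/funext => x; rewrite mul1r.
Qed.

Lemma cf_sub g h : smooth_on setT g -> smooth_on setT h ->
  L (fun x => g x - h x) = L g - L h.
Proof.
move=> sg sh; rewrite addrC -mulN1r -(cf_linear LP) //.
by congr L; apply/funext => x; rewrite mulN1r addrC.
Qed.

Local Notation ell xi := (L (ew xi)).

Lemma fourpi_ge1 xi : 1 <= 4 * pi * (1 + `|xi|) :> R.
Proof.
rewrite (le_trans _ (ler_wpM2l _ (jnorm_ge1 xi))) ?mulr_ge0 ?pi_ge0 //.
by rewrite mulr1; have := @pi_ge2 R; lra.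
Qed.

Lemma cf_ew_bound xi : cabs (ell xi) <= C * (4 * pi * (1 + `|xi|)) ^+ N.
Proof.
have [sew dew] := smooth_ew xi; apply: (cf_bound LP) => // x _ w sw uw.
rewrite dew cabsM cabs_ew mulr1 (le_trans (cabs_mono _ uw)) //.
by rewrite ler_weXn2l // fourpi_ge1.
Qed.

(** Telescoping over the factors of the product. The constant doubles from [4 * pi] to [8 * pi]
    because [1 + |xi'|] is at most [2 * (1 + |xi|)] at distance at most 1. *)
Lemma mono_lip w xi xi' : unit_word w -> `|xi - xi'| <= 1 ->
  cabs (mono w xi - mono w xi') <=
  (size w)%:R * (8 * pi * (1 + `|xi|)) ^+ size w * `|xi - xi'|.
Proof.
move=> + d1; set M := 8 * pi * (1 + `|xi|).
have M0 : 0 <= M by rewrite mulr_ge0 ?mulr_ge0 ?pi_ge0 // addr_ge0.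
have h8 : 4 * pi * (1 + `|xi'|) <= M.
  rewrite /M (_ : 8 * pi * _ = 4 * pi * (2 * (1 + `|xi|))); last by ring.
  rewrite ler_wpM2l ?mulr_ge0 ?pi_ge0 //.
  have : `|xi'| <= `|xi| + `|xi - xi'| by rewrite -{1}(subKr xi xi') ler_normB.
  have := normr_ge0 xi; lra.
elim: w => [|v w IH]; first by rewrite !mono_nil subrr cabs0 !mul0r.
rewrite {1}/unit_word /= => /andP[v1 uw]; rewrite !mono_cons.
set a := 0 +i* _; set b := 0 +i* _.
have -> : a * mono w xi - b * mono w xi' = a * (mono w xi - mono w xi') + (a - b) * mono w xi'.
  by ring.
have cd u : cabs (0 +i* (- (2 * pi * dot2 u v)) : R[i]) <= 4 * pi * `|u|.
  rewrite cabs_imag normrN normrM ger0_norm ?mulr_ge0 ?pi_ge0 //.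
  rewrite (_ : 4 * pi * _ = 2 * pi * (2 * `|u|)); last by ring.
  rewrite ler_wpM2l ?mulr_ge0 ?pi_ge0 // (le_trans (dot2_le _ _)) // ler_wpM2l //.
  by rewrite ler_piMr.
rewrite (le_trans (cabsD _ _)) // !cabsM.
have ha : cabs a <= M.
  rewrite (le_trans (cd xi)) // /M (_ : 8 * pi * _ = 4 * pi * (2 * (1 + `|xi|))); last by ring.
  by rewrite ler_wpM2l ?mulr_ge0 ?pi_ge0 //; have := normr_ge0 xi; lra.
have hab : cabs (a - b) <= M * `|xi - xi'|.
  have -> : a - b = 0 +i* (- (2 * pi * dot2 (xi - xi') v)).
    by apply: complex_ext; rewrite !reimE /= ?subrr // dot2Dl dot2Nl; ring.
  rewrite (le_trans (cd _)) // ler_wpM2r // /M -[leLHS]mulr1 ler_pM ?mulr_ge0 ?pi_ge0 ?jnorm_ge1 //.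
  by rewrite ler_wpM2r ?pi_ge0 //; lra.
have hm : cabs (mono w xi') <= M ^+ size w.
  rewrite (le_trans (cabs_mono _ uw)) // lerXn2r ?nnegrE //.
  by rewrite mulr_ge0 ?mulr_ge0 ?pi_ge0 // addr_ge0.
rewrite (le_trans (lerD (ler_pM _ _ ha (IH uw)) (ler_pM _ _ hab hm))) ?cabs_ge0 //=.
by rewrite exprS -[X in _ <= X%:R * _ * _]addn1 natrD le_eqVlt; apply/orP; left; apply/eqP; ring.
Qed.

(** [N] accounts for the polynomial factor [mono], and [4 * pi * rho] for the variation of the
    character on the box of radius [rho]. *)
Definition lipc : R := N%:R + 4 * pi * rho.

Lemma lipc_ge0 : 0 <= lipc.
Proof. by rewrite addr_ge0 ?ler0n // !mulr_ge0 ?pi_ge0 //; exact: cf_rho LP. Qed.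

Lemma mono_ew_lip w xi xi' x : unit_word w -> (size w <= N)%N -> `|x| <= rho ->
  `|xi - xi'| <= 1 ->
  cabs (mono w xi * ew xi x - mono w xi' * ew xi' x) <=
  lipc * (8 * pi * (1 + `|xi|)) ^+ N * `|xi - xi'|.
Proof.
move=> uw sw xr d1; set M := 8 * pi * (1 + `|xi|).
have M1 : 1 <= M.
  have := fourpi_ge1 xi; rewrite /M; have := normr_ge0 xi; have := @pi_ge2 R; nra.
have M0 : 0 <= M by exact: le_trans M1.
have -> : mono w xi * ew xi x - mono w xi' * ew xi' x =
   (mono w xi - mono w xi') * ew xi' x + mono w xi * (ew xi x - ew xi' x) by ring.
rewrite (le_trans (cabsD _ _)) // !cabsM cabs_ew mulr1.
have h1 : cabs (mono w xi - mono w xi') <= N%:R * M ^+ N * `|xi - xi'|.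
  rewrite (le_trans (mono_lip uw d1)) // ler_wpM2r // ler_pM ?ler0n ?exprn_ge0 ?ler_nat //.
  by rewrite ler_weXn2l.
have h2 : cabs (mono w xi) <= M ^+ N.
  rewrite (le_trans (cabs_mono _ uw)) //.
  apply: (@le_trans _ _ (M ^+ size w)); last by rewrite ler_weXn2l.
  rewrite lerXn2r ?nnegrE ?mulr_ge0 ?pi_ge0 ?addr_ge0 //.
  by rewrite /M ler_wpM2r ?addr_ge0 // ler_wpM2r ?pi_ge0 //; lra.
have h3 : cabs (ew xi x - ew xi' x) <= 4 * pi * rho * `|xi - xi'|.
  have -> : ew xi x - ew xi' x = ew xi' x * (expi (- (2 * pi * dot2 (xi - xi') x)) - 1).
    rewrite mulrBr mulr1 /ew -expiD; congr (expi _ - _); rewrite dot2Dl dot2Nl; ring.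
  rewrite cabsM cabs_ew mul1r (le_trans (cabs_expiB1 _)) //.
  rewrite normrN normrM ger0_norm ?mulr_ge0 ?pi_ge0 //.
  rewrite (_ : 4 * pi * _ * _ = 2 * pi * (2 * (`|xi - xi'| * rho))); last by ring.
  rewrite ler_wpM2l ?mulr_ge0 ?pi_ge0 // (le_trans (dot2_le _ _)) // ler_wpM2l //.
  by rewrite ler_wpM2l.
rewrite (le_trans (lerD h1 (ler_pM _ _ h2 h3))) ?cabs_ge0 //.
by rewrite /lipc le_eqVlt; apply/orP; left; apply/eqP; ring.
Qed.

Lemma cf_ew_lip xi xi' : `|xi - xi'| <= 1 ->
  cabs (ell xi - ell xi') <= C * (lipc * (8 * pi * (1 + `|xi|)) ^+ N * `|xi - xi'|).
Proof.
move=> d1; have [s1 e1] := smooth_ew xi; have [s2 e2] := smooth_ew xi'.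
rewrite -cf_sub //.
have s2' : smooth_on setT (fun x => -1 * ew xi' x).
  by apply: smooth_onM openT _ s2; exact: smooth_on_cst.
have E : (fun x => ew xi x - ew xi' x) = (fun x => ew xi x + -1 * ew xi' x).
  by apply/funext => x; rewrite mulN1r.
rewrite E; apply: (cf_bound LP); first exact: smooth_onD openT _ _.
move=> x xr w sw uw; rewrite cdirDD // cdirDZ // e1 e2 mulN1r.
exact: mono_ew_lip.
Qed.

Lemma Ccontinuous_cf_ew : Ccontinuous (fun xi => ell xi).
Proof.
suff H xi : forall e : R, 0 < e -> \forall xi' \near xi, cabs (ell xi - ell xi') < e.
  split=> xi; apply/cvgrPdist_lt => e e0; have := H xi e e0; apply: filterS => y.
    by apply: le_lt_trans; rewrite -Re_opp -Re_add; exact: cabs_Re.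
  by apply: le_lt_trans; rewrite -Im_opp -Im_add; exact: cabs_Im.
move=> e e0; set A := C * (lipc * (8 * pi * (1 + `|xi|)) ^+ N).
have A0 : 0 <= A.
  rewrite mulr_ge0 ?(cf_ge0 LP) // mulr_ge0 ?lipc_ge0 // exprn_ge0 //.
  by rewrite mulr_ge0 ?mulr_ge0 ?pi_ge0 // addr_ge0.
apply/nbhs_ballP; exists (Num.min 1 (e / (1 + A))).
  by rewrite /= lt_min ltr01 divr_gt0 // ltr_pwDl.
move=> y; rewrite -ball_normE /ball_ /= lt_min => /andP[y1 ye].
rewrite (le_lt_trans (cf_ew_lip (ltW y1))) // mulrA -/A.
move: ye; rewrite ltr_pdivlMr ?ltr_pwDl //; apply: le_lt_trans.
by rewrite mulrC ler_wpM2l // lerDr.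
Qed.

Lemma pgrowth_cf_ew : pgrowth (fun xi => ell xi).
Proof.
split; first by apply: cmeas_continuous; exact: Ccontinuous_cf_ew.
exists N, (C * (4 * pi) ^+ N) => xi.
by rewrite -mulrA -exprMn; exact: cf_ew_bound.
Qed.

(** The failure of [L] to commute with the integral that defines [FT K]. It is additive in [K], and
    the weight [(1 + |xi|) ^+ N] in [cf_mass] is the growth of [L (ew xi)]. *)
Definition cf_defect K := L (FT K) - Cint leb2 setT (fun xi => K xi * ell xi).
Definition cf_mass K : R := \int[leb2]_xi (cabs (K xi) * (1 + `|xi|) ^+ N).

Lemma rapid_ell K : rapid K -> rapid (fun xi => K xi * ell xi).
Proof. move=> rK; apply: rapid_pgrowth => //; exact: pgrowth_cf_ew. Qed.

Lemma pgrowth_jnorm n : pgrowth (fun xi : P => ((1 + `|xi|) ^+ n)%:C).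
Proof.
split.
  apply: cmeas_continuous; split => x /=; last exact: cvg_cst.
  apply: (@continuous_comp _ _ _ (fun x : P => 1 + `|x|) (fun y : R => y ^+ n)).
    by apply: cvgD; [exact: cvg_cst|exact: norm_continuous].
  exact: exprn_continuous.
exists n, 1 => x; rewrite cabs_real mul1r ger0_norm // exprn_ge0 // ltW // jnorm_gt0 //.
Qed.

Lemma integrable_mass K n : rapid K ->
  (@leb2 R).-integrable setT (EFin \o (fun xi : P => cabs (K xi) * (1 + `|xi|) ^+ n)).
Proof.
move=> rK; have := cintable_cabs (rapid_cintable (rapid_pgrowth rK (pgrowth_jnorm n))).
congr (_.-integrable _ _); apply/funext => x /=; congr EFin.
rewrite -[LHS]/(cabs _) cabsM cabs_real ger0_norm // exprn_ge0 // ltW // jnorm_gt0 //.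
Qed.

Lemma cf_defectD K K' : rapid K -> rapid K' ->
  cf_defect (fun xi => K xi + K' xi) = cf_defect K + cf_defect K'.
Proof.
move=> rK rK'; rewrite /cf_defect FTD // cf_add; [|exact: (FT_smooth _).1..].
have -> : (fun xi => (K xi + K' xi) * ell xi) = (fun xi => K xi * ell xi + K' xi * ell xi).
  by apply/funext => x; rewrite mulrDl.
rewrite CintD; [|apply: rapid_cintable; exact: rapid_ell..].
ring.
Qed.

(** Crude bound without smallness, used only for the part of [K] outside a large box. *)
Lemma cf_defect_bound K : rapid K ->
  cabs (cf_defect K) <= 2 * C * (4 * pi) ^+ N * cf_mass K.
Proof.
move=> rK; rewrite (le_trans (cabsB _ _)) // (_ : 2 * C * _ * _ =
  C * ((4 * pi) ^+ N * cf_mass K) + C * (4 * pi) ^+ N * cf_mass K); last by ring.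
have i0 := integrable_mass N rK.
apply: lerD.
  have [s E] := FT_smooth rK; apply: (cf_bound LP) => // x _ w sw uw; rewrite E.
  rewrite /cf_mass -RintegralZl //; apply: Cint_abs_le.
  - by apply: cintable_cmeas; apply: cintable_FT; exact: rapid_mono.
  - exact: (integrableZl measurableT _ i0).
  - move=> xi; rewrite !cabsM cabs_ew mulr1 mulrC mulrCA ler_wpM2l ?cabs_ge0 // -exprMn.
    by rewrite (le_trans (cabs_mono _ uw)) // ler_weXn2l // fourpi_ge1.
rewrite /cf_mass -RintegralZl //; apply: Cint_abs_le.
- by apply: cintable_cmeas; apply: rapid_cintable; exact: rapid_ell.
- exact: (integrableZl measurableT _ i0).
- move=> xi; rewrite cabsM mulrCA ler_wpM2l ?cabs_ge0 // -mulrA -exprMn.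
  exact: cf_ew_bound.
Qed.

(* Freezing the frequency at [xi0] on the support of [K] bounds the defect by
   the diameter of the support times the mass of [K]. *)
Lemma cf_defect_local K xi0 s : rapid K -> s <= 1 ->
  (forall xi, K xi != 0 -> `|xi - xi0| <= s) ->
  cabs (cf_defect K) <= 2 * C * lipc * (8 * pi) ^+ N * s * cf_mass K.
Proof.
move=> rK s1 Ks; pose c0 := Cint leb2 setT K.
have [sm E] := FT_smooth rK; have [se ee] := smooth_ew xi0.
have cK := rapid_cintable rK.
have -> : cf_defect K = L (fun x => -c0 * ew xi0 x + FT K x) -
     Cint leb2 setT (fun xi => K xi * (ell xi - ell xi0)).
  rewrite (cf_linear LP) // /cf_defect.
  have -> : (fun xi => K xi * (ell xi - ell xi0)) = (fun xi => K xi * ell xi - ell xi0 * K xi).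
    by apply/funext => x; ring.
  rewrite CintB ?CintZ //; first by rewrite -/c0; ring.
    by apply: rapid_cintable; exact: rapid_ell.
  by apply: cintableZ.
rewrite (le_trans (cabsB _ _)) //.
rewrite (_ : 2 * C * _ * _ * _ * _ =
  C * ((lipc * (8 * pi) ^+ N * s) * cf_mass K) + C * (lipc * (8 * pi) ^+ N * s) * cf_mass K); last by ring.
have i0 := integrable_mass N rK.
have key y xi : y <= lipc * (8 * pi * (1 + `|xi|)) ^+ N * `|xi - xi0| ->
    cabs (K xi) * y <= lipc * (8 * pi) ^+ N * s * (cabs (K xi) * (1 + `|xi|) ^+ N).
  move=> hy; have [->|Kx] := eqVneq (K xi) 0; first by rewrite cabs0 !mul0r mulr0.
  rewrite mulrCA ler_wpM2l ?cabs_ge0 // (le_trans hy) // exprMn.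
  rewrite (_ : _ * s * _ = lipc * ((8 * pi) ^+ N * (1 + `|xi|) ^+ N) * s); last by ring.
  rewrite ler_wpM2l ?Ks // mulr_ge0 ?lipc_ge0 // mulr_ge0 // exprn_ge0 ?mulr_ge0 ?pi_ge0 ?addr_ge0 //.
apply: lerD.
  apply: (cf_bound LP).
    apply: smooth_onD openT _ sm; apply: smooth_onM openT _ se; exact: smooth_on_cst.
  move=> x xr w sw uw; rewrite cdirDD //; last first.
    by apply: smooth_onM openT _ se; exact: smooth_on_cst.
  rewrite cdirDZ // E ee.
  have -> : - c0 * (mono w xi0 * ew xi0 x) + FT (fun xi => mono w xi * K xi) x =
     Cint leb2 setT (fun xi => K xi * (mono w xi * ew xi x - mono w xi0 * ew xi0 x)).
    have -> : (fun xi => K xi * (mono w xi * ew xi x - mono w xi0 * ew xi0 x)) =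
       (fun xi => mono w xi * K xi * ew xi x - (mono w xi0 * ew xi0 x) * K xi).
      by apply/funext => xi; ring.
    rewrite CintB ?CintZ //; first by rewrite FTE -/c0; ring.
      by apply: cintable_FT; exact: rapid_mono.
    exact: cintableZ.
  rewrite /cf_mass -RintegralZl //; apply: Cint_abs_le.
  - apply: cmeasM; first exact: rK.1.
    apply: cmeasD; first by apply: cmeasM; [exact: (pgrowth_mono w).1|under eq_fun do rewrite ewC; exact: cmeas_ew].
    exact: cmeas_cst.
  - exact: (integrableZl measurableT _ i0).
  - move=> xi; rewrite cabsM; have [K0|Kx] := eqVneq (K xi) 0.
      by rewrite K0 cabs0 !mul0r mulr0.
    by apply: key; apply: mono_ew_lip => //; exact: le_trans (Ks _ Kx) s1.
rewrite -mulrA /cf_mass -RintegralZl // -RintegralZl //; last exact: (integrableZl measurableT _ i0).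
apply: Cint_abs_le.
- apply: cmeasM; first exact: rK.1.
  by apply: cmeasD; [exact: pgrowth_cf_ew.1|exact: cmeas_cst].
- by apply: integrable_scale; exact: integrable_scale i0.
- move=> xi; rewrite cabsM; have [K0|Kx] := eqVneq (K xi) 0.
    by rewrite K0 cabs0 !mul0r !mulr0.
  have := cf_ew_lip (le_trans (Ks _ Kx) s1).
  move=> /(ler_wpM2l (cabs_ge0 (K xi))) h; rewrite (le_trans h) // mulrCA.
  by rewrite ler_wpM2l ?(cf_ge0 LP) // key.
Qed.

(** Half-open, so that cutting a box at a coordinate gives an exact partition. *)
Definition box (a b c e : R) : set pl := `[a, b[%classic `*` `[c, e[%classic.

Lemma measurable_box a b c e : measurable (box a b c e).
Proof. by apply: measurableX; exact: measurable_itv. Qed.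

Definition cut Q K : P -> R[i] := fun xi => K xi * (\1_Q (xi : pl))%:C.

Lemma pgrowth_indic Q : measurable Q -> pgrowth (fun xi : P => (\1_Q (xi : pl) : R)%:C).
Proof.
move=> mQ; apply: (pgrowth_bounded (C := 1)).
  exact: cmeas_real (measurable_indic mQ).
move=> x; rewrite cabs_real indicE normr_nat (_ : 1 = 1%:R) // ler_nat.
by case: (_ \in _).
Qed.

Lemma rapid_cut Q K : measurable Q -> rapid K -> rapid (cut Q K).
Proof. by move=> mQ rK; apply: rapid_pgrowth => //; exact: pgrowth_indic. Qed.

Lemma cutU Q1 Q2 K : Q1 `&` Q2 = set0 ->
  cut (Q1 `|` Q2) K = (fun xi => cut Q1 K xi + cut Q2 K xi).
Proof.
move=> dQ; apply/funext => x; rewrite /cut -mulrDr; congr (_ * _).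
rewrite !indicE in_setU; apply: complex_ext; rewrite !reimE /= ?addr0 //.
have [x1|_] := boolP ((x : pl) \in Q1); have [x2|_] := boolP ((x : pl) \in Q2);
  rewrite ?addr0 ?add0r //.
exfalso; have : (Q1 `&` Q2) x by split; apply/set_mem.
by rewrite dQ.
Qed.

Lemma cut_mass_indic Q K : cf_mass (cut Q K) =
  \int[leb2]_xi (\1_Q xi * (cabs (K xi) * (1 + `|xi : P|) ^+ N)).
Proof.
apply: eq_Rintegral => x _; rewrite /cut cabsM cabs_real [X in _ * X * _]ger0_norm.
  by rewrite -mulrA mulrCA.
by rewrite indicE ler0n.
Qed.

Lemma cut_massU Q1 Q2 K : measurable Q1 -> measurable Q2 -> rapid K ->
  Q1 `&` Q2 = set0 ->
  cf_mass (cut (Q1 `|` Q2) K) = cf_mass (cut Q1 K) + cf_mass (cut Q2 K).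
Proof.
move=> m1 m2 rK dQ; rewrite /cf_mass -RintegralD //; last 2 first.
  by apply: integrable_mass; exact: rapid_cut.
  by apply: integrable_mass; exact: rapid_cut.
apply: eq_Rintegral => x _; rewrite -mulrDl; congr (_ * _).
rewrite cutU // /cut !indicE.
have [x1|_] := boolP ((x : pl) \in Q1); have [x2|_] := boolP ((x : pl) \in Q2);
  rewrite ?mulr1 ?mulr0 ?addr0 ?add0r ?cabs0 ?addr0 ?add0r //.
exfalso; have : (Q1 `&` Q2) x by split; apply/set_mem.
by rewrite dQ.
Qed.

Section Bisection.
Variable K : P -> R[i].
Hypothesis rK : rapid K.

Let dfc Q := cabs (cf_defect (cut Q K)).
Let mss Q := cf_mass (cut Q K).

Lemma box_split1 a b m c e : a <= m <= b ->
  box a b c e = box a m c e `|` box m b c e /\ box a m c e `&` box m b c e = set0.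
Proof.
move=> /andP[am mb]; split.
  rewrite /box; apply/seteqP; split=> [[x y] /= [/=]|[x y] /= [] [/=]];
    rewrite !in_itv /= => /andP[h1 h2] hy.
  - by rewrite h1 h2 hy; have [xm|xm] := ltP x m; [left|right].
  - by rewrite h1 (lt_le_trans h2).
  - by rewrite h2 (le_trans am).
apply/seteqP; split=> // -[x y] /= [[/= + _] [/= + _]].
by rewrite !in_itv /= => /andP[_ h1] /andP[h2 _]; move: (lt_le_trans h1 h2); rewrite ltxx.
Qed.

Lemma box_split2 a b c m e : c <= m <= e ->
  box a b c e = box a b c m `|` box a b m e /\ box a b c m `&` box a b m e = set0.
Proof.
move=> /andP[am mb]; split.
  rewrite /box; apply/seteqP; split=> [[x y] /= [/= hx]|[x y] /= [] [/= hx]];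
    rewrite !in_itv /= => /andP[h1 h2].
  - by move: hx; rewrite in_itv /= h1 h2 => ->; have [xm|xm] := ltP y m; [left|right].
  - by move: hx; rewrite in_itv /= h1 (lt_le_trans h2) // => ->.
  - by move: hx; rewrite in_itv /= h2 (le_trans am) // => ->.
apply/seteqP; split=> // -[x y] /= [[/= _ +] [/= _ +]].
by rewrite !in_itv /= => /andP[_ h1] /andP[h2 _]; move: (lt_le_trans h1 h2); rewrite ltxx.
Qed.

Lemma defect_union Q1 Q2 B : measurable Q1 -> measurable Q2 -> Q1 `&` Q2 = set0 ->
  dfc Q1 <= B * mss Q1 -> dfc Q2 <= B * mss Q2 -> dfc (Q1 `|` Q2) <= B * mss (Q1 `|` Q2).
Proof.
move=> m1 m2 dQ h1 h2; rewrite /dfc /mss cutU // cf_defectD; [|exact: rapid_cut..].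
by rewrite -cutU // cut_massU // mulrDr (le_trans (cabsD _ _)) // lerD.
Qed.

(** Defects are subadditive and masses additive over disjoint pieces, so the same constant [B]
    passes from boxes of side at most [s] to boxes of side at most [2 * s]. *)
Lemma defect_quarter B s : (forall a b c e, a <= b <= a + s -> c <= e <= c + s ->
    dfc (box a b c e) <= B * mss (box a b c e)) ->
  forall a b c e, a <= b <= a + 2 * s -> c <= e <= c + 2 * s ->
    dfc (box a b c e) <= B * mss (box a b c e).
Proof.
move=> H a b c e /andP[ab bs] /andP[ce es].
have ab2 : a <= (a + b) / 2 <= b by apply/andP; split; lra.
have ce2 : c <= (c + e) / 2 <= e by apply/andP; split; lra.
have [E1 D1] := box_split1 c e ab2; rewrite E1.
apply: defect_union D1 _ _; try exact: measurable_box.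
  have [E2 D2] := box_split2 a ((a + b) / 2) ce2; rewrite E2.
  by apply: defect_union D2 _ _; try exact: measurable_box;
    apply: H; apply/andP; split; lra.
have [E2 D2] := box_split2 ((a + b) / 2) b ce2; rewrite E2.
by apply: defect_union D2 _ _; try exact: measurable_box;
  apply: H; apply/andP; split; lra.
Qed.

Let A := 2 * C * lipc * (8 * pi) ^+ N.

(** After [n] bisections the pieces have side [s / 2 ^+ n], and the local estimate is proportional
    to the side. *)
Lemma defect_box_small n s : 0 <= s <= 1 -> forall a b c e,
  a <= b <= a + s -> c <= e <= c + s ->
  dfc (box a b c e) <= A * s / 2 ^+ n * mss (box a b c e).
Proof.
elim: n s => [|n IH] s /andP[s0 s1] a b c e.
  move=> /andP[ab bs] /andP[ce es]; rewrite expr0 divr1.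
  (* The frequency is frozen at the lower left corner. *)
  apply: (cf_defect_local (xi0 := (a, c))) => //; first by apply: rapid_cut => //; exact: measurable_box.
  move=> [x y]; rewrite /cut indicE; have [/set_mem [/=]|_] := boolP (_ \in _); last first.
    by rewrite mulr0 eqxx.
  rewrite !in_itv /= => /andP[x1 x2] /andP[y1 y2] _.
  rewrite norm_plane_le /= !ger0_norm ?subr_ge0 //; apply/andP; split; lra.
move=> hab hce; have -> : A * s / 2 ^+ n.+1 = A * (s / 2) / 2 ^+ n.
  by rewrite exprS; field; rewrite expf_neq0.
apply: (@defect_quarter _ (s / 2)).
- by apply: IH; apply/andP; split; lra.
- by rewrite mulrC divfK.
- by rewrite mulrC divfK.
Qed.

Lemma le_geometric_zero (x y : R) : (forall n, x <= y / 2 ^+ n) -> x <= 0.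
Proof.
move=> H; rewrite leNgt; apply/negP => x0.
have y0 : 0 < y by have := H 0%N; rewrite expr0 divr1; exact: lt_le_trans.
have := archimedean.Num.Theory.archi_boundP (ltW (divr_gt0 y0 x0)).
set n0 := (X in X%:R) => h.
have := H n0; rewrite ler_pdivlMr ?exprn_gt0 // leNgt => /negP; apply.
have n2 : (n0%:R : R) <= 2 ^+ n0 by rewrite -natrX ler_nat ltnW // ltn_expl.
have := lt_le_trans h n2; rewrite ltr_pdivrMr // mulrC.
by [].
Qed.

(** Boxes of side at most 1 have zero defect by letting the number of bisections grow; the constant
    0 is then doubled up to side [2 ^+ k]. *)
Lemma defect_box0 k a b c e : a <= b <= a + 2 ^+ k -> c <= e <= c + 2 ^+ k ->
  cf_defect (cut (box a b c e) K) = 0.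
Proof.
suff H : forall a b c e, a <= b <= a + 2 ^+ k -> c <= e <= c + 2 ^+ k ->
    dfc (box a b c e) <= 0 * mss (box a b c e).
  move=> hab hce; apply: cabs_eq0; apply: le_anti; rewrite cabs_ge0 andbT.
  by rewrite (le_trans (H _ _ _ _ hab hce)) // mul0r.
elim: k => [|k IH].
  rewrite expr0 => a' b' c' e' hab hce; rewrite mul0r.
  apply: (@le_geometric_zero _ (A * mss (box a' b' c' e'))) => n.
  by have := @defect_box_small n 1 _ a' b' c' e' hab hce; rewrite mulr1 mulrAC; apply; rewrite ler01 lexx.
by rewrite exprS; apply: defect_quarter.
Qed.

Lemma cf_fourier_K : L (FT K) = Cint leb2 setT (fun xi => K xi * ell xi).
Proof.
apply/eqP; rewrite -subr_eq0; apply/eqP; rewrite -/(cf_defect K).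
apply: cabs_eq0; apply: le_anti; rewrite cabs_ge0 andbT.
pose M := \int[leb2]_(xi in setT) (cabs (K xi) * (1 + `|xi : P|) ^+ N.+1).
apply: (@le_geometric_zero _ (2 * C * (4 * pi) ^+ N * M)) => k.
(* Outside [Q] the norm is at least [2 ^+ k], so the mass with weight exponent [N] is at most
   [2 ^- k] times the mass with exponent [N + 1]. *)
pose Q := box (- 2 ^+ k) (2 ^+ k) (- 2 ^+ k) (2 ^+ k).
have mQ : measurable Q by exact: measurable_box.
have k0 : 0 < 2 ^+ k :> R by rewrite exprn_gt0.
have -> : cf_defect K = cf_defect (cut (~` Q) K).
  have -> : K = (fun xi => cut Q K xi + cut (~` Q) K xi).
    rewrite -cutU ?setICr // setUv; apply/funext => x.
    by rewrite /cut indicT mulr1.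
  rewrite cf_defectD; [|by apply: rapid_cut => //; exact: measurableC..].
  have -> : cf_defect (cut Q K) = 0.
    (* The side of [Q] is [2 * 2 ^+ k], hence the successor. *)
    by apply: (@defect_box0 k.+1); rewrite exprS; apply/andP; split; lra.
  rewrite add0r -cutU ?setICr // setUv; congr cf_defect; congr cut; apply/funext => x.
  by rewrite /cut indicT mulr1.
have mQc : measurable (~` Q) by exact: measurableC.
rewrite (le_trans (cf_defect_bound (rapid_cut mQc rK))) // -[leRHS]mulrA.
rewrite ler_wpM2l //.
  by rewrite !mulr_ge0 ?(cf_ge0 LP) // exprn_ge0 // mulr_ge0 ?pi_ge0.
rewrite ler_pdivlMr // mulrC cut_mass_indic /M -RintegralZl //; last first.
  have := integrable_mass N (rapid_cut mQc rK); congr (_.-integrable _ _).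
  apply/funext => x /=; rewrite -/(cabs _) /cut cabsM cabs_real [X in _ * X * _]ger0_norm ?indicE ?ler0n //.
  by congr EFin; rewrite -mulrA mulrCA.
apply: le_Rintegral => //.
- apply: integrable_scale.
  have := integrable_mass N (rapid_cut mQc rK); congr (_.-integrable _ _).
  apply/funext => x /=; rewrite -/(cabs _) /cut cabsM cabs_real [X in _ * X * _]ger0_norm ?indicE ?ler0n //.
  by congr EFin; rewrite -mulrA mulrCA.
- exact: integrable_mass.
move=> [x y] _; rewrite indicE; have [/set_mem nQ|_] := boolP (_ \in _); last first.
  by rewrite mul0r mulr0 mulr_ge0 ?cabs_ge0 // exprn_ge0 // ltW // jnorm_gt0.
rewrite mul1r mulrCA ler_wpM2l ?cabs_ge0 // exprS ler_wpM2r ?exprn_ge0 ?addr_ge0 //.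
rewrite (@le_trans _ _ `|(x, y)|) ?lerDr // leNgt norm_plane_lt /=; apply/negP => /andP[hx hy].
apply: nQ; split => /=; rewrite in_itv /=.
  by move: hx; rewrite ltr_norml => /andP[/ltW -> ->].
by move: hy; rewrite ltr_norml => /andP[/ltW -> ->].
Qed.

End Bisection.

End CompactFunctional.

(* In place of a vector-valued integral: the defect is subadditive when [K] is cut into boxes and is at
   most [eps] times the mass of [K] on small boxes, so that repeated bisection makes it vanish. *)
Theorem cf_fourier {R : realType} (L : (R * R -> R[i]) -> R[i]) rho N C K :
  compact_functional L rho N C -> rapid K ->
  L (FT K) = Cint leb2 setT (fun xi => K xi * L (ew xi)).
Proof. by move=> LP rK; apply: cf_fourier_K LP _ rK. Qed.

(** * Test functions and the rapid decay of their Fourier transforms *)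

Section TestFunctions.
Context {R : realType}.
Local Notation P := (R * R)%type.
Local Notation pl := (measurableTypeR R * measurableTypeR R)%type.
Implicit Types (g h K : P -> R[i]) (x xi v : P) (w : seq P).

Definition smooth_cpt g := smooth_on setT g /\ exists r : R, forall x, r < `|x| -> g x = 0.

Lemma compact_box (r : R) : compact [set x : P | `|x| <= r].
Proof.
have -> : [set x : P | `|x| <= r] = `[- r, r]%classic `*` `[- r, r]%classic.
  apply/seteqP; split=> [x|x [/=]] /=; rewrite norm_plane_le !in_itv /= !ler_norml.
    by move=> /andP[].
  by move=> -> ->.
by apply: compact_setX; exact: segment_compact.
Qed.

Lemma test_smooth_cpt U g : test_fun U g -> smooth_cpt g.
Proof.
move=> [sg cg _]; split => //.
have [M [_ HM]] := compact_bounded cg.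
exists (Num.max 0 M + 1) => x Mx; apply: contrapT => /eqP gx.
have : `|x| <= Num.max 0 M + 1.
  apply: HM; last by apply: subset_closure.
  by rewrite (le_lt_trans (y := Num.max 0 M)) ?le_max ?lexx ?orbT // ltrDl.
by rewrite leNgt Mx.
Qed.

Lemma closure_le (r : R) : closed [set x : P | `|x| <= r].
Proof. by apply: compact_closed; [exact: norm_hausdorff|exact: compact_box]. Qed.

Lemma smooth_cpt_test U g (D : set P) : smooth_on setT g -> closed D -> D `<=` U ->
  (exists r : R, forall x, D x -> `|x| <= r) -> (forall x, ~ D x -> g x = 0) -> test_fun U g.
Proof.
move=> sg cD DU [r Dr] gD.
have sD : support_of g `<=` D.
  rewrite /support_of closureE; apply: smallest_sub => // x /= gx.
  by apply: contrapT => /gD /eqP; rewrite (negbTE gx).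
split => //; last by move=> x /sD /DU.
apply: (@subclosed_compact _ _ [set x : P | `|x| <= r]).
- exact: closed_closure.
- exact: compact_box.
- by move=> x /sD /Dr.
Qed.

Lemma smooth_cptM g h : smooth_cpt g -> smooth_on setT h -> smooth_cpt (fun x => g x * h x).
Proof.
move=> [sg [r gr]] sh; split; first exact: smooth_onM openT _ _.
by exists r => x /gr ->; rewrite mul0r.
Qed.

Lemma smooth_cptJ g : smooth_cpt g -> smooth_cpt (fun x => (g x)^*).
Proof.
move=> [sg [r gr]]; split; first exact: smooth_onJ openT _.
by exists r => x /gr ->; rewrite conjc0.
Qed.

Lemma open_norm_gt (r : R) : open [set x : P | r < `|x|].
Proof.
have -> : [set x : P | r < `|x|] = ~` [set x : P | `|x| <= r].
  by apply/seteqP; split=> x /=; rewrite ltNge => /negP.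
by rewrite openC; exact: closure_le.
Qed.

Lemma cdirD_zero w : cdirD w (fun=> 0 : R[i]) = (fun=> 0) :> (P -> R[i]).
Proof.
elim/last_ind: w => [|w v IH]; first by rewrite cdirD_nil.
by rewrite cdirD_rcons cD_cst IH.
Qed.

Lemma smooth_cpt_cdirD w g : smooth_cpt g -> smooth_cpt (cdirD w g).
Proof.
move=> [sg [r gr]]; split; first exact: smooth_cdirD.
exists r => x rx; rewrite (eq_cdirD_on w (@open_norm_gt r) (h := fun=> 0)) //.
by rewrite cdirD_zero.
Qed.

Lemma smooth_Ccontinuous g : smooth_on setT g -> Ccontinuous g.
Proof.
by move=> sg; split=> x; have [d1 d2] := smooth_on_diff sg (x := x) I;
  apply: differentiable_continuous.
Qed.

Lemma Ccontinuous_bounded g (r : R) : Ccontinuous g ->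
  exists C : R, forall x, `|x| <= r -> cabs (g x) <= C.
Proof.
move=> [c1 c2].
have bd (h : P -> R) : continuous h -> exists C : R, forall x, `|x| <= r -> `|h x| <= C.
  move=> ch; have := continuous_compact (continuous_subspaceT ch) (@compact_box r).
  move=> /compact_bounded [M [_ HM]]; exists (M + 1) => x xr.
  by apply: (HM (M + 1)); [rewrite ltrDl|exists x].
have [C1 H1] := bd _ c1; have [C2 H2] := bd _ c2; exists (C1 + C2) => x xr.
by rewrite (le_trans (cabs_le _)) // lerD ?H1 ?H2.
Qed.

Lemma cpt_rapid g (r : R) : Ccontinuous g -> (forall x, r < `|x| -> g x = 0) -> rapid g.
Proof.
move=> cg gr; split; first exact: cmeas_continuous.
have [C HC] := Ccontinuous_bounded r cg.
move=> n; exists ((1 + `|r|) ^+ n * `|C|) => x.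
have [xr|xr] := leP `|x| r; last by rewrite gr // cabs0 mulr0 mulr_ge0 // exprn_ge0 // addr_ge0.
rewrite ler_pM ?cabs_ge0 ?exprn_ge0 ?addr_ge0 //; last by rewrite (le_trans (HC _ xr)) // ler_norm.
by rewrite lerXn2r ?nnegrE ?addr_ge0 // lerD2l (le_trans xr) // ler_norm.
Qed.

Lemma smooth_cpt_rapid g : smooth_cpt g -> rapid g.
Proof. by move=> [sg [r gr]]; apply: cpt_rapid gr; exact: smooth_Ccontinuous. Qed.

Lemma smooth_cpt_schwartz g : smooth_cpt g -> schwartz g.
Proof.
move=> tg; split; first exact: tg.1.
by move=> n w; have [_ /(_ n)] := smooth_cpt_rapid (smooth_cpt_cdirD w tg).
Qed.

Lemma line_derive (h : P -> R) x v (t : R) : (forall y, differentiable h y) ->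
  is_derive t 1 (fun t : R => h (t *: v + x)) ('D_v h (t *: v + x)).
Proof.
move=> dh.
have Ll : forall (s : R) (y z : R), (s *: y + z) *: v = s *: (y *: v) + z *: v.
  by move=> s y z; rewrite scalerDl scalerA.
have E := derive_comp_affine h x (1 : R) Ll; rewrite scale1r in E.
apply: DeriveDef; last exact: (congr1 (fun k : R -> R => k t) E).
apply: diff_derivable; apply: differentiable_comp => //.
Qed.

Lemma continuous_pair1 (y : R) : continuous (fun x : R => (x, y) : P).
Proof. move=> x; apply: (@cvg_pair _ _ _ _ (nbhs x) (nbhs y)); [exact: cvg_id|exact: cvg_cst]. Qed.
Lemma continuous_pair2 (x : R) : continuous (fun y : R => (x, y) : P).
Proof. move=> y; apply: (@cvg_pair _ _ _ _ (nbhs x) (nbhs y)); [exact: cvg_cst|exact: cvg_id]. Qed.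

Lemma slice1_continuous (h : P -> R) (y : R) : continuous h -> continuous (fun x : R => h (x, y)).
Proof.
move=> ch x; apply: (@continuous_comp _ _ _ (fun x : R => (x, y)) h); last exact: ch.
exact: continuous_pair1.
Qed.
Lemma slice2_continuous (h : P -> R) (x : R) : continuous h -> continuous (fun y : R => h (x, y)).
Proof.
move=> ch y; apply: (@continuous_comp _ _ _ (fun y : R => (x, y)) h); last exact: ch.
exact: continuous_pair2.
Qed.

Lemma omega1_le1 (x : R) : omega1 x <= 1.
Proof. by rewrite invf_le1 ?lerDl ?sqr_ge0 // ltr_pwDl ?sqr_ge0. Qed.

Lemma slice_cintable1 g (y : R) : Ccontinuous g -> rapid g ->
  cintable leb1 (fun x : measurableTypeR R => g (x, y)).
Proof.
move=> [c1 c2] rg; have [C C0 HC] := rapid_le 0 rg.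
refine (cintable_le (h := fun x : measurableTypeR R => C * omega1 x) _ _ _).
- by split; apply: continuous_measurable_fun;
    [exact: (slice1_continuous (y := y) c1)|exact: (slice1_continuous (y := y) c2)].
- exact: integrable_scale integrable_omega1.
- move=> x; have := HC (x, y); rewrite expr0 mul1r => /le_trans; apply.
  by rewrite /omega /= ler_wpM2l // ler_piMr ?omega1_ge0 ?omega1_le1.
Qed.

Lemma slice_cintable2 g (x : R) : Ccontinuous g -> rapid g ->
  cintable leb1 (fun y : measurableTypeR R => g (x, y)).
Proof.
move=> [c1 c2] rg; have [C C0 HC] := rapid_le 0 rg.
refine (cintable_le (h := fun y : measurableTypeR R => C * omega1 y) _ _ _).
- by split; apply: continuous_measurable_fun;
    [exact: (slice2_continuous (x := x) c1)|exact: (slice2_continuous (x := x) c2)].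
- exact: integrable_scale integrable_omega1.
- move=> y; have := HC (x, y); rewrite expr0 mul1r => /le_trans; apply.
  by rewrite /omega /= ler_wpM2l // ler_piMl ?omega1_ge0 ?omega1_le1.
Qed.

Lemma integral_derive_cpt (h dh : R -> R) (r : R) :
  (forall t : R, is_derive t 1 h (dh t)) -> continuous dh ->
  (forall t, r < `|t| -> h t = 0) -> (forall t, r < `|t| -> dh t = 0) ->
  \int[leb1]_t dh t = 0.
Proof.
move=> hdh cdh h0 dh0; pose s := `|r| + 1.
have s0 : 0 < s by rewrite ltr_wpDl.
have sr : r < `|s| by rewrite ger0_norm ?ltW // (le_lt_trans (ler_norm r)) // ltrDl.
have ch : continuous h.
  by move=> t; apply: differentiable_continuous; apply/derivable1_diffP; case: (hdh t).
have -> : \int[leb1]_t dh t = \int[leb1]_(t in `[- s, s]) dh t.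
  rewrite [RHS]Rintegral_mkcond; apply: eq_Rintegral => t _; rewrite patchE.
  case: ifPn => // /negP; rewrite inE /= in_itv /= -ler_norml => /negP; rewrite -ltNge => st.
  by apply: dh0; rewrite (lt_trans _ st) // (le_lt_trans (ler_norm r)) // ltrDl.
rewrite /Rintegral (continuous_FTC2 (F := h)) //.
- by rewrite !h0 ?normrN // subee.
- by rewrite (lt_trans _ s0) // oppr_lt0.
- exact: continuous_subspaceT.
- split.
  + by move=> t _; case: (hdh t).
  + by apply: cvg_at_right_filter; exact: ch.
  + by apply: cvg_at_left_filter; exact: ch.
- by move=> t _; rewrite derive1E; case: (hdh t).
Qed.

Lemma integral_partial1 (h dh : P -> R) (r y : R) : (forall z, differentiable h z) ->
  (forall z, 'D_(1, 0) h z = dh z) -> continuous dh ->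
  (forall z, r < `|z| -> h z = 0) -> (forall z, r < `|z| -> dh z = 0) ->
  \int[leb1]_x dh (x, y) = 0.
Proof.
move=> hd hdh cdh h0 dh0.
have ns (t : R) : r < `|t| -> r < `|(t, y) : P| by move=> st; rewrite norm_plane lt_max st.
apply: (@integral_derive_cpt (fun x : R => h (x, y)) (fun x : R => dh (x, y)) r).
- move=> t; have := @line_derive h (0, y) (1, 0) t hd.
  have E (u : R) : u *: ((1, 0) : P) + (0, y) = (u, y).
    by congr pair; rewrite /= /GRing.scale /= ?mulr1 ?mulr0 ?addr0 ?add0r.
  by rewrite E hdh; under eq_fun do rewrite E.
- exact: slice1_continuous.
- by move=> t /ns; exact: h0.
- by move=> t /ns; exact: dh0.
Qed.

Lemma integral_partial2 (h dh : P -> R) (r x : R) : (forall z, differentiable h z) ->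
  (forall z, 'D_(0, 1) h z = dh z) -> continuous dh ->
  (forall z, r < `|z| -> h z = 0) -> (forall z, r < `|z| -> dh z = 0) ->
  \int[leb1]_y dh (x, y) = 0.
Proof.
move=> hd hdh cdh h0 dh0.
have ns (t : R) : r < `|t| -> r < `|(x, t) : P| by move=> st; rewrite norm_plane lt_max st orbT.
apply: (@integral_derive_cpt (fun y : R => h (x, y)) (fun y : R => dh (x, y)) r).
- move=> t; have := @line_derive h (x, 0) (0, 1) t hd.
  have E (u : R) : u *: ((0, 1) : P) + (x, 0) = (x, u).
    by congr pair; rewrite /= /GRing.scale /= ?mulr1 ?mulr0 ?addr0 ?add0r.
  by rewrite E hdh; under eq_fun do rewrite E.
- exact: slice2_continuous.
- by move=> t /ns; exact: h0.
- by move=> t /ns; exact: dh0.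
Qed.

Lemma smooth_cpt_radius w g : smooth_cpt g -> exists r : R,
  (forall z, r < `|z| -> g z = 0) /\ (forall z, r < `|z| -> cdirD w g z = 0).
Proof.
move=> tg; have [_ [r' dr]] := smooth_cpt_cdirD w tg; have [_ [r gr]] := tg.
by exists (Num.max r r'); split=> z; rewrite gt_max => /andP[? ?]; [exact: gr|exact: dr].
Qed.

Lemma Cint_cD1 g : smooth_cpt g -> Cint leb2 setT (cD ((1, 0) : P) g) = 0.
Proof.
move=> tg; have td := smooth_cpt_cdirD [:: ((1, 0) : P)] tg.
have cc := smooth_Ccontinuous td.1; have rr := smooth_cpt_rapid td.
rewrite Cint_fubini_swap; [|exact: rapid_cintable|by move=> y; exact: slice_cintable1].
rewrite -[RHS](Cint0 leb1); congr Cint; apply/funext => y.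
have [r [gr dr]] := smooth_cpt_radius [:: ((1, 0) : P)] tg; have [c1 c2] := cc.
rewrite /Cint (_ : 0 = 0 +i* 0) //; congr Complex.
  apply: (@integral_partial1 (fun x => Re (g x)) (fun z => Re (cdirD [:: ((1, 0) : P)] g z)) r y) => //.
  - by move=> z; have [] := smooth_on_diff tg.1 (x := z) I.
  - by move=> z /gr ->.
  - by move=> z /dr ->.
apply: (@integral_partial1 (fun x => Im (g x)) (fun z => Im (cdirD [:: ((1, 0) : P)] g z)) r y) => //.
- by move=> z; have [] := smooth_on_diff tg.1 (x := z) I.
- by move=> z /gr ->.
- by move=> z /dr ->.
Qed.

Lemma Cint_cD2 g : smooth_cpt g -> Cint leb2 setT (cD ((0, 1) : P) g) = 0.
Proof.
move=> tg; have td := smooth_cpt_cdirD [:: ((0, 1) : P)] tg.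
have cc := smooth_Ccontinuous td.1; have rr := smooth_cpt_rapid td.
rewrite Cint_fubini; [|exact: rapid_cintable|by move=> y; exact: slice_cintable2].
rewrite -[RHS](Cint0 leb1); congr Cint; apply/funext => x.
have [r [gr dr]] := smooth_cpt_radius [:: ((0, 1) : P)] tg; have [c1 c2] := cc.
rewrite /Cint (_ : 0 = 0 +i* 0) //; congr Complex.
  apply: (@integral_partial2 (fun x => Re (g x)) (fun z => Re (cdirD [:: ((0, 1) : P)] g z)) r x) => //.
  - by move=> z; have [] := smooth_on_diff tg.1 (x := z) I.
  - by move=> z /gr ->.
  - by move=> z /dr ->.
apply: (@integral_partial2 (fun x => Im (g x)) (fun z => Im (cdirD [:: ((0, 1) : P)] g z)) r x) => //.
- by move=> z; have [] := smooth_on_diff tg.1 (x := z) I.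
- by move=> z /gr ->.
- by move=> z /dr ->.
Qed.

(** Integration by parts: the derivative of [g * ew x] along [v] has integral zero. Only the two
    axes occur, since Fubini reduces this to the fundamental theorem of calculus on lines parallel
    to them. *)
Lemma FT_cD g v x : v = (1, 0) \/ v = (0, 1) -> smooth_cpt g ->
  FT (cD v g) x = - mono [:: v] x * FT g x.
Proof.
move=> hv tg; have [sw dw] := smooth_ew x.
have tge : smooth_cpt (fun xi => g xi * ew x xi) by exact: smooth_cptM.
have I0 : Cint leb2 setT (cD v (fun xi => g xi * ew x xi)) = 0.
  by case: hv => ->; [exact: Cint_cD1|exact: Cint_cD2].
have rd := smooth_cpt_rapid (smooth_cpt_cdirD [:: v] tg).
have rg := smooth_cpt_rapid tg.
move: I0; have -> : cD v (fun xi => g xi * ew x xi) =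
    (fun xi => cD v g xi * ew xi x + mono [:: v] x * (g xi * ew xi x)).
  apply/funext => xi; rewrite (cDM v tg.1 sw) // -/(cdirD [:: v] (ew x)) -/(cD v (ew x)).
  by rewrite /cD dw (ewC x); ring.
rewrite CintD ?CintZ; [|exact: cintable_FT|exact: cintable_FT|by apply: cintableZ; exact: cintable_FT].
by move=> /eqP; rewrite addr_eq0 mulNr => /eqP.
Qed.

Lemma FT_decay g n v : v = (1, 0) \/ v = (0, 1) -> smooth_cpt g ->
  exists C, forall x, `|dot2 x v| ^+ n * cabs (FT g x) <= C.
Proof.
move=> hv; elim: n g => [|n IH] g tg.
  have rg := smooth_cpt_rapid tg.
  exists (\int[leb2]_xi cabs (g xi)) => x; rewrite expr0 mul1r.
  apply: Cint_abs_le; first by apply: cintable_cmeas; exact: cintable_FT.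
    exact: cintable_cabs (rapid_cintable rg).
  by move=> xi; rewrite cabsM cabs_ew mulr1.
have [C HC] := IH _ (smooth_cpt_cdirD [:: v] tg); exists C => x.
apply: le_trans (HC x); rewrite (FT_cD _ hv tg) cabsM cabsN mono1 cabs_imag normrN normrM.
rewrite exprSr -mulrA ler_wpM2l ?exprn_ge0 // ler_wpM2r ?cabs_ge0 //.
rewrite ler_peMl // ger0_norm ?mulr_ge0 ?pi_ge0 //; have := @pi_ge2 R; lra.
Qed.

(** Decay along each axis suffices, the norm being the larger of the two coordinates and
    [(1 + y) ^+ n] being at most [2 ^+ n * (1 + y ^+ n)]. *)
Lemma FT_rapid g : smooth_cpt g -> rapid (FT g).
Proof.
move=> tg; have rg := smooth_cpt_rapid tg.
split; first by apply: cmeas_continuous; apply: smooth_Ccontinuous; exact: (FT_smooth rg).1.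
move=> n.
have [C0 H0] := FT_decay 0 (or_introl erefl) tg.
have [C1 H1] := FT_decay n (or_introl erefl) tg.
have [C2 H2] := FT_decay n (or_intror erefl) tg.
exists (2 ^+ n * (C0 + C1 + C2)) => x.
have h0 := H0 x; have h1 := H1 x; have h2 := H2 x.
rewrite expr0 mul1r in h0.
have {}h1 : `|x.1| ^+ n * cabs (FT g x) <= C1.
  by move: h1; rewrite dot2E /= mulr1 mulr0 addr0.
have {}h2 : `|x.2| ^+ n * cabs (FT g x) <= C2.
  by move: h2; rewrite dot2E /= mulr1 mulr0 add0r.
have c0 := cabs_ge0 (FT g x).
have p1 : 0 <= `|x.1| ^+ n * cabs (FT g x) by rewrite mulr_ge0 ?exprn_ge0.
have p2 : 0 <= `|x.2| ^+ n * cabs (FT g x) by rewrite mulr_ge0 ?exprn_ge0.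
have key (y : R) : 0 <= y -> (1 + y) ^+ n <= 2 ^+ n * (1 + y ^+ n).
  move=> y0; have [y1|y1] := leP y 1.
    rewrite (@le_trans _ _ (2 ^+ n)) // ?lerXn2r ?nnegrE ?addr_ge0 //; first lra.
    by rewrite ler_peMr ?exprn_ge0 // lerDl exprn_ge0.
  rewrite (@le_trans _ _ ((2 * y) ^+ n)) // ?lerXn2r ?nnegrE ?addr_ge0 ?mulr_ge0 //; first lra.
  by rewrite exprMn ler_wpM2l ?exprn_ge0 // lerDr.
have hx := key _ (normr_ge0 x).
rewrite (le_trans (ler_wpM2r c0 hx)) // -mulrA ler_wpM2l ?exprn_ge0 // mulrDl mul1r.
suff : `|x| ^+ n * cabs (FT g x) <= `|x.1| ^+ n * cabs (FT g x) + `|x.2| ^+ n * cabs (FT g x) by lra.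
rewrite norm_plane; case: (leP `|x.1| `|x.2|) => _; rewrite ?lerDr ?lerDl //.
Qed.

Lemma conjc_invol (z : R[i]) : (z^*)^* = z.
Proof. by apply: complex_ext; rewrite !reimE ?opprK. Qed.

(** The inverse transform, expressed by conjugation so that every property of [FT] carries over. *)
Definition IFT g : P -> R[i] := fun x => (FT (fun xi => (g xi)^*) x)^*.

Lemma IFTE g x : rapid g -> IFT g x = Cint leb2 setT (fun xi => g xi * (ew xi x)^*).
Proof.
move=> rg; rewrite /IFT FTE -CintJ; last by apply: cintable_FT; exact: rapidJ.
by congr Cint; apply/funext => y; rewrite conjcM conjc_invol.
Qed.

Lemma IFT_rapid g : smooth_cpt g -> rapid (IFT g).
Proof. by move=> tg; apply: rapidJ; apply: FT_rapid; exact: smooth_cptJ. Qed.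

Lemma smooth_mono w : smooth_on setT (mono w : P -> R[i]).
Proof.
elim: w => [|v w IH].
  by rewrite (_ : mono [::] = fun=> 1) ?(smooth_on_cst _ 1) //; [exact: smooth_on_cst|apply/funext => x; rewrite mono_nil].
rewrite (_ : mono (v :: w) = fun x => (0 +i* (- (2 * pi * dot2 x v))) * mono w x); last first.
  by apply/funext => x; rewrite mono_cons.
apply: smooth_onM openT _ IH; apply/smooth_onP => n; split; first exact: smooth_upto_cst.
apply: (eq_smooth_upto openT (h := fun x => (- (2 * pi)) * linform v.1 v.2 x)).
  by move=> x _; rewrite /= dot2E /linform; ring.
apply: smooth_uptoM openT _ _; first exact: smooth_upto_cst.
apply: smooth_upto_linear openT; exact: continuous_linform.
Qed.

Lemma FT_schwartz g : smooth_cpt g -> schwartz (FT g).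
Proof.
move=> tg; have [sF dF] := FT_smooth (smooth_cpt_rapid tg); split => // n w.
have tm : smooth_cpt (fun xi => mono w xi * g xi).
  under eq_fun do rewrite mulrC; apply: smooth_cptM => //; exact: smooth_mono.
by have [_ /(_ n)[C H]] := FT_rapid tm; exists C => x; rewrite dF.
Qed.

Lemma schwartzJ g : schwartz g -> schwartz (fun x => (g x)^*).
Proof.
move=> [sg H]; split; first exact: smooth_onJ openT _.
by move=> n w; have [C HC] := H n w; exists C => x; rewrite cdirDJ // cabsJ.
Qed.

Lemma IFT_schwartz g : smooth_cpt g -> schwartz (IFT g).
Proof. by move=> tg; apply: schwartzJ; apply: FT_schwartz; exact: smooth_cptJ. Qed.

Lemma schwartz_rapid g : schwartz g -> rapid g.
Proof.
move=> [sg H]; split; first by apply: cmeas_continuous; exact: smooth_Ccontinuous.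
by move=> n; have [C HC] := H n [::]; exists C => x; have := HC x; rewrite cdirD_nil.
Qed.

End TestFunctions.

(** * Changes of variable, from nonnegative to integrable functions *)

Section Substitution.
Context {R : realType} {dd : measure_display} {T : measurableType dd}.
Variables (mu : {measure set T -> \bar R}) (phi : T -> T) (c : R).
Hypothesis c0 : 0 < c.
Hypothesis mphi : measurable_fun setT phi.
Hypothesis subst_ge0 : forall f : T -> \bar R, measurable_fun setT f ->
  (forall x, 0 <= f x)%E -> (\int[mu]_x f x = c%:E * \int[mu]_x f (phi x))%E.

Lemma integrable_subst (f : T -> R) : mu.-integrable setT (EFin \o f) ->
  mu.-integrable setT (EFin \o (f \o phi)).
Proof.
move=> /integrableP[mf fi]; apply/integrableP; split.
  exact: (measurableT_comp mf mphi).
have mf' : measurable_fun setT (abse \o (EFin \o f)) by exact: measurableT_comp.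
have E := subst_ge0 mf' (fun x => abse_ge0 _).
rewrite ltNge; apply/negP; rewrite leye_eq => /eqP Y.
by move: fi; rewrite [X in (X < _)%E]E Y mulry gtr0_sg // mul1e ltxx.
Qed.

Lemma Rint_subst (f : T -> R) : mu.-integrable setT (EFin \o f) ->
  \int[mu]_x f x = c * \int[mu]_x f (phi x).
Proof.
move=> fi; have fi' := integrable_subst fi.
have mf := measurable_int _ fi.
have mp : measurable_fun setT ((EFin \o f)^\+)%E by exact: measurable_funepos.
have mn : measurable_fun setT ((EFin \o f)^\-)%E by exact: measurable_funeneg.
have Ep := subst_ge0 mp (fun x => funepos_ge0 _ x).
have En := subst_ge0 mn (fun x => funeneg_ge0 _ x).
have Fp := integrable_pos_fin_num measurableT fi'.
have Fn := integrable_neg_fin_num measurableT fi'.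
have E1 : (\int[mu]_x ((EFin \o f)^\+) (phi x) = \int[mu]_x ((EFin \o (f \o phi))^\+) x)%E.
  by apply: eq_integral => x _; rewrite !funeposE.
have E2 : (\int[mu]_x ((EFin \o f)^\-) (phi x) = \int[mu]_x ((EFin \o (f \o phi))^\-) x)%E.
  by apply: eq_integral => x _; rewrite !funenegE.
rewrite /Rintegral integralE Ep En E1 E2 [in RHS]integralE.
by rewrite -(fineK Fp) -(fineK Fn) -!EFinM -!EFinB /= mulrBr.
Qed.

Lemma cintable_subst (g : T -> R[i]) : cintable mu g -> cintable mu (fun x => g (phi x)).
Proof. by move=> [g1 g2]; split; [exact: integrable_subst g1|exact: integrable_subst g2]. Qed.

Lemma Cint_subst (g : T -> R[i]) : cintable mu g ->
  Cint mu setT g = c%:C * Cint mu setT (fun x => g (phi x)).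
Proof.
move=> [g1 g2]; apply: complex_ext; rewrite !reimE /= !mul0r ?subr0 ?addr0.
  exact: (Rint_subst g1).
exact: (Rint_subst g2).
Qed.

End Substitution.

(** * Affine changes of variable on the line and the plane *)

Section Affine.
Context {R : realType}.
Local Notation mu := (@lebesgue_measure R).
Local Notation line := (measurableTypeR R).
Local Notation pl := (measurableTypeR R * measurableTypeR R)%type.

Definition affine1 (c d : R) : line -> line := fun x => c * x + d.

Lemma measurable_affine1 (c d : R) : measurable_fun setT (affine1 c d).
Proof.
apply: continuous_measurable_fun => x; apply: cvgD; last exact: cvg_cst.
by apply: cvgM; [exact: cvg_cst|exact: cvg_id].
Qed.

Lemma preimage_affine1 (c d a b : R) : c != 0 ->
  mu (affine1 c d @^-1` `]a, b]) = ((`|c|^-1)%:E * mu `]a, b])%E.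
Proof.
move=> c0; rewrite lebesgue_measure_itv /= lte_fin.
case: (ltrgtP c 0) c0 => // c0 _.
- have -> : affine1 c d @^-1` `]a, b] = `[(b - d) / c, (a - d) / c[%classic.
    apply/seteqP; split=> x /=; rewrite !in_itv /= /affine1 ltr_ndivlMr // ler_ndivrMr //
      ltrBlDr lerBrDr [x * c]mulrC; by move=> /andP[-> ->].
  rewrite lebesgue_measure_itv /= lte_fin ltr_nM2r ?invr_lt0 // ltrD2r.
  case: ifP => _; last by rewrite mule0.
  rewrite -!EFinB -EFinM ltr0_norm // invrN; congr EFin; field; by rewrite lt_eqF.
- have -> : affine1 c d @^-1` `]a, b] = `](a - d) / c, (b - d) / c]%classic.
    apply/seteqP; split=> x /=; rewrite !in_itv /= /affine1 ltr_pdivrMr // ler_pdivlMr //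
      ltrBlDr lerBrDr [x * c]mulrC; by move=> /andP[-> ->].
  rewrite lebesgue_measure_itv /= lte_fin ltr_pM2r ?invr_gt0 // ltrD2r.
  case: ifP => _; last by rewrite mule0.
  by rewrite -!EFinB -EFinM gtr0_norm //; congr EFin; field; rewrite gt_eqF.
Qed.

(** The suitably scaled image of Lebesgue measure agrees with Lebesgue measure on half-open
    intervals, hence everywhere by uniqueness. *)
Lemma ge0_integral_affine1 (c d : R) : c != 0 -> forall f : line -> \bar R,
  measurable_fun setT f -> (forall x, 0 <= f x)%E ->
  (\int[@leb1 R]_x f x = (`|c|)%:E * \int[@leb1 R]_x f (affine1 c d x))%E.
Proof.
move=> c0 f mf f0.
have a0 : 0 < `|c| by rewrite normr_gt0.
pose pf : {measure set line -> \bar R} := pushforward mu (affine1 c d).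
transitivity (\int[mscale (NngNum (ltW a0)) (pf (@measurable_affine1 c d))]_x f x)%E.
  apply: eq_measure_integral => A mA _.
  apply: lebesgue_measure_unique => //= _ [[a b]] _ <-.
  rewrite /mscale /= /pushforward preimage_affine1 // muleA -EFinM divff ?mul1e //.
  by rewrite gt_eqF.
rewrite ge0_integral_mscale // ge0_integral_pushforward //.
exact: measurable_affine1.
Qed.

(** Triangular, so that Tonelli reduces it to two changes of variable on lines; the transpose of
    [Mas a s] has this shape. *)
Definition affine2 (c d p q e : R) : pl -> pl := fun x => (c * x.1 + p, d * x.2 + (e * x.1 + q)).

Lemma measurable_affine2 c d p q e : measurable_fun setT (affine2 c d p q e).
Proof.
apply/measurable_fun_pairP; split => /=.
  exact: (measurableT_comp (@measurable_affine1 c p) measurable_fst).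
apply: measurable_funD; first by apply: measurable_funM => //; exact: measurable_snd.
exact: (measurableT_comp (@measurable_affine1 e q) measurable_fst).
Qed.

Lemma ge0_integral_affine2 c d p q e : c != 0 -> d != 0 -> forall f : pl -> \bar R,
  measurable_fun setT f -> (forall x, 0 <= f x)%E ->
  (\int[@leb2 R]_x f x = (`|c| * `|d|)%:E * \int[@leb2 R]_x f (affine2 c d p q e x))%E.
Proof.
move=> c0 d0 f mf f0.
have mf' : measurable_fun setT (f \o affine2 c d p q e).
  exact: (measurableT_comp mf (@measurable_affine2 c d p q e)).
have F0 x : (0 <= fubini_F (@lebesgue_measure R) f x)%E by exact: integral_ge0.
have mF := measurable_fun_fubini_tonelli_F (m2 := @lebesgue_measure R) _ mf f0.
rewrite [LHS](fubini_tonelli1 _ mf f0) (fubini_tonelli1 _ mf' (fun x => f0 _)).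
rewrite [LHS](ge0_integral_affine1 p c0 mF F0) /fubini_F.
rewrite EFinM -muleA; congr (_ * _)%E.
rewrite -ge0_integralZl //; last 2 first.
- exact: (measurable_fun_fubini_tonelli_F _ mf' (fun x => f0 _)).
- by move=> x _; apply: integral_ge0 => y _; exact: f0.
apply: eq_integral => x _.
rewrite (@ge0_integral_affine1 d (e * x + q) d0) //.
exact: (measurableT_comp mf (pair1_measurable _)).
Qed.

Lemma measurable_Jswap : measurable_fun setT (Jswap : pl -> pl).
Proof. by apply/measurable_fun_pairP; split; [exact: measurable_snd|exact: measurable_fst]. Qed.

(** The factor [1%:E] gives the statement the form of the hypothesis [subst_ge0]. *)
Lemma ge0_integral_swap (f : pl -> \bar R) :
  measurable_fun setT f -> (forall x, 0 <= f x)%E ->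
  (\int[@leb2 R]_x f x = 1%:E * \int[@leb2 R]_x f (Jswap x))%E.
Proof.
move=> mf f0; rewrite mul1e.
have mf' : measurable_fun setT (f \o Jswap) by exact: (measurableT_comp mf measurable_Jswap).
transitivity (\int[@leb2 R]_x (f \o Jswap) x)%E; last by [].
rewrite [LHS](fubini_tonelli1 _ mf f0); symmetry.
exact: (fubini_tonelli2 (m1 := @lebesgue_measure R) (m2 := @lebesgue_measure R) (f \o Jswap) mf' (fun x => f0 _)).
Qed.

Definition integrable_affine1 c d (c0 : c != 0) := integrable_subst (etrans (normr_gt0 c) c0)
  (@measurable_affine1 c d) (@ge0_integral_affine1 c d c0).
Definition Rint_affine1 c d (c0 : c != 0) := Rint_subst (etrans (normr_gt0 c) c0)
  (@measurable_affine1 c d) (@ge0_integral_affine1 c d c0).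

End Affine.

(** * Dominated convergence for real-valued integrals *)

Section Convergence.
Context {R : realType} {dd : measure_display} {T : measurableType dd}.
Variable mu : {measure set T -> \bar R}.

Lemma Rdominated (f_ : nat -> T -> R) (f g : T -> R) :
  (forall n, measurable_fun setT (f_ n)) -> (forall x, f_ n x @[n --> \oo] --> f x) ->
  mu.-integrable setT (EFin \o g) -> (forall n x, `|f_ n x| <= g x) ->
  \int[mu]_x f_ n x @[n --> \oo] --> \int[mu]_x f x.
Proof.
move=> mf cf ig fg.
have i_ n : mu.-integrable setT (EFin \o f_ n) by exact: le_integrable_real ig (fg n).
have mfl : measurable_fun setT f.
  apply: (@measurable_fun_cvg _ _ _ _ f_ f) => // x _; exact: cf.
have fgl x : `|f x| <= g x.
  apply: (@closed_cvg _ _ \oo _ (fun n => `|f_ n x|) (fun y => y <= g x)); last exact: cvg_norm.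
    exact: closed_le.
  by apply: nearW => n; exact: fg.
have il : mu.-integrable setT (EFin \o f) by exact: le_integrable_real ig fgl.
have := @dominated_cvg _ _ _ mu setT measurableT (fun n x => (f_ n x)%:E) (EFin \o f) (EFin \o g).
move=> H; apply: fine_cvg; rewrite fineK ?integrable_fin_num //.
apply: H => //.
- by move=> n; exact/measurable_EFinP.
- by move=> x _; apply: cvg_EFin; [exact: nearW|exact: cf].
- by move=> n x _ /=; rewrite lee_fin.
Qed.

End Convergence.

(** * Fourier inversion by Abel summation *)

Section AbelKernel.
Context {R : realType}.
Local Notation line := (measurableTypeR R).
Local Notation pl := (measurableTypeR R * measurableTypeR R)%type.
Local Notation P := (R * R)%type.

Definition expabs (x : R) : R := expR (- `|x|).
(** The Fourier transform of [expabs] in the normalization of [ew], a Poisson kernel of total mass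
    1. *)
Definition abelK (y : R) : R := 2 * omega1 (2 * pi * y).

Lemma continuous_expabs : continuous expabs.
Proof.
move=> x; apply: (@continuous_comp _ _ _ (fun x : R => - `|x|) (@expR R)); last exact: continuous_expR.
by apply: cvgN; exact: norm_continuous.
Qed.

Lemma expabs_ge0 x : 0 <= expabs x. Proof. exact: expR_ge0. Qed.

(** Adding 1 to the cosine makes the integrand nonnegative, so that the fundamental theorem applies
    on the whole half-line before integrability is known. *)
Lemma integral_expabs_cos1 (b : R) :
  (\int[@leb1 R]_x (expabs x * (1 + cos (b * x)))%:E = (2 * (1 + omega1 b))%:E)%E.
Proof.
have c0 : 0 < 1 + b ^+ 2 by rewrite ltr_wpDr ?sqr_ge0.
have cc : continuous (fun x => cos (b * x)).
  move=> x; apply: (@continuous_comp _ _ _ (fun x : R => b * x) (@cos R)); last exact: continuous_cos.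
  by apply: cvgM; [exact: cvg_cst|exact: cvg_id].
have cs : continuous (fun x => sin (b * x)).
  move=> x; apply: (@continuous_comp _ _ _ (fun x : R => b * x) (@sin R)); last exact: continuous_sin.
  by apply: cvgM; [exact: cvg_cst|exact: cvg_id].
have cont : continuous (fun x => expabs x * (1 + cos (b * x))).
  move=> x; apply: cvgM; first exact: continuous_expabs.
  by apply: cvgD; [exact: cvg_cst|exact: cc].
rewrite ge0_symfun_integralT; last 3 first.
- by move=> x; rewrite mulr_ge0 ?expabs_ge0 // addrC -lerBlDr sub0r cos_geN1.
- exact: cont.
- by move=> x; rewrite /= /expabs normrN mulrN cosN.
pose f x : R := expR (- x) * (1 + cos (b * x)).
(* Primitive of [f], found by integrating [exp (- x) * cos (b x)] by parts twice. *)
pose F x : R := expR (- x) * ((b * sin (b * x) - cos (b * x)) * omega1 b - 1).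
have dF (x : R) : is_derive x (1 : R) F (f x).
  have -> : f x = expR (- x) * ((b * (b * cos (b * x)) + b * sin (b * x)) * omega1 b)
     + ((b * sin (b * x) - cos (b * x)) * omega1 b - 1) * (- expR (- x)).
    rewrite /f /omega1; field; by rewrite gt_eqF.
  rewrite /F; apply: is_derive_eq; rewrite /GRing.scale /=; ring.
have -> : (\int[lebesgue_measure]_(x in [set x : R | (0 <= x)%R]) (expabs x * (1 + cos (b * x)))%:E =
    \int[lebesgue_measure]_(x in `[0%R, +oo[) (f x)%:E)%E.
  rewrite -set_itvcy; apply: eq_integral => x; rewrite inE /= in_itv /= andbT => x0.
  by rewrite /f /expabs ger0_norm.
have cF : continuous F.
  by move=> x; apply: differentiable_continuous; apply/derivable1_diffP; exact: ex_derive.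
rewrite (@ge0_continuous_FTC2y _ f F 0 0).
- rewrite /F mulr0 sin0 cos0 oppr0 expR0 /= -EFinB -EFinM; congr EFin; ring.
- by move=> x _; rewrite mulr_ge0 ?expR_ge0 // addrC -lerBlDr sub0r cos_geN1.
- apply: continuous_subspaceT => x; apply: cvgM; last by apply: cvgD; [exact: cvg_cst|exact: cc].
  apply: (@continuous_comp _ _ _ (fun x : R => - x) (@expR R)); last exact: continuous_expR.
  exact: opp_continuous.
- pose M := (`|b| + 1) * omega1 b + 1.
  have bd x : `|F x| <= M * expR (- x).
    rewrite normrM (ger0_norm (expR_ge0 _)) mulrC ler_wpM2r ?expR_ge0 //.
    rewrite (le_trans (ler_normB _ _)) // normr1 lerD2r normrM (ger0_norm (omega1_ge0 _)).
    rewrite ler_wpM2r ?omega1_ge0 // (le_trans (ler_normB _ _)) // lerD //.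
      by rewrite normrM ler_piMr // ler_norml sin_geN1 sin_le1.
    by rewrite ler_norml cos_geN1 cos_le1.
  have E : M * expR (- x) @[x --> +oo] --> (0 : R).
    by rewrite -[X in _ --> X](mulr0 M); apply: cvgMr; exact: cvgr_expR.
  apply: norm_cvg0; apply: (squeeze_cvgr _ (cvg_cst 0) E).
  by apply: nearW => x; rewrite normr_ge0 bd.
- by move=> x _; exact: ex_derive.
- by apply: cvg_at_right_filter; exact: cF.
- by move=> x _; rewrite derive1E derive_val.
Qed.

Lemma integrable_expabs : (@leb1 R).-integrable setT (EFin \o expabs).
Proof.
apply/integrableP; split; first by apply/measurable_EFinP; apply: continuous_measurable_fun; exact: continuous_expabs.
have := integral_expabs_cos1 0 => E.
apply: (@le_lt_trans _ _ (\int[@leb1 R]_x (expabs x * (1 + cos (0 * x)))%:E)%E); last by rewrite E ltry.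
apply: ge0_le_integral => //.
- by apply: measurableT_comp => //; apply/measurable_EFinP; apply: continuous_measurable_fun; exact: continuous_expabs.
- apply/measurable_EFinP; rewrite (_ : (fun _ => _) = (fun x => expabs x * 2)).
    by apply: measurable_funM => //; apply: continuous_measurable_fun; exact: continuous_expabs.
  by apply/funext => x; rewrite mul0r cos0.
- move=> x _ /=; rewrite lee_fin ger0_norm ?expabs_ge0 // mul0r cos0.
  by rewrite ler_peMr ?expabs_ge0 // lerDl.
Qed.

Lemma integrable_expabs_bounded (h : R -> R) : continuous h -> (forall x, `|h x| <= 1) ->
  (@leb1 R).-integrable setT (EFin \o (fun x => expabs x * h x)).
Proof.
move=> ch h1; refine (@le_integrable_real R _ line leb1 _ expabs _ _ _).
- by apply: continuous_measurable_fun => x; apply: cvgM; [exact: continuous_expabs|exact: ch].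
- exact: integrable_expabs.
- by move=> x; rewrite normrM (ger0_norm (expabs_ge0 _)) ler_piMr ?expabs_ge0.
Qed.

Lemma continuous_cosM (b : R) : continuous (fun x => cos (b * x)).
Proof.
move=> x; apply: (@continuous_comp _ _ _ (fun x : R => b * x) (@cos R)); last exact: continuous_cos.
by apply: cvgM; [exact: cvg_cst|exact: cvg_id].
Qed.

Lemma continuous_sinM (b : R) : continuous (fun x => sin (b * x)).
Proof.
move=> x; apply: (@continuous_comp _ _ _ (fun x : R => b * x) (@sin R)); last exact: continuous_sin.
by apply: cvgM; [exact: cvg_cst|exact: cvg_id].
Qed.

Lemma norm_cos_le1 (x : R) : `|cos x| <= 1. Proof. by rewrite ler_norml cos_geN1 cos_le1. Qed.
Lemma norm_sin_le1 (x : R) : `|sin x| <= 1. Proof. by rewrite ler_norml sin_geN1 sin_le1. Qed.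

Lemma Rint_expabs_cos (b : R) : \int[@leb1 R]_x (expabs x * cos (b * x)) = 2 * omega1 b.
Proof.
have ic a := integrable_expabs_bounded (@continuous_cosM a) (fun x => norm_cos_le1 _).
have E a : \int[@leb1 R]_x expabs x + \int[@leb1 R]_x (expabs x * cos (a * x)) = 2 * (1 + omega1 a).
  rewrite -RintegralD //; last exact: integrable_expabs.
  rewrite -[RHS]/(fine (2 * (1 + omega1 a))%:E) -integral_expabs_cos1 /Rintegral; congr fine.
  by apply: eq_integral => x _; rewrite mulrDr mulr1.
have := E b; have := E 0.
rewrite (_ : \int[leb1]_x (expabs x * cos (0 * x)) = \int[leb1]_x expabs x); last first.
  by apply: eq_Rintegral => x _; rewrite mul0r cos0 mulr1.
rewrite {1}/omega1 expr0n addr0 invr1 => E0 Eb; lra.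
Qed.

Lemma Rint_expabs_sin (b : R) : \int[@leb1 R]_x (expabs x * sin (b * x)) = 0.
Proof.
have is_ := integrable_expabs_bounded (@continuous_sinM b) (fun x => norm_sin_le1 _).
have n0 : (-1 : R) != 0 by rewrite oppr_eq0 oner_eq0.
have := Rint_affine1 0 n0 is_.
have -> : \int[@leb1 R]_x (expabs (affine1 (-1) 0 x) * sin (b * affine1 (-1) 0 x)) =
    - \int[@leb1 R]_x (expabs x * sin (b * x)); last by rewrite normrN1 mul1r; lra.
rewrite -[RHS]mulN1r -RintegralZl //.
by apply: eq_Rintegral => x _; rewrite /affine1 addr0 !mulN1r /expabs normrN mulrN sinN mulrN.
Qed.

Lemma cintable_expabs_expi (b : R) : cintable leb1 (fun x => (expabs x)%:C * expi (b * x)).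
Proof.
have := integrable_expabs_bounded (@continuous_cosM b) (fun x => norm_cos_le1 _).
have := integrable_expabs_bounded (@continuous_sinM b) (fun x => norm_sin_le1 _).
move=> i1 i2; split; [move: i2|move: i1]; congr (integrable _ _ _); apply/funext => x.
  by rewrite /= mul0r subr0.
by rewrite /= mul0r addr0.
Qed.

Lemma Cint_expabs_expi (b : R) : Cint leb1 setT (fun x => (expabs x)%:C * expi (b * x)) = (2 * omega1 b)%:C.
Proof.
apply: complex_ext => /=.
  by rewrite -Rint_expabs_cos; apply: eq_Rintegral => x _; rewrite mul0r subr0.
by rewrite -[RHS](Rint_expabs_sin b); apply: eq_Rintegral => x _; rewrite mul0r addr0.
Qed.

Lemma integrable_abelK : (@leb1 R).-integrable setT (EFin \o abelK).
Proof.
apply: integrable_scale; have c0 : (2 * pi : R) != 0 by rewrite mulf_neq0 // gt_eqF // pi_gt0.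
have := integrable_affine1 0 c0 integrable_omega1.
by congr (integrable _ _ _); apply/funext => x; rewrite /= /affine1 addr0.
Qed.

Lemma Rint_abelK : \int[@leb1 R]_y abelK y = 1.
Proof.
have c0 : (2 * pi : R) != 0 by rewrite mulf_neq0 // gt_eqF // pi_gt0.
have p0 : (0 : R) <= 2 * pi by rewrite mulr_ge0 ?pi_ge0.
have := Rint_affine1 0 c0 integrable_omega1.
have -> : \int[@leb1 R]_x omega1 x = pi.
  rewrite /Rintegral (ge0_symfun_integralT (f := omega1)); last 3 first.
  - exact: omega1_ge0.
  - exact: continuous_oneDsqrV.
  - by move=> x; rewrite /omega1 /= sqrrN.
  by rewrite -set_itvcy integral0y_oneDsqr /=; field.
rewrite ger0_norm // => E.
rewrite (_ : \int[leb1]_y abelK y = 2 * \int[leb1]_y omega1 (affine1 (2 * pi) 0 y)).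
  have p1 : (pi : R) != 0 by rewrite gt_eqF // pi_gt0.
  by apply: (mulfI p1); rewrite mulr1 mulrCA mulrA -E.
rewrite -RintegralZl //; last exact: (integrable_affine1 0 c0 integrable_omega1).
by apply: eq_Rintegral => x _; rewrite /abelK /affine1 addr0.
Qed.

End AbelKernel.

(** * Convergence of complex sequences and of their integrals *)

Section Ccvg.
Context {R : realType}.

Definition ccvg (z_ : nat -> R[i]) (z : R[i]) :=
  (Re (z_ n) @[n --> \oo] --> Re z) /\ (Im (z_ n) @[n --> \oo] --> Im z).

Lemma ccvg_unique (z_ : nat -> R[i]) z z' : ccvg z_ z -> ccvg z_ z' -> z = z'.
Proof.
move=> [r i] [r' i']; apply: complex_ext.
  exact: (cvg_unique _ r r').
exact: (cvg_unique _ i i').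
Qed.

Lemma ccvgM (z_ w_ : nat -> R[i]) z w : ccvg z_ z -> ccvg w_ w -> ccvg (fun n => z_ n * w_ n) (z * w).
Proof.
move=> [r i] [r' i']; split.
  rewrite reimE (_ : (fun n => _) = (fun n => Re (z_ n) * Re (w_ n) - Im (z_ n) * Im (w_ n))); last first.
    by apply/funext => n; rewrite reimE.
  by apply: cvgB; apply: cvgM.
rewrite reimE (_ : (fun n => _) = (fun n => Re (z_ n) * Im (w_ n) + Im (z_ n) * Re (w_ n))); last first.
  by apply/funext => n; rewrite reimE.
by apply: cvgD; apply: cvgM.
Qed.

Lemma ccvg_cst z : ccvg (fun=> z) z. Proof. by split; exact: cvg_cst. Qed.

Context {dd : measure_display} {T : measurableType dd}.
Variable mu : {measure set T -> \bar R}.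

Lemma Cdominated (f_ : nat -> T -> R[i]) (f : T -> R[i]) (h : T -> R) :
  (forall n, cmeas (f_ n)) -> (forall x, ccvg (fun n => f_ n x) (f x)) ->
  mu.-integrable setT (EFin \o h) -> (forall n x, cabs (f_ n x) <= h x) ->
  ccvg (fun n => Cint mu setT (f_ n)) (Cint mu setT f).
Proof.
move=> mf cf ih fh; split.
  apply: (@Rdominated _ _ _ mu (fun n x => Re (f_ n x)) (fun x => Re (f x)) h) => //.
  - by move=> n; case: (mf n).
  - by move=> x; case: (cf x).
  - by move=> n x; exact: le_trans (cabs_Re _) (fh n x).
apply: (@Rdominated _ _ _ mu (fun n x => Im (f_ n x)) (fun x => Im (f x)) h) => //.
- by move=> n; case: (mf n).
- by move=> x; case: (cf x).
- by move=> n x; exact: le_trans (cabs_Im _) (fh n x).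
Qed.

End Ccvg.

(** * Inversion formula and Plancherel identity *)

Section Inversion.
Context {R : realType}.
Local Notation pl := (measurableTypeR R * measurableTypeR R)%type.
Local Notation P := (R * R)%type.
Implicit Types (g h K : P -> R[i]).

Lemma cf_density g (r : R) : Ccontinuous g -> (forall x, r < `|x| -> g x = 0) -> 0 <= r ->
  exists C, compact_functional (fun h => Cint leb2 setT (fun x => g x * h x)) r 0 C.
Proof.
move=> cg g0 r0; have rg := cpt_rapid cg g0.
have igh h : smooth_on setT h -> rapid (fun x => g x * h x).
  move=> sh; apply: (@cpt_rapid _ _ r) => [|x rx]; last by rewrite g0 // mul0r.
  by apply: Ccontinuous_mul => //; exact: smooth_Ccontinuous.
exists (\int[leb2]_x cabs (g x)); split => //.
- move=> c h k sh sk; rewrite -CintZ; last exact/rapid_cintable/igh.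
  rewrite -CintD; [|by apply: cintableZ; exact/rapid_cintable/igh|exact/rapid_cintable/igh].
  by congr Cint; apply/funext => x; rewrite mulrDr mulrCA.
- by apply: Rintegral_ge0 => x _; exact: cabs_ge0.
- move=> h B sh hB; have ic := cintable_cabs (rapid_cintable rg).
  rewrite mulrC -RintegralZl //; apply: Cint_abs_le.
  + by case: (igh h sh).
  + exact: (integrable_scale _ ic).
  + move=> x; rewrite cabsM mulrC; case: (leP `|x| r) => xr.
      by rewrite ler_wpM2r ?cabs_ge0 //; have := hB x xr [::] isT isT; rewrite cdirD_nil.
    by rewrite g0 // cabs0 !mulr0.
Qed.

(** An instance of [cf_fourier], for the functional of integration against [g]. *)
Lemma parseval g K : smooth_cpt g -> rapid K ->
  Cint leb2 setT (fun x => g x * FT K x) = Cint leb2 setT (fun xi => K xi * FT g xi).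
Proof.
move=> [sg [r g0]] rK.
have g0' x : Num.max r 0 < `|x| -> g x = 0 by rewrite gt_max => /andP[/g0].
have m0 : 0 <= Num.max r 0 by rewrite le_max lexx orbT.
have [C LC] := cf_density (smooth_Ccontinuous sg) g0' m0.
rewrite (cf_fourier LC rK); congr Cint; apply/funext => xi; congr (_ * _).
by rewrite FTE; congr Cint; apply/funext => x; rewrite ewC.
Qed.

Lemma parsevalJ g K : smooth_cpt g -> rapid K ->
  Cint leb2 setT (fun x => (g x * FT K x)^*) = Cint leb2 setT (fun x => (K x * FT g x)^*).
Proof.
move=> sg rK; have rg := smooth_cpt_rapid sg.
have i1 : cintable leb2 ((fun x => g x * FT K x) : pl -> R[i]).
  apply: rapid_cintable; apply: rapid_pgrowth => //.
  split; first by apply: cmeas_continuous; apply: smooth_Ccontinuous; case: (FT_smooth rK).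
  exists 0%N, (\int[leb2]_z cabs (K z)) => x; rewrite expr0 mulr1 FTE; apply: Cint_abs_le.
  - by case: (rapid_ew x rK).
  - exact: cintable_cabs (rapid_cintable rK).
  - by move=> z; rewrite cabsM cabs_ew mulr1.
have i2 : cintable leb2 ((fun x => K x * FT g x) : pl -> R[i]).
  by apply: rapid_cintable; apply: rapid_pgrowth rK _; apply: pgrowth_rapid; exact: FT_rapid.
by rewrite (CintJ i1) (CintJ i2) (parseval sg rK).
Qed.

Definition abelK2 (x : P) : R[i] := (expabs x.1 * expabs x.2)%:C.

Lemma Ccontinuous_abelK2 : Ccontinuous abelK2.
Proof.
split => /=; last exact: cst_continuous.
by move=> x; apply: cvgM; apply: (@continuous_comp _ _ _ _ (@expabs R)); try exact: continuous_expabs;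
  [exact: continuous_fst2|exact: continuous_snd2].
Qed.

Lemma rapid_abelK2 : rapid abelK2.
Proof.
split; first exact/cmeas_continuous/Ccontinuous_abelK2.
move=> n; exists ((n.+1)`!%:R * expR 1) => x.
have e1 : (1 + `|x|) ^+ n <= (n.+1)`!%:R * expR (1 + `|x|).
  apply: (@le_trans _ _ ((1 + `|x|) ^+ n.+1)); first by apply: ler_weXn2l => //; exact: jnorm_ge1.
  rewrite mulrC -ler_pdivrMr ?ltr0n ?fact_gt0 //.
  by apply: le_trans (expR_ge1Dxn n (ltW (jnorm_gt0 x))); rewrite lerDr.
have e2 : cabs (abelK2 x) <= expR (- `|x|).
  rewrite cabs_real ger0_norm; last by rewrite mulr_ge0 ?expabs_ge0.
  rewrite -expRD ler_expR norm_plane; case: (leP `|x.1| `|x.2|) => _; by rewrite -opprD lerN2 ?lerDl ?lerDr.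
apply: le_trans (ler_pM _ (cabs_ge0 _) e1 e2) _; first by rewrite exprn_ge0 // ltW ?jnorm_gt0.
by rewrite -mulrA -expRD addrK.
Qed.

Lemma FT_abelK2 xi : FT abelK2 xi = (abelK xi.1 * abelK xi.2)%:C.
Proof.
have e x y : abelK2 (x, y) * ew (x, y) xi =
    ((expabs x)%:C * expi (- (2 * pi * xi.1) * x)) * ((expabs y)%:C * expi (- (2 * pi * xi.2) * y)).
  rewrite /abelK2 rmorphM mulrACA -expiD; congr (_ * expi _); rewrite dot2E /=; ring.
rewrite FTE Cint_fubini; first last.
- move=> x; rewrite (_ : (fun y => _) = (fun y => ((expabs x)%:C * expi (- (2 * pi * xi.1) * x)) *
      ((expabs y)%:C * expi (- (2 * pi * xi.2) * y)))); last by apply/funext => y; exact: e.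
  by apply: cintableZ; exact: cintable_expabs_expi.
- exact: cintable_FT rapid_abelK2.
rewrite (_ : (fun x => _) = (fun x => (2 * omega1 (2 * pi * xi.2))%:C *
   ((expabs x)%:C * expi (- (2 * pi * xi.1) * x)))); last first.
  apply/funext => x; rewrite (_ : (fun y => _) = (fun y => ((expabs x)%:C * expi (- (2 * pi * xi.1) * x)) *
      ((expabs y)%:C * expi (- (2 * pi * xi.2) * y)))); last by apply/funext => y; exact: e.
  rewrite CintZ; last exact: cintable_expabs_expi.
  by rewrite Cint_expabs_expi mulrC /omega1 sqrrN.
rewrite CintZ; last exact: cintable_expabs_expi.
by rewrite Cint_expabs_expi -rmorphM mulrC /abelK /omega1 sqrrN.
Qed.

Lemma integrable_abelK2 : (@leb2 R).-integrable setT (EFin \o (fun x : pl => abelK x.1 * abelK x.2)).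
Proof. by apply: integrable_tensor; exact: integrable_abelK. Qed.

Lemma Cint_abelK2 : Cint leb2 setT (fun x : pl => (abelK x.1 * abelK x.2)%:C : R[i]) = 1.
Proof.
rewrite Cint_real Rint_fubini; last 2 first.
- exact: integrable_abelK2.
- by move=> x /=; apply: integrable_scale; exact: integrable_abelK.
rewrite (_ : \int[_]_x _ = 1) // -Rint_abelK; apply: eq_Rintegral => x _ /=.
by rewrite RintegralZl ?Rint_abelK ?mulr1 //; exact: integrable_abelK.
Qed.

Lemma smooth_cpt_affine g (a : R) (b : P) : a != 0 -> smooth_cpt g -> smooth_cpt (fun x => g (a *: x + b)).
Proof.
move=> a0 [sg [r g0]]; split.
  apply: (@smooth_comp_affine _ _ _ g ( *:%R a) b _ sg).
  exact: (@scaler_continuous R P a).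
exists ((Num.max r 0 + `|b|) / `|a|) => x; rewrite ltr_pdivrMr ?normr_gt0 // => rx; apply: g0.
have : `|x| * `|a| <= `|a *: x + b| + `|b|.
  by rewrite mulrC -normrZ -[in leLHS](addrK b (a *: x)); exact: ler_normB.
by move: rx; case: (leP r 0) => r0; lra.
Qed.

(** Inversion at the origin. By [parseval] and scaling, the integral of [g (x / c) * FT abelK2 x]
    equals that of [abelK2 (xi / c) * FT g xi]. As [c] grows, the first tends to [g 0], the kernel
    having mass 1, and the second to the integral of [FT g], since [abelK2] is 1 at 0. *)
Lemma Cint_FT0 g : smooth_cpt g -> Cint leb2 setT (FT g) = g 0.
Proof.
move=> sg; pose c (n : nat) : R := n.+1%:R.
have c0 n : 0 < c n by rewrite ltr0n.
have cn0 n : c n != 0 by rewrite gt_eqF.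
have cc0 n : 0 < `|c n| * `|c n| by rewrite mulr_gt0 ?normr_gt0.
have eaff n x : affine2 (c n) (c n) 0 0 0 x = c n *: x.
  by rewrite /affine2 mul0r !addr0; case: x.
pose gn n : P -> R[i] := fun x => g ((c n)^-1 *: x).
have sgn n : smooth_cpt (gn n).
  have := @smooth_cpt_affine g (c n)^-1 0 _ sg; rewrite invr_eq0 => /(_ (cn0 n)).
  by congr smooth_cpt; apply/funext => x; rewrite addr0.
have rg := smooth_cpt_rapid sg.
have rFg := FT_rapid sg.
have FTgn n xi : FT (gn n) xi = (`|c n| * `|c n|)%:C * FT g (c n *: xi).
  rewrite !FTE (Cint_subst (cc0 n) (@measurable_affine2 _ _ _ _ _ _)
    (@ge0_integral_affine2 _ (c n) (c n) 0 0 0 (cn0 n) (cn0 n))).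
    congr (_ * _); congr Cint; apply/funext => x; rewrite eaff /gn scalerA mulVf // scale1r.
    by congr (_ * expi _); rewrite dot2E [dot2 x _]dot2E; case: (x) (xi) => [x1 x2] [y1 y2] /=; rewrite /GRing.scale /=; ring.
  by apply: cintable_FT; exact: smooth_cpt_rapid.
have aK0 (x : P) : 0 <= abelK x.1 * abelK x.2 by rewrite mulr_ge0 // mulr_ge0 ?omega1_ge0.
have scaled (h : P -> R[i]) x : Ccontinuous h -> ccvg (fun n => h ((c n)^-1 *: x)) (h 0).
  have L := cvg_comp (fun n => (c n)^-1) (fun t : R => t *: (x : P)) (@cvg_harmonic R) (@scalel_continuous R P x 0).
  rewrite scale0r in L.
  by move=> [h1 h2]; split; [apply: (cvg_comp _ _ L (h1 0))|apply: (cvg_comp _ _ L (h2 0))].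
have bK (x : P) : cabs (abelK2 x) <= 1.
  rewrite cabs_real ger0_norm; last by rewrite mulr_ge0 ?expabs_ge0.
  by rewrite mulr_ile1 ?expabs_ge0 // /expabs -expR0 ler_expR oppr_le0.
have cKn n : Ccontinuous (fun xi : P => abelK2 ((c n)^-1 *: xi)).
  have [k1 k2] := Ccontinuous_abelK2.
  split => x; [apply: (@continuous_comp _ _ _ (fun x : P => (c n)^-1 *: x) (fun x => Re (abelK2 x)))
    |apply: (@continuous_comp _ _ _ (fun x : P => (c n)^-1 *: x) (fun x => Im (abelK2 x)))];
    by [exact: scaler_continuous|exact: k1|exact: k2].
have mKn n : cmeas ((fun xi : P => abelK2 ((c n)^-1 *: xi)) : pl -> R[i]).
  exact: cmeas_continuous.
have iK n : cintable leb2 ((fun xi : P => abelK2 ((c n)^-1 *: xi) * FT g xi) : pl -> R[i]).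
  apply: rapid_cintable; rewrite (_ : (fun _ => _) = (fun xi => FT g xi * abelK2 ((c n)^-1 *: xi))).
    by apply: rapid_pgrowth => //; apply: (@pgrowth_bounded _ _ 1).
  by apply/funext => x; rewrite mulrC.
have key n : Cint leb2 setT (fun x => gn n x * (abelK x.1 * abelK x.2)%:C) =
    Cint leb2 setT (fun xi => abelK2 ((c n)^-1 *: xi) * FT g xi).
  transitivity (Cint leb2 setT (fun x => gn n x * FT abelK2 x)).
    by congr Cint; apply/funext => x; rewrite FT_abelK2.
  apply: etrans (parseval (sgn n) rapid_abelK2) _.
  rewrite [RHS](Cint_subst (cc0 n) (@measurable_affine2 _ _ _ _ _ _)
    (@ge0_integral_affine2 _ (c n) (c n) 0 0 0 (cn0 n) (cn0 n))).
    rewrite -CintZ.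
      by congr Cint; apply/funext => x; rewrite eaff FTgn scalerA mulVf // scale1r mulrCA.
    exact: (cintable_subst (cc0 n) (@measurable_affine2 _ _ _ _ _ _)
      (@ge0_integral_affine2 _ (c n) (c n) 0 0 0 (cn0 n) (cn0 n)) (iK n)).
  exact: iK.
have lim1 : ccvg (fun n => Cint leb2 setT (fun x => gn n x * (abelK x.1 * abelK x.2)%:C)) (g 0).
  rewrite -[g 0]mulr1 -Cint_abelK2 -CintZ; last first.
    by split => //=; [exact: integrable_abelK2|apply: integrable0].
  have [B hB] := proj2 (smooth_cpt_rapid sg) 0%N.
  have {}hB x : cabs (g x) <= B by rewrite -[cabs _]mul1r -(expr0 (1 + `|x|)).
  apply: (@Cdominated R _ pl leb2 (fun n x => gn n x * (abelK x.1 * abelK x.2)%:C)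
    (fun x => g 0 * (abelK x.1 * abelK x.2)%:C) (fun x => B * (abelK x.1 * abelK x.2))).
  - by move=> n; apply: cmeasM; [case: (smooth_cpt_rapid (sgn n))|apply: cmeas_real; case/integrableP: integrable_abelK2 => /measurable_EFinP].
  - move=> x; apply: ccvgM; last exact: ccvg_cst.
    by apply: scaled; first [exact: Ccontinuous_abelK2|exact: smooth_Ccontinuous (proj1 sg)].
  - exact: integrable_scale integrable_abelK2.
  - move=> n x; rewrite cabsM cabs_real (ger0_norm (aK0 x)).
    by apply: ler_wpM2r; [exact: aK0|exact: hB].
have lim2 : ccvg (fun n => Cint leb2 setT (fun xi => abelK2 ((c n)^-1 *: xi) * FT g xi)) (Cint leb2 setT (FT g)).
  have -> : Cint leb2 setT (FT g) = Cint leb2 setT (fun xi => abelK2 0 * FT g xi).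
    by congr Cint; apply/funext => x; rewrite /abelK2 /expabs normr0 oppr0 expR0 mulr1 mul1r.
  apply: (@Cdominated R _ pl leb2 (fun n x => abelK2 ((c n)^-1 *: x) * FT g x)
    (fun x => abelK2 0 * FT g x) (fun x => cabs (FT g x))).
  - by move=> n; case: (iK n) => /integrableP[/measurable_EFinP m1 _] /integrableP[/measurable_EFinP m2 _].
  - move=> x; apply: ccvgM; last exact: ccvg_cst.
    by apply: scaled; first [exact: Ccontinuous_abelK2|exact: smooth_Ccontinuous (proj1 sg)].
  - exact: cintable_cabs (rapid_cintable rFg).
  - by move=> n x; rewrite cabsM ler_piMl ?cabs_ge0.
apply: (ccvg_unique lim2); rewrite (_ : (fun n => _) = (fun n => Cint leb2 setT
  (fun x => gn n x * (abelK x.1 * abelK x.2)%:C))) //.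
by apply/funext => n; rewrite key.
Qed.

Lemma FT_shift g b xi : smooth_cpt g -> FT (fun x => g (x + b)) xi = (ew b xi)^* * FT g xi.
Proof.
move=> sg.
have n1 : (1 : R) != 0 by exact: oner_neq0.
have n11 : 0 < `|1 : R| * `|1 : R| by rewrite normr1 mulr1.
have eaff x : affine2 1 1 b.1 b.2 0 x = x + b.
  by rewrite /affine2 !mul1r mul0r add0r; case: (x) (b) => [? ?] [].
have ig : cintable leb2 (fun x => g x * ew x xi) by apply: cintable_FT; exact: smooth_cpt_rapid.
rewrite [FT g xi]FTE (Cint_subst n11 (@measurable_affine2 _ _ _ _ _ _)
  (@ge0_integral_affine2 _ 1 1 b.1 b.2 0 n1 n1)) //.
rewrite normr1 mulr1 mul1r -CintZ; last first.
  exact: (cintable_subst n11 (@measurable_affine2 _ _ _ _ _ _)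
    (@ge0_integral_affine2 _ 1 1 b.1 b.2 0 n1 n1) ig).
rewrite FTE; congr Cint; apply/funext => x; rewrite eaff [ew (x + b) xi]ewC ewDr (ewC xi b) (ewC xi x).
rewrite [RHS]mulrCA; congr (_ * _); rewrite mulrCA [_^* * _]mulrC mulc_conj cabs_ew expr1n.
by rewrite mulr1.
Qed.

(** [Cint_FT0] for the translate by [x] of the conjugate of [g]; translation becomes multiplication
    by a character. *)
Theorem FT_IFT g x : smooth_cpt g -> FT (IFT g) x = g x.
Proof.
move=> sg; have sJ := smooth_cptJ sg; set h := fun x => (g x)^* in sJ.
have sh : smooth_cpt (fun y => h (y + x)).
  have := smooth_cpt_affine x (oner_neq0 R) sJ.
  by congr smooth_cpt; apply/funext => y; rewrite scale1r.
have := Cint_FT0 sh; rewrite add0r => E.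
rewrite -[g x]conjc_invol -/(h x) -E -CintJ; last exact: rapid_cintable (FT_rapid sh).
rewrite FTE; congr Cint; apply/funext => xi.
by rewrite FT_shift // conjcM conjc_invol mulrC ewC.
Qed.

(** [parseval] with [K] the inverse transform of the conjugate of [g], so that [FT K] is this
    conjugate. *)
Theorem plancherel g : smooth_cpt g ->
  \int[leb2]_xi (cabs (FT g xi) ^+ 2) = \int[leb2]_x (cabs (g x) ^+ 2).
Proof.
move=> sg; have sJ := smooth_cptJ sg.
have := parseval sg (IFT_rapid sJ).
rewrite [X in Cint _ _ X = _](_ : _ = (fun x => (cabs (g x) ^+ 2)%:C)); last first.
  by apply/funext => x; rewrite FT_IFT // mulc_conj.
rewrite [X in _ = Cint _ _ X](_ : _ = (fun x => (cabs (FT g x) ^+ 2)%:C)); last first.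
  apply/funext => x; rewrite mulrC /IFT (_ : (fun _ => _) = g) ?mulc_conj //.
  by apply/funext => y; rewrite conjc_invol.
by rewrite !Cint_real => E; have [] := E.
Qed.

End Inversion.

(** * Cut-off functions *)

Section SmoothStep.
Context {R : realType}.
Local Notation line := (measurableTypeR R).

(* The only smooth functions at hand with compact support are those of the generator, e.g. [b = psi2h];
   the step is a normalized primitive of [|b|^2]. *)
Lemma smooth_step (b : R -> R[i]) (y0 : R) : test_fun setT b -> b y0 != 0 ->
  exists (st : R -> R) (l : R), [/\ 0 < l, forall n, smooth_upto n setT st,
    forall t, 0 <= st t <= 1, forall t, t <= - l -> st t = 0 & forall t, l <= t -> st t = 1].
Proof.
move=> [sb cb _] by0; have [M [_ HM]] := compact_bounded cb.
pose l : R := `|M| + 1; have l0 : 0 < l by rewrite ltr_wpDl.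
have b0 t : l <= `|t| -> b t = 0.
  move=> lt; apply/eqP; apply: contraT => bt.
  have : `|t| <= M + 2^-1.
    by apply: HM; [rewrite ltrDl invr_gt0|exact: subset_closure].
  by rewrite leNgt (lt_le_trans _ lt) // ler_ltD ?ler_norm // invf_lt1 // ltr1n.
pose p t := Re (b t) * Re (b t) + Im (b t) * Im (b t).
have p0 t : 0 <= p t by rewrite addr_ge0 // -expr2 sqr_ge0.
have pl t : l <= `|t| -> p t = 0 by move=> /b0; rewrite /p => ->; rewrite mulr0 addr0.
have sp n : smooth_upto n setT p.
  have [s1 s2] := (smooth_onP setT b).1 sb n.
  by apply: smooth_uptoD; [exact: openT|apply: smooth_uptoM; [exact: openT|exact: s1|exact: s1]|
    apply: smooth_uptoM; [exact: openT|exact: s2|exact: s2]].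
have cp : continuous p by move=> t; apply: differentiable_continuous; exact: smooth_upto_diff (sp 0%N) I.
have pE : p \_ `[- l, l] = p.
  apply/funext => t; rewrite patchE; case: ifPn => // /negP; rewrite inE /= in_itv /= -ler_norml => /negP.
  by rewrite -ltNge => /ltW /pl ->.
have ip : (@leb1 R).-integrable setT (EFin \o p).
  have := @continuous_compact_integrable R p `[- l, l] (@segment_compact _ _ _) (continuous_subspaceT cp).
  rewrite integrable_mkcond // => H; move: H; congr (integrable _ _ _).
  by apply/funext => t; rewrite -{2}pE /= !patchE; case: ifP.
have ipA (A : set line) : measurable A -> (@leb1 R).-integrable A (EFin \o p).
  by move=> mA; exact: integrableS ip.
pose A (x : R) : set line := [set` Interval -oo%O (BRight x)].
have mA x : measurable (A x) by exact: measurable_itv.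
pose G x : R := \int[@leb1 R]_(t in A x) p t.
pose c := \int[@leb1 R]_t p t.
have dG x : is_derive x (1 : R) G (p x).
  have [d1 d2] : derivable G x 1 /\ derive1 G x = p x.
    apply: (@continuous_FTC1 R p -oo%O x (x + 1)); [by rewrite ltrDl|exact: ipA|exact: ltNyr|exact: cp].
  exact: (DeriveDef d1 (etrans (esym (derive1E G x)) d2)).
have imA x : (@leb1 R).-integrable setT (EFin \o (p \_ (A x))).
  have := ipA _ (mA x); rewrite integrable_mkcond // => H; move: H; congr (integrable _ _ _).
  by apply/funext => t; rewrite /= !patchE; case: ifP.
have GE x : G x = \int[@leb1 R]_t (p \_ (A x)) t by rewrite /G Rintegral_mkcond.
have pA x t : 0 <= (p \_ (A x)) t <= p t by rewrite patchE; case: ifP; rewrite ?lexx ?p0.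
have G0 x : 0 <= G x by rewrite GE; apply: Rintegral_ge0 => t _; case/andP: (pA x t).
have Gc x : G x <= c.
  by rewrite GE; apply: le_Rintegral => // t _; case/andP: (pA x t).
(* If the total mass vanished, the primitive [G] would be constant and its derivative [p] would
   vanish at [y0]. *)
have c0 : 0 < c.
  rewrite lt_neqAle (le_trans (G0 0) (Gc 0)) andbT; apply/eqP => c0.
  have G00 : G = cst 0 by apply/funext => x; apply/le_anti; rewrite G0 c0 Gc.
  have := dG y0; rewrite G00 => /@derive_val; rewrite derive_cst => /esym/eqP.
  rewrite /p paddr_eq0 ?mulf_eq0 ?orbb -?expr2 ?sqr_ge0 // => /andP[/eqP e1 /eqP e2].
  by move: by0 => /eqP; apply; apply: complex_ext.
exists (fun x => c^-1 * G x), l; split => //.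
- move=> n; apply: smooth_uptoM; [exact: openT|exact: smooth_upto_cst|].
  case: n => [|n]; first by apply/smooth_upto0 => x _; apply: derivable_diff1; exact: ex_derive.
  apply/smooth_uptoS; split=> [x _|v]; first by apply: derivable_diff1; exact: ex_derive.
  have -> : 'D_v G = fun x => v * p x.
    apply/funext => x; rewrite derive_diffE; last by apply: derivable_diff1; exact: ex_derive.
    have -> : 'd G x v = v * 'd G x (1 : R) by rewrite -[in LHS](mulr1 v) -[v * 1]/(v *: (1 : R)) linearZ.
    by rewrite -derive_diffE ?derive_val //; apply: derivable_diff1; exact: ex_derive.
  by apply: smooth_uptoM; [exact: openT|exact: smooth_upto_cst|exact: sp].
- by move=> t; rewrite mulr_ge0 ?invr_ge0 ?(ltW c0) //= mulrC ler_pdivrMr // mul1r.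
- move=> t tl; rewrite GE (_ : _ \_ _ = cst 0) /Rintegral ?integral0 ?mulr0 //.
  apply/funext => s; rewrite patchE; case: ifPn => //; rewrite inE /A /= in_itv /= => st; apply: pl.
  by rewrite ler_normr lerNr (le_trans st tl) orbT.
- move=> t lt; rewrite GE (_ : _ \_ _ = p) ?mulVf ?gt_eqF //.
  apply/funext => s; rewrite patchE; case: ifPn => // /negP; rewrite inE /A /= in_itv /= => /negP.
  by rewrite -ltNge => ts; rewrite pl // ler_normr (le_trans lt (ltW ts)).
Qed.

End SmoothStep.

Section Bump.
Context {R : realType}.
Local Notation P := (R * R)%type.

(** Plateau functions for boxes in the maximum norm. Their being real is what later lets [Phi_conj]
    exchange opposite frequencies. *)
Record bump (c : P) (r r' : R) (phi : P -> R[i]) : Prop := {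
  bump_smooth : smooth_on setT phi ;
  bump_real : forall x, Im (phi x) = 0 ;
  bump_01 : forall x, 0 <= Re (phi x) <= 1 ;
  bump_1 : forall x, `|x - c| <= r -> phi x = 1 ;
  bump_0 : forall x, r' <= `|x - c| -> phi x = 0 }.

Lemma closed_box (c : P) (r : R) : closed [set x : P | `|x - c| <= r].
Proof.
have cn : continuous (fun x : P => `|x - c|).
  move=> x; apply: (@continuous_comp _ _ _ (fun x : P => x - c) (fun x : P => `|x|)).
    by apply: cvgB; [exact: cvg_id|exact: cvg_cst].
  exact: norm_continuous.
exact: (closed_comp (fun x _ => cn x) (@closed_le R r)).
Qed.

(** A product of four smooth steps, one for each side of the box. *)
Lemma bump_exists (b : R -> R[i]) (y0 : R) : test_fun setT b -> b y0 != 0 ->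
  forall c r r', r < r' -> exists phi, bump c r r' phi.
Proof.
move=> tb by0 c r r' rr'; have [st [l [l0 ss s01 sl sr]]] := smooth_step tb by0.
(* [al] shrinks the transition interval [[- l, l]] of the step to length [r' - r], and [rho] centres
   it halfway between [r] and [r']. *)
pose al : R := 2 * l / (r' - r); pose rho : R := (r + r') / 2.
have d0 : 0 < r' - r by rewrite subr_gt0.
have al0 : 0 < al by rewrite divr_gt0 // mulr_gt0.
pose F (a b' : R) x := st (linform (al * a) (al * b') x + al * (rho - dot2 (a, b') c)).
have FE a b' x : F a b' x = st (al * (rho + (a * (x.1 - c.1) + b' * (x.2 - c.2)))).
  by rewrite /F /linform dot2E /=; congr st; ring.
have sF a b' n : smooth_upto n setT (F a b').
  apply: (@smooth_upto_comp _ _ _ _ st); [exact: openT|exact: ss|].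
  apply: smooth_uptoD; [exact: openT| |exact: smooth_upto_cst].
  by apply: smooth_upto_linear; [exact: continuous_linform|exact: openT].
have F1 a b' x : - (a * (x.1 - c.1) + b' * (x.2 - c.2)) <= r -> F a b' x = 1.
  move=> h; rewrite FE; apply: sr.
  have -> : l = al * ((r' - r) / 2) by rewrite /al; field; rewrite gt_eqF.
  by rewrite ler_pM2l // /rho; lra.
have F0 a b' x : r' <= - (a * (x.1 - c.1) + b' * (x.2 - c.2)) -> F a b' x = 0.
  move=> h; rewrite FE; apply: sl.
  have -> : - l = al * ((r - r') / 2) by rewrite /al; field; rewrite gt_eqF.
  by rewrite ler_pM2l // /rho; lra.
pose q x := F 1 0 x * F (-1) 0 x * (F 0 1 x * F 0 (-1) x).
exists (fun x => (q x)%:C); split => //.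
- apply: smooth_on_real => n; apply: smooth_uptoM; [exact: openT| |];
    by apply: smooth_uptoM; [exact: openT|exact: sF|exact: sF].
- move=> x /=; have /andP[a1 a2] := s01 (linform (al * 1) (al * 0) x + al * (rho - dot2 (1, 0) c)).
  have /andP[b1 b2] := s01 (linform (al * -1) (al * 0) x + al * (rho - dot2 (-1, 0) c)).
  have /andP[c1 c2] := s01 (linform (al * 0) (al * 1) x + al * (rho - dot2 (0, 1) c)).
  have /andP[d1 d2] := s01 (linform (al * 0) (al * -1) x + al * (rho - dot2 (0, -1) c)).
  by rewrite !mulr_ge0 // !mulr_ile1 // mulr_ge0.
- move=> x; rewrite norm_plane ge_max /= !ler_norml => /andP[/andP[h1 h2] /andP[h3 h4]].
  by rewrite /q !F1 ?mulr1 //; lra.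
- move=> x; rewrite norm_plane le_max /= !ler_normr -!orbA => /or4P[] h; rewrite /q.
  + by rewrite (F0 (-1) 0) ?mulr0 ?mul0r //; lra.
  + by rewrite (F0 1 0) ?mulr0 ?mul0r //; lra.
  + by rewrite (F0 0 (-1)) ?mulr0 //; lra.
  + by rewrite (F0 0 1) ?mul0r ?mulr0 //; lra.
Qed.

Variables (c : P) (r r' : R) (phi : P -> R[i]).
Hypothesis B : bump c r r' phi.

Lemma bumpE x : phi x = (Re (phi x))%:C.
Proof. by apply: complex_ext; rewrite ?(bump_real B). Qed.

Lemma bump_smooth_cpt : smooth_cpt phi.
Proof.
split; first exact: bump_smooth B.
exists (r' + `|c|) => x h; apply: (bump_0 B).
by have := ler_normB x (x - c); have := ler_normD (x - c) c; rewrite subrK; lra.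
Qed.

Lemma bump_test (U : set P) : [set x | `|x - c| <= r'] `<=` U -> test_fun U phi.
Proof.
move=> DU; apply: (@smooth_cpt_test _ _ _ [set x | `|x - c| <= r']) => //.
- exact: bump_smooth B.
- exact: closed_box.
- exists (r' + `|c|) => x /= h.
  by have := ler_normD (x - c) c; rewrite subrK; lra.
- by move=> x /negP; rewrite -ltNge => /ltW; exact: (bump_0 B).
Qed.

End Bump.

Lemma integrable_indic_fin (R : realType) (dd : measure_display) (T : measurableType dd)
  (mu : {measure set T -> \bar R}) (I : set T) : measurable I -> (mu I < +oo)%E ->
  mu.-integrable setT (EFin \o (\1_I : T -> R)).
Proof.
move=> mI fI; apply/integrableP; split; first exact/measurable_EFinP/measurable_indic.
rewrite (eq_integral (fun x => (\1_I x)%:E)) ?integral_indic ?setIT // => x _ /=.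
by rewrite ger0_norm // indicE ler0n.
Qed.

(** * The fundamental lemma of the calculus of variations *)

Section Fundamental.
Context {R : realType}.
Local Notation P := (R * R)%type.
Local Notation pl := (measurableTypeR R * measurableTypeR R)%type.
Hypothesis bumps : forall (c : P) (r r' : R), r < r' -> exists phi, bump c r r' phi.

Lemma leb2_box (c : P) (r : R) : 0 < r ->
  (@leb2 R) [set x : P | `|x - c| <= r] = ((2 * r) ^+ 2)%:E.
Proof.
move=> r0.
have -> : [set x : P | `|x - c| <= r] = `[c.1 - r, c.1 + r] `*` `[c.2 - r, c.2 + r].
  apply/seteqP; split => x /=; rewrite norm_plane ge_max /= !in_itv /= !ler_distl;
    [by move=> /andP[-> ->]|by move=> [-> ->]].
transitivity (lebesgue_measure `[(c.1 - r)%R, (c.1 + r)%R] * lebesgue_measure `[(c.2 - r)%R, (c.2 + r)%R])%E.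
  exact: (@product_measure1E _ _ _ _ R (@lebesgue_measure R) (@lebesgue_measure R) _ _
  (measurable_itv `[c.1 - r, c.1 + r]) (measurable_itv `[c.2 - r, c.2 + r])).
have E (a : R) : lebesgue_measure `[a - r, a + r]%classic = (2 * r)%:E.
  rewrite lebesgue_measure_itv /= lte_fin ifT; last by lra.
  by rewrite -EFinB; congr EFin; ring.
by rewrite !E -EFinM expr2.
Qed.

(** If [Re (D x)] were positive, integration against a bump near [x], where [Re D] exceeds half that
    value, would give a positive number. Applying this to [D0] times 1, -1, i and -i annihilates
    both parts. *)
Lemma fundamental_lemma (D0 : P -> R[i]) : Ccontinuous D0 ->
  (forall h, smooth_cpt h -> Cint leb2 setT (fun x => D0 x * h x) = 0) -> forall x, D0 x = 0.
Proof.
suff pos (D : P -> R[i]) : Ccontinuous D ->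
  (forall h, smooth_cpt h -> Cint leb2 setT (fun x => D x * h x) = 0) -> forall x, Re (D x) <= 0.
  move=> cD0 H x.
  have K (a : R[i]) : Re (a * D0 x) <= 0.
    apply: (pos (fun x => a * D0 x)) => [|h sh].
      by apply: Ccontinuous_mul => //; exact: Ccontinuous_cst.
    rewrite (_ : (fun x => _) = (fun x => D0 x * (a * h x))); last by apply/funext => y; ring.
    apply: H; rewrite (_ : (fun y => _) = (fun y => h y * a)); last by apply/funext => y; rewrite mulrC.
    by apply: smooth_cptM sh _; exact: smooth_on_cst.
  have := K 1; have := K (-1); have := K (0 +i* 1); have := K (0 -i* 1).
  rewrite !reimE /= => h1 h2 h3 h4; apply: complex_ext; apply/le_anti => /=; apply/andP; split; lra.
move=> cD0 H x; rewrite leNgt; apply/negP => Dx0; pose d := Re (D x) / 2.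
have d0 : 0 < d by rewrite divr_gt0.
have [e /= e0 He] : exists2 e : R, 0 < e & forall y, `|x - y| < e -> d < Re (D y).
  have : \forall y \near x, d < Re (D y).
    by apply: (cvgr_gt _ (cD0.1 x)); rewrite /d; lra.
  by move=> /nbhs_normP [e e0 He]; exists e => // y; exact: He.
have e24 : e / 4 < e / 2 by lra.
have e40 : 0 < e / 4 by lra.
have [phi B] := bumps x e24; have sphi := bump_smooth_cpt B.
have h0 : \int[leb2]_y Re (D y * phi y) = 0 by exact: (congr1 (fun z => Re z) (H _ sphi)).
have ic : rapid (fun y => D y * phi y).
  apply: (@cpt_rapid _ _ (e / 2 + `|x|)) => [|y yr].
    by apply: Ccontinuous_mul => //; exact: (smooth_Ccontinuous (proj1 sphi)).
  rewrite (bump_0 B) ?mulr0 //.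
  by have := ler_normD (y - x) x; rewrite subrK; lra.
have mbox : measurable ([set y : P | `|y - x| <= e / 4] : set pl).
  rewrite -[X in measurable X]setCK; apply: measurableC; apply: open_measurable_plane.
  exact: closed_openC (@closed_box _ _ _).
have iind : (@leb2 R).-integrable setT (EFin \o (\1_[set y : P | `|y - x| <= e / 4] : pl -> R)).
  by apply: (integrable_indic_fin mbox); rewrite leb2_box // ltry.
pose low (y : P) : R := d * \1_[set y : P | `|y - x| <= e / 4] y.
have ilow : (@leb2 R).-integrable setT (EFin \o (low : pl -> R)).
  exact: integrable_scale.
have : \int[leb2]_y low y <= \int[leb2]_y Re (D y * phi y).
  apply: le_Rintegral => //.
    by case: (rapid_cintable ic).
  move=> y _; rewrite (bumpE B y) reimE /= mulr0 subr0 /low indicE.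
  have /andP[b0 _] := bump_01 B y.
  case: (boolP (y \in _)) => [|_].
    rewrite inE /= => h; rewrite (bump_1 B) // !mulr1; apply: ltW; apply: He; rewrite distrC; lra.
  rewrite mulr0; case: (leP (e / 2) `|y - x|) => h; first by rewrite (bump_0 B) //= mulr0.
  by rewrite mulr_ge0 // ltW // (lt_trans d0) //; apply: He; rewrite distrC; lra.
rewrite h0 /low RintegralZl //.
rewrite /Rintegral integral_indic // setIT [X in fine X]leb2_box //=; apply/negP; rewrite -ltNge.
by rewrite mulr_gt0 // exprn_gt0 // mulr_gt0.
Qed.

End Fundamental.

(** * Shearlets as Fourier integrals *)

Section Generator.
Context {R : realType}.
Local Notation P := (R * R)%type.
Variables (psi1 psi1h psi2 psi2h : R -> R[i]) (psi : P -> R[i]).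
Hypothesis hpsi : shearlet_generator psi1 psi1h psi2 psi2h psi.

Definition psihat (xi : P) : R[i] := psi1h xi.1 * psi2h (xi.2 / xi.1).

Lemma psi1h_supp a : psi1h a != 0 -> 2^-1 <= `|a| <= 2.
Proof.
move=> h; have /(sg_psi1h_supp hpsi) := @subset_closure _ [set x | psi1h x != 0] a h.
move=> [] /=; rewrite in_itv /= => /andP[h1 h2].
  by rewrite ler0_norm; [rewrite lerNr h2 lerNl h1|rewrite (le_trans h2) // oppr_le0 invr_ge0].
by rewrite ger0_norm ?h1 ?h2 // (le_trans _ h1) // invr_ge0.
Qed.

Lemma psi2h_supp b : psi2h b != 0 -> `|b| <= 1.
Proof.
move=> h; have /(sg_psi2h_supp hpsi) := @subset_closure _ [set x | psi2h x != 0] b h.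
by rewrite /= in_itv /= ler_norml.
Qed.

Lemma psihat_supp xi : psihat xi != 0 -> [/\ 2^-1 <= `|xi.1|, `|xi.1| <= 2 & `|xi.2| <= `|xi.1|].
Proof.
rewrite /psihat mulf_eq0 negb_or => /andP[/psi1h_supp /andP[a1 a2] /psi2h_supp b1]; split => //.
have x0 : 0 < `|xi.1| by rewrite (lt_le_trans _ a1) // invr_gt0.
by move: b1; rewrite normrM normfV ler_pdivrMr // mul1r.
Qed.

Lemma psi2h_neq0 : exists y, psi2h y != 0.
Proof.
apply: contrapT => /forallNP H.
have := sg_psi2h_norm hpsi; rewrite (_ : (fun x => _) = cst 0%E); last first.
  by apply/funext => x; have /negP := H x; rewrite negbK => /eqP ->; rewrite cabs0.
by rewrite Lnorm0 => // /eqP; rewrite lt_eqF.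
Qed.

(** The normalization on each half-line forces a nonzero value there, so that frequencies on either
    side of the axis can be reached. *)
Lemma psi1h_neq0_pos : exists2 a, 0 < a & psi1h a != 0.
Proof.
apply: contrapT => H.
have := sg_psi1h_pos hpsi; rewrite (eq_integral (cst 0%E)); last first.
  move=> x; rewrite inE /= in_itv /= andbT => x0.
  have /eqP -> : psi1h x == 0 by apply: contraT => h; exfalso; apply: H; exists x.
  by rewrite cabs0 expr0n mul0r.
by rewrite integral0 => /eqP; rewrite lt_eqF.
Qed.

Lemma psi1h_neq0_neg : exists2 a, 0 < a & psi1h (- a) != 0.
Proof.
apply: contrapT => H.
have := sg_psi1h_neg hpsi; rewrite (eq_integral (cst 0%E)); last first.
  move=> x; rewrite inE /= in_itv /= andbT => x0.
  have /eqP -> : psi1h (- x) == 0 by apply: contraT => h; exfalso; apply: H; exists x.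
  by rewrite cabs0 expr0n mul0r.
by rewrite integral0 => /eqP; rewrite lt_eqF.
Qed.

Lemma generator_bumps (c : P) r r' : r < r' -> exists phi, bump c r r' phi.
Proof.
by move=> rr'; have [y0 h] := psi2h_neq0; exact: (bump_exists (sg_psi2h_test hpsi) h).
Qed.

(** Glued from two open sets: where [x.1] is nonzero the quotient is smooth, and for [|x.1| < 1 / 2]
    the function vanishes. *)
Lemma smooth_cpt_psihat : smooth_cpt psihat.
Proof.
split; last first.
  exists 2 => x; rewrite norm_plane => h; apply/eqP; apply: contraTT h => /psihat_supp[h1 h2 h3].
  by rewrite -leNgt ge_max h2 (le_trans h3).
pose U1 := [set x : P | x.1 != 0]; pose U2 := [set x : P | `|x.1| < 2^-1].
have oU1 : open U1.
  have -> : U1 = (fun x : P => x.1) @^-1` [set t : R | t != 0] by [].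
  by apply: open_comp; [move=> x _; exact: continuous_fst2|exact: open_neq].
have oU2 : open U2.
  have -> : U2 = (fun x : P => `|x.1|) @^-1` [set t : R | t < 2^-1] by [].
  apply: open_comp; last exact: open_lt.
  move=> x _; apply: (@continuous_comp _ _ _ (fun x : P => x.1) (fun t : R => `|t|)); first exact: continuous_fst2.
  exact: norm_continuous.
have S1 : smooth_on U1 psihat.
  have sl (a b : R) n : smooth_upto n U1 (linform a b : P -> R).
    by apply: smooth_upto_linear => //; exact: continuous_linform.
  apply: smooth_onM => //.
    apply: (smooth_on_comp (g := psi1h) (q := fun x => x.1)) => //.
      by case: (sg_psi1h_test hpsi).
    move=> n; apply: (eq_smooth_upto oU1 _ (sl 1 0 n)) => x _.
    by rewrite /linform mulr1 mulr0 addr0.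
  apply: (@smooth_on_comp _ _ U1 psi2h (fun x : P => x.2 / x.1)) => //.
    by case: (sg_psi2h_test hpsi).
  move=> n; apply: smooth_uptoM => //.
    apply: (eq_smooth_upto oU1 _ (sl 0 1 n)) => x _.
    by rewrite /linform mulr1 mulr0 add0r.
  apply: smooth_uptoV => //; apply: (eq_smooth_upto oU1 _ (sl 1 0 n)) => x _.
  by rewrite /linform mulr1 mulr0 addr0.
have S2 : smooth_on U2 psihat.
  apply: (eq_smooth_on oU2 (g := fun=> 0)); last exact: smooth_on_cst.
  move=> x; rewrite /U2 /= => h; apply/esym/eqP; apply: contraTT h => /psihat_supp[h1 _ _].
  by rewrite -leNgt.
move=> w x _; have [x0|x0] := eqVneq x.1 0; last exact: S1.
by apply: S2; rewrite /U2 /= x0 normr0 invr_gt0.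
Qed.

(** The hypothesis on the transform of [psi], tested on [IFT h], equates the integrals of [psi * h]
    and [psihat * IFT h]; Parseval moves the inverse transform to [psihat]. Both sides being
    continuous, the equality is pointwise. *)
Lemma psiE x : psi x = IFT psihat x.
Proof.
have sp := smooth_cpt_psihat; have rI := IFT_rapid sp.
have smI : smooth_on setT (IFT psihat) by case: (IFT_schwartz sp).
have cD0 : Ccontinuous (fun x => psi x - IFT psihat x).
  have [c1 c2] := sg_psi_continuous hpsi; have [d1 d2] := smooth_Ccontinuous smI.
  split => y.
    rewrite (_ : (fun x => _) = (fun x => Re (psi x) - Re (IFT psihat x))); last by apply/funext => z; rewrite reimE.
    by apply: cvgB; [exact: c1|exact: d1].
  rewrite (_ : (fun x => _) = (fun x => Im (psi x) - Im (IFT psihat x))); last by apply/funext => z; rewrite reimE.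
  by apply: cvgB; [exact: c2|exact: d2].
apply/eqP; rewrite -subr_eq0; apply/eqP; move: x.
apply: (fundamental_lemma generator_bumps cD0) => h sh.
have rh := smooth_cpt_rapid sh.
have := sg_psi_fourier hpsi (IFT_schwartz sh).
rewrite -[fourier leb2 dot2 _]/(FT (IFT h)) (_ : FT (IFT h) = h); last by apply/funext => y; exact: FT_IFT.
rewrite -/psihat => E.
have E2 : Cint leb2 setT (fun x => psihat x * IFT h x) = Cint leb2 setT (fun x => h x * IFT psihat x).
  have E2 := parsevalJ (smooth_cptJ sp) (rapidJ rh).
  transitivity (Cint leb2 setT (fun x => ((psihat x)^* * FT (fun x0 => (h x0)^*) x)^*)).
    by congr Cint; apply/funext => y; rewrite conjcM conjc_invol.
  by rewrite E2; congr Cint; apply/funext => y; rewrite conjcM conjc_invol.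
rewrite (_ : (fun x => _) = (fun x => psi x * h x - h x * IFT psihat x)); last by apply/funext => y; ring.
rewrite CintB; first by rewrite E E2 subrr.
  have [sh1 [r r0]] := sh; apply: rapid_cintable; apply: (@cpt_rapid _ _ r) => [|y /r0 ->]; last by rewrite mulr0.
  by apply: Ccontinuous_mul; [exact: (sg_psi_continuous hpsi)|exact: smooth_Ccontinuous].
exact: (rapid_cintable (rapid_pgrowth rh (pgrowth_rapid rI))).
Qed.

End Generator.

Lemma powR_add (R : realType) (a x y : R) : 0 < a -> a `^ (x + y) = a `^ x * a `^ y.
Proof. by move=> a0; rewrite powRD // (gt_eqF a0) implybT. Qed.

(** * The matrices of the shearlet transforms *)

Section Lin2.
Context {R : realType}.
Local Notation P := (R * R)%type.

Definition lin2 (p q r s : R) (x : P) : P := (p * x.1 + q * x.2, r * x.1 + s * x.2).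

Lemma lin2_linear p q r s : linear (lin2 p q r s).
Proof.
move=> a [x1 x2] [y1 y2]; rewrite /lin2 /=.
rewrite -[a *: (_, _)]/(a * (p * x1 + q * x2), a * (r * x1 + s * x2)) -[(_, _) + (_, _) in RHS]/(_ + _, _ + _).
by congr (_, _); rewrite /= /GRing.scale /=; ring.
Qed.

HB.instance Definition _ p q r s := GRing.isLinear.Build R P P _ (lin2 p q r s) (lin2_linear p q r s).

Lemma continuous_lin2 p q r s : continuous (lin2 p q r s).
Proof.
move=> x; apply: (@cvg_pair _ _ _ _ (nbhs (p * x.1 + q * x.2)) (nbhs (r * x.1 + s * x.2))).
  by apply: cvgD; apply: cvgM; try exact: cvg_cst; [exact: continuous_fst2|exact: continuous_snd2].
by apply: cvgD; apply: cvgM; try exact: cvg_cst; [exact: continuous_fst2|exact: continuous_snd2].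
Qed.

Lemma lin2_norm p q r s x : `|lin2 p q r s x| <= (`|p| + `|q| + `|r| + `|s|) * `|x|.
Proof.
have h (a c : R) (y : P) : `|a * y.1 + c * y.2| <= (`|a| + `|c|) * `|y|.
  rewrite (le_trans (ler_normD _ _)) // !normrM mulrDl lerD // ler_wpM2l //; [exact: norm_fst|exact: norm_snd].
rewrite norm_plane ge_max /=; apply/andP; split; apply: le_trans (h _ _ _) _;
  rewrite ler_wpM2r //.
  by rewrite -!addrA lerD2l lerDl addr_ge0.
by rewrite -addrA lerDr addr_ge0.
Qed.

(** One boolean carries the horizontal and vertical cases through every later argument. *)
Definition jb (b : bool) (x : P) : P := if b then Jswap x else x.

Lemma jbK b : involutive (jb b).
Proof. by case: b => -[]. Qed.

Lemma jb_norm b x : `|jb b x| = `|x|.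
Proof. by case: b => //; rewrite !norm_plane /= maxC. Qed.

Lemma dot2_jb b x y : dot2 (jb b x) y = dot2 x (jb b y).
Proof. by case: b => //; rewrite !dot2E /=; ring. Qed.

Lemma jbB b x y : jb b (x - y) = jb b x - jb b y.
Proof. by case: b. Qed.

(* The transpose of [Mas a s], precomposed with the coordinate swap if [b]. *)
Definition MT (b : bool) (a s : R) : P -> P :=
  if b then lin2 0 a (Num.sqrt a) (- (Num.sqrt a * s)) else lin2 a 0 (- (Num.sqrt a * s)) (Num.sqrt a).

Lemma MTE b a s x : MT b a s x = (a * (jb b x).1, Num.sqrt a * ((jb b x).2 - s * (jb b x).1)).
Proof. by rewrite /MT /jb; case: b; rewrite /lin2 /=; congr (_, _); ring. Qed.

(** The map inside [psi_ast] and [psi_ast_v], that is, the inverse of [Mas a s] after the optional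
    swap; [MT] is its inverse transpose. *)
Definition Minv (b : bool) (a s : R) : P -> P :=
  if b then lin2 (s / a) a^-1 (Num.sqrt a)^-1 0 else lin2 a^-1 (s / a) 0 (Num.sqrt a)^-1.

Lemma MinvE b a s x : Minv b a s x = (((jb b x).1 + s * (jb b x).2) / a, (jb b x).2 / Num.sqrt a).
Proof. by rewrite /Minv /jb; case: b; rewrite /lin2 /=; congr (_, _); ring. Qed.

Lemma dot2_MT b a s x y : 0 < a -> dot2 (MT b a s x) (Minv b a s y) = dot2 x y.
Proof.
move=> a0; have sa : Num.sqrt a != 0 by rewrite gt_eqF // sqrtr_gt0.
rewrite MTE MinvE -[x in RHS](jbK b) dot2_jb !dot2E /=; field; by rewrite sa gt_eqF.
Qed.

Lemma continuous_MT b a s : continuous (MT b a s).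
Proof. by rewrite /MT; case: b; exact: continuous_lin2. Qed.

Lemma mxapp_Mas a s (x : P) : 0 < a -> mxapp (invmx (Mas a s)) x = Minv false a s x.
Proof.
move=> a0; have sa0 : 0 < Num.sqrt a by rewrite sqrtr_gt0.
pose c : 'cV[R]_2 := \col_(i < 2) if i == 0 then x.1 else x.2.
pose v : 'cV[R]_2 := \col_(i < 2) if i == 0 then (Minv false a s x).1 else (Minv false a s x).2.
have Mv : Mas a s *m v = c.
  apply/matrixP => i j; rewrite !mxE !big_ord_recl big_ord0 !mxE MinvE /= addr0.
  case: i => [[|[|i]] hi] //=; field; by rewrite ?(gt_eqF sa0) gt_eqF.
have uM : Mas a s \in unitmx.
  rewrite unitmxE (expand_det_row _ 0) !big_ord_recl big_ord0 /cofactor !det_mx11 !mxE /=.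
  by rewrite !(mul0r, mulr0, addr0) /= unitfE mulf_neq0 ?gt_eqF // !mul1r ?addr0.
rewrite /mxapp -/c -Mv mulmxA mulVmx // mul1mx !mxE /=.
by rewrite /Minv /lin2.
Qed.

Local Notation pl := (measurableTypeR R * measurableTypeR R)%type.

Lemma Cint_MT b a s (g : P -> R[i]) : 0 < a -> cintable leb2 (g : pl -> R[i]) ->
  cintable leb2 ((fun x => g (MT b a s x)) : pl -> R[i]) /\
  Cint leb2 setT g = (a * Num.sqrt a)%:C * Cint leb2 setT (fun x => g (MT b a s x)).
Proof.
move=> a0 ig; have sa0 : 0 < Num.sqrt a by rewrite sqrtr_gt0.
have an0 : a != 0 by rewrite gt_eqF.
have sn0 : Num.sqrt a != 0 by rewrite gt_eqF.
have p0 : 0 < `|a| * `|Num.sqrt a| by rewrite mulr_gt0 ?normr_gt0.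
have S := (@ge0_integral_affine2 R a (Num.sqrt a) 0 0 (- (Num.sqrt a * s)) an0 sn0).
have M := (@measurable_affine2 R a (Num.sqrt a) 0 0 (- (Num.sqrt a * s))).
have e x : affine2 a (Num.sqrt a) 0 0 (- (Num.sqrt a * s)) x = MT false a s x.
  by rewrite MTE /affine2 /=; congr (_, _); ring.
have E : (fun x => g (affine2 a (Num.sqrt a) 0 0 (- (Num.sqrt a * s)) x)) = (fun x => g (MT false a s x)).
  by apply/funext => x; rewrite e.
have I1 : cintable leb2 ((fun x => g (MT false a s x)) : pl -> R[i]).
  by rewrite -E; exact: (cintable_subst p0 M S ig).
have C1 : Cint leb2 setT g = (a * Num.sqrt a)%:C * Cint leb2 setT (fun x => g (MT false a s x)).
  by rewrite (Cint_subst p0 M S ig) E !gtr0_norm.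
case: b; last by [].
have e2 : (fun x : P => g (MT false a s (Jswap x))) = (fun x => g (MT true a s x)).
  by apply/funext => x; rewrite !MTE.
rewrite -e2; split.
  exact: (cintable_subst ltr01 (@measurable_Jswap R) (@ge0_integral_swap R) I1).
by rewrite C1 (Cint_subst ltr01 (@measurable_Jswap R) (@ge0_integral_swap R) I1) mul1r.
Qed.

End Lin2.

(** * Frequency kernels of the two transforms *)

Section Kast.
Context {R : realType}.
Local Notation P := (R * R)%type.
Local Notation pl := (measurableTypeR R * measurableTypeR R)%type.
Variables (psi1 psi1h psi2 psi2h : R -> R[i]) (psi : P -> R[i]).
Hypothesis hpsi : shearlet_generator psi1 psi1h psi2 psi2h psi.
Local Notation psihat := (psihat psi1h psi2h).

Definition hpsihat (xi : P) : R[i] := (psihat xi)^*.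

(* [b] selects the vertical transform; [FT (Kast b a s t)] is the complex conjugate of the shearlet. *)
Definition Kast b a s t (z : P) : R[i] :=
  (a `^ (3 / 4))%:C * (hpsihat (MT b a s z) * (ew t z)^*).

Definition SHb (b : bool) : functional R -> R -> R -> P -> R[i] := if b then SHv psi else SH psi.

Lemma smooth_cpt_hpsihat : smooth_cpt hpsihat.
Proof. exact: smooth_cptJ (smooth_cpt_psihat hpsi). Qed.

Lemma smooth_ewJ (t : P) : smooth_on setT (fun z => (ew t z)^*).
Proof. by apply: smooth_onJ; [exact: openT|case: (smooth_ew t)]. Qed.

Lemma hpsihat_supp z : hpsihat z != 0 -> [/\ 2^-1 <= `|z.1|, `|z.1| <= 2 & `|z.2| <= `|z.1|].
Proof.
rewrite /hpsihat => h; apply: (psihat_supp hpsi); apply: contraNneq h => ->.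
by rewrite conjc0.
Qed.

Lemma smooth_cpt_Kast b a s t : 0 < a -> smooth_cpt (Kast b a s t).
Proof.
move=> a0; have sa0 : 0 < Num.sqrt a by rewrite sqrtr_gt0.
have [sh _] := smooth_cpt_hpsihat.
split.
  apply: smooth_onM; [exact: openT|exact: smooth_on_cst|].
  apply: smooth_onM; [exact: openT| |exact: smooth_ewJ].
  rewrite (_ : (fun z => _) = (fun z => hpsihat (MT b a s z + 0))); last by apply/funext => z; rewrite addr0.
  by rewrite /MT; case: b; apply: smooth_comp_affine => //; exact: continuous_lin2.
exists (2 / a + (2 / Num.sqrt a + `|s| * (2 / a))) => z zr.
suff /eqP E : hpsihat (MT b a s z) == 0 by rewrite /Kast E mul0r mulr0.
apply: contraTT zr => /hpsihat_supp[_ +]; rewrite MTE /= -leNgt => h1 h2.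
have u1 : `|(jb b z).1| <= 2 / a.
  by rewrite ler_pdivlMr // mulrC -[X in X * _](gtr0_norm a0) -normrM.
have u2 : `|(jb b z).2 - s * (jb b z).1| <= 2 / Num.sqrt a.
  rewrite ler_pdivlMr // mulrC -[X in X * _](gtr0_norm sa0) -normrM.
  exact: le_trans h2 h1.
have u3 : `|(jb b z).2| <= 2 / Num.sqrt a + `|s| * (2 / a).
  rewrite -[(jb b z).2](subrK (s * (jb b z).1)) (le_trans (ler_normD _ _)) // lerD // normrM.
  by rewrite ler_wpM2l.
have p1 : 0 <= 2 / a by rewrite divr_ge0 // ltW.
have p2 : 0 <= 2 / Num.sqrt a + `|s| * (2 / a) by apply: addr_ge0; [apply: divr_ge0 => //; exact: ltW|apply: mulr_ge0].
by rewrite -(jb_norm b) norm_plane ge_max; apply/andP; split; [rewrite (le_trans u1) ?lerDl|rewrite (le_trans u3) ?lerDr].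
Qed.

(** The substitution [MT] has determinant [a ^ (3 / 2)], which turns the normalization
    [a ^ (- 3 / 4)] of the shearlet into the factor [a ^ (3 / 4)] of [Kast]. *)
Lemma FT_Kast b a s t x : 0 < a ->
  FT (Kast b a s t) x = (a `^ (- (3 / 4)))%:C * FT hpsihat (Minv b a s (x - t)).
Proof.
move=> a0; have sa0 : 0 < Num.sqrt a by rewrite sqrtr_gt0.
have rh := smooth_cpt_rapid smooth_cpt_hpsihat.
have i1 := cintable_FT (Minv b a s (x - t)) rh.
have [i2 E] := Cint_MT b s a0 i1.
rewrite FTE [FT hpsihat _]FTE E mulrA -rmorphM.
have -> : a `^ (- (3 / 4)) * (a * Num.sqrt a) = a `^ (3 / 4).
  transitivity (a `^ (- (3 / 4)) * (a `^ 1 * a `^ (2^-1))).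
    by rewrite (powRr1 (ltW a0)) (powR12_sqrt (ltW a0)).
  by rewrite -!powR_add //; congr (_ `^ _); field.
rewrite -CintZ //; congr Cint; apply/funext => z.
rewrite /Kast -!mulrA; congr (_ * (_ * _)).
rewrite -ewN -[RHS]/(expi _) dot2_MT // ewC -/(ew z (x - t)) ewDr mulrC; congr (_ * _).
by rewrite ewC ewN ewN ewC.
Qed.

(** The pairing conjugates the shearlet, and the conjugate of [psi] is [FT hpsihat] by [psiE]. *)
Lemma SHbE b u a s t : 0 < a -> SHb b u a s t = u (FT (Kast b a s t)).
Proof.
move=> a0.
have K y : (psi y)^* = FT hpsihat y by rewrite (psiE hpsi) /IFT conjc_invol.
rewrite /SHb; case: b; rewrite /SHv /SH /pairing; congr u; apply/funext => x;
  rewrite FT_Kast // /psi_ast_v /psi_ast conjcM conjc_real mxapp_Mas // K.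
  by congr (_ * FT _ _); rewrite !MinvE.
by [].
Qed.

End Kast.

(** * Localization of distributions and of their shearlet transforms *)

Section BasisWords.
Context {R : realType}.
Local Notation P := (R * R)%type.
Implicit Types (g h chi : P -> R[i]) (w : seq P).

Definition basis_word w := all (fun v => (v == (1, 0)) || (v == (0, 1))) w.

Lemma linear_basis (l : {linear P -> R}) (v : P) : l v = v.1 * l (1, 0) + v.2 * l (0, 1).
Proof.
have {1}-> : v = v.1 *: (1, 0) + v.2 *: (0, 1).
  by case: v => v1 v2; congr (_, _); rewrite /= /GRing.scale /=; ring.
by rewrite linearD !linearZ.
Qed.

Lemma cD_basis v g : smooth_on setT g ->
  cD v g = (fun x => v.1%:C * cD ((1, 0) : P) g x + v.2%:C * cD ((0, 1) : P) g x).
Proof.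
move=> sg; apply/funext => x; have [d1 d2] := smooth_on_diff sg (I : setT x).
have E (h : P -> R) : differentiable h x -> 'D_v h x = v.1 * 'D_((1, 0) : P) h x + v.2 * 'D_((0, 1) : P) h x.
  by move=> dh; rewrite !derive_diffE //; exact: linear_basis.
have [E1 E2] := (E _ d1, E _ d2).
have F (c r i : R) : c%:C * (r +i* i) = (c * r) +i* (c * i) by rewrite -[LHS]/(_ +i* _) !mul0r subr0 addr0.
by rewrite /cD /cdirD /= !F E1 E2.
Qed.

(** Each direction of norm at most 1 is expanded in the two basis vectors with coefficients at most
    1, at the cost of a factor 2 per derivative. *)
Lemma derbound_basis n g x (B : R) : smooth_on setT g -> 0 <= B ->
  (forall w, (size w <= n)%N -> basis_word w -> cabs (cdirD w g x) <= B) ->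
  derbound n g x (2 ^+ n * B).
Proof.
move=> sg B0 H w sw uw.
have : cabs (cdirD w g x) <= 2 ^+ size w * B.
  elim/last_ind: w n g sg H sw uw => [|w v IH] n g sg H sw uw.
    by rewrite expr0 mul1r; exact: H.
  have [v1 uw'] : `|v| <= 1 /\ unit_word w by move: uw; rewrite /unit_word all_rcons => /andP.
  rewrite size_rcons in sw.
  have sD e : smooth_on setT (cD e g) by exact: smooth_cD.
  have bD (e : P) : (e == (1, 0)) || (e == (0, 1)) -> cabs (cdirD w (cD e g) x) <= 2 ^+ size w * B.
    move=> he; apply: (IH n.-1) => //; last by case: (n) sw.
    move=> w' sw' bw'; rewrite -cdirD_rcons; apply: H; last by rewrite /basis_word all_rcons he.
    by rewrite size_rcons; case: (n) sw sw'.
  rewrite cdirD_rcons cD_basis // cdirDD; [|by apply: smooth_onM; [exact: openT|exact: smooth_on_cst|exact: sD]..].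
  rewrite !cdirDZ // (le_trans (cabsD _ _)) // size_rcons exprS -mulrA mulr2n mulrDl mul1r.
  have c1 (c : R) (z : R[i]) : `|c| <= 1 -> cabs (c%:C * z) <= cabs z.
    by move=> c1; rewrite cabsM cabs_real ler_piMl ?cabs_ge0.
  apply: lerD; (apply: le_trans (c1 _ _ _) _; [apply: le_trans v1; by [exact: norm_fst|exact: norm_snd]|apply: bD; by rewrite eqxx ?orbT]).
move=> /le_trans; apply; rewrite ler_wpM2r //; apply: ler_weXn2l => //; exact: ler1n.
Qed.

(** [schwartz] gives a constant for each single word; words in the two basis vectors of bounded
    length are finite in number, which makes the constant uniform. *)
Lemma basis_words_bound (F : seq P -> P -> R) n :
  (forall w, basis_word w -> exists C : R, forall x, F w x <= C) ->
  exists C : R, 0 <= C /\ forall w, (size w <= n)%N -> basis_word w -> forall x, F w x <= C.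
Proof.
elim: n F => [|n IH] F H.
  have [C HC] := H [::] isT; exists (Num.max 0 C); rewrite le_max lexx; split => // -[|//] _ _ x.
  by rewrite le_max HC orbT.
have [C0 H0] := H [::] isT.
have K (v : P) : (v == (1, 0)) || (v == (0, 1)) -> forall w, basis_word w -> exists C : R, forall x, F (v :: w) x <= C.
  by move=> hv w bw; apply: H; rewrite /basis_word /= hv.
have [C1 [C10 H1]] := IH (fun w => F ((1, 0) :: w)) (K (1, 0) (introT orP (or_introl (eqxx _)))).
have [C2 [C20 H2]] := IH (fun w => F ((0, 1) :: w)) (K (0, 1) (introT orP (or_intror (eqxx _)))).
exists (Num.max C0 (Num.max C1 C2)); split; first by rewrite !le_max C10 orbT.
case=> [_ _ x|v w]; first by rewrite le_max H0.
rewrite /= ltnS => sw /andP[/orP[/eqP ->|/eqP ->] bw] x; rewrite !le_max.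
  by rewrite H1 ?orbT.
by rewrite H2 ?orbT.
Qed.

Lemma schwartz_derbound g : schwartz g -> forall n L, exists C : R, 0 <= C /\
  forall x, derbound n g x (C / (1 + `|x|) ^+ L).
Proof.
move=> [sg H] n L.
have [C [C0 HC]] := @basis_words_bound (fun w x => (1 + `|x|) ^+ L * cabs (cdirD w g x)) n (fun w _ => H L w).
exists (2 ^+ n * C); split; first by rewrite mulr_ge0 ?exprn_ge0.
move=> x; have p0 : 0 < (1 + `|x|) ^+ L by rewrite exprn_gt0 ?jnorm_gt0.
rewrite -mulrA; apply: derbound_basis => //; first by rewrite divr_ge0 // ltW.
by move=> w sw bw; rewrite ler_pdivlMr // mulrC; exact: HC.
Qed.

Lemma derbound_schwartz g : smooth_on setT g ->
  (forall n L, exists C : R, 0 <= C /\ forall x, derbound n g x (C / (1 + `|x|) ^+ L)) -> schwartz g.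
Proof.
move=> sg H; split => // L w; have [C [C0 HC]] := H (size w) L.
pose K : R := 1 + \sum_(v <- w) `|v|.
have K0 : 0 < K by rewrite ltr_pwDl // sumr_ge0.
have wK : all (fun v => `|v| <= K) w.
  apply/allP => v vw; rewrite /K (big_rem v) //= addrA addrAC lerDr addr_ge0 // sumr_ge0 //.
exists (K ^+ size w * C) => x; have p0 : 0 < (1 + `|x|) ^+ L by rewrite exprn_gt0 ?jnorm_gt0.
have := derbound_dirD sg openT (I : setT x) K0 (HC x) (leqnn _) wK.
by rewrite mulrA ler_pdivlMr // mulrC.
Qed.

(** The class of multipliers of Schwartz functions used below: it contains [1 - chi] for a cut-off
    [chi], which has no compact support. *)
Definition bounded_derivs g := smooth_on setT g /\
  forall n, exists A : R, 0 <= A /\ forall x, derbound n g x A.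

Lemma smooth_cpt_bounded g : smooth_cpt g -> bounded_derivs g.
Proof.
move=> sg; split; first by case: sg.
move=> n; have [C [C0 H]] := schwartz_derbound (smooth_cpt_schwartz sg) n 0.
by exists C; split => // x; have := H x; rewrite expr0 divr1.
Qed.

Lemma derbound_cst n (c : R[i]) (x : P) : derbound n (fun=> c) x (cabs c).
Proof.
move=> w _ _; case/lastP: w => [|w v]; first by rewrite cdirD_nil.
by rewrite cdirD_rcons cD_cst cdirD_zero cabs0 cabs_ge0.
Qed.

Lemma bounded_derivs_1B g : bounded_derivs g -> bounded_derivs (fun x => 1 - g x).
Proof.
move=> [sg H]; have sN : smooth_on setT (fun x => (- 1) * g x).
  by apply: smooth_onM; [exact: openT|exact: smooth_on_cst|].
have E : (fun x => 1 - g x) = (fun x => (fun=> 1) x + (fun x => (- 1) * g x) x).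
  by apply/funext => x; rewrite mulN1r.
rewrite E; split; first by apply: smooth_onD; [exact: openT|exact: smooth_on_cst|].
move=> n; have [A [A0 HA]] := H n; exists (1 + A); split; first by rewrite addr_ge0.
move=> x w sw uw; rewrite cdirDD //; last exact: smooth_on_cst.
rewrite (le_trans (cabsD _ _)) // lerD //.
  by rewrite -[leRHS]cabs1; exact: derbound_cst.
by rewrite cdirDZ // cabsM cabsN cabs1 mul1r; exact: HA.
Qed.

Lemma schwartzM chi g : bounded_derivs chi -> schwartz g -> schwartz (fun x => chi x * g x).
Proof.
move=> [sc Hc] Sg; have sg := proj1 Sg.
apply: derbound_schwartz; first exact: smooth_onM openT _ _.
move=> n L; have [A [A0 HA]] := Hc n; have [C [C0 HC]] := schwartz_derbound Sg n L.
exists (2 ^+ n * (A * C)); split; first by rewrite !mulr_ge0 // exprn_ge0.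
move=> x; have := derboundM openT sc sg (I : setT x) (HA x) (HC x).
by rewrite !mulrA.
Qed.

Lemma enorm_le (x : P) : enorm x <= 2 * `|x|.
Proof.
rewrite /enorm -[leRHS]ger0_norm ?mulr_ge0 // -sqrtr_sqr ler_sqrt ?sqr_ge0 //.
have h1 := norm_fst x; have h2 := norm_snd x.
have q (y : R) : `|y| <= `|x| -> y * y <= `|x| ^+ 2.
  by move=> h; rewrite -expr2 -[y ^+ 2]ger0_norm ?sqr_ge0 // normrX lerXn2r ?nnegrE.
rewrite dot2E exprMn; have := q _ h1; have := q _ h2; have := sqr_ge0 `|x|; lra.
Qed.

(** Temperedness with explicit order and constant, in the maximum norm and over all words of unit
    vectors; common to tempered extensions of [f] and to the products [phi f]. *)
Record wtempered (u : functional R) (N : nat) (C : R) : Prop := {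
  wt_linear : linear_on (@schwartz R _) u ;
  wt_ge0 : 0 <= C ;
  wt_bound : forall eta B, schwartz eta ->
    (forall x w, (size w <= N)%N -> unit_word w -> (1 + `|x|) ^+ N * cabs (cdirD w eta x) <= B) ->
    cabs (u eta) <= C * B }.

Lemma unit_pderiv i j : unit_word (nseq i ((1, 0) : P) ++ nseq j ((0, 1) : P)).
Proof.
have u1 : `|(1, 0) : P| <= 1 by rewrite norm_plane ge_max /= normr1 normr0 lexx ler01.
have u2 : `|(0, 1) : P| <= 1 by rewrite norm_plane ge_max /= normr1 normr0 lexx ler01.
by rewrite /unit_word all_cat !all_nseq u1 u2 !orbT.
Qed.

Lemma tempered_wtempered u : tempered u -> exists N C, wtempered u N C.
Proof.
move=> [lu [C [N [C0 H]]]]; exists N, (C * 2 ^+ N); split => //.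
  by rewrite mulr_ge0 ?exprn_ge0.
move=> eta B Se HB; rewrite -mulrA; apply: H => // i j x ij.
have -> : 2 ^+ N * B = 2 ^+ N * B by [].
apply: (@le_trans _ _ (2 ^+ N * ((1 + `|x|) ^+ N * cabs (pderiv i j eta x)))).
  rewrite mulrA -exprMn ler_wpM2r ?cabs_ge0 // lerXn2r ?nnegrE ?addr_ge0 ?mulr_ge0 ?sqrtr_ge0 //.
  by rewrite mulrDr mulr1 lerD ?enorm_le // ler1n.
rewrite ler_wpM2l ?exprn_ge0 //; apply: HB; last exact: unit_pderiv.
by rewrite size_cat !size_nseq.
Qed.

End BasisWords.

(** * Localized distributions and their Fourier transforms *)

Section Distribution.
Context {R : realType}.
Local Notation P := (R * R)%type.
Variables (Omega : set P) (f : functional R).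
Hypothesis Omega_open : open Omega.
Hypothesis f_dist : is_distribution Omega f.

Lemma test_funM phi eta : test_fun Omega phi -> smooth_on setT eta ->
  test_fun Omega (fun x => phi x * eta x) /\
  support_of (fun x => phi x * eta x) `<=` support_of phi.
Proof.
move=> [sphi cphi phiO] seta.
have sub : support_of (fun x => phi x * eta x) `<=` support_of phi.
  by apply: closure_subset => x /=; apply: contraNneq => ->; rewrite mul0r.
split => //; split; first exact: smooth_onM openT _ _.
  by apply: subclosed_compact cphi sub; exact: closed_closure.
by move=> x /sub /phiO.
Qed.

Lemma cdirD_off_support (g : P -> R[i]) w x : ~ support_of g x -> cdirD w g x = 0.
Proof.
move=> nx; pose U := ~` support_of g.
have oU : open U by apply: closed_openC; exact: closed_closure.
have g0 y : U y -> g y = (fun=> 0 : R[i]) y.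
  by move=> Uy; apply/eqP; apply: contraT => gy; exfalso; apply: Uy; exact: subset_closure.
by rewrite (eq_cdirD_on w oU g0 nx) cdirD_zero.
Qed.

Lemma dist_bound phi : test_fun Omega phi -> exists N C, 0 <= C /\
  forall eta B, smooth_on setT eta -> 0 <= B ->
    (forall x, support_of phi x -> derbound N eta x B) -> cabs (f (fun x => phi x * eta x)) <= C * B.
Proof.
move=> tphi; have [sphi cphi phiO] := tphi.
have [C [N [C0 H]]] := f_dist.2 _ cphi phiO.
have [_ /(_ N) [A [A0 HA]]] := smooth_cpt_bounded (test_smooth_cpt tphi).
exists N, (C * (2 ^+ N * A)); split; first by rewrite !mulr_ge0 ?exprn_ge0.
move=> eta B seta B0 HB; have [t1 t2] := test_funM tphi seta.
rewrite -mulrA; apply: H => // i j x ij.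
have [sx|nx] := pselect (support_of phi x); last first.
  rewrite /pderiv cdirD_off_support ?cabs0 ?mulr_ge0 ?exprn_ge0 //.
  by move=> /t2.
rewrite -mulrA; apply: (derboundM openT sphi seta (I : setT x) (HA x) (HB x sx)).
  by rewrite size_cat !size_nseq.
exact: unit_pderiv.
Qed.

Lemma mul_dist_linear phi c eta zeta : test_fun Omega phi -> smooth_on setT eta -> smooth_on setT zeta ->
  mul_dist phi f (fun x => c * eta x + zeta x) = c * mul_dist phi f eta + mul_dist phi f zeta.
Proof.
move=> tphi se sz; rewrite /mul_dist -f_dist.1; last 2 first.
- by case: (test_funM tphi se).
- by case: (test_funM tphi sz).
by congr f; apply/funext => x; rewrite mulrDr mulrCA.
Qed.

Lemma mul_dist_wtempered phi : test_fun Omega phi -> exists N C, wtempered (mul_dist phi f) N C.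
Proof.
move=> tphi; have [N [C [C0 H]]] := dist_bound tphi; exists N, C; split => //.
  by move=> c eta zeta [se _] [sz _]; exact: mul_dist_linear.
move=> eta B [se _] HB.
have B0 : 0 <= B.
  by apply: le_trans (HB 0 [::] isT isT); rewrite mulr_ge0 ?cabs_ge0 // exprn_ge0 // ltW ?jnorm_gt0.
apply: H => // x _ w sw uw; apply: le_trans (HB x w sw uw).
by rewrite ler_peMl ?cabs_ge0 // exprn_ege1 ?jnorm_ge1.
Qed.

Lemma mul_dist_compact phi : test_fun Omega phi ->
  exists rho N C, compact_functional (mul_dist phi f) rho N C.
Proof.
move=> tphi; have [N [C [C0 H]]] := dist_bound tphi.
have [_ cphi _] := tphi; have [M [_ HM]] := compact_bounded cphi.
pose rho : R := `|M| + 1; have rho0 : 0 <= rho by rewrite addr_ge0.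
exists rho, N, C; split => //; first by move=> c g h sg sh; exact: mul_dist_linear.
move=> g B sg HB; have B0 := derbound_ge0 (HB 0 _); rewrite normr0 in B0.
apply: H => //; first exact: B0.
move=> x sx; apply: HB; apply: HM => //.
by rewrite /rho (le_lt_trans (ler_norm M)) // ltrDl.
Qed.

(* The pointwise value of the Fourier transform of [phi f]. *)
Definition Phi (phi : P -> R[i]) (xi : P) : R[i] := f (fun x => phi x * ew xi x).

Lemma mul_dist_FT phi K : test_fun Omega phi -> rapid K ->
  mul_dist phi f (FT K) = Cint leb2 setT (fun xi => K xi * Phi phi xi).
Proof. by move=> tphi rK; have [rho [N [C LP]]] := mul_dist_compact tphi; exact: cf_fourier LP rK. Qed.

Lemma Ccontinuous_Phi phi : test_fun Omega phi -> Ccontinuous (Phi phi).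
Proof. by move=> tphi; have [rho [N [C LP]]] := mul_dist_compact tphi; exact: (Ccontinuous_cf_ew LP). Qed.

Lemma pgrowth_Phi phi : test_fun Omega phi -> pgrowth (Phi phi).
Proof. by move=> tphi; have [rho [N [C LP]]] := mul_dist_compact tphi; exact: (pgrowth_cf_ew LP). Qed.

(** Because [phi * tau = tau], the distribution [tau f] is [tau (phi f)], and its transform is a
    convolution. The function [tau * ew xi] is written as [FT] of its inverse transform so that
    [mul_dist_FT] applies. *)
Lemma Phi_conv phi tau xi : test_fun Omega phi -> smooth_cpt tau -> (forall x, phi x * tau x = tau x) ->
  Phi tau xi = Cint leb2 setT (fun z => FT tau (xi - z) * Phi phi z).
Proof.
move=> tphi st pt.
have st' : smooth_cpt (fun x => tau x * ew xi x) by apply: smooth_cptM => //; case: (smooth_ew xi).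
have E z : IFT (fun x => tau x * ew xi x) z = FT tau (xi - z).
  rewrite IFTE ?FTE; last exact: smooth_cpt_rapid.
  by congr Cint; apply/funext => x; rewrite -mulrA (ewC x (xi - z)) [ew (xi - z) x]ewC ewDr ewN [in LHS]ewC.
rewrite (_ : Phi tau xi = mul_dist phi f (FT (IFT (fun x => tau x * ew xi x)))).
  rewrite mul_dist_FT //; last exact: IFT_rapid.
  by congr Cint; apply/funext => z; rewrite E.
rewrite /Phi /mul_dist; congr f; apply/funext => x.
by rewrite FT_IFT // mulrA pt.
Qed.

(** The character is split into real and imaginary parts, on which the real distribution [phi f]
    takes real values. *)
Lemma Phi_conj phi xi : real_valued Omega f -> test_fun Omega phi -> (forall x, Im (phi x) = 0) ->
  Phi phi (- xi) = (Phi phi xi)^*.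
Proof.
move=> fr tphi phir.
pose A : P -> R[i] := fun x => (Re (ew xi x))%:C; pose B : P -> R[i] := fun x => (Im (ew xi x))%:C.
have [se _] := smooth_ew xi.
have sJ : smooth_on setT (fun x => (ew xi x)^*) by apply: smooth_onJ; [exact: openT|].
have sA : smooth_on setT A.
  rewrite (_ : A = (fun x => 2^-1%:C * (ew xi x + (ew xi x)^*))).
    by apply: smooth_onM; [exact: openT|exact: smooth_on_cst|exact: smooth_onD openT _ _].
  by apply/funext => x; apply: complex_ext; rewrite !reimE /=; field.
have sB : smooth_on setT B.
  rewrite (_ : B = (fun x => (0 -i* 2^-1) * (ew xi x + (- 1) * (ew xi x)^*))).
    apply: smooth_onM; [exact: openT|exact: smooth_on_cst|apply: smooth_onD; [exact: openT|by []|]].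
    by apply: smooth_onM; [exact: openT|exact: smooth_on_cst|].
  by apply/funext => x; apply: complex_ext; rewrite !reimE /=; field.
have rl (g : P -> R[i]) : smooth_on setT g -> (forall x, Im (g x) = 0) -> (mul_dist phi f g)^* = mul_dist phi f g.
  move=> sg g0; apply: complex_ext; rewrite !reimE //.
  have -> : Im (mul_dist phi f g) = 0; last by rewrite oppr0.
  apply: fr; first by case: (test_funM tphi sg).
  by move=> x; rewrite reimE phir g0 mulr0 mul0r addr0.
have E1 : Phi phi xi = (0 +i* 1) * mul_dist phi f B + mul_dist phi f A.
  rewrite -mul_dist_linear //; congr f; apply/funext => x; congr (_ * _).
  by apply: complex_ext; rewrite !reimE /=; ring.
have E2 : Phi phi (- xi) = (0 -i* 1) * mul_dist phi f B + mul_dist phi f A.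
  rewrite -mul_dist_linear //; congr f; apply/funext => x; congr (_ * _).
  by rewrite [ew (- xi) x]ewC ewN ewC; apply: complex_ext; rewrite !reimE /=; ring.
by rewrite E1 E2 conjcD conjcM !rl //; congr (_ * _ + _); apply: complex_ext; rewrite !reimE /= ?oppr0.
Qed.

End Distribution.

(** * Negligibility of shearlets away from their centre *)

Section Localization.
Context {R : realType}.
Local Notation P := (R * R)%type.
Variables (psi1 psi1h psi2 psi2h : R -> R[i]) (psi : P -> R[i]).
Hypothesis hpsi : shearlet_generator psi1 psi1h psi2 psi2h psi.
Local Notation hpsihat := (hpsihat psi1h psi2h).
Local Notation Kast := (Kast psi1h psi2h).
Local Notation SHb := (SHb psi).

Lemma sqrtr_le_id (a : R) : 0 < a <= 1 -> a <= Num.sqrt a <= 1.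
Proof.
move=> /andP[a0 a1]; have s0 := sqrtr_ge0 a; have s2 := sqr_sqrtr (ltW a0).
have s1 : Num.sqrt a <= 1 by rewrite -sqrtr1 ler_sqrt.
by rewrite s1 andbT -{1}s2 expr2 ler_piMl.
Qed.

(** The bound [|s| <= 3] holds near every slope of []-2, 2[], all radii being at most 1. *)
Lemma Minv_upper b (a s : R) (y : P) : 0 < a <= 1 -> `|s| <= 3 -> `|Minv b a s y| <= 5 / a * `|y|.
Proof.
move=> a01 s3; have /andP[a0 a1] := a01; have /andP[sa1 sa2] := sqrtr_le_id a01.
have s0 : 0 < Num.sqrt a by rewrite sqrtr_gt0.
have e1 : `|a^-1| = a^-1 by rewrite gtr0_norm // invr_gt0.
have e2 : `|s / a| <= 3 / a by rewrite normrM e1 ler_wpM2r // invr_ge0 ltW.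
have e3 : `|(Num.sqrt a)^-1| <= a^-1 by rewrite gtr0_norm ?invr_gt0 // lef_pV2.
by rewrite /Minv; case: b; apply: le_trans (lin2_norm _ _ _ _ _) _; rewrite ler_wpM2r // normr0 e1; lra.
Qed.

(** With the shear bounded, [Minv] magnifies distances at least by a constant times [1 / sqrt a];
    this is the source of all decay away from [t]. *)
Lemma Minv_lower b (a s : R) (y : P) : 0 < a <= 1 -> `|s| <= 3 -> `|y| <= 5 * Num.sqrt a * `|Minv b a s y|.
Proof.
move=> a01 s3; have /andP[a0 a1] := a01; have /andP[sa1 sa2] := sqrtr_le_id a01.
have s0 : 0 < Num.sqrt a by rewrite sqrtr_gt0.
set v := Minv b a s y; have v0 := normr_ge0 v.
have z2 : (jb b y).2 = Num.sqrt a * v.2 by rewrite /v MinvE /=; field; rewrite gt_eqF.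
have z1 : (jb b y).1 = a * v.1 - s * Num.sqrt a * v.2.
  by rewrite /v MinvE /=; field; rewrite !gt_eqF.
have h1 := norm_fst v; have h2 := norm_snd v.
have b2 : `|Num.sqrt a * v.2| <= Num.sqrt a * `|v| by rewrite normrM (gtr0_norm s0) ler_wpM2l // ltW.
have b1 : `|a * v.1| <= Num.sqrt a * `|v|.
  by rewrite normrM (gtr0_norm a0) ler_pM // ltW.
have b3 : `|s * Num.sqrt a * v.2| <= 3 * (Num.sqrt a * `|v|) by rewrite -mulrA normrM ler_pM.
have p0 : 0 <= Num.sqrt a * `|v| by rewrite mulr_ge0 // ltW.
rewrite -(jb_norm b y) norm_plane ge_max z1 z2 -[leRHS]mulrA; apply/andP; split; last by lra.
by rewrite (le_trans (ler_normB _ _)) //; lra.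
Qed.

(** Chain rule: each derivative costs the norm [5 / a] of [Minv], while the Schwartz decay of
    [FT hpsihat] is available to any order [L]. *)
Lemma Kast_derbound N L : exists C : R, 0 <= C /\ forall b a s t x, 0 < a <= 1 -> `|s| <= 3 ->
  derbound N (FT (Kast b a s t)) x
    (a `^ (- (3 / 4)) * ((5 / a) ^+ N * (C / (1 + `|Minv b a s (x - t)|) ^+ L))).
Proof.
have SF := FT_schwartz (smooth_cpt_hpsihat hpsi).
have [C [C0 HC]] := schwartz_derbound SF N L; exists C; split => //.
move=> b a s t x a01 s3 w sw uw; have /andP[a0 a1] := a01.
pose Ml : {linear P -> P} := if b then (lin2 (s / a) a^-1 (Num.sqrt a)^-1 0 : {linear P -> P})
  else (lin2 a^-1 (s / a) 0 (Num.sqrt a)^-1 : {linear P -> P}).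
have ME y : Minv b a s y = Ml y by rewrite /Minv /Ml; case: (b).
have E1 : FT (Kast b a s t) = (fun x => (a `^ (- (3 / 4)))%:C * (fun y => FT hpsihat (Ml y + - Ml t)) x).
  by apply/funext => y; rewrite (FT_Kast hpsi) // ME linearB.
have cM : continuous Ml by rewrite /Ml; case: (b); exact: continuous_lin2.
rewrite E1 cdirDZ; last by apply: smooth_comp_affine => //; case: SF.
rewrite cabsM cabs_real ger0_norm ?powR_ge0 // ler_wpM2l ?powR_ge0 //.
rewrite cdirD_comp_affine; last by move=> *; exact: linearP.
rewrite ME linearB; have K1 : 1 <= 5 / a by rewrite ler_pdivlMr // mul1r (le_trans a1) // ler1n.
have K0 : 0 < 5 / a by exact: lt_le_trans K1.
have := derbound_dirD (proj1 SF) openT (I : setT (Ml x - Ml t)) K0 (HC _) _ _ => /(_ (map Ml w)).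
rewrite size_map => /(_ sw) H; apply: le_trans (H _) _.
  apply/allP => _ /mapP[e ew' ->]; rewrite -ME (le_trans (Minv_upper _ _ a01 s3)) //.
  by apply: ler_piMr; [exact: ltW|move/allP: uw => /(_ _ ew')].
by rewrite ler_wpM2r ?ler_weXn2l // divr_ge0 // exprn_ge0 // addr_ge0.
Qed.

Lemma powR_nat (a : R) n : 0 < a -> a `^ n%:R = a ^+ n.
Proof. by move=> a0; rewrite powR_mulrn // ltW. Qed.

Lemma powR_exprC (x y : R) n : 0 <= x -> (x ^+ n) `^ y = (x `^ y) ^+ n.
Proof. by move=> x0; rewrite -(powR_mulrn n x0) -(powR_mulrn n (powR_ge0 x y)) -2!powRrM mulrC. Qed.

(** On the support of [chi] the distance to [t] is bounded below, so the argument of the shearlet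
    has norm at least a constant times [1 / sqrt a], and its Schwartz decay beats every power of
    [1 / a] lost to derivatives and normalization. *)
Lemma localization u N C chi x0 (dl dl' : R) b (k : R) : wtempered u N C -> bounded_derivs chi -> 0 < dl ->
  dl' < dl ->
  (forall x, `|x - x0| < dl -> chi x = 0) ->
  exists C' : R, 0 <= C' /\ forall a s t, 0 < a <= 1 -> `|s| <= 3 -> `|t - x0| <= dl' ->
    cabs (u (fun x => chi x * FT (Kast b a s t) x)) <= C' * a `^ k.
Proof.
move=> wu bc d0 dd' chi0; have [sc Hc] := bc; have [A [A0 HA]] := Hc N.
(* The final exponent of [a] is [- 3 / 4 - N + M / 2], which is at least [k] once
   [M >= 2 * (k + 1 + N)]. *)
pose M := archimedean.Num.Def.archi_bound (2 * `|k| + 2 + 2 * N%:R).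
have HM : 2 * (k + 1 + N%:R) <= M%:R.
  have n0 : 0 <= 2 * `|k| + 2 + 2 * N%:R by rewrite !addr_ge0 // mulr_ge0.
  have := archimedean.Num.Theory.archi_boundP n0; rewrite -/M => /ltW h.
  by apply: le_trans h; have := ler_norm k; lra.
have [CL [CL0 HL]] := Kast_derbound N (N + M).
have e0 : 0 < dl - dl' by rewrite subr_gt0.
(* Chosen so that [1 + |x| <= D * |x - t|] whenever [x] is at distance at least [dl] and [t] at
   distance at most [dl'] from [x0]. *)
pose D : R := 1 + (1 + `|x0| + dl) * (dl - dl')^-1.
have D1 : 1 <= D.
  by rewrite lerDl; apply: mulr_ge0; [rewrite !addr_ge0 // ltW|rewrite invr_ge0 ltW].
have D0 : 0 < D by exact: lt_le_trans D1.
pose B0 : R := 2 ^+ N * (A * (5 ^+ N * CL)) * (5 * D) ^+ (N + M).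
have B00 : 0 <= B0 by rewrite !mulr_ge0 ?exprn_ge0 ?mulr_ge0 // ltW.
exists (C * B0); split; first by rewrite mulr_ge0 // (wt_ge0 wu).
move=> a s t a01 s3 td; have /andP[a0 a1] := a01.
have sK := smooth_cpt_Kast hpsi b s t a0.
have SK := FT_schwartz sK.
rewrite -mulrA; apply: (wt_bound wu); first exact: schwartzM.
move=> x w sw uw; have RHS0 : 0 <= B0 * a `^ k by rewrite mulr_ge0 ?powR_ge0.
have [xd|xd] := ltP `|x - x0| dl.
  rewrite (_ : cdirD w _ x = 0) ?cabs0 ?mulr0 //.
  have oU : open [set y : P | `|y - x0| < dl].
    have cn : continuous (fun x : P => `|x - x0|).
      move=> y; apply: (@continuous_comp _ _ _ (fun x : P => x - x0) (fun x : P => `|x|)).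
        by apply: cvgB; [exact: cvg_id|exact: cvg_cst].
      exact: norm_continuous.
    have -> : [set y : P | `|y - x0| < dl] = (fun y : P => `|y - x0|) @^-1` [set r : R | r < dl] by [].
    by apply: open_comp; [move=> y _; exact: cn|exact: open_lt].
  rewrite (eq_cdirD_on (h := fun=> 0) w oU _ xd) ?cdirD_zero // => y yU.
  by rewrite chi0 // mul0r.
have yt : dl - dl' <= `|x - t|.
  have h2 : `|x - x0| <= `|x - t| + `|t - x0|.
    by have := ler_normD (x - t) (t - x0); rewrite addrA subrK.
  lra.
have s0 : 0 < Num.sqrt a by rewrite sqrtr_gt0.
have /andP[sa1 sa2] := sqrtr_le_id a01.
set v := Minv b a s (x - t).
have x1 : 1 + `|x| <= D * `|x - t|.
  have h1 : `|t| <= `|x0| + dl by have := ler_normD (t - x0) x0; rewrite subrK; lra.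
  have h2 : `|x| <= `|x - t| + `|t| by have := ler_normD (x - t) t; rewrite subrK.
  have h3 : 1 <= (dl - dl')^-1 * `|x - t| by rewrite mulrC ler_pdivlMr // mul1r.
  have h4 : 1 + `|x0| + dl <= (1 + `|x0| + dl) * ((dl - dl')^-1 * `|x - t|).
    by rewrite ler_peMr // !addr_ge0 // ltW.
  rewrite /D mulrDl mul1r -mulrA; lra.
have vl : (1 + `|x|) <= 5 * D * Num.sqrt a * (1 + `|v|).
  have m1 := Minv_lower b (x - t) a01 s3.
  apply: le_trans x1 _; apply: (@le_trans _ _ (D * (5 * Num.sqrt a * `|v|))).
    by rewrite ler_wpM2l // ltW.
  have p5 : 0 <= 5 * Num.sqrt a * D by rewrite !mulr_ge0 // ltW.
  have p6 : 0 <= `|v| by exact: normr_ge0.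
  have -> : D * (5 * Num.sqrt a * `|v|) = 5 * Num.sqrt a * D * `|v| by ring.
  have -> : 5 * D * Num.sqrt a * (1 + `|v|) = 5 * Num.sqrt a * D * `|v| + 5 * Num.sqrt a * D by ring.
  by rewrite lerDl.
have v1 : 0 < 1 + `|v| by rewrite ltr_pwDl.
(* All [N + M] powers go into [1 + |x| <= 5 * D * sqrt a * (1 + |v|)]; of the resulting powers of
   [sqrt a] only [M] are kept. *)
have key : (1 + `|x|) ^+ N * (1 + `|v|) ^- (N + M) <= (5 * D) ^+ (N + M) * Num.sqrt a ^+ M.
  rewrite ler_pdivrMr ?exprn_gt0 //.
  apply: (@le_trans _ _ ((5 * D * Num.sqrt a * (1 + `|v|)) ^+ (N + M))).
    apply: (@le_trans _ _ ((1 + `|x|) ^+ (N + M))).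
      by apply: ler_weXn2l; [exact: jnorm_ge1|exact: leq_addr].
    by rewrite lerXn2r ?nnegrE ?(ltW (jnorm_gt0 _)) // !mulr_ge0 // ltW.
  rewrite exprMn; apply: ler_wpM2r; first by rewrite exprn_ge0 // ltW.
  rewrite exprMn; apply: ler_wpM2l; first by rewrite exprn_ge0 // mulr_ge0 // ltW.
  by rewrite exprD; apply: ler_piMl; [rewrite exprn_ge0 // ltW|rewrite exprn_ile1 // ltW].
have := derboundM openT sc (proj1 SK) (I : setT x) (HA x) (HL b a s t x a01 s3) sw uw.
rewrite -/v => DB; apply: (@le_trans _ _ ((1 + `|x|) ^+ N *
   (2 ^+ N * (A * (a `^ (- (3 / 4)) * ((5 / a) ^+ N * (CL / (1 + `|v|) ^+ (N + M)))))))).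
  by rewrite ler_wpM2l ?exprn_ge0 // ltW ?jnorm_gt0.
apply: (@le_trans _ _ (2 ^+ N * (A * (5 ^+ N * CL)) * (a `^ (- (3 / 4)) * a ^- N) *
    ((5 * D) ^+ (N + M) * Num.sqrt a ^+ M))).
  rewrite [leLHS](_ : _ = 2 ^+ N * (A * (5 ^+ N * CL)) * (a `^ (- (3 / 4)) * a ^- N) *
    ((1 + `|x|) ^+ N * (1 + `|v|) ^- (N + M))); last first.
    rewrite expr_div_n; set e1 := (_ ^+ (N + M))^-1; set e2 := (a ^+ N)^-1.
    by move: e1 e2 => e1 e2; ring.
  apply: ler_wpM2l => //; apply: mulr_ge0; first by rewrite !mulr_ge0 ?exprn_ge0.
  by rewrite divr_ge0 ?powR_ge0 // exprn_ge0 // ltW.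
have E2 : a `^ (- (3 / 4)) * (a ^- N * Num.sqrt a ^+ M) = a `^ (- (3 / 4) - N%:R + M%:R / 2).
  rewrite -(powR12_sqrt (ltW a0)) -(powR_nat M) ?powR_gt0 // -powRrM -powR_nat // -powRN -!powR_add //.
  by congr (_ `^ _); field.
rewrite [leLHS](_ : _ = B0 * (a `^ (- (3 / 4)) * (a ^- N * Num.sqrt a ^+ M))); last first.
  by rewrite /B0; set e := (a ^+ N)^-1; move: e => e; ring.
rewrite E2; apply: ler_wpM2l => //; apply: ger_powR => //; lra.
Qed.

End Localization.

(** * Comparison with the transform of a cut-off distribution *)

Section Reading.
Context {R : realType}.
Local Notation P := (R * R)%type.
Variables (psi1 psi1h psi2 psi2h : R -> R[i]) (psi : P -> R[i]).
Hypothesis hpsi : shearlet_generator psi1 psi1h psi2 psi2h psi.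
Local Notation hpsihat := (hpsihat psi1h psi2h).
Local Notation Kast := (Kast psi1h psi2h).
Local Notation SHb := (SHb psi).
Variables (Omega : set P) (f : functional R).
Hypothesis Omega_open : open Omega.
Hypothesis f_dist : is_distribution Omega f.
Variable F : P -> functional R.
Hypothesis F_reading : shearlet_reading Omega f F.

Lemma norm_le_enorm (x : P) : `|x| <= enorm x.
Proof.
have q (y z : R) : `|y| <= Num.sqrt (y * y + z * z).
  by rewrite -sqrtr_sqr ler_wsqrtr // expr2 lerDl -expr2 sqr_ge0.
rewrite norm_plane ge_max /enorm dot2E; apply/andP; split; first exact: q.
by rewrite addrC; exact: q.
Qed.

Lemma open_box (U : set P) x : open U -> U x -> exists2 r : R, 0 < r & [set y | `|y - x| <= r] `<=` U.
Proof.
move=> oU Ux; have := open_nbhs_nbhs (conj oU Ux) => /nbhs_normP[e /= e0 He].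
exists (e / 2); first by rewrite divr_gt0.
by move=> y /= h; apply: He; rewrite /= distrC; lra.
Qed.

(** Both alternatives of [shearlet_reading] are reduced to one fact: [F x] is tempered and agrees
    with [f] on test functions supported near [x]. *)
Lemma reading_local x : Omega x -> exists N C, exists2 rho : R, 0 < rho &
  wtempered (F x) N C /\ forall eta, test_fun Omega eta -> (forall y, rho <= `|y - x| -> eta y = 0) ->
    F x eta = f eta.
Proof.
move=> Ox; case: F_reading => [[u [tu ue] Fu]|[_ H]].
  rewrite Fu //; have [N [C w]] := tempered_wtempered tu.
  (* A tempered extension agrees with [f] on every test function, so the radius 1 is arbitrary. *)
  by exists N, C, 1 => //; split => // eta te _; exact: ue.
have [phi [tphi phi1] ->] := H x Ox.
have [N [C w]] := mul_dist_wtempered f_dist tphi.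
have [e e0 He] : exists2 e : R, 0 < e & forall y, `|x - y| < e -> phi y = 1.
  by move: phi1 => /nbhs_normP[e e0 He]; exists e => // y; exact: He.
exists N, C, e => //; split=> // eta teta eta0; rewrite /mul_dist; congr f; apply/funext => y.
have [/eta0 ->|h] := leP e `|y - x|; first by rewrite mulr0.
by rewrite He ?mul1r // distrC.
Qed.

(** The shearlet transform of [phi f] as an integral over frequencies; [GbE] identifies the two. *)
Definition Gb b (phi : P -> R[i]) (a s : R) (t : P) : R[i] :=
  Cint leb2 setT (fun z => Kast b a s t z * Phi f phi z).

Lemma GbE b phi a s t : 0 < a -> test_fun Omega phi -> Gb b phi a s t = mul_dist phi f (FT (Kast b a s t)).
Proof.
move=> a0 tphi; rewrite (mul_dist_FT f_dist tphi) //.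
exact: smooth_cpt_rapid (smooth_cpt_Kast hpsi b s t a0).
Qed.

(** A cut-off [chi] is placed where [phi] is 1 and [F x] agrees with [f]. The [chi] parts of the two
    transforms coincide and the [1 - chi] parts are negligible by [localization]. *)
Lemma SHb_Gb b phi c r r' x k : bump c r r' phi -> [set y | `|y - c| <= r'] `<=` Omega -> r < r' ->
  `|x - c| < r -> exists C r0 : R, [/\ 0 <= C, 0 < r0, r0 <= 1 &
    forall a s t, 0 < a < r0 -> `|s| <= 3 -> `|t - x| <= r0 ->
      cabs (SHb b (F x) a s t - Gb b phi a s t) <= C * a `^ k].
Proof.
move=> B BO rr' xc; have tphi := bump_test B BO.
have Ox : Omega x by apply: BO => /=; rewrite (le_trans (ltW xc)) // ltW.
have [N [C [rho rho0 [wF Fe]]]] := reading_local Ox.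
have [N' [C' wL]] := mul_dist_wtempered f_dist tphi.
pose d := Num.min (r - `|x - c|) rho; have d0 : 0 < d by rewrite lt_min subr_gt0 xc.
have dr : d <= r - `|x - c| by rewrite ge_min lexx.
have drho : d <= rho by rewrite ge_min lexx orbT.
have d2 : d / 2 < d by lra.
have [chi Bc] := generator_bumps hpsi x d2.
have inner y : `|y - x| <= d -> `|y - c| <= r.
  by move=> h; have := ler_normD (y - x) (x - c); rewrite addrA subrK; lra.
have chiO : [set y | `|y - x| <= d] `<=` Omega.
  by move=> y /= /inner h; apply: BO => /=; lra.
have tchi := bump_test Bc chiO.
have phichi y : phi y * chi y = chi y.
  have [h|h] := leP d `|y - x|; first by rewrite (bump_0 Bc h) mulr0.
  by rewrite (bump_1 B) ?mul1r //; apply: inner; exact: ltW.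
have bc := smooth_cpt_bounded (bump_smooth_cpt Bc).
have b1 := bounded_derivs_1B bc.
have d20 : 0 < d / 2 by lra.
have out y : `|y - x| < d / 2 -> 1 - chi y = 0.
  by move=> h; rewrite (bump_1 Bc) ?subrr // ltW.
have d22 : d / 2 / 2 < d / 2 by lra.
have [C1 [C10 H1]] := localization hpsi b k wF b1 d20 d22 out.
have [C2 [C20 H2]] := localization hpsi b k wL b1 d20 d22 out.
exists (C1 + C2), (Num.min 1 (d / 2 / 2)); split.
- exact: addr_ge0.
- by rewrite lt_min ltr01 divr_gt0.
- by rewrite ge_min lexx.
move=> a s t /andP[a0]; rewrite lt_min => /andP[a1 _] s3; rewrite le_min => /andP[_ td].
have a01 : 0 < a <= 1 by rewrite a0 ltW.
rewrite (SHbE hpsi) // GbE //; set K := FT (Kast b a s t).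
have SK : schwartz K by exact: FT_schwartz (smooth_cpt_Kast hpsi b s t a0).
have S1 := schwartzM b1 SK; have S2 := schwartzM bc SK.
have split1 u : linear_on (@schwartz R _) u -> u K = u (fun y => (1 - chi y) * K y) + u (fun y => chi y * K y).
  move=> lu; rewrite -[u (fun y => (1 - chi y) * _)]mul1r -lu //; congr u; apply/funext => y.
  by rewrite mul1r -mulrDl subrK mul1r.
rewrite (split1 _ (wt_linear wF)) (split1 _ (wt_linear wL)).
have -> : mul_dist phi f (fun y => chi y * K y) = F x (fun y => chi y * K y).
  rewrite Fe.
  - by rewrite /mul_dist; congr f; apply/funext => y; rewrite mulrA phichi.
  - by case: (test_funM tchi (proj1 SK)).
  - by move=> y h; rewrite (bump_0 Bc) ?mul0r // (le_trans drho).
rewrite opprD addrACA subrr addr0 mulrDl (le_trans (cabsB _ _)) // lerD //; [exact: H1|exact: H2].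
Qed.

Lemma decays_add (T T' : R -> R -> P -> R[i]) (k s0 : R) x0 : -2 < s0 < 2 ->
  (exists C r0 : R, [/\ 0 <= C, 0 < r0, r0 <= 1 &
    forall a s t, 0 < a < r0 -> `|s| <= 3 -> `|t - x0| <= r0 ->
      cabs (T a s t - T' a s t) <= C * a `^ k]) -> decays T' k s0 x0 -> decays T k s0 x0.
Proof.
move=> s02 [C [r0 [C0 r00 r01 H]]] [r1 [C1 [r10 C10 H1]]].
exists (Num.min r0 r1), (C + C1); split; [by rewrite lt_min r00|by rewrite ltr_wpDl|].
move=> a s t; rewrite !lt_min => /andP[a0 /andP[ar0 ar1]] /andP[sr0 sr1] /andP[tr0 tr1].
rewrite -[T a s t](subrK (T' a s t)) (le_trans (cabsD _ _)) // mulrDl lerD //.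
  apply: H; [by rewrite a0| |by rewrite (le_trans (norm_le_enorm _)) // ltW].
  have s2 : `|s0| <= 2 by rewrite ler_norml; case/andP: s02 => ? ?; rewrite !ltW.
  by have := ler_normD (s - s0) s0; rewrite subrK; lra.
by apply: H1; rewrite ?a0.
Qed.

Lemma decays_SHb_Gb b phi c r r' x s0 k : bump c r r' phi -> [set y | `|y - c| <= r'] `<=` Omega -> r < r' ->
  `|x - c| < r -> -2 < s0 < 2 -> decays (SHb b (F x)) k s0 x <-> decays (Gb b phi) k s0 x.
Proof.
move=> B BO rr' xc s02; have [C [r0 [C0 r00 r01 H]]] := SHb_Gb b k B BO rr' xc.
split; apply: decays_add => //; exists C, r0; split => // a s t h1 h2 h3.
by rewrite -cabsN opprB; exact: H.
Qed.

End Reading.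

(** * Cones of frequencies *)

Section Cones.
Context {R : realType}.
Local Notation P := (R * R)%type.

(* With [b = false]: the slopes [z.2 / z.1] at distance less than [d] from [s], [z.1] having the
   sign of [r]. *)
Definition scone (b : bool) (r s d : R) : set P := [set z | 0 < r * (jb b z).1 /\
  `|(jb b z).2 - s * (jb b z).1| < d * `|(jb b z).1|].

Lemma open_scone b r s d : open (scone b r s d).
Proof.
have j1 : continuous (fun z : P => (jb b z).1) by case: (b); [exact: continuous_snd2|exact: continuous_fst2].
have j2 : continuous (fun z : P => (jb b z).2) by case: (b); [exact: continuous_fst2|exact: continuous_snd2].
have n1 (g : P -> R) : continuous g -> continuous (fun z => `|g z|).
  by move=> cg z; apply: (@continuous_comp _ _ _ g (fun x : R => `|x|)); [exact: cg|exact: norm_continuous].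
have -> : scone b r s d = (fun z => r * (jb b z).1) @^-1` [set y | 0 < y] `&`
    (fun z => d * `|(jb b z).1| - `|(jb b z).2 - s * (jb b z).1|) @^-1` [set y | 0 < y].
  by apply/seteqP; split => z /=; rewrite subr_gt0.
apply: openI; apply: open_comp; try exact: (@open_gt R).
  by move=> z _; apply: cvgM; [exact: cvg_cst|exact: j1].
move=> z _; apply: cvgB; first by apply: cvgM; [exact: cvg_cst|exact: (n1 _ j1)].
apply: (n1 (fun z => (jb b z).2 - s * (jb b z).1)) => y; apply: cvgB; first exact: j2.
by apply: cvgM; [exact: cvg_cst|exact: j1].
Qed.

Lemma scone_norm b r s d z : 0 < d -> scone b r s d z -> `|z| <= (1 + `|s| + d) * `|(jb b z).1|.
Proof.
move=> d0 [_ h]; rewrite -(jb_norm b) norm_plane ge_max; apply/andP; split.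
  by rewrite -addrA mulrDl mul1r lerDl mulr_ge0 ?addr_ge0 // ltW.
have := ler_normD ((jb b z).2 - s * (jb b z).1) (s * (jb b z).1); rewrite subrK normrM.
by rewrite !mulrDl mul1r; have := normr_ge0 (jb b z).1; lra.
Qed.

(** Outside the larger cone, either the first coordinate has the wrong sign, and differs from that
    of [xi] by at least its size, or the slopes differ by at least [d' - d]. *)
Lemma scone_sep b r s d d' : r != 0 -> 0 < d -> d < d' -> exists2 c : R, 0 < c &
  forall xi z, scone b r s d xi -> ~ scone b r s d' z -> c * `|xi| <= `|xi - z|.
Proof.
move=> r0 d0 dd'; pose A := 1 + `|s| + d; pose A' := 1 + `|s| + d'.
have A0 : 0 < A by rewrite ltr_wpDl // addr_ge0.
have A'0 : 0 < A' by rewrite ltr_wpDl ?addr_ge0 // (lt_trans d0).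
pose e := Num.min 1 ((d' - d) / A').
have e0 : 0 < e by rewrite lt_min ltr01 divr_gt0 // subr_gt0.
exists (e / A); first by rewrite divr_gt0.
move=> xi z hx hz; have hn := scone_norm d0 hx.
apply: (@le_trans _ _ (e * `|(jb b xi).1|)).
  by rewrite -mulrA ler_wpM2l ?(ltW e0) // ler_pdivrMl.
rewrite -(jb_norm b (xi - z)) jbB; have [hx1 hx2] := hx.
have n1 : `|(jb b xi).1 - (jb b z).1| <= `|jb b xi - jb b z| by exact: (norm_fst (jb b xi - jb b z)).
have n2 : `|(jb b xi).2 - (jb b z).2| <= `|jb b xi - jb b z| by exact: (norm_snd (jb b xi - jb b z)).
set y := `|jb b xi - jb b z| in n1 n2 *.
have [rz|rz] := leP (r * (jb b z).1) 0.
  have h : `|(jb b xi).1| <= `|(jb b xi).1 - (jb b z).1|.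
    rewrite -(ler_pM2l (x := `|r|)) ?normr_gt0 // -!normrM mulrBr (gtr0_norm hx1) ger0_norm; lra.
  apply: le_trans n1; apply: le_trans h.
  by rewrite ler_piMl // ge_min lexx.
have hz2 : d' * `|(jb b z).1| <= `|(jb b z).2 - s * (jb b z).1|.
  by rewrite leNgt; apply/negP => h; apply: hz.
have t1 : `|(jb b xi).1| <= `|(jb b z).1| + y.
  by have := ler_normD (jb b z).1 ((jb b xi).1 - (jb b z).1); rewrite addrCA subrr addr0; lra.
have t2 : `|(jb b z).2 - s * (jb b z).1| <= `|(jb b xi).2 - s * (jb b xi).1| + (y + `|s| * y).
  have -> : (jb b z).2 - s * (jb b z).1 = ((jb b xi).2 - s * (jb b xi).1) -
     (((jb b xi).2 - (jb b z).2) - s * ((jb b xi).1 - (jb b z).1)) by ring.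
  rewrite (le_trans (ler_normB _ _)) // lerD2l (le_trans (ler_normB _ _)) // normrM lerD //.
  by rewrite ler_wpM2l.
have t3 : (d' - d) * `|(jb b xi).1| <= A' * y.
  have := ler_wpM2l (ltW (lt_trans d0 dd')) t1.
  rewrite /A' !mulrDl mul1r mulrDr mulNr; lra.
apply: (@le_trans _ _ ((d' - d) / A' * `|(jb b xi).1|)).
  by rewrite ler_wpM2r // ge_min lexx orbT.
by rewrite mulrAC ler_pdivrMr // [leRHS]mulrC.
Qed.

Lemma jnorm_submult (x y : P) : 1 + `|x| <= (1 + `|y|) * (1 + `|x - y|).
Proof.
have := ler_normD (x - y) y; rewrite subrK.
by have := mulr_ge0 (normr_ge0 y) (normr_ge0 (x - y)); rewrite mulrDl mulrDr; lra.
Qed.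

Lemma peetre (p : R) (x y : P) : (1 + `|x|) `^ p <= (1 + `|y|) `^ p * (1 + `|x - y|) `^ `|p|.
Proof.
have j0 (z : P) : 0 <= 1 + `|z| by exact: ltW (jnorm_gt0 z).
have [p0|p0] := leP 0 p.
  rewrite ger0_norm // -powRM //; apply: ge0_ler_powR; rewrite ?nnegrE ?mulr_ge0 //.
  exact: jnorm_submult.
rewrite ltr0_norm // -[p in leLHS]opprK -[p in X in X * _]opprK ![_ `^ (- - p)]powRN.
rewrite mulrC ler_pdivlMr ?powR_gt0 ?jnorm_gt0 // mulrC ler_pdivrMr ?powR_gt0 ?jnorm_gt0 // -powRM //.
have np : 0 <= - p by lra.
apply: ge0_ler_powR; rewrite ?nnegrE ?mulr_ge0 //.
by rewrite mulrC -[`|x - y|]normrN opprB; exact: jnorm_submult.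
Qed.

End Cones.

Lemma ler_Xn (R : realDomainType) n (x y : R) : 0 <= x -> x <= y -> x ^+ n <= y ^+ n.
Proof. by move=> x0 xy; rewrite lerXn2r // nnegrE // (le_trans x0). Qed.

(** * Weighted convolution estimates for nested cones *)

Section Convolution.
Context {R : realType}.
Local Notation P := (R * R)%type.
Local Notation pl := (measurableTypeR R * measurableTypeR R)%type.
Implicit Types (V kap g h : P -> R).

Lemma sigma_finite_leb2 : sigma_finite setT (@leb2 R).
Proof.
exists (fun n => [set x : P | `|x - 0| <= n.+1%:R]).
  apply/esym/seteqP; split => // x _; have := archimedean.Num.Theory.archi_boundP (normr_ge0 x).
  by move=> h; exists (archimedean.Num.Def.archi_bound `|x|) => //=; rewrite subr0 (le_trans (ltW h)) // ler_nat.
move=> n; split; last by rewrite [X in (X < _)%E]leb2_box ?ltr0n // ltry.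
rewrite -[X in measurable X]setCK; apply: measurableC; apply: open_measurable_plane.
exact: closed_openC (@closed_box _ _ _).
Qed.

(** The sigma-finite structure under which Tonelli applies to pairs of points of the plane, in
    [convV_finite]. *)
Definition leb2sf : {sigma_finite_measure set pl -> \bar R} :=
  HB.pack (Measure.sort (@leb2 R)) (Measure_isSigmaFinite.Build _ _ _ (@leb2 R) sigma_finite_leb2).

(** Cauchy-Schwarz: the integral of [h * (g - m) ^+ 2] is a nonnegative quadratic polynomial in
    [m]. *)
Lemma jensen_sq (h g : P -> R) : (forall x, 0 <= h x) ->
  (@leb2 R).-integrable setT (EFin \o (h : pl -> R)) ->
  (@leb2 R).-integrable setT (EFin \o ((fun x => h x * g x) : pl -> R)) ->
  (@leb2 R).-integrable setT (EFin \o ((fun x => h x * g x ^+ 2) : pl -> R)) ->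
  (\int[leb2]_x (h x * g x)) ^+ 2 <= (\int[leb2]_x h x) * \int[leb2]_x (h x * g x ^+ 2).
Proof.
move=> h0 ih ihg ihg2.
set A := \int[leb2]_x h x; set B := \int[leb2]_x (h x * g x); set D := \int[leb2]_x (h x * g x ^+ 2).
have A0 : 0 <= A by apply: Rintegral_ge0.
have D0 : 0 <= D by apply: Rintegral_ge0 => x _; rewrite mulr_ge0 // sqr_ge0.
have Q (m : R) : 0 <= D - 2 * m * B + m ^+ 2 * A.
  have -> : D - 2 * m * B + m ^+ 2 * A = \int[leb2]_x (h x * (g x - m) ^+ 2).
    have i1 := integrable_scale (2 * m) ihg; have i2 := integrable_scale (m ^+ 2) ih.
    have i3 : (@leb2 R).-integrable setT (EFin \o ((fun x => h x * g x ^+ 2 - 2 * m * (h x * g x)) : pl -> R)).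
      exact: (integrableB measurableT ihg2 i1).
    rewrite /D /B /A -!RintegralZl // -RintegralB // -?RintegralD //.
    by apply: eq_Rintegral => x _; ring.
  by apply: Rintegral_ge0 => x _; rewrite mulr_ge0 // sqr_ge0.
have [A00|Ap] := eqVneq A 0.
  have : B = 0; last by move=> ->; rewrite A00 mul0r expr0n.
  apply/eqP; apply: contraT => B0.
  (* When [A = 0] the polynomial is affine in [m], and this value of [m] makes it equal to -1. *)
  have := Q ((D + 1) / B / 2); rewrite A00 mulr0 addr0.
  have -> : 2 * ((D + 1) / B / 2) * B = D + 1 by field.
  by lra.
have A1 : 0 < A by rewrite lt_neqAle eq_sym Ap.
have := Q (B / A); have -> : D - 2 * (B / A) * B + (B / A) ^+ 2 * A = D - B ^+ 2 / A by field.
by rewrite subr_ge0 ler_pdivrMr // mulrC.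
Qed.

Lemma measurable_omega_sub : measurable_fun setT (fun w : pl * pl => omega (w.1.1 - w.2.1, w.1.2 - w.2.2)).
Proof.
have m1 (p q : pl * pl -> measurableTypeR R) : measurable_fun setT p -> measurable_fun setT q ->
    measurable_fun setT (fun w => omega1 (p w - q w)).
  by move=> mp mq; apply: (measurableT_comp (@measurable_omega1 R)); exact: measurable_funB.
apply: measurable_funM; apply: m1.
- exact: (measurableT_comp measurable_fst measurable_fst).
- exact: (measurableT_comp measurable_fst measurable_snd).
- exact: (measurableT_comp measurable_snd measurable_fst).
- exact: (measurableT_comp measurable_snd measurable_snd).
Qed.

Lemma omega_le1 (x : P) : omega x <= 1.
Proof. by rewrite /omega mulr_ile1 ?omega1_ge0 // omega1_le1. Qed.

(** Common majorant of squared convolutions: bounded by the mass of [V], which gives pointwise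
    estimates, and integrable with [V], which gives L^2 ones. *)
Definition convV V (xi : P) : R := \int[leb2]_z (omega (xi - z) * V z).

Section ConvV.
Variable V : P -> R.
Hypothesis V0 : forall z, 0 <= V z.
Hypothesis iV : (@leb2 R).-integrable setT (EFin \o (V : pl -> R)).

Let mV : measurable_fun setT (V : pl -> R).
Proof. by case/integrableP: iV => /measurable_EFinP. Qed.

Lemma measurable_omega_shift (xi : P) : measurable_fun setT ((fun z => omega (xi - z)) : pl -> R).
Proof.
exact: (measurableT_comp measurable_omega_sub (pair1_measurable (xi : pl))).
Qed.

Lemma integrable_omegaV xi : (@leb2 R).-integrable setT (EFin \o ((fun z => omega (xi - z) * V z) : pl -> R)).
Proof.
refine (@le_integrable_real R _ pl leb2 _ V _ iV _).
  by apply: measurable_funM => //; exact: measurable_omega_shift.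
by move=> x; rewrite normrM !ger0_norm ?omega_ge0 // ler_piMl // omega_le1.
Qed.

Lemma convV_ge0 xi : 0 <= convV V xi.
Proof. by apply: Rintegral_ge0 => z _; rewrite mulr_ge0 ?omega_ge0. Qed.

Lemma convV_le xi : convV V xi <= \int[leb2]_z V z.
Proof.
apply: le_Rintegral => //; first exact: integrable_omegaV.
by move=> z _; rewrite ler_piMl // omega_le1.
Qed.

Lemma integrable_omega_shift xi : (@leb2 R).-integrable setT (EFin \o ((fun z => omega (xi - z)) : pl -> R)) /\
  \int[leb2]_z omega (xi - z) = \int[leb2]_z omega z.
Proof.
have n1 : (-1 : R) != 0 by rewrite oppr_eq0 oner_neq0.
have p1 : 0 < `|-1 : R| * `|-1 : R| by rewrite normrN1 mulr1.
have S := @ge0_integral_affine2 R (-1) (-1) xi.1 xi.2 0 n1 n1.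
have M := @measurable_affine2 R (-1) (-1) xi.1 xi.2 0.
have E : (omega \o affine2 (-1) (-1) xi.1 xi.2 0 : pl -> R) = (fun z => omega (xi - z)).
  apply/funext => z; rewrite /affine2 /= /omega /=; congr (omega1 _ * omega1 _); ring.
split; first by rewrite -E; exact: (integrable_subst p1 M S integrable_omega).
rewrite [RHS](Rint_subst p1 M S integrable_omega) normrN1 !mul1r.
by apply: eq_Rintegral => z _; exact: (esym (congr1 (fun q : pl -> R => q z) E)).
Qed.

Lemma convV_finite : measurable_fun setT (convV V : pl -> R) /\
  (\int[@leb2 R]_xi (convV V xi)%:E < +oo)%E.
Proof.
pose G (w : pl * pl) : \bar R := (omega (w.1.1 - w.2.1, w.1.2 - w.2.2) * V w.2)%:E.
have mG : measurable_fun setT G.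
  apply/measurable_EFinP; apply: measurable_funM; first exact: measurable_omega_sub.
  exact: (measurableT_comp mV measurable_snd).
have G0 w : (0 <= G w)%E by rewrite lee_fin mulr_ge0 ?omega_ge0.
pose m2 := leb2sf.
have E xi : (convV V xi)%:E = fubini_F m2 G xi.
  by rewrite /convV /Rintegral fineK //; exact: (integrable_fin_num measurableT (integrable_omegaV xi)).
have F1 := measurable_fun_fubini_tonelli_F (m2 := m2) _ mG G0.
split; first by apply/measurable_EFinP; rewrite (_ : EFin \o _ = fubini_F m2 G) //; apply/funext => xi; exact: E.
rewrite (eq_integral (fubini_F m2 G)); last by move=> xi _; exact: E.
rewrite -[X in (X < _)%E](fubini_tonelli1 (m1 := m2) _ mG G0) (fubini_tonelli2 _ mG G0).
apply: (@le_lt_trans _ _ (\int[m2]_z ((\int[leb2]_w omega w) * V z)%:E)%E).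
  apply: ge0_le_integral => //.
  - by move=> z _; apply: integral_ge0 => w _; exact: G0.
  - exact: (measurable_fun_fubini_tonelli_G _ mG G0).
  - by apply/measurable_EFinP; exact: measurable_funM.
  move=> z _; rewrite /fubini_G /G /=.
  have [i1 i2] := integrable_omega_shift z.
  rewrite (eq_integral (fun x : pl => (V z)%:E * (omega (z - x))%:E)%E); last first.
    move=> x _; rewrite -EFinM mulrC; congr (_ * _)%:E.
    by rewrite /omega /omega1 /= -(opprB z.1) -(opprB z.2) !sqrrN.
  rewrite integralZl // EFinM muleC; apply: lee_wpmul2r; first by rewrite lee_fin.
  by rewrite -i2 /Rintegral fineK // (integrable_fin_num measurableT i1).
have : m2.-integrable setT (EFin \o ((fun z => (\int[leb2]_w omega w) * V z) : pl -> R)).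
  exact: (integrable_scale (mu := leb2) (\int[leb2]_w omega w) iV).
move=> /integrableP[_]; apply: le_lt_trans; apply: ge0_le_integral => //.
- move=> z _; rewrite lee_fin mulr_ge0 //; apply: Rintegral_ge0 => w _; exact: omega_ge0.
- by apply/measurable_EFinP; exact: measurable_funM.
- by apply: measurableT_comp => //; apply/measurable_EFinP; exact: measurable_funM.
- by move=> z _; exact: lee_abs.
Qed.

End ConvV.

Section Domination.
Variables (Ph : P -> R[i]) (kap : P -> R) (b : bool) (r s d d' p : R).
Hypothesis gPh : pgrowth Ph.
Hypothesis kap0 : forall y, 0 <= kap y.
Hypothesis mkap : measurable_fun setT (kap : pl -> R).
Hypothesis rkap : forall n, exists2 C : R, 0 <= C & forall y, (1 + `|y|) ^+ n * kap y <= C * omega y.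
Hypothesis r0 : r != 0.
Hypothesis d0 : 0 < d.
Hypothesis dd' : d < d'.

(* The summand [omega] absorbs the rapidly decreasing contributions from outside the cone. *)
Definition coneV (z : P) : R :=
  omega z + \1_(scone b r s d') z * ((1 + `|z|) `^ p * cabs (Ph z) ^+ 2).

Lemma coneV_ge0 z : 0 <= coneV z.
Proof. apply: addr_ge0; first exact: omega_ge0.
by apply: mulr_ge0; [rewrite indicE ler0n|apply: mulr_ge0; [exact: powR_ge0|exact: sqr_ge0]]. Qed.

(** For [z] in the larger cone, Peetre's inequality moves the weight from [xi] to [z] at the price
    of powers of [1 + |xi - z|]. For the other [z], [scone_sep] bounds [|xi|], hence [|z|], by
    [|xi - z|], and the decay of [kap] absorbs the weight and the growth of [Ph]. *)
Lemma kernel_split_bound : exists2 C : R, 0 <= C & forall xi z, scone b r s d xi ->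
  (1 + `|xi|) `^ p * (kap (xi - z) * cabs (Ph z)) ^+ 2 <= C * (omega (xi - z)) ^+ 2 * coneV z.
Proof.
have [c c0 sep] := scone_sep b s r0 d0 dd'.
have [_ [q [D HD]]] := gPh.
pose Pn := archimedean.Num.Def.archi_bound `|p|.
have pPn : `|p| <= Pn%:R by apply: ltW; exact: archimedean.Num.Theory.archi_boundP.
(* [Pn] powers pay for the weight, [4 * q] for the growth of [|Ph z| ^+ 2] and 8 for [1 / omega z],
   since [1 + |z|] is at most quadratic in [1 + |xi - z|] outside the cone. *)
pose n := (Pn + (q * 4 + 8))%N.
have [C C0 HC] := rkap n.
pose A : R := 1 + c^-1; have A1 : 1 <= A by rewrite lerDl invr_ge0 ltW.
have A0 : 0 <= A by exact: le_trans A1.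
have j1 (x : P) : 1 <= 1 + `|x| by exact: jnorm_ge1.
have j0 (x : P) : 0 <= 1 + `|x| by exact: ltW (jnorm_gt0 x).
have jP (x : P) (e : R) : e <= Pn%:R -> (1 + `|x|) `^ e <= (1 + `|x|) ^+ Pn.
  by move=> eP; rewrite -powR_nat ?jnorm_gt0 //; apply: ler_powR.
pose E : R := A ^+ Pn * (D ^+ 2 * A ^+ (q * 2)) * A ^+ 4.
have E0 : 0 <= E by apply: mulr_ge0; [apply: mulr_ge0; [|apply: mulr_ge0; [exact: sqr_ge0|]]|]; exact: exprn_ge0.
exists ((1 + E) * C ^+ 2); first by rewrite mulr_ge0 ?sqr_ge0 // addr_ge0.
move=> xi z hxi; set y := xi - z.
have K : ((1 + `|y|) ^+ n * kap y) ^+ 2 <= C ^+ 2 * omega y ^+ 2.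
  by rewrite -exprMn; apply: ler_Xn; [apply: mulr_ge0; [exact: exprn_ge0|]|exact: HC].
have K' m : (m <= n)%N -> (1 + `|y|) ^+ m * kap y ^+ 2 <= C ^+ 2 * omega y ^+ 2.
  move=> mn; apply: le_trans K; rewrite exprMn ler_wpM2r ?sqr_ge0 // -exprM.
  by apply: ler_weXn2l => //; rewrite (leq_trans mn) // leq_pmulr.
have W0 : 0 <= C ^+ 2 * omega y ^+ 2 by rewrite mulr_ge0 ?sqr_ge0.
have V0 := coneV_ge0 z.
set jy := 1 + `|y| in K K' *; have jy0 : 0 <= jy by exact: j0.
set X := _ `^ p; set kk := kap y ^+ 2 in K' *; set G := cabs (Ph z) ^+ 2.
have kk0 : 0 <= kk by exact: sqr_ge0.
have G0 : 0 <= G by exact: sqr_ge0.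
have X0 : 0 <= X by exact: powR_ge0.
rewrite exprMn -/kk -/G -[(1 + E) * _ * _]mulrA.
have [hz|hz] := pselect (scone b r s d' z).
  have hV : (1 + `|z|) `^ p * G <= coneV z.
    by rewrite /coneV indicE mem_set // mul1r lerDr omega_ge0.
  have hX : X <= (1 + `|z|) `^ p * jy ^+ Pn.
    by apply: le_trans (peetre p xi z) _; rewrite ler_wpM2l ?powR_ge0 //; exact: jP.
  apply: (@le_trans _ _ ((jy ^+ Pn * kk) * ((1 + `|z|) `^ p * G))).
    have -> : jy ^+ Pn * kk * ((1 + `|z|) `^ p * G) = ((1 + `|z|) `^ p * jy ^+ Pn) * (kk * G) by ring.
    by rewrite ler_wpM2r // mulr_ge0.
  apply: ler_pM => //; [by apply: mulr_ge0 => //; exact: exprn_ge0|by apply: mulr_ge0 => //; exact: powR_ge0|].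
  apply: le_trans (K' Pn (leq_addr _ _)) _.
  by rewrite mulrDl mul1r lerDl mulr_ge0.
have hxi2 : 1 + `|xi| <= A * jy.
  have := sep _ _ hxi hz; rewrite -/y mulrC -ler_pdivlMr // => h.
  rewrite /A /jy mulrDl mul1r mulrDr mulr1 [c^-1 * _]mulrC.
  have := normr_ge0 y; have : 0 <= c^-1 by rewrite invr_ge0 ltW.
  lra.
have hz2 : 1 + `|z| <= A * jy ^+ 2.
  apply: le_trans (jnorm_submult z xi) _; rewrite expr2 mulrA ler_pM //.
  by rewrite -normrN opprB.
have hX : X <= A ^+ Pn * jy ^+ Pn.
  apply: (@le_trans _ _ ((1 + `|xi|) ^+ Pn)); first by apply: jP; apply: le_trans pPn; exact: ler_norm.
  by rewrite -exprMn; exact: ler_Xn.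
have hG : G <= D ^+ 2 * A ^+ (q * 2) * jy ^+ (q * 4).
  have -> : D ^+ 2 * A ^+ (q * 2) * jy ^+ (q * 4) = (D * (A * jy ^+ 2) ^+ q) ^+ 2.
    by rewrite exprMn -exprM exprMn -exprM mulrA mulnCA.
  have D0 : 0 <= D.
    by have := le_trans (cabs_ge0 _) (HD 0); rewrite normr0 addr0 expr1n mulr1.
  apply: ler_Xn; first exact: cabs_ge0.
  by apply: le_trans (HD z) _; apply: ler_wpM2l => //; exact: ler_Xn.
have h1 : 1 <= omega z * (A ^+ 4 * jy ^+ 8).
  rewrite mulrC -ler_pdivrMr ?omega_gt0 // mul1r; apply: le_trans (omegaV_le z) _.
  have -> : A ^+ 4 * jy ^+ 8 = (A * jy ^+ 2) ^+ 4 by rewrite exprMn -exprM.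
  exact: ler_Xn.
have hVz : omega z <= coneV z.
  rewrite lerDl; apply: mulr_ge0; first by rewrite indicE ler0n.
  by apply: mulr_ge0 => //; exact: powR_ge0.
apply: (@le_trans _ _ ((A ^+ Pn * jy ^+ Pn) * (kk * (D ^+ 2 * A ^+ (q * 2) * jy ^+ (q * 4))) *
   (omega z * (A ^+ 4 * jy ^+ 8)))).
  rewrite -[leLHS]mulr1; apply: ler_pM => //; first by apply: mulr_ge0 => //; exact: mulr_ge0.
  by apply: ler_pM => //; [exact: mulr_ge0|exact: ler_wpM2l].
have -> : (A ^+ Pn * jy ^+ Pn) * (kk * (D ^+ 2 * A ^+ (q * 2) * jy ^+ (q * 4))) *
   (omega z * (A ^+ 4 * jy ^+ 8)) = E * (jy ^+ n * kk) * omega z.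
  rewrite /E /n !exprD; set a1 := A ^+ Pn; set a2 := A ^+ (q * 2); set a3 := A ^+ 4.
  set b1 := jy ^+ Pn; set b2 := jy ^+ (q * 4); set b3 := jy ^+ 8; set dd := D ^+ 2.
  by move: a1 a2 a3 b1 b2 b3 dd => a1 a2 a3 b1 b2 b3 dd; ring.
apply: ler_pM => //; [by do 2 apply: mulr_ge0 => //; exact: exprn_ge0|exact: omega_ge0|].
rewrite mulrDl mul1r; apply: (@le_trans _ _ (E * (C ^+ 2 * omega y ^+ 2))); last by rewrite lerDr.
by rewrite ler_wpM2l // K'.
Qed.

Lemma measurable_coneV : measurable_fun setT (coneV : pl -> R).
Proof.
have [mP _] := gPh.
apply: measurable_funD; first exact: measurable_omega.
apply: measurable_funM; first by apply: measurable_indic; apply: open_measurable_plane; exact: open_scone.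
apply: measurable_funM; last by apply: measurable_funX; exact: cmeas_cabs.
apply: (measurableT_comp (@measurable_powR R p)); apply: continuous_measurable_plane => z.
by apply: cvgD; [exact: cvg_cst|exact: continuous_norm_plane].
Qed.

Hypothesis iV : (@leb2 R).-integrable setT (EFin \o (coneV : pl -> R)).

(** The square root of [kernel_split_bound] is integrated in [z], and [jensen_sq] with the weight
    [omega (xi - z)] brings the square back inside the integral. *)
Lemma cone_conv_bound : exists2 C : R, 0 <= C & forall xi, scone b r s d xi ->
  (1 + `|xi|) `^ p * (\int[leb2]_z (kap (xi - z) * cabs (Ph z))) ^+ 2 <= C * convV coneV xi.
Proof.
have [C C0 HC] := kernel_split_bound; have [mP _] := gPh.
exists (C * \int[leb2]_z omega z); first by apply: mulr_ge0 => //; apply: Rintegral_ge0 => z _; exact: omega_ge0.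
move=> xi hxi; have j0 : 0 < (1 + `|xi|) `^ p by rewrite powR_gt0 // jnorm_gt0.
pose K := Num.sqrt (C / (1 + `|xi|) `^ p).
pose sV z := Num.sqrt (coneV z).
have sV2 z : sV z ^+ 2 = coneV z by rewrite sqr_sqrtr // coneV_ge0.
have K2 : K ^+ 2 = C / (1 + `|xi|) `^ p by rewrite sqr_sqrtr // divr_ge0 // ltW.
have K0 : 0 <= K by exact: sqrtr_ge0.
have pt z : kap (xi - z) * cabs (Ph z) <= K * (omega (xi - z) * sV z).
  have p1 : 0 <= kap (xi - z) * cabs (Ph z) by rewrite mulr_ge0 ?cabs_ge0.
  have p2 : 0 <= K * (omega (xi - z) * sV z) by do 2 apply: mulr_ge0 => //; [exact: omega_ge0|exact: sqrtr_ge0].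
  rewrite -(@ler_pXn2r _ 2) //.
  have -> : (K * (omega (xi - z) * sV z)) ^+ 2 = C * omega (xi - z) ^+ 2 * coneV z / (1 + `|xi|) `^ p.
    by rewrite !exprMn K2 sV2; ring.
  by rewrite ler_pdivlMr // mulrC; exact: HC.
have [io ioE] := integrable_omega_shift xi.
have iov := integrable_omegaV coneV_ge0 iV xi.
have mo := measurable_omega_shift xi.
have msV : measurable_fun setT (sV : pl -> R).
  apply: (measurableT_comp (f := @Num.sqrt R) _ measurable_coneV).
  exact: continuous_measurable_fun (@sqrt_continuous R).
have bnd u : `|omega (xi - u) * sV u| <= omega (xi - u) + omega (xi - u) * coneV u.
  have s0 : 0 <= sV u by exact: sqrtr_ge0.
  have o0 := omega_ge0 (xi - u); rewrite ger0_norm; last exact: mulr_ge0.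
  have -> : omega (xi - u) + omega (xi - u) * coneV u = omega (xi - u) * (1 + coneV u) by ring.
  apply: ler_wpM2l => //; have := sqr_ge0 (sV u - 1); rewrite sqrrB sV2 expr1n mulr1.
  by have := coneV_ge0 u; lra.
have ios : (@leb2 R).-integrable setT (EFin \o ((fun z => omega (xi - z) * sV z) : pl -> R)).
  have ms : measurable_fun setT ((fun z => omega (xi - z) * sV z) : pl -> R) by exact: measurable_funM.
  exact: (@le_integrable_real R _ pl leb2 _ (fun z => omega (xi - z) + omega (xi - z) * coneV z) ms (integrableD measurableT io iov) bnd).
have mks : measurable_fun setT ((fun z => kap (xi - z)) : pl -> R).
  have n1 := (@measurable_affine2 R (-1) (-1) xi.1 xi.2 0).
  have -> : (fun z : P => kap (xi - z)) = (fun z : P => kap (affine2 (-1) (-1) xi.1 xi.2 0 z)).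
    apply/funext; case=> z1 z2; rewrite /affine2 /=; congr (kap _).
    by case: (xi) => x1 x2 /=; congr (_, _) => /=; ring.
  exact: (measurableT_comp mkap n1).
have iks : (@leb2 R).-integrable setT (EFin \o ((fun z => kap (xi - z) * cabs (Ph z)) : pl -> R)).
  have ms : measurable_fun setT ((fun z => kap (xi - z) * cabs (Ph z)) : pl -> R).
    by apply: measurable_funM => //; exact: cmeas_cabs.
  have bnd2 z : `|kap (xi - z) * cabs (Ph z)| <= K * (omega (xi - z) * sV z).
    by rewrite ger0_norm // mulr_ge0 ?cabs_ge0.
  exact: (@le_integrable_real R _ pl leb2 _ (fun z => K * (omega (xi - z) * sV z)) ms (integrable_scale K ios) bnd2).
have le1 : \int[leb2]_z (kap (xi - z) * cabs (Ph z)) <= K * \int[leb2]_z (omega (xi - z) * sV z).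
  rewrite -RintegralZl //; apply: le_Rintegral => //.
  exact: integrable_scale ios.
have o0 : 0 <= \int[leb2]_z (kap (xi - z) * cabs (Ph z)).
  by apply: Rintegral_ge0 => z _; rewrite mulr_ge0 ?cabs_ge0.
have j2 := @jensen_sq (fun z => omega (xi - z)) sV (fun z => omega_ge0 _) io ios.
have E2 : (fun z => omega (xi - z) * sV z ^+ 2) = (fun z => omega (xi - z) * coneV z).
  by apply/funext => z; rewrite sV2.
rewrite E2 ioE in j2; have {}j2 := j2 iov.
rewrite -/(convV coneV xi) in j2.
apply: (@le_trans _ _ ((1 + `|xi|) `^ p * (K ^+ 2 * ((\int[leb2]_z omega z) * convV coneV xi)))).
  apply: ler_wpM2l; first exact: ltW.
  apply: le_trans (ler_Xn 2 o0 le1) _; rewrite exprMn; apply: ler_wpM2l => //; exact: sqr_ge0.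
by rewrite K2 mulrA [X in X * _]mulrC divfK ?gt_eqF // mulrA.
Qed.

End Domination.
End Convolution.

(** * Rapid decay in a cone and its effect on the transform *)

Section ConeRapid.
Context {R : realType}.
Local Notation P := (R * R)%type.
Local Notation pl := (measurableTypeR R * measurableTypeR R)%type.
Variables (Omega : set P) (f : functional R).
Hypothesis f_dist : is_distribution Omega f.

Definition cone_rapid (S : set P) (Ph : P -> R[i]) := forall n : nat, exists2 C : R, 0 <= C &
  forall xi, S xi -> (1 + `|xi|) ^+ n * cabs (Ph xi) <= C.

Lemma cone_rapid_coneV b r s d p Ph : pgrowth Ph -> cone_rapid (scone b r s d) Ph ->
  (@leb2 R).-integrable setT (EFin \o (coneV Ph b r s d p : pl -> R)).
Proof.
move=> gP H; pose Pn := archimedean.Num.Def.archi_bound `|p|.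
have pPn : p <= Pn%:R.
  by apply: le_trans (ler_norm p) _; apply: ltW; exact: archimedean.Num.Theory.archi_boundP.
have [C C0 HC] := H (Pn + 4)%N.
refine (@le_integrable_real R _ pl leb2 _ (fun z => (1 + C ^+ 2) * omega z) _ (integrable_scale _ integrable_omega) _).
  exact: measurable_coneV.
move=> z; rewrite ger0_norm ?coneV_ge0 // mulrDl mul1r /coneV lerD2l indicE.
case: (boolP (z \in _)) => [|_]; last by rewrite mul0r mulr_ge0 ?sqr_ge0 ?omega_ge0.
rewrite inE mul1r => hz; have j1 := jnorm_ge1 z; have j0 := ltW (jnorm_gt0 z).
rewrite -ler_pdivrMr ?omega_gt0 //.
apply: (@le_trans _ _ (((1 + `|z|) ^+ (Pn + 4) * cabs (Ph z)) ^+ 2)); last first.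
  by apply: ler_Xn; [rewrite mulr_ge0 ?cabs_ge0 ?exprn_ge0|exact: HC].
rewrite exprMn mulrAC ler_wpM2r ?sqr_ge0 // -exprM.
apply: (@le_trans _ _ ((1 + `|z|) ^+ Pn * (1 + `|z|) ^+ 4)).
  apply: ler_pM; [exact: powR_ge0|by rewrite invr_ge0 omega_ge0| |exact: omegaV_le].
  by rewrite -powR_nat ?jnorm_gt0 //; apply: ler_powR.
by rewrite -exprD; apply: ler_weXn2l => //; rewrite leq_pmulr.
Qed.

(** The factor [1 + |y|] anticipates the commutator of [key_inequality], which produces [|xi - z|];
    the same kernel then serves all estimates. *)
Lemma rapid_kap (tau : P -> R[i]) : smooth_cpt tau -> forall n, exists2 C : R, 0 <= C &
  forall y, (1 + `|y|) ^+ n * ((1 + `|y|) * cabs (FT tau y)) <= C * omega y.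
Proof.
move=> st n; have [C C0 H] := rapid_le n.+1 (FT_rapid st); exists C => // y.
by rewrite mulrA -exprSr.
Qed.

Lemma measurable_kap (tau : P -> R[i]) : smooth_cpt tau ->
  measurable_fun setT ((fun y => (1 + `|y|) * cabs (FT tau y)) : pl -> R).
Proof.
move=> st; have [m _] := FT_rapid st; apply: measurable_funM; last exact: cmeas_cabs.
apply: continuous_measurable_plane => z.
by apply: cvgD; [exact: cvg_cst|exact: continuous_norm_plane].
Qed.

Lemma kap_ge0 (tau : P -> R[i]) y : 0 <= (1 + `|y|) * cabs (FT tau y).
Proof. by rewrite mulr_ge0 ?cabs_ge0 // ltW ?jnorm_gt0. Qed.

Lemma integrable_kap (tau : P -> R[i]) (Ph : P -> R[i]) xi : smooth_cpt tau -> pgrowth Ph ->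
  (@leb2 R).-integrable setT (EFin \o ((fun z => (1 + `|xi - z|) * cabs (FT tau (xi - z)) * cabs (Ph z)) : pl -> R)).
Proof.
move=> st [mP [q [D HD]]]; have [C C0 HC] := rapid_kap st q.
have [io _] := integrable_omega_shift xi.
have D0 : 0 <= D by have := le_trans (cabs_ge0 _) (HD 0); rewrite normr0 addr0 expr1n mulr1.
have mk : measurable_fun setT ((fun z => (1 + `|xi - z|) * cabs (FT tau (xi - z))) : pl -> R).
  have n1 := (@measurable_affine2 R (-1) (-1) xi.1 xi.2 0).
  have -> : (fun z : P => (1 + `|xi - z|) * cabs (FT tau (xi - z))) =
      (fun z : P => (fun y => (1 + `|y|) * cabs (FT tau y)) (affine2 (-1) (-1) xi.1 xi.2 0 z)).
    apply/funext; case=> z1 z2.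
    have -> : affine2 (-1) (-1) xi.1 xi.2 0 (z1, z2) = xi - (z1, z2); last by [].
    by rewrite /affine2 /=; case: (xi) => x1 x2 /=; congr (_, _) => /=; ring.
  exact: (measurableT_comp (measurable_kap st) n1).
have ms : measurable_fun setT ((fun z => (1 + `|xi - z|) * cabs (FT tau (xi - z)) * cabs (Ph z)) : pl -> R).
  by apply: measurable_funM => //; exact: cmeas_cabs.
refine (@le_integrable_real R _ pl leb2 _ (fun z => D * (1 + `|xi|) ^+ q * C * omega (xi - z)) ms (integrable_scale _ io) _).
move=> z; rewrite ger0_norm ?mulr_ge0 ?cabs_ge0 ?(ltW (jnorm_gt0 _)) //.
set y := xi - z; have jy := ltW (jnorm_gt0 y); have jx := ltW (jnorm_gt0 xi).
apply: (@le_trans _ _ ((1 + `|y|) * cabs (FT tau y) * (D * ((1 + `|xi|) ^+ q * (1 + `|y|) ^+ q)))).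
  apply: ler_wpM2l; first by rewrite mulr_ge0 ?cabs_ge0.
  apply: le_trans (HD z) _; apply: ler_wpM2l => //; rewrite -exprMn; apply: ler_Xn; first exact: ltW (jnorm_gt0 z).
  by apply: le_trans (jnorm_submult z xi) _; rewrite -[`|z - xi|]normrN opprB.
have -> : (1 + `|y|) * cabs (FT tau y) * (D * ((1 + `|xi|) ^+ q * (1 + `|y|) ^+ q)) =
  D * (1 + `|xi|) ^+ q * ((1 + `|y|) ^+ q * ((1 + `|y|) * cabs (FT tau y))) by ring.
by rewrite -[leRHS]mulrA; apply: ler_wpM2l; [rewrite mulr_ge0 ?exprn_ge0|exact: HC].
Qed.

Lemma cabs_Phi_conv phi tau xi : test_fun Omega phi -> smooth_cpt tau -> (forall x, phi x * tau x = tau x) ->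
  cabs (Phi f tau xi) <= \int[leb2]_z ((1 + `|xi - z|) * cabs (FT tau (xi - z)) * cabs (Phi f phi z)).
Proof.
move=> tphi st pt; rewrite (Phi_conv f_dist xi tphi st pt).
have gP := pgrowth_Phi f_dist tphi; have [mP _] := gP.
apply: Cint_abs_le.
- apply: cmeasM => //.
  have n1 := (@measurable_affine2 R (-1) (-1) xi.1 xi.2 0).
  have E z : affine2 (-1) (-1) xi.1 xi.2 0 z = xi - z.
    by case: z => z1 z2; rewrite /affine2 /=; case: (xi) => x1 x2 /=; congr (_, _) => /=; ring.
  have [[m1 m2] _] := FT_rapid st; split.
    by have := measurableT_comp m1 n1; congr (measurable_fun _ _); apply/funext => z; rewrite /= E.
  by have := measurableT_comp m2 n1; congr (measurable_fun _ _); apply/funext => z; rewrite /= E.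
- exact: integrable_kap.
- move=> z; rewrite cabsM ler_wpM2r ?cabs_ge0 // ler_peMl ?cabs_ge0 //.
  exact: jnorm_ge1.
Qed.

(** Convolution with [FT tau] turns an integral bound into a supremum bound, because [convV] is at
    most the total mass. *)
Lemma cone_pointwise phi tau b r s d d' p : test_fun Omega phi -> smooth_cpt tau ->
  (forall x, phi x * tau x = tau x) -> r != 0 -> 0 < d -> d < d' ->
  (@leb2 R).-integrable setT (EFin \o (coneV (Phi f phi) b r s d' p : pl -> R)) ->
  exists2 C : R, 0 <= C & forall xi, scone b r s d xi -> (1 + `|xi|) `^ p * cabs (Phi f tau xi) ^+ 2 <= C.
Proof.
move=> tphi st pt r0 d0 dd' iV; have gP := pgrowth_Phi f_dist tphi.
have [C C0 H] := cone_conv_bound gP (kap_ge0 tau) (measurable_kap st) (rapid_kap st) r0 d0 dd' iV.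
exists (C * \int[leb2]_z coneV (Phi f phi) b r s d' p z).
  by rewrite mulr_ge0 //; apply: Rintegral_ge0 => z _; exact: coneV_ge0.
move=> xi hxi; apply: le_trans (le_trans (H xi hxi) _); last first.
  apply: ler_wpM2l => //; apply: convV_le => //; exact: coneV_ge0.
rewrite ler_wpM2l ?powR_ge0 //; apply: ler_Xn; first exact: cabs_ge0.
exact: cabs_Phi_conv.
Qed.

Lemma cone_rapid_of_L2 phi tau b r s d d' : test_fun Omega phi -> smooth_cpt tau ->
  (forall x, phi x * tau x = tau x) -> r != 0 -> 0 < d -> d < d' ->
  (forall n : nat, (@leb2 R).-integrable setT (EFin \o (coneV (Phi f phi) b r s d' n%:R : pl -> R))) ->
  cone_rapid (scone b r s d) (Phi f tau).
Proof.
move=> tphi st pt r0 d0 dd' iV n.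
have [C C0 H] := cone_pointwise tphi st pt r0 d0 dd' (iV (n * 2)%N).
exists (1 + C); first by rewrite addr_ge0.
move=> xi hxi; have := H xi hxi; rewrite powR_nat ?jnorm_gt0 // exprM -exprMn.
(* The exponent was doubled to bound [y ^+ 2]; then [y <= 1 + y ^+ 2]. *)
set y := _ * cabs _ => h; have := sqr_ge0 (y - 1); rewrite sqrrB expr1n mulr1.
by have : 0 <= y by [rewrite mulr_ge0 ?cabs_ge0 // exprn_ge0 // ltW ?jnorm_gt0]; lra.
Qed.

Lemma cone_rapid_shrink phi tau b r s d d' : test_fun Omega phi -> smooth_cpt tau ->
  (forall x, phi x * tau x = tau x) -> r != 0 -> 0 < d -> d < d' ->
  cone_rapid (scone b r s d') (Phi f phi) -> cone_rapid (scone b r s d) (Phi f tau).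
Proof.
move=> tphi st pt r0 d0 dd' H; apply: (cone_rapid_of_L2 tphi st pt r0 d0 dd') => n.
by apply: cone_rapid_coneV => //; exact: (pgrowth_Phi f_dist tphi).
Qed.

Variables (psi1 psi1h psi2 psi2h : R -> R[i]) (psi : P -> R[i]).
Hypothesis hpsi : shearlet_generator psi1 psi1h psi2 psi2h psi.
Local Notation hpsihat := (hpsihat psi1h psi2h).
Local Notation Kast := (Kast psi1h psi2h).
Local Notation Gb := (Gb psi1h psi2h f).

Lemma hpsihat_bounded : exists2 B : R, 0 <= B & forall z, cabs (hpsihat z) <= B.
Proof.
have [_ /(_ 0%N)[B HB]] := smooth_cpt_rapid (smooth_cpt_hpsihat hpsi).
have {}HB z : cabs (hpsihat z) <= B by have := HB z; rewrite expr0 mul1r.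
by exists B => //; exact: le_trans (cabs_ge0 _) (HB 0).
Qed.

Lemma Kast_supp b a s t z : 0 < a -> Kast b a s t z != 0 ->
  [/\ 2^-1 <= a * `|(jb b z).1|, a * `|(jb b z).1| <= 2 &
      `|(jb b z).2 - s * (jb b z).1| <= Num.sqrt a * `|(jb b z).1|].
Proof.
move=> a0; have s0 : 0 < Num.sqrt a by rewrite sqrtr_gt0.
rewrite /Kast !mulf_eq0 !negb_or => /andP[_ /andP[h _]].
have := hpsihat_supp hpsi h; rewrite MTE /= !normrM !(gtr0_norm a0) (gtr0_norm s0) => -[h1 h2 h3].
split => //; rewrite -(ler_pM2l s0) mulrA -expr2 sqr_sqrtr // ltW //.
Qed.

(** The window of a shearlet meets both half-planes, hence the hypotheses on the cones of [r] and
    [- r]. For small [a] and slopes near [s] the window lies in their union. *)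
Lemma cone_rapid_decays b r s0 d phi s k x : test_fun Omega phi -> 0 < d ->
  cone_rapid (scone b r s0 d) (Phi f phi) -> cone_rapid (scone b (- r) s0 d) (Phi f phi) -> r != 0 ->
  `|s - s0| < d / 4 -> decays (Gb b phi) k s x.
Proof.
move=> tphi d0 H1 H2 r0 ss0.
have [B B0 HB] := hpsihat_bounded.
pose n := archimedean.Num.Def.archi_bound `|k|.
have kn : k <= n%:R.
  by apply: le_trans (ler_norm k) _; apply: ltW; exact: archimedean.Num.Theory.archi_boundP.
have [C1 C10 HC1] := H1 (n + 4)%N; have [C2 C20 HC2] := H2 (n + 4)%N.
pose C := C1 + C2 + 1; have C0 : 0 < C by rewrite /C; lra.
pose I := \int[@leb2 R]_z omega z.
have I0 : 0 <= I by apply: Rintegral_ge0 => z _; exact: omega_ge0.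
pose e := d / 4; have e0 : 0 < e by rewrite divr_gt0.
(* [e ^+ 2] ensures [sqrt a < e]. The three deviations [|s' - s|], [|s - s0|] and [sqrt a] are each
   at most [d / 4], which keeps the window within slope distance [d] of [s0]. *)
exists (Num.min 1 (Num.min e (e ^+ 2))), (1 + B * C * 2 ^+ n * I); split.
- by rewrite !lt_min ltr01 e0 exprn_gt0.
- by rewrite ltr_pwDl //; do 2 (apply: mulr_ge0; last by rewrite ?exprn_ge0); exact: mulr_ge0 B0 (ltW C0).
move=> a s' t; rewrite !lt_min => /andP[a0 /andP[a1 /andP[_ ae]]] /andP[_ /andP[ss' _]] _.
have sa : Num.sqrt a < e by rewrite -[ltRHS]gtr0_norm // -sqrtr_sqr ltr_sqrt // exprn_gt0.
have a34 : a `^ (3 / 4) <= 1 by rewrite -[leRHS](powRr0 a); apply: ger_powR; rewrite ?a0 ?(ltW a1) //.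
have BC0 : 0 <= B * C * 2 ^+ n by apply: mulr_ge0; [exact: mulr_ge0 B0 (ltW C0)|exact: exprn_ge0].
have an0 : 0 <= a ^+ n by rewrite exprn_ge0 // ltW.
have pt z : cabs (Kast b a s' t z * Phi f phi z) <= B * C * 2 ^+ n * a ^+ n * omega z.
  have [->|K0] := eqVneq (Kast b a s' t z) 0.
    by rewrite mul0r cabs0; apply: mulr_ge0; [exact: mulr_ge0|exact: omega_ge0].
  have [h1 h2 h3] := Kast_supp a0 K0; set z1 := (jb b z).1 in h1 h2 h3; set z2 := (jb b z).2 in h3.
  have z10 : 0 < `|z1|.
    by rewrite -(pmulr_rgt0 _ a0); apply: lt_le_trans h1; rewrite invr_gt0.
  have K1 : cabs (Kast b a s' t z) <= B.
    rewrite /Kast cabsM cabs_real ger0_norm ?powR_ge0 // cabsM cabsJ cabs_ew mulr1.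
    by rewrite -[leRHS]mul1r ler_pM ?powR_ge0 ?cabs_ge0.
  have hs : `|z2 - s0 * z1| < d * `|z1|.
    have -> : z2 - s0 * z1 = (z2 - s' * z1) + (s' - s) * z1 + (s - s0) * z1 by ring.
    rewrite (le_lt_trans (ler_normD _ _)) // (le_lt_trans (lerD (ler_normD _ _) (lexx _))) // !normrM.
    have u1 : `|s' - s| * `|z1| <= e * `|z1| by rewrite ler_wpM2r // ltW.
    have u2 : `|s - s0| * `|z1| <= e * `|z1| by rewrite ler_wpM2r // ltW.
    have u3 : Num.sqrt a * `|z1| <= e * `|z1| by rewrite ler_wpM2r // ltW.
    have : 0 < e * `|z1| by rewrite mulr_gt0.
    have -> : d * `|z1| = 4 * (e * `|z1|) by rewrite /e; field.
    lra.
  have HC : (1 + `|z|) ^+ (n + 4) * cabs (Phi f phi z) <= C.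
    have z1n : r * z1 != 0 by rewrite mulf_neq0 // -normr_gt0.
    case: (ltgtP 0 (r * z1)) z1n => // rz _.
      by apply: le_trans (HC1 z _) _; [split|rewrite /C; lra].
    by apply: le_trans (HC2 z _) _; [split; rewrite // mulNr oppr_gt0|rewrite /C; lra].
  have j0 := jnorm_gt0 z.
  (* Of the [n + 4] available powers of [1 + |z|], this turns [n] into [a ^+ n]; the other 4 become
     [omega z]. *)
  have ja : 1 <= 2 * a * (1 + `|z|).
    have zz : `|z1| <= `|z| by rewrite -(jb_norm b z); exact: norm_fst.
    have : a * `|z1| <= a * `|z| by rewrite ler_wpM2l // ltW.
    have -> : 2 * a * (1 + `|z|) = 2 * a + 2 * (a * `|z|) by ring.
    by have -> : (1 : R) = 2 * 2^-1 by [rewrite divff]; lra.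
  rewrite cabsM; apply: (@le_trans _ _ (B * (C * ((2 * a) ^+ n * omega z)))).
    apply: ler_pM; rewrite ?cabs_ge0 //.
    have P1 : cabs (Phi f phi z) <= C / (1 + `|z|) ^+ (n + 4) by rewrite ler_pdivlMr ?exprn_gt0 // mulrC.
    apply: le_trans P1 _; rewrite ler_wpM2l ?(ltW C0) // exprD invfM ler_pM ?invr_ge0 ?exprn_ge0 ?(ltW j0) //.
      by rewrite -[leLHS]mul1r ler_pdivrMr ?exprn_gt0 // -exprMn exprn_ege1.
    by rewrite invf_ple ?posrE ?exprn_gt0 ?omega_gt0 // omegaV_le.
  by rewrite exprMn !mulrA.
have mK : cmeas ((fun z => Kast b a s' t z * Phi f phi z) : pl -> R[i]).
  apply: cmeasM; first by case: (smooth_cpt_rapid (smooth_cpt_Kast hpsi b s' t a0)).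
  by case: (pgrowth_Phi f_dist tphi).
have io := integrable_scale (B * C * 2 ^+ n * a ^+ n) (@integrable_omega R).
apply: le_trans (Cint_abs_le mK io pt) _.
rewrite RintegralZl //; last exact: integrable_omega.
rewrite -/I; apply: (@le_trans _ _ (B * C * 2 ^+ n * I * a ^+ n)); first by rewrite mulrAC.
have an : a ^+ n <= a `^ k by rewrite -powR_nat //; apply: ger_powR; rewrite ?a0 ?(ltW a1).
by apply: ler_pM => //; [exact: mulr_ge0|rewrite lerDr].
Qed.

End ConeRapid.

(** * From shearlet decay to decay in a cone *)

Section KeyInequality.
Context {R : realType}.
Local Notation P := (R * R)%type.
Local Notation pl := (measurableTypeR R * measurableTypeR R)%type.

Lemma cabs_ew_sub (xi x y : P) : cabs (ew xi x - ew xi y) <= 4 * pi * (`|xi| * `|x - y|).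
Proof.
have -> : ew xi x - ew xi y = ew xi y * (ew xi (x - y) - 1).
  by rewrite mulrBr mulr1 -ewDr (addrC y) subrK.
rewrite cabsM cabs_ew mul1r; apply: le_trans (cabs_expiB1 _) _.
rewrite normrN normrM ger0_norm ?mulr_ge0 ?pi_ge0 //.
have := dot2_le xi (x - y); have : (0 : R) <= pi by exact: pi_ge0.
by move=> p0 h; have := ler_wpM2l p0 h; rewrite -!mulrA; lra.
Qed.

(** Read off from the inversion formula: the Lipschitz constant comes from the first moment of the
    inverse transform. *)
Lemma smooth_cpt_lipschitz (g : P -> R[i]) : smooth_cpt g ->
  exists2 L : R, 0 <= L & forall x y, cabs (g x - g y) <= L * `|x - y|.
Proof.
move=> sg; have rI := IFT_rapid sg; have [C C0 HC] := rapid_le 1 rI.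
pose I := \int[@leb2 R]_z omega z.
have I0 : 0 <= I by apply: Rintegral_ge0 => z _; exact: omega_ge0.
exists (4 * pi * C * I); first by rewrite !mulr_ge0 ?pi_ge0.
move=> x y; rewrite -(FT_IFT x sg) -(FT_IFT y sg) !FTE -CintB; last 2 first.
- exact: cintable_FT.
- exact: cintable_FT.
have io := integrable_scale (4 * pi * C * `|x - y|) (@integrable_omega R).
have -> : 4 * pi * C * I * `|x - y| = \int[leb2]_z (4 * pi * C * `|x - y| * omega z).
  by rewrite RintegralZl //; [rewrite /I; ring|exact: integrable_omega].
apply: Cint_abs_le => //.
  apply: cintable_cmeas; apply: cintableD; first exact: cintable_FT.
  have -> : (fun z => - (IFT g z * ew z y)) = (fun z => (- 1) * (IFT g z * ew z y)).
    by apply/funext => z; rewrite mulN1r.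
  by apply: cintableZ; exact: cintable_FT.
move=> z; rewrite -mulrBr cabsM.
apply: le_trans (ler_wpM2l (cabs_ge0 _) (cabs_ew_sub z x y)) _.
have := HC z; rewrite expr1 mulrDl mul1r => h.
have : `|z| * cabs (IFT g z) <= C * omega z by have := cabs_ge0 (IFT g z); lra.
have p0 : (0 : R) <= 4 * pi * `|x - y| by rewrite !mulr_ge0 ?pi_ge0.
by move=> /(ler_wpM2l p0); congr (_ <= _); ring.
Qed.

Lemma IFT_mod (tau : P -> R[i]) xi z : smooth_cpt tau ->
  IFT (fun x => tau x * ew xi x) z = FT tau (xi - z).
Proof.
move=> st; have st' : smooth_cpt (fun x => tau x * ew xi x) by apply: smooth_cptM => //; case: (smooth_ew xi).
rewrite IFTE ?FTE; last exact: smooth_cpt_rapid.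
by congr Cint; apply/funext => x; rewrite -mulrA (ewC x (xi - z)) [ew (xi - z) x]ewC ewDr ewN [in LHS]ewC.
Qed.

(** Inverse transform for functions that are merely [rapid], as [Hast] is. *)
Definition IFTr (H : P -> R[i]) (t : P) : R[i] := Cint leb2 setT (fun z => H z * (ew t z)^*).

Lemma IFTrE H t : rapid H -> IFTr H t = (FT (fun z => (H z)^*) t)^*.
Proof.
move=> rH; rewrite FTE -CintJ; last by apply: cintable_FT; exact: rapidJ.
by congr Cint; apply/funext => z; rewrite conjcM conjc_invol ewC.
Qed.

Lemma smooth_IFTr H : rapid H -> smooth_on setT (IFTr H).
Proof.
move=> rH; rewrite (_ : IFTr H = fun t => (FT (fun z => (H z)^*) t)^*); last by apply/funext => t; exact: IFTrE.
by apply: smooth_onJ; [exact: openT|case: (FT_smooth (rapidJ rH))].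
Qed.

Lemma FT_mul_IFTr tau H xi : smooth_cpt tau -> rapid H ->
  FT (fun t => tau t * IFTr H t) xi = Cint leb2 setT (fun z => FT tau (xi - z) * H z).
Proof.
move=> st rH.
have st' : smooth_cpt (fun x => tau x * ew xi x) by apply: smooth_cptM => //; case: (smooth_ew xi).
have E := parsevalJ (smooth_cptJ st') (rapidJ rH).
rewrite FTE; transitivity (Cint leb2 setT (fun x => ((tau x * ew xi x)^* * FT (fun z => (H z)^*) x)^*)).
  by congr Cint; apply/funext => t; rewrite (IFTrE t rH) (conjcM (_ ^*)) conjc_invol (ewC xi t); ring.
rewrite E; congr Cint; apply/funext => z; rewrite conjcM conjc_invol mulrC; congr (_ * _).
by rewrite -(IFT_mod xi z st).
Qed.

Variables (psi1 psi1h psi2 psi2h : R -> R[i]) (psi : P -> R[i]).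
Hypothesis hpsi : shearlet_generator psi1 psi1h psi2 psi2h psi.
Local Notation hpsihat := (hpsihat psi1h psi2h).
Local Notation Kast := (Kast psi1h psi2h).
Variables (Omega : set P) (f : functional R).
Hypothesis f_dist : is_distribution Omega f.
Local Notation Gb := (Gb psi1h psi2h f).

Definition Hast b (phi : P -> R[i]) a s (z : P) : R[i] :=
  (a `^ (3 / 4))%:C * hpsihat (MT b a s z) * Phi f phi z.

Lemma rapid_Hast b phi a s : 0 < a -> test_fun Omega phi -> rapid (Hast b phi a s).
Proof.
move=> a0 tphi; apply: rapid_pgrowth; last exact: (pgrowth_Phi f_dist tphi).
have ew0 (z : P) : ew (0 : P) z = 1 by rewrite /ew dot2E !mul0r addr0 mulr0 oppr0 expi0.
have := smooth_cpt_rapid (smooth_cpt_Kast hpsi b s 0 a0); congr rapid; apply/funext => z.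
by rewrite /Kast ew0 conjc1 mulr1.
Qed.

Lemma Gb_IFTr b phi a s t : Gb b phi a s t = IFTr (Hast b phi a s) t.
Proof. by congr Cint; apply/funext => z; rewrite /Kast /Hast; ring. Qed.

(** Fourier transform in [t] of the localized shearlet transform at fixed [(a, s)]; Plancherel
    converts decay in [a] into the L^2 bound of [Aast_L2]. *)
Definition Aast b phi tau a s : P -> R[i] := FT (fun t => tau t * Gb b phi a s t).

Lemma smooth_cpt_tauG b phi tau a s : 0 < a -> test_fun Omega phi -> smooth_cpt tau ->
  smooth_cpt (fun t => tau t * Gb b phi a s t).
Proof.
move=> a0 tphi st; apply: smooth_cptM => //.
have -> : Gb b phi a s = IFTr (Hast b phi a s) by apply/funext => t; exact: Gb_IFTr.
by apply: smooth_IFTr; exact: rapid_Hast.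
Qed.

Lemma MT_norm b (a s : R) (z : P) : 0 < a <= 1 -> `|s| <= 3 -> `|MT b a s z| <= 5 * Num.sqrt a * `|z|.
Proof.
move=> a01 s3; have /andP[a0 a1] := a01; have /andP[sa1 sa2] := sqrtr_le_id a01.
have s0 : 0 <= Num.sqrt a by exact: sqrtr_ge0.
have h : `|Num.sqrt a * s| <= 3 * Num.sqrt a by rewrite normrM (ger0_norm s0) mulrC ler_wpM2r.
rewrite /MT; case: b; apply: le_trans (lin2_norm _ _ _ _ _) _; rewrite ler_wpM2r // normr0 normrN (ger0_norm s0) (gtr0_norm a0); lra.
Qed.

Lemma MTB b (a s : R) (x y : P) : MT b a s (x - y) = MT b a s x - MT b a s y.
Proof. by rewrite /MT; case: b; exact: linearB. Qed.

(* [Aast] is the integral of [FT tau (xi - z)] against [hpsihat (MT z) * Phi phi z]. Freezing the Lipschitz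
   factor [hpsihat \o MT] at [z = xi] leaves [hpsihat (MT xi) * Phi tau xi], at the cost of the factor
   [sqrt a] that bounds the norm of [MT]. *)
Lemma key_inequality b phi tau : test_fun Omega phi -> smooth_cpt tau -> (forall x, phi x * tau x = tau x) ->
  exists2 L : R, 0 <= L & forall a s xi, 0 < a <= 1 -> `|s| <= 3 ->
    cabs (hpsihat (MT b a s xi)) * cabs (Phi f tau xi) <=
    a `^ (- (3 / 4)) * cabs (Aast b phi tau a s xi) +
    L * Num.sqrt a * \int[leb2]_z ((1 + `|xi - z|) * cabs (FT tau (xi - z)) * cabs (Phi f phi z)).
Proof.
move=> tphi st pt; have gP := pgrowth_Phi f_dist tphi.
have [Lh Lh0 HL] := smooth_cpt_lipschitz (smooth_cpt_hpsihat hpsi).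
exists (5 * Lh); first by rewrite mulr_ge0.
move=> a s xi a01 s3; have /andP[a0 a1] := a01.
have mF : cmeas ((fun z => FT tau (xi - z)) : pl -> R[i]).
  have n1 := (@measurable_affine2 R (-1) (-1) xi.1 xi.2 0).
  have E z : affine2 (-1) (-1) xi.1 xi.2 0 z = xi - z.
    by case: z => z1 z2; rewrite /affine2 /=; case: (xi) => x1 x2 /=; congr (_, _) => /=; ring.
  have [[m1 m2] _] := FT_rapid st; split.
    by have := measurableT_comp m1 n1; congr (measurable_fun _ _); apply/funext => z; rewrite /= E.
  by have := measurableT_comp m2 n1; congr (measurable_fun _ _); apply/funext => z; rewrite /= E.
have ik := integrable_kap xi st gP.
set B := \int[leb2]_z _.
have iF (c : R) (q : P -> R[i]) : cmeas (q : pl -> R[i]) -> (forall z, cabs (q z) <= c) ->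
    cintable leb2 ((fun z => FT tau (xi - z) * (q z * Phi f phi z)) : pl -> R[i]).
  move=> mq qc; have c0 : 0 <= c by exact: le_trans (cabs_ge0 _) (qc 0).
  refine (cintable_le (h := fun z : pl => c * ((1 + `|xi - z|) * cabs (FT tau (xi - z)) * cabs (Phi f phi z))) _ (integrable_scale c ik) _).
    by apply: cmeasM => //; apply: cmeasM => //; case: gP.
  move=> z; rewrite !cabsM mulrCA ler_pM ?mulr_ge0 ?cabs_ge0 // ler_wpM2r ?cabs_ge0 //.
  by rewrite ler_peMl ?cabs_ge0 // jnorm_ge1.
have [Bh Bh0 HB] := hpsihat_bounded hpsi.
have mh : cmeas ((fun z => hpsihat (MT b a s z)) : pl -> R[i]).
  apply: cmeas_continuous; have [c1 c2] := smooth_Ccontinuous (proj1 (smooth_cpt_hpsihat hpsi)).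
  have cM := @continuous_MT R b a s.
  split=> z; [apply: (@continuous_comp _ _ _ (MT b a s) (fun y => Re (hpsihat y)))|
    apply: (@continuous_comp _ _ _ (MT b a s) (fun y => Im (hpsihat y)))]; first [exact: cM|exact: c1|exact: c2].
have i1 := iF Bh _ mh (fun z => HB _).
have i2 := iF Bh _ (cmeas_cst _) (fun z => HB (MT b a s xi)).
have a34 : 0 < a `^ (3 / 4) by rewrite powR_gt0.
have EA : Aast b phi tau a s xi = (a `^ (3 / 4))%:C * Cint leb2 setT (fun z => FT tau (xi - z) * (hpsihat (MT b a s z) * Phi f phi z)).
  rewrite /Aast (_ : (fun t => _) = (fun t => tau t * IFTr (Hast b phi a s) t)); last first.
    by apply/funext => t; rewrite Gb_IFTr.
  rewrite FT_mul_IFTr //; last exact: rapid_Hast.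
  by rewrite -CintZ //; congr Cint; apply/funext => z; rewrite /Hast; ring.
have E2 : hpsihat (MT b a s xi) * Phi f tau xi =
    (a `^ (- (3 / 4)))%:C * Aast b phi tau a s xi +
    Cint leb2 setT (fun z => FT tau (xi - z) * ((hpsihat (MT b a s xi) - hpsihat (MT b a s z)) * Phi f phi z)).
  rewrite EA mulrA -rmorphM powRN mulVf ?gt_eqF // mul1r (Phi_conv f_dist xi tphi st pt).
  rewrite -CintZ -?CintD //.
  - by congr Cint; apply/funext => z; ring.
  - apply: (iF (Bh + Bh)) => [|z]; last by rewrite (le_trans (cabsB _ _)) // lerD.
    by apply: cmeasD; [exact: cmeas_cst|exact: cmeasN].
  - have := iF 1 (fun=> 1) (cmeas_cst _) _; rewrite cabs1 => /(_ (fun=> lexx _)).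
    by congr (cintable _ _); apply/funext => z; rewrite mul1r.
rewrite -cabsM E2; apply: le_trans (cabsD _ _) _; apply: lerD.
  by rewrite cabsM cabs_real ger0_norm ?powR_ge0.
have -> : 5 * Lh * Num.sqrt a * B = \int[leb2]_z (5 * Lh * Num.sqrt a *
   ((1 + `|xi - z|) * cabs (FT tau (xi - z)) * cabs (Phi f phi z))) by rewrite RintegralZl.
apply: Cint_abs_le; last first.
- move=> z; rewrite !cabsM.
  have h1 : cabs (hpsihat (MT b a s xi) - hpsihat (MT b a s z)) <= Lh * (5 * Num.sqrt a * (1 + `|xi - z|)).
    apply: le_trans (HL _ _) _; apply: ler_wpM2l => //; rewrite -MTB.
    apply: le_trans (MT_norm _ _ a01 s3) _; apply: ler_wpM2l; first by rewrite mulr_ge0 ?sqrtr_ge0.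
    by rewrite lerDr.
  have p0 : 0 <= cabs (FT tau (xi - z)) * cabs (Phi f phi z) by rewrite mulr_ge0 ?cabs_ge0.
  have := ler_wpM2l p0 h1; congr (_ <= _); ring.
- exact: integrable_scale.
- apply: cmeasM => //; apply: cmeasM; last by case: gP.
  by apply: cmeasD; [exact: cmeas_cst|exact: cmeasN].
Qed.

Lemma Aast_L2 b phi tau (s : R) (a E : R) : test_fun Omega phi -> smooth_cpt tau -> 0 < a -> 0 <= E ->
  (forall t, tau t != 0 -> cabs (Gb b phi a s t) <= E) ->
  (@leb2 R).-integrable setT (EFin \o ((fun xi => cabs (Aast b phi tau a s xi) ^+ 2) : pl -> R)) /\
  \int[leb2]_xi (cabs (Aast b phi tau a s xi) ^+ 2) <= E ^+ 2 * \int[leb2]_t (cabs (tau t) ^+ 2).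
Proof.
move=> tphi st a0 E0 HE; have sG := smooth_cpt_tauG b s a0 tphi st.
have sq (g : P -> R[i]) : rapid g -> (@leb2 R).-integrable setT (EFin \o ((fun x => cabs (g x) ^+ 2) : pl -> R)).
  move=> rg; have := cintable_cabs (rapid_cintable (rapid_pgrowth rg (pgrowth_rapid rg))).
  by congr (integrable _ _ _); apply/funext => x; rewrite /= cabsM expr2.
split; first by apply: sq; exact: FT_rapid.
rewrite plancherel // -RintegralZl //; last by apply: sq; exact: smooth_cpt_rapid.
apply: le_Rintegral => //.
- by apply: sq; exact: smooth_cpt_rapid.
- by apply: (integrable_scale (E ^+ 2)); apply: sq; exact: smooth_cpt_rapid.
- move=> t _; rewrite cabsM exprMn mulrC; have [->|t0] := eqVneq (tau t) 0; first by rewrite cabs0 expr0n !mulr0.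
  by rewrite ler_wpM2r ?sqr_ge0 //; apply: ler_Xn; [exact: cabs_ge0|exact: HE].
Qed.

End KeyInequality.

(** * Grids of scales and slopes *)

Section Discretization.
Context {R : realType}.
Local Notation P := (R * R)%type.

(** The least [n] with [mu ^+ n * y < a0] is positive because [a0 <= y]; its predecessor is the
    required scale. *)
Lemma scale_pick (a0 mu y : R) : 0 < a0 -> 0 < mu < 1 -> a0 <= y ->
  exists i : nat, a0 <= mu ^+ i * y /\ mu ^+ i.+1 * y < a0.
Proof.
move=> a00 /andP[mu0 mu1] ay; have y0 : 0 < y := lt_le_trans a00 ay.
have ex : exists n : nat, mu ^+ n * y < a0.
  have : `|mu| < 1 by rewrite gtr0_norm.
  move=> /(@cvg_geometric R 1) /cvgrPdist_lt /(_ (a0 / y)).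
  rewrite divr_gt0 // => /(_ isT)[n _ /(_ n (leqnn n))]; rewrite /geometric /= sub0r normrN mul1r => h.
  by exists n; rewrite -ltr_pdivlMr // (le_lt_trans (ler_norm _)).
case: (ex_minnP ex) => -[|n] hn mn; first by move: hn; rewrite expr0 mul1r ltNge ay.
by exists n; split => //; rewrite leNgt; apply/negP => /mn; rewrite ltnn.
Qed.

Lemma grid_pick (D h v : R) : 0 < h -> - D <= v <= D ->
  exists2 j : nat, (j < (Num.truncn (2 * D / h)).+1)%N & 0 <= v - (j%:R * h - D) <= h.
Proof.
move=> h0 /andP[v1 v2]; have q0 : 0 <= (v + D) / h by apply: divr_ge0; lra.
have /andP[t1 t2] := truncn_itv q0.
exists (Num.truncn ((v + D) / h)).
  by rewrite ltnS; apply: le_truncn; rewrite ler_pM2r ?invr_gt0 //; lra.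
move: t1 t2; rewrite ler_pdivlMr // ltr_pdivrMr // -[_.+1%:R]natr1.
set w := (Num.truncn _)%:R; rewrite [(w + 1) * h]mulrDl mul1r => t1 t2.
by apply/andP; split; lra.
Qed.

Lemma grid_card (D h : R) : 0 <= D -> 0 < h -> (Num.truncn (2 * D / h)).+1%:R <= 2 * D / h + 1.
Proof.
move=> D0 h0; rewrite mulrSr lerD2r; have q0 : 0 <= 2 * D / h by rewrite divr_ge0 ?mulr_ge0 // ltW.
by have /andP[] := truncn_itv q0.
Qed.

Lemma geometric_nneseries (u : nat -> \bar R) (C z : R) : 0 <= C -> 0 <= z < 1 ->
  (forall i, (0 <= u i)%E) -> (forall i, (u i <= (C * z ^+ i)%:E)%E) ->
  (\big[+%E/0%E]_(0 <= i <oo) u i < +oo)%E.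
Proof.
move=> C0 /andP[z0 z1] u0 uC; apply: (@le_lt_trans _ _ (C / (1 - z))%:E); last by rewrite ltry.
apply: lime_le; first by apply: is_cvg_nneseries => n _ _; exact: u0.
near=> n; apply: (@le_trans _ _ (\sum_(0 <= i < n) (C * z ^+ i)%:E)%E).
  by apply: lee_sum => i _.
rewrite sumEFin lee_fin -mulr_sumr; apply: ler_wpM2l => //.
rewrite -[leRHS]mul1r ler_pdivlMr ?subr_gt0 // mulrC.
have := subrX1 z n; rewrite big_mkord => E.
have -> : (1 - z) * \sum_(i < n) z ^+ i = 1 - z ^+ n by rewrite -[1 - z]opprB mulNr -E opprB.
by rewrite lerBlDr lerDl exprn_ge0.
Unshelve. all: by end_near. Qed.


Lemma neq0_lower (g : R -> R[i]) u : smooth_on setT g -> g u != 0 ->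
  exists c sg : R, [/\ 0 < c, 0 < sg & forall x, `|x - u| <= sg -> c <= cabs (g x)].
Proof.
move=> sg gu; have [d1 d2] := sg [::] u I.
have c0 : 0 < cabs (g u) by rewrite cabs_gt0.
have c1 := differentiable_continuous d1; have c2 := differentiable_continuous d2.
have e0 : 0 < cabs (g u) / 4 by rewrite divr_gt0.
move: c1 c2 => /cvgrPdist_lt /(_ _ e0) h1 /cvgrPdist_lt /(_ _ e0) h2.
have /nbhs_ballP[sgm /= s0 hs] : \forall t \near u, `|Re (g u) - Re (g t)| < cabs (g u) / 4 /\ `|Im (g u) - Im (g t)| < cabs (g u) / 4.
  by near=> t; split; near: t; [exact: h1|exact: h2].
exists (cabs (g u) / 2), (sgm / 2); split; [by rewrite divr_gt0|by rewrite divr_gt0|move=> x hx].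
have [] := hs x; first by rewrite /ball /= distrC; lra.
move=> a1 a2; have := cabs_le (g u - g x); rewrite !Re_add !Im_add Re_opp Im_opp => b1.
have := cabsD (g u - g x) (g x); rewrite subrK; lra.
Unshelve. all: by end_near. Qed.

End Discretization.

(** * Covering a half-plane by shearlet windows *)

Section FrameCover.
Context {R : realType}.
Local Notation P := (R * R)%type.
Variables (psi1 psi1h psi2 psi2h : R -> R[i]) (psi : P -> R[i]).
Hypothesis hpsi : shearlet_generator psi1 psi1h psi2 psi2h psi.
Local Notation hpsihat := (hpsihat psi1h psi2h).

(** [psi1h] is nonzero at a point with the sign of [r] and [psi2h] at [y0]; by continuity both stay
    away from zero nearby. In the coordinates of [MT] these neighbourhoods are a range of ratio
    [lam] for [a * |z1|] and a slope interval of half-width [sg * sqrt a]. *)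
Lemma frame_cover (r : R) : r != 0 -> exists a0 lam y0 sg c : R,
  [/\ 0 < a0, 1 < lam, 0 < sg <= 1, `|y0| <= 1 & 0 < c /\
   forall b (a s : R) (z : P), 0 < a -> 0 < r * (jb b z).1 ->
     a0 <= a * `|(jb b z).1| <= lam * a0 ->
     `|((jb b z).2 / (jb b z).1 - s) - y0 * Num.sqrt a| <= sg * Num.sqrt a ->
     c <= cabs (hpsihat (MT b a s z))].
Proof.
move=> r0; have [y0 hy0] := psi2h_neq0 hpsi.
have [a0 a00 ha0] : exists2 a0, 0 < a0 & psi1h (Num.sg r * a0) != 0.
  have [rp|rn|rz] := ltgtP 0 r; last by rewrite -rz eqxx in r0.
    by rewrite gtr0_sg //; have [a h1 h2] := psi1h_neq0_pos hpsi; exists a => //; rewrite mul1r.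
  by rewrite ltr0_sg //; have [a h1 h2] := psi1h_neq0_neg hpsi; exists a => //; rewrite mulN1r.
have [s1 _ _] := sg_psi1h_test hpsi; have [s2 _ _] := sg_psi2h_test hpsi.
have [c1 [d1 [c10 d10 H1]]] := neq0_lower s1 ha0.
have [c2 [d2 [c20 d20 H2]]] := neq0_lower s2 hy0.
exists a0, (1 + d1 / a0), y0, (Num.min 1 d2), (c1 * c2); split => //.
- by rewrite ltrDl divr_gt0.
- by rewrite lt_min ltr01 d20 ge_min lexx.
- exact: psi2h_supp hpsi _ hy0.
split; first exact: mulr_gt0.
move=> b a s z ap rz; rewrite mulrDl mul1r divfK ?gt_eqF // => /andP[h1 h2] h3.
have sa0 : 0 < Num.sqrt a by rewrite sqrtr_gt0.
have z0 : (jb b z).1 != 0 by apply: contraTneq rz => ->; rewrite mulr0 ltxx.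
rewrite /hpsihat cabsJ MTE /psihat /= cabsM; apply: ler_pM; try exact: ltW.
  have E : (jb b z).1 = Num.sg r * `|(jb b z).1|.
    rewrite {1}[(jb b z).1]numEsg; congr (_ * _); move: rz.
    have [rp|rn|rz] := ltgtP 0 r; last by rewrite -rz eqxx in r0.
      by rewrite pmulr_rgt0 // => zp; rewrite !gtr0_sg.
    by rewrite nmulr_rgt0 // => zp; rewrite !ltr0_sg.
  apply: H1; rewrite E mulrCA -mulrBr normrM normr_sg r0 mul1r ger0_norm; lra.
apply: H2.
have -> : Num.sqrt a * ((jb b z).2 - s * (jb b z).1) / (a * (jb b z).1) - y0 =
   (Num.sqrt a)^-1 * (((jb b z).2 / (jb b z).1 - s) - y0 * Num.sqrt a).
  rewrite -[in X in _ / (X * _)](sqr_sqrtr (ltW ap)); field; by rewrite z0 gt_eqF.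
rewrite normrM normfV (gtr0_norm sa0) ler_pdivrMl //; apply: le_trans h3 _.
by rewrite mulrC; apply: ler_wpM2l; [exact: ltW|rewrite ge_min lexx orbT].
Qed.

End FrameCover.

(** * The pointwise gain at a single frequency *)

Section L2Gain.
Context {R : realType}.
Local Notation P := (R * R)%type.
Local Notation pl := (measurableTypeR R * measurableTypeR R)%type.
Variables (psi1 psi1h psi2 psi2h : R -> R[i]) (psi : P -> R[i]).
Hypothesis hpsi : shearlet_generator psi1 psi1h psi2 psi2h psi.
Local Notation hpsihat := (hpsihat psi1h psi2h).
Variables (Omega : set P) (f : functional R).
Hypothesis f_dist : is_distribution Omega f.
Local Notation Gb := (Gb psi1h psi2h f).
Local Notation Aast := (Aast psi1h psi2h f).

Lemma powR_between (a c u p : R) : 0 < a -> a <= u <= c -> u `^ p <= a `^ p + c `^ p.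
Proof.
move=> a0 /andP[au uc]; have u0 : 0 < u := lt_le_trans a0 au.
have [p0|p0] := leP 0 p.
  by apply: (@le_trans _ _ (c `^ p)); [apply: ge0_ler_powR => //; rewrite nnegrE ltW // (lt_le_trans u0)|rewrite lerDr powR_ge0].
apply: (@le_trans _ _ (a `^ p)); last by rewrite lerDl powR_ge0.
rewrite -(opprK p) !(powRN _ (- p)) lef_pV2 ?posrE ?powR_gt0 //.
by apply: ge0_ler_powR => //; rewrite ?nnegrE ?oppr_ge0 ltW.
Qed.

Lemma scone_slope b r s0 d (z : P) : scone b r s0 d z -> `|(jb b z).2 / (jb b z).1 - s0| < d.
Proof.
move=> [h1 h2]; have z0 : (jb b z).1 != 0 by apply: contraTneq h1 => ->; rewrite mulr0 ltxx.
rewrite -(ltr_pM2r (x := `|(jb b z).1|)) ?normr_gt0 // -normrM mulrBl divfK //.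
Qed.

Variables (b : bool) (phi tau : P -> R[i]) (r s0 d d' p : R).
Hypothesis tphi : test_fun Omega phi.
Hypothesis ttau : test_fun Omega tau.
Hypothesis pt : forall x, phi x * tau x = tau x.
Hypothesis r0 : r != 0.
Hypothesis s02 : `|s0| <= 2.
Hypothesis d0 : 0 < d.
Hypothesis dd' : d < d'.
Hypothesis d'1 : d' <= 1.

Local Notation st := (test_smooth_cpt ttau).
Local Notation B := (fun xi : P => \int[leb2]_z ((1 + `|xi - z|) * cabs (FT tau (xi - z)) * cabs (Phi f phi z))).

Definition grid_slope (h : R) (j : nat) : R := s0 + (j%:R * h - d').
Definition grid_size (h : R) : nat := (Num.truncn (2 * d' / h)).+1.

(* Scales [al * mu ^+ i] and slopes on a grid of mesh [sg * sqrt a] are dense enough for some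
   [hpsihat \o MT] to be bounded below at every frequency of the cone. *)
Lemma gain_pointwise (al : R) : 0 < al <= 1 -> 2 * Num.sqrt al <= d' - d ->
  exists mu sg M X0 : R, [/\ 0 < mu < 1, 0 < sg <= 1, 0 <= M & forall xi, scone b r s0 d xi -> X0 <= `|(jb b xi).1| ->
    exists i j : nat, let a := al * mu ^+ i in let h := sg * Num.sqrt a in
      [/\ (j < grid_size h)%N, `|grid_slope h j - s0| < d' &
       (1 + `|xi|) `^ p * cabs (Phi f tau xi) ^+ 2 <=
       M * (a `^ (- p - 3 / 2) * cabs (Aast b phi tau a (grid_slope h j) xi) ^+ 2 + (1 + `|xi|) `^ (p - 1) * B xi ^+ 2)]].
Proof.
have l1 (u y q qa : R) : `|u| < d -> `|y| <= q -> q <= qa -> 2 * qa <= d' - d -> - d' <= u - y <= d'.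
  by rewrite ltr_norml ler_norml => /andP[? ?] /andP[? ?] ? ?; apply/andP; split; lra.
have l2 (u y q qa h g : R) : `|u| < d -> `|y| <= q -> q <= qa -> 2 * qa <= d' - d -> h <= q ->
    0 <= u - y - g -> u - y - g <= h -> `|g| < d'.
  rewrite !ltr_norml ler_norml => /andP[? ?] /andP[? ?] ? ? ? ? ?; apply/andP; split; lra.
have l3 (w y g h : R) : 0 <= w - s0 - y - g -> w - s0 - y - g <= h -> `|w - (s0 + g) - y| <= h.
  by move=> ? ?; rewrite ger0_norm; lra.
have l4 (u v : R) : u < d' -> v <= 2 -> u + v <= 3 by move: d'1; lra.
have l5 (v : R) : v <= 2 -> 1 + v + d <= 4 by move: dd' d'1; lra.
have l6 (X Y : R) : (X + Y) ^+ 2 <= 2 * X ^+ 2 + 2 * Y ^+ 2.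
  by have := sqr_ge0 (X - Y); rewrite sqrrB sqrrD; lra.
have l7 (U V x y z : R) : U * (x * y * z) <= V * (x * y * z) -> U * x * (2 * (y * z)) <= 2 * V * (x * y * z) by lra.
have l8 (a j Q x y z : R) : a * j * (x * (y * z)) <= Q * (x * (y * z)) -> j * y * (2 * (x * a * z)) <= 2 * x * Q * (y * z) by lra.
have l9 (U L Q x y : R) : 0 <= L * Q * x -> 0 <= U * y ->
    2 * U * x + 2 * L * Q * y <= (2 * U + 2 * L * Q) * (x + y) by lra.
move=> /andP[al0 al1] ald.
have [a0 [lam [y0 [sg [c [a00 lam1 /andP[sg0 sg1] hy0 [c0 cover]]]]]]] := frame_cover hpsi r0.
have [L L0 key] := key_inequality hpsi f_dist b tphi st pt.
have lam0 : 0 < lam by rewrite (lt_trans ltr01).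
have mu01 : 0 < lam^-1 < 1 by rewrite invr_gt0 lam0 invf_lt1.
(* Upper bound for [a * (1 + |xi|)], from [a <= 1], [|xi| <= 4 * |x1|] on the cone and
   [a * |x1| <= lam * a0]. *)
pose Q := 1 + 4 * lam * a0.
have Q0 : 0 < Q by rewrite addr_gt0 // !mulr_gt0.
pose Mp := a0 `^ p + Q `^ p.
have Mp0 : 0 <= Mp by rewrite addr_ge0 ?powR_ge0.
(* The ratio of consecutive scales matches the range of ratio [lam] in [frame_cover]; frequencies
   below [a0 / al] are too low for the coarsest scale [al]. *)
exists lam^-1, sg, ((2 * Mp + 2 * L ^+ 2 * Q) / c ^+ 2), (a0 / al); split => //.
- by rewrite sg0 sg1.
- by rewrite divr_ge0 ?sqr_ge0 // addr_ge0 ?mulr_ge0 ?sqr_ge0 // ltW.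
move=> xi hxi hX.
have [i [i1 i2]] : exists i : nat, a0 <= lam^-1 ^+ i * (al * `|(jb b xi).1|) /\ lam^-1 ^+ i.+1 * (al * `|(jb b xi).1|) < a0.
  by apply: scale_pick => //; rewrite mulrC -ler_pdivrMr.
pose a := al * lam^-1 ^+ i; pose h := sg * Num.sqrt a.
have mi0 : 0 < lam^-1 ^+ i by rewrite exprn_gt0 ?invr_gt0.
have ap : 0 < a by rewrite mulr_gt0.
have mi1 : lam^-1 ^+ i <= 1 by rewrite exprn_ile1 ?invr_ge0 ?(ltW lam0) // invf_le1 // ltW.
have aal : a <= al by rewrite -[leRHS]mulr1 ler_pM2l.
have a1 : a <= 1 by exact: le_trans aal al1.
have sa0 : 0 < Num.sqrt a by rewrite sqrtr_gt0.
have saal : Num.sqrt a <= Num.sqrt al by rewrite ler_sqrt // ltW.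
have h0 : 0 < h by rewrite mulr_gt0.
have hsa : h <= Num.sqrt a by rewrite -[leRHS]mul1r ler_pM2r.
have ax1 : a0 <= a * `|(jb b xi).1| by move: i1; rewrite /a; congr (_ <= _); ring.
have ax2 : a * `|(jb b xi).1| <= lam * a0.
  move: i2; rewrite exprS -mulrA ltr_pdivrMl // => i2; apply: ltW; move: i2; congr (_ < _); rewrite /a; ring.
have sl := scone_slope hxi.
set w := (jb b xi).2 / (jb b xi).1 in sl *.
have ysa : `|y0 * Num.sqrt a| <= Num.sqrt a.
  by rewrite normrM (gtr0_norm sa0) -[leRHS]mul1r ler_pM2r.
have [j hj /andP[j1 j2]] : exists2 j : nat, (j < grid_size h)%N & 0 <= (w - s0 - y0 * Num.sqrt a) - (j%:R * h - d') <= h.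
  apply: grid_pick => //; exact: l1 sl ysa saal ald.
have gs : `|grid_slope h j - s0| < d'.
  rewrite /grid_slope addrAC subrr add0r; exact: l2 sl ysa saal ald hsa j1 j2.
exists i, j; split => //; rewrite -/a -/h in hj *.
clearbody a.
have Hc : c <= cabs (hpsihat (MT b a (grid_slope h j) xi)).
  apply: cover => //; [by case: hxi|by rewrite ax1|].
  exact: l3 j1 j2.
have s3 : `|grid_slope h j| <= 3.
  have gn := ler_normD (grid_slope h j - s0) s0; rewrite subrK in gn; apply: le_trans gn _.
  exact: l4 gs s02.
have {}key := key a (grid_slope h j) xi _ s3; rewrite ap a1 in key; have {key} := key isT.
set A := cabs (Aast _ _ _ _ _ _); set Bx := \int[leb2]_z _; set T := cabs (Phi f tau xi) => key.
have T0 : 0 <= T by exact: cabs_ge0.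
have A0 : 0 <= A by exact: cabs_ge0.
have {}key : c * T <= a `^ (- (3 / 4)) * A + L * Num.sqrt a * Bx by apply: le_trans key; exact: ler_wpM2r.
clearbody A Bx T; clear cover Hc tphi ttau pt hj j1 j2 gs s3.
set jw := 1 + `|xi|; have jw0 : 0 < jw by exact: jnorm_gt0.
have n1 : `|(jb b xi).1| <= `|xi| by rewrite -(jb_norm b); exact: norm_fst.
have n2 := scone_norm d0 hxi.
have u1 : a0 <= a * jw by apply: le_trans ax1 _; rewrite ler_pM2l // /jw ler_wpDl.
have u2 : a * jw <= Q.
  rewrite /jw mulrDr mulr1; apply: lerD => //.
  apply: (@le_trans _ _ (a * (4 * `|(jb b xi).1|))).
    rewrite ler_pM2l //; apply: le_trans n2 _; apply: ler_wpM2r => //.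
    exact: l5.
  by rewrite mulrCA -mulrA ler_pM2l.
(* As [a * (1 + |xi|)] lies between [a0] and [Q], the weight [(1 + |xi|) ^ p] is at most a constant
   times [a ^ (- p)]. *)
have Ep : jw `^ p = (a * jw) `^ p * a `^ (- p).
  by rewrite powRM ?(ltW ap) ?(ltW jw0) // mulrAC -powR_add // subrr powRr0 mul1r.
have Up : (a * jw) `^ p <= Mp by apply: powR_between => //; rewrite u1.
have Ep1 : jw `^ p = jw * jw `^ (p - 1) by rewrite -{2}[jw]powRr1 ?(ltW jw0) // -powR_add // addrC subrK.
have sq : (c * T) ^+ 2 <= 2 * (a `^ (- (3 / 2)) * A ^+ 2) + 2 * (L ^+ 2 * a * Bx ^+ 2).
  have E1 : a `^ (- (3 / 2)) * A ^+ 2 = (a `^ (- (3 / 4)) * A) ^+ 2.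
    by rewrite exprMn -(@powR_mulrn _ (a `^ _)) ?powR_ge0 // -powRrM; congr (_ `^ _ * _); field.
  have E2 : L ^+ 2 * a * Bx ^+ 2 = (L * Num.sqrt a * Bx) ^+ 2 by rewrite !exprMn sqr_sqrtr // ltW.
  rewrite E1 E2; apply: le_trans (ler_Xn 2 _ key) _; first by rewrite mulr_ge0 // ltW.
  exact: l6.
have c20 : 0 < c ^+ 2 by rewrite exprn_gt0.
rewrite -(ler_pM2l c20) [leRHS](_ : _ = (2 * Mp + 2 * L ^+ 2 * Q) * (a `^ (- p - 3 / 2) * A ^+ 2 + jw `^ (p - 1) * Bx ^+ 2)); last first.
  by rewrite mulrA mulrCA mulfV ?gt_eqF // mulr1.
have -> : c ^+ 2 * (jw `^ p * T ^+ 2) = jw `^ p * (c * T) ^+ 2 by rewrite exprMn; ring.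
apply: (@le_trans _ _ (jw `^ p * (2 * (a `^ (- (3 / 2)) * A ^+ 2) + 2 * (L ^+ 2 * a * Bx ^+ 2)))).
  by apply: ler_wpM2l => //; exact: powR_ge0.
rewrite mulrDr.
have X1 : jw `^ p * (2 * (a `^ (- (3 / 2)) * A ^+ 2)) <= 2 * Mp * (a `^ (- p - 3 / 2) * A ^+ 2).
  rewrite Ep powR_add //; set e1 := a `^ (- p); set e2 := a `^ (- (3 / 2)).
  have e0 : 0 <= e1 * e2 * A ^+ 2 by rewrite !mulr_ge0 ?powR_ge0 ?sqr_ge0.
  exact: l7 (ler_wpM2r e0 Up).
(* The squared commutator carries the factor [a], at most [Q / (1 + |xi|)]: this is the gain of one
   power. *)
have X2 : jw `^ p * (2 * (L ^+ 2 * a * Bx ^+ 2)) <= 2 * L ^+ 2 * Q * (jw `^ (p - 1) * Bx ^+ 2).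
  rewrite Ep1; set e1 := jw `^ (p - 1).
  have e0 : 0 <= L ^+ 2 * (e1 * Bx ^+ 2).
    by apply: mulr_ge0; [exact: sqr_ge0|apply: mulr_ge0; [exact: powR_ge0|exact: sqr_ge0]].
  exact: l8 (ler_wpM2r e0 u2).
apply: le_trans (lerD X1 X2) _.
have Y1 : 0 <= a `^ (- p - 3 / 2) * A ^+ 2 by rewrite mulr_ge0 ?powR_ge0 ?sqr_ge0.
have Y2 : 0 <= jw `^ (p - 1) * Bx ^+ 2 by rewrite mulr_ge0 ?powR_ge0 ?sqr_ge0.
have Z1 : 0 <= L ^+ 2 * Q by rewrite mulr_ge0 ?sqr_ge0 // ltW.
exact: l9 (mulr_ge0 Z1 Y1) (mulr_ge0 Mp0 Y2).
Qed.

End L2Gain.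

Section IntegralAux.
Context {R : realType} {dT : measure_display} {T : measurableType dT} (mu : {measure set T -> \bar R}).

Lemma integrable_ge0_fin (g : T -> R) : measurable_fun setT g -> (forall x, 0 <= g x) ->
  (\int[mu]_x (g x)%:E < +oo)%E -> mu.-integrable setT (EFin \o g).
Proof.
move=> mg g0 fg; apply/integrableP; split; first exact/measurable_EFinP.
rewrite (eq_integral (fun x => (g x)%:E)) // => x _.
by rewrite /= ger0_norm.
Qed.

Lemma integrable_EFin_lty (g : T -> R) : mu.-integrable setT (EFin \o g) -> (\int[mu]_x (g x)%:E < +oo)%E.
Proof. by move=> ig; exact: (integrable_lty measurableT ig). Qed.

Lemma integral_EFinE (g : T -> R) : mu.-integrable setT (EFin \o g) ->
  (\int[mu]_x (g x)%:E)%E = (\int[mu]_x g x)%:E.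
Proof. by move=> ig; rewrite /Rintegral fineK //; exact: (integrable_fin_num measurableT ig). Qed.

Lemma integrable_sum_bound (I : Type) (s : seq I) (Q : pred I) (F : I -> T -> R) (E : R) : 0 <= E ->
  (forall i, Q i -> mu.-integrable setT (EFin \o F i) /\ \int[mu]_x F i x <= E) ->
  mu.-integrable setT (EFin \o (fun x => \sum_(i <- s | Q i) F i x)) /\
  \int[mu]_x (\sum_(i <- s | Q i) F i x) <= (size s)%:R * E.
Proof.
move=> E0 HF; elim: s => [|i s [IH1 IH2]].
  have -> : (fun x => \sum_(i <- [::] | Q i) F i x) = (fun=> 0) by apply/funext => x; rewrite big_nil.
  rewrite mul0r /Rintegral integral0; split => //; exact: integrable0.
have -> : (fun x => \sum_(j <- i :: s | Q j) F j x) =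
    (fun x => (if Q i then F i x else 0) + \sum_(j <- s | Q j) F j x).
  by apply/funext => x; rewrite big_cons; case: ifP => // _; rewrite add0r.
have [i1 i2] : mu.-integrable setT (EFin \o (fun x => if Q i then F i x else 0)) /\
    \int[mu]_x (if Q i then F i x else 0) <= E.
  case E1: (Q i); first exact: HF.
  by rewrite /Rintegral integral0; split => //; exact: integrable0.
split.
  exact: (integrableD measurableT i1 IH1).
by rewrite RintegralD //= -natr1 mulrDl mul1r addrC lerD.
Qed.

End IntegralAux.

(** * Summation over the grid *)

Section L2GainMain.
Context {R : realType}.
Local Notation P := (R * R)%type.
Local Notation pl := (measurableTypeR R * measurableTypeR R)%type.
Variables (psi1 psi1h psi2 psi2h : R -> R[i]) (psi : P -> R[i]).
Hypothesis hpsi : shearlet_generator psi1 psi1h psi2 psi2h psi.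
Variables (Omega : set P) (f : functional R).
Hypothesis f_dist : is_distribution Omega f.
Local Notation Gb := (Gb psi1h psi2h f).
Local Notation Aast := (Aast psi1h psi2h f).

(** On the cone a bound on the first coordinate bounds [xi] itself, by the factor 4 that majorizes
    [1 + |s| + d]; on a bounded set everything is dominated by a multiple of [omega]. *)
Lemma coneV_low (Ph : P -> R[i]) p b r s d (X0 : R) : pgrowth Ph -> 0 < d -> `|s| + d <= 3 ->
  exists2 M : R, 0 <= M & forall xi, scone b r s d xi -> `|(jb b xi).1| < X0 ->
    (1 + `|xi|) `^ p * cabs (Ph xi) ^+ 2 <= M * omega xi.
Proof.
move=> [_ [n [D HD]]] d0 sd.
have D0 : 0 <= D by have := le_trans (cabs_ge0 _) (HD 0); rewrite normr0 addr0 expr1n mulr1.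
pose J := 1 + 4 * `|X0|; have J1 : 1 <= J by rewrite /J; have := normr_ge0 X0; lra.
have J0 : 0 <= J by lra.
exists ((1 `^ p + J `^ p) * (D * J ^+ n) ^+ 2 * J ^+ 4).
  by apply: mulr_ge0; [apply: mulr_ge0; [rewrite addr_ge0 ?powR_ge0|exact: sqr_ge0]|exact: exprn_ge0].
move=> xi hxi hX; have n2 := scone_norm d0 hxi.
have jJ : 1 + `|xi| <= J.
  rewrite /J lerD2l; apply: le_trans n2 _; apply: (@le_trans _ _ (4 * `|(jb b xi).1|)).
    by apply: ler_wpM2r => //; move: (`|s|) sd => u ?; lra.
  by apply: ler_wpM2l => //; rewrite (le_trans (ltW hX)) // ler_norm.
have j0 : 0 < 1 + `|xi| by exact: jnorm_gt0.
have w1 : 1 <= J ^+ 4 * omega xi.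
  have o0 := omega_gt0 xi; have := omegaV_le xi; move=> /(ler_wpM2r (ltW o0)); rewrite mulVf ?gt_eqF // => h.
  apply: le_trans h _; apply: ler_wpM2r; first exact: ltW.
  by apply: ler_Xn => //; exact: ltW.
rewrite -mulrA -[leLHS]mulr1; apply: ler_pM => //.
- by apply: mulr_ge0; [exact: powR_ge0|exact: sqr_ge0].
apply: ler_pM; [exact: powR_ge0|exact: sqr_ge0| |].
  by apply: powR_between => //; rewrite jJ andbT; have := normr_ge0 xi; lra.
apply: ler_Xn; first exact: cabs_ge0.
by apply: le_trans (HD xi) _; apply: ler_wpM2l => //; apply: ler_Xn => //; exact: ltW.
Qed.

(* Summing [key_inequality] over the grid, of size [O (a ^ (- 1 / 2))] at scale [a], the main term is a
   geometric series with exponent [2 k - 2 - p], and the error gains one power of the frequency. *)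
Lemma L2_gain b phi tau r s0 d d' p (a1 C k : R) : test_fun Omega phi -> test_fun Omega tau ->
  (forall x, phi x * tau x = tau x) -> r != 0 -> `|s0| <= 2 -> 0 < d -> d < d' -> d' <= 1 ->
  0 < a1 -> 0 <= C ->
  (forall a s t, 0 < a < a1 -> `|s - s0| < d' -> tau t != 0 -> cabs (Gb b phi a s t) <= C * a `^ k) ->
  p < 2 * k - 2 ->
  (@leb2 R).-integrable setT (EFin \o (coneV (Phi f phi) b r s0 d' (p - 1) : pl -> R)) ->
  (@leb2 R).-integrable setT (EFin \o (coneV (Phi f tau) b r s0 d p : pl -> R)).
Proof.
have l1 (u : R) : u <= 2 -> d < d' -> d' <= 1 -> u + d <= 3 by lra.
have l2 : p < 2 * k - 2 -> 0 < 2 * k - p - 2 by lra.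
move=> tphi ttau pt r0 s02 d0 dd' d'1 a10 C0 HG pk iV.
have sd3 := l1 _ s02 dd' d'1; have q0 := l2 pk; have d'0 := ltW (lt_trans d0 dd').
have st := test_smooth_cpt ttau; have gP := pgrowth_Phi f_dist tphi; have gT := pgrowth_Phi f_dist ttau.
have e0 : 0 < (d' - d) / 2 by rewrite divr_gt0 // subr_gt0.
(* The coarsest scale lies in the range of the decay hypothesis, and the offset of a window, of
   order [sqrt al], fits in the gap [d' - d]. *)
pose al := Num.min 1 (Num.min (a1 / 2) (((d' - d) / 2) ^+ 2)).
have al0 : 0 < al by rewrite !lt_min ltr01 divr_gt0 // exprn_gt0.
have al1 : al <= 1 by rewrite ge_min lexx.
have ala : al < a1 by rewrite (@le_lt_trans _ _ (a1 / 2)) ?ltr_pdivrMr // ?ge_min ?lexx ?orbT //; lra.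
have sal : 2 * Num.sqrt al <= d' - d.
  rewrite mulrC -ler_pdivlMr // -[leRHS]ger0_norm ?(ltW e0) // -sqrtr_sqr ler_sqrt ?exprn_ge0 ?(ltW e0) //.
  by rewrite !ge_min lexx !orbT.
have al01 : 0 < al <= 1 by rewrite al0 al1.
have [mu [sg [M [X0 [/andP[mu0 mu1] /andP[sg0 sg1] M0 gain]]]]] :=
  gain_pointwise hpsi f_dist b p tphi ttau pt r0 s02 d0 dd' d'1 al01 sal.
have [C2 C20 HC2] := cone_conv_bound gP (kap_ge0 tau) (measurable_kap st) (rapid_kap st) r0 d0 dd' iV.
have [M0' M0'0 low] := coneV_low p b r (X0) gT d0 sd3.
pose a i := al * mu ^+ i; pose h i := sg * Num.sqrt (a i).
pose F i j (xi : P) := (a i) `^ (- p - 3 / 2) * cabs (Aast b phi tau (a i) (grid_slope s0 d' (h i) j) xi) ^+ 2.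
(* Grid slopes not within [d'] of [s0] are discarded, the decay hypothesis saying nothing about
   them. *)
pose Q i j := `|grid_slope s0 d' (h i) j - s0| < d'.
pose S i (xi : P) := \sum_(j <- iota 0 (grid_size d' (h i)) | Q i j) F i j xi.
pose V := coneV (Phi f phi) b r s0 d' (p - 1).
pose W := \int[leb2]_t (cabs (tau t) ^+ 2).
have W0 : 0 <= W by apply: Rintegral_ge0 => t _; exact: sqr_ge0.
have ai0 i : 0 < a i by rewrite mulr_gt0 ?exprn_gt0.
have aia i : a i <= al by rewrite -[leRHS]mulr1 ler_pM2l // exprn_ile1 // ltW.
have F0 i j xi : 0 <= F i j xi by rewrite mulr_ge0 ?powR_ge0 ?sqr_ge0.
have S0 i xi : 0 <= S i xi by apply: sumr_ge0 => j _; exact: F0.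
have V0 z : 0 <= V z by exact: coneV_ge0.
have HF i j : Q i j -> (@leb2 R).-integrable setT (EFin \o (F i j : pl -> R)) /\
    \int[leb2]_x F i j x <= (a i) `^ (- p - 3 / 2) * ((C * (a i) `^ k) ^+ 2 * W).
  move=> Qij; have E0 : 0 <= C * (a i) `^ k by rewrite mulr_ge0 ?powR_ge0.
  have [t|i1 i2] := Aast_L2 hpsi f_dist (b := b) (s := grid_slope s0 d' (h i) j) tphi st (ai0 i) E0.
    by move=> tt; apply: HG => //; rewrite ai0 (le_lt_trans (aia i)).
  split; first exact: integrable_scale.
  by rewrite RintegralZl //; apply: ler_wpM2l => //; exact: powR_ge0.
have HS i : (@leb2 R).-integrable setT (EFin \o (S i : pl -> R)) /\
    \int[leb2]_x S i x <= (2 / sg + 1) * (C ^+ 2 * W) * (al `^ (2 * k - p - 2) * (mu `^ (2 * k - p - 2)) ^+ i).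
  have E0 : 0 <= (a i) `^ (- p - 3 / 2) * ((C * (a i) `^ k) ^+ 2 * W).
    by apply: mulr_ge0; [exact: powR_ge0|apply: mulr_ge0 => //; exact: sqr_ge0].
  have [i1 i2] := integrable_sum_bound (iota 0 (grid_size d' (h i))) E0 (HF i).
  split => //; apply: le_trans i2 _; rewrite size_iota.
  have sa0 : 0 < Num.sqrt (a i) by rewrite sqrtr_gt0.
  have h0 : 0 < h i by rewrite mulr_gt0.
  (* A slope interval of length [2 * d'] at mesh [sg * sqrt a], with [d' <= 1] and
     [1 <= 1 / sqrt a]. *)
  have card : (grid_size d' (h i))%:R <= (2 / sg + 1) * (a i) `^ (- (1 / 2)).
    apply: le_trans (grid_card d'0 h0) _.
    have -> : a i `^ (- (1 / 2)) = (Num.sqrt (a i))^-1 by rewrite powRN mul1r powR12_sqrt ?(ltW (ai0 i)).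
    set x := (Num.sqrt (a i))^-1; have x1 : 1 <= x.
      rewrite invf_ge1 //; have ai1 : 0 < a i <= 1 by rewrite ai0 (le_trans (aia i)).
      by have /andP[_] := sqrtr_le_id ai1.
    have -> : 2 * d' / h i = 2 / sg * x * d' by rewrite /x /h; field; rewrite gt_eqF // gt_eqF.
    have y0 : 0 <= 2 / sg * x by rewrite mulr_ge0 ?divr_ge0 ?(ltW sg0) // (le_trans _ x1).
    rewrite [leRHS]mulrDl [1 * x]mul1r; apply: lerD => //; exact: ler_piMr.
  have -> : al `^ (2 * k - p - 2) * (mu `^ (2 * k - p - 2)) ^+ i = (a i) `^ (2 * k - p - 2).
    rewrite /a powRM ?exprn_ge0 ?(ltW al0) ?(ltW mu0) //; congr (_ * _).
    by rewrite powR_exprC // ltW.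
  apply: le_trans (ler_wpM2r E0 card) _.
  (* Number of slopes, then weight and normalization, then squared decay:
     [- 1 / 2 + (- p - 3 / 2) + 2 k]. *)
  have -> : (a i) `^ (2 * k - p - 2) = (a i) `^ (- (1 / 2)) * ((a i) `^ (- p - 3 / 2) * ((a i) `^ k * (a i) `^ k)).
    by rewrite -!powR_add //; congr (_ `^ _); field.
  by rewrite exprMn [_ `^ k ^+ 2]expr2 le_eqVlt; apply/orP; left; apply/eqP; ring.
have muq : 0 <= mu `^ (2 * k - p - 2) < 1.
  rewrite powR_ge0 /=; have : mu `^ (2 * k - p - 2) < 1 `^ (2 * k - p - 2).
    by apply: gt0_ltr_powR => //; rewrite nnegrE ltW.
  by rewrite powR1.
have mV : measurable_fun setT (V : pl -> R) by exact: measurable_coneV.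
have [mcV fcV] := convV_finite V0 iV.
have icV : (@leb2 R).-integrable setT (EFin \o (convV V : pl -> R)).
  by apply: integrable_ge0_fin => // z; exact: convV_ge0.
apply: integrable_ge0_fin; [exact: measurable_coneV|by move=> z; exact: coneV_ge0|].
have iO := integrable_scale (1 + M0') (@integrable_omega R).
have iC := integrable_scale (M * C2) icV.
have iS i := integrable_scale M (HS i).1.
have mE (g : P -> R) : (@leb2 R).-integrable setT (EFin \o (g : pl -> R)) -> measurable_fun setT (EFin \o (g : pl -> R)).
  by move=> /integrableP[].
(* Majorant in three parts: [omega] for the region off the cone and the low frequencies, [convV] for
   the commutators, and the series for the main terms. At each high frequency a single term of the
   series suffices. *)
apply: (@le_lt_trans _ _ (\int[@leb2 R]_z (((1 + M0') * omega z)%:E +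
   (((M * C2) * convV V z)%:E + \big[+%E/0%E]_(0 <= i <oo) (M * S i z)%:E)))%E).
  apply: ge0_le_integral => //.
  - by move=> z _; rewrite lee_fin coneV_ge0.
  - by apply/measurable_EFinP; exact: measurable_coneV.
  - apply: emeasurable_funD; first exact: mE iO.
    apply: emeasurable_funD; first exact: mE iC.
    apply: ge0_emeasurable_sum => [i z _ _|i _]; first by rewrite lee_fin mulr_ge0.
    exact: mE (iS i).
  move=> z _; rewrite /coneV indicE.
  have c0 : 0 <= M * C2 * convV V z by rewrite !mulr_ge0 // convV_ge0.
  have o0 := omega_ge0 z.
  have ser0 : (0 <= \big[+%E/0%E]_(0 <= i <oo) (M * S i z)%:E)%E.
    by apply: nneseries_ge0 => i _ _; rewrite lee_fin mulr_ge0.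
  case: (boolP (z \in scone b r s0 d)) => [/set_mem hz|_]; last first.
    rewrite mul0r addr0; apply: lee_paddr; first by apply: adde_ge0.
    by rewrite lee_fin mulrDl mul1r lerDl mulr_ge0.
  rewrite mul1r mulrDl mul1r; have [hX|hX] := leP X0 `|(jb b z).1|; last first.
    apply: lee_paddr; first by apply: adde_ge0.
    by rewrite lee_fin lerD2l low.
  have [i [j gij]] := gain z hz hX; lazy zeta in gij; have [jn Qij le1] := gij.
  rewrite EFinD; apply: leeD.
    by rewrite lee_fin lerDl mulr_ge0.
  apply: (@le_trans _ _ ((M * C2 * convV V z)%:E + (M * S i z)%:E)%E).
    rewrite -EFinD lee_fin; apply: le_trans le1 _; rewrite -mulrA -mulrDr; apply: ler_wpM2l => //.
    rewrite addrC; apply: lerD; first exact: HC2.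
    have jin : j \in iota 0 (grid_size d' (h i)) by rewrite mem_iota.
    rewrite /S (big_rem j jin) ifT // -[leLHS]/(F i j z) lerDl.
    by apply: sumr_ge0 => j' _; exact: F0.
  apply: leeD => //.
  have u0 n : (0 <= (M * S n z)%:E)%E by rewrite lee_fin mulr_ge0.
  apply: le_trans (nneseries_lim_ge i.+1 (fun n _ _ => u0 n)).
  by rewrite big_nat_recr //=; apply: lee_paddl => //; apply: sume_ge0 => n _.
rewrite ge0_integralD //; first last.
- apply: emeasurable_funD; first exact: mE iC.
  apply: ge0_emeasurable_sum => [i z _ _|i _]; first by rewrite lee_fin mulr_ge0.
  exact: mE (iS i).
- by move=> z _; apply: adde_ge0; [rewrite lee_fin !mulr_ge0 // convV_ge0|apply: nneseries_ge0 => i _ _; rewrite lee_fin mulr_ge0].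
- exact: mE iO.
- by move=> z _; rewrite lee_fin mulr_ge0 ?omega_ge0 // addr_ge0.
apply: lte_add_pinfty; first exact: integrable_EFin_lty.
rewrite ge0_integralD //; first last.
- apply: ge0_emeasurable_sum => [i z _ _|i _]; first by rewrite lee_fin mulr_ge0.
  exact: mE (iS i).
- by move=> z _; apply: nneseries_ge0 => i _ _; rewrite lee_fin mulr_ge0.
- exact: mE iC.
- by move=> z _; rewrite lee_fin !mulr_ge0 // convV_ge0.
apply: lte_add_pinfty; first exact: integrable_EFin_lty.
rewrite integral_nneseries //; last 2 first.
- by move=> i; exact: mE (iS i).
- by move=> i z _; rewrite lee_fin mulr_ge0.
apply: (@geometric_nneseries _ _ (M * ((2 / sg + 1) * (C ^+ 2 * W) * al `^ (2 * k - p - 2))) _ _ muq).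
- apply: mulr_ge0 => //; apply: mulr_ge0; last exact: powR_ge0.
  by rewrite !mulr_ge0 ?sqr_ge0 // addr_ge0 // divr_ge0 // ltW.
- by move=> i; apply: integral_ge0 => z _; rewrite lee_fin mulr_ge0.
move=> i; rewrite integral_EFinE // lee_fin RintegralZl //; last by case: (HS i).
rewrite -mulrA; apply: ler_wpM2l => //; have [_] := HS i.
by rewrite !mulrA.
Qed.

End L2GainMain.

(** * Iteration of the gain *)

Section Bootstrap.
Context {R : realType}.
Local Notation P := (R * R)%type.
Local Notation pl := (measurableTypeR R * measurableTypeR R)%type.
Variables (psi1 psi1h psi2 psi2h : R -> R[i]) (psi : P -> R[i]).
Hypothesis hpsi : shearlet_generator psi1 psi1h psi2 psi2h psi.
Local Notation Kast := (Kast psi1h psi2h).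
Variables (Omega : set P) (f : functional R).
Hypothesis f_dist : is_distribution Omega f.
Local Notation Gb := (Gb psi1h psi2h f).

Lemma bump_mul (c : P) r0 r1 r2 r3 (phi tau : P -> R[i]) : bump c r2 r3 phi -> bump c r0 r1 tau -> r1 <= r2 ->
  forall x, phi x * tau x = tau x.
Proof.
move=> Bp Bt r12 x; have [h|h] := leP r1 `|x - c|; first by rewrite (bump_0 Bt h) mulr0.
by rewrite (bump_1 Bp) ?mul1r // (le_trans (ltW h)).
Qed.

(** The difference is the transform of [(1 - phi) phi0 f], which vanishes near [t], so
    [localization] applies. *)
Lemma Gb_localize b c R0 R0' phi0 r1 r2 phi (rho k : R) : bump c R0 R0' phi0 ->
  [set y | `|y - c| <= R0'] `<=` Omega -> R0 < R0' -> bump c r1 r2 phi -> r2 <= R0 -> 0 < r1 -> rho < r1 ->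
  exists2 C : R, 0 <= C & forall a s t, 0 < a <= 1 -> `|s| <= 3 -> `|t - c| <= rho ->
    cabs (Gb b phi0 a s t - Gb b phi a s t) <= C * a `^ k.
Proof.
move=> B0 BO R00 B r2R r10 rr; have t0 := bump_test B0 BO.
have t1 : test_fun Omega phi.
  by apply: (bump_test B) => x /= h; apply: BO => /=; rewrite (le_trans h) // (le_trans r2R) // ltW.
have [N [C wL]] := mul_dist_wtempered f_dist t0.
have bc := smooth_cpt_bounded (bump_smooth_cpt B); have b1 := bounded_derivs_1B bc.
have out y : `|y - c| < r1 -> 1 - phi y = 0.
  by move=> h; rewrite (bump_1 B) ?subrr // ltW.
have [C1 [C10 H1]] := localization hpsi b k wL b1 r10 rr out.
exists C1 => // a s t a01 s3 tr; have /andP[a0 _] := a01.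
have pp := bump_mul B0 B r2R.
have SK : schwartz (FT (Kast b a s t)) by exact: FT_schwartz (smooth_cpt_Kast hpsi b s t a0).
have S1 := schwartzM b1 SK; have S2 := schwartzM bc SK.
rewrite !(GbE hpsi f_dist) // (_ : _ - _ = mul_dist phi0 f (fun x => (1 - phi x) * FT (Kast b a s t) x)); first exact: H1.
have -> : mul_dist phi f (FT (Kast b a s t)) = mul_dist phi0 f (fun x => phi x * FT (Kast b a s t) x).
  by rewrite /mul_dist; congr f; apply/funext => x; rewrite mulrA pp.
apply/eqP; rewrite subr_eq; apply/eqP.
rewrite -[mul_dist phi0 f (fun x => (1 - phi x) * _)]mul1r -(wt_linear wL) //; congr mul_dist; apply/funext => y.
by rewrite mul1r -mulrDl subrK mul1r.
Qed.

(** The exponent [q] is fixed before [tau], so the number of iterations does not depend on the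
    cut-offs chosen along the way. *)
Lemma Phi_growth phi0 : test_fun Omega phi0 -> exists q : nat, forall tau, test_fun Omega tau ->
  (forall x, phi0 x * tau x = tau x) -> exists2 D : R, 0 <= D & forall xi, cabs (Phi f tau xi) <= D * (1 + `|xi|) ^+ q.
Proof.
move=> t0; have gP := pgrowth_Phi f_dist t0; have [_ [q [D HD]]] := gP; exists q => tau tt pt.
have D0 : 0 <= D by have := le_trans (cabs_ge0 _) (HD 0); rewrite normr0 addr0 expr1n mulr1.
have st := test_smooth_cpt tt; have [C C0 HC] := rapid_kap st q.
have I0 : 0 <= \int[@leb2 R]_z omega z by apply: Rintegral_ge0 => z _; exact: omega_ge0.
exists (D * C * \int[@leb2 R]_z omega z); first by rewrite !mulr_ge0.
move=> xi; apply: le_trans (cabs_Phi_conv f_dist xi t0 st pt) _.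
have [io eo] := integrable_omega_shift xi.
have j0 (z : P) : 0 < 1 + `|z| := jnorm_gt0 z.
have -> : D * C * \int[@leb2 R]_z omega z * (1 + `|xi|) ^+ q =
    \int[leb2]_z (D * C * (1 + `|xi|) ^+ q * omega (xi - z)).
  by rewrite RintegralZl // eo; ring.
apply: le_Rintegral => //; [exact: integrable_kap|exact: integrable_scale|move=> z _].
have k0 := kap_ge0 tau (xi - z).
apply: le_trans (ler_wpM2l k0 (HD z)) _.
have pz : (1 + `|z|) ^+ q <= (1 + `|xi|) ^+ q * (1 + `|xi - z|) ^+ q.
  by rewrite -exprMn; apply: ler_Xn; [exact: ltW|rewrite -[`|xi - z|]normrN opprB; exact: jnorm_submult].
have kD : 0 <= (1 + `|xi - z|) * cabs (FT tau (xi - z)) * D by rewrite mulr_ge0.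
have := HC (xi - z); set X := (1 + `|xi - z|) ^+ q in pz *; set Y := (1 + `|xi|) ^+ q in pz *.
have Y0 : 0 <= Y by rewrite exprn_ge0 // ltW.
have DY : 0 <= D * Y by rewrite mulr_ge0.
move=> /(ler_wpM2l DY) h1; have := ler_wpM2l kD pz; move: h1.
set K := (1 + `|xi - z|) * _; set Z := (1 + `|z|) ^+ q; move: (omega _) => o.
move=> h1 h2; rewrite mulrA; apply: le_trans h2 _.
by rewrite [leLHS](_ : _ = D * Y * (X * K)); [apply: le_trans h1 _; rewrite le_eqVlt; apply/orP; left; apply/eqP|]; ring.
Qed.

(** Starting point of the iteration: [2 * q] offsets the squared growth and 4 provides
    integrability. *)
Lemma coneV_growth Ph (q : nat) (D p : R) b r s d : pgrowth Ph -> 0 <= D -> (forall xi, cabs (Ph xi) <= D * (1 + `|xi|) ^+ q) ->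
  p <= - (2 * q%:R) - 4 -> (@leb2 R).-integrable setT (EFin \o (coneV Ph b r s d p : pl -> R)).
Proof.
move=> gP D0 HD hp.
refine (@le_integrable_real R _ pl leb2 _ (fun z => (1 + D ^+ 2) * omega z) _ (integrable_scale _ integrable_omega) _).
  exact: measurable_coneV.
move=> z; rewrite ger0_norm ?coneV_ge0 // /coneV mulrDl mul1r lerD2l.
have o0 := omega_gt0 z; have j0 : 0 < 1 + `|z| := jnorm_gt0 z; have j1 : 1 <= 1 + `|z| := jnorm_ge1 z.
have h1 : (1 + `|z|) `^ p * cabs (Ph z) ^+ 2 <= D ^+ 2 * omega z.
  have e1 : (1 + `|z|) `^ p <= (1 + `|z|) `^ (- (2 * q%:R) - 4) by apply: ler_powR.
  have e2 : cabs (Ph z) ^+ 2 <= D ^+ 2 * (1 + `|z|) `^ (2 * q%:R).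
    apply: le_trans (ler_Xn 2 (cabs_ge0 _) (HD z)) _; rewrite exprMn -exprM mulnC.
    by rewrite -[2 * q%:R]natrM powR_nat.
  apply: le_trans (ler_pM (powR_ge0 _ _) (sqr_ge0 _) e1 e2) _.
  rewrite mulrCA; apply: ler_wpM2l; first exact: sqr_ge0.
  rewrite -powR_add // addrAC addNr add0r powRN powR_nat //.
  rewrite -[leRHS]invrK lef_pV2 ?posrE ?invr_gt0 ?exprn_gt0 //; exact: omegaV_le.
rewrite indicE; case: (_ \in _); rewrite ?mul1r ?mul0r //.
by rewrite mulr_ge0 ?sqr_ge0 // ltW.
Qed.

(* Starting from the polynomial growth of [Phi], each application of [L2_gain] raises the exponent by one
   on a smaller support and a smaller cone. *)
Lemma cone_L2_of_decay b c R0 R0' phi0 s0 r1 a1 C k p r : bump c R0 R0' phi0 ->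
  [set y | `|y - c| <= R0'] `<=` Omega -> R0 < R0' -> r != 0 -> `|s0| <= 2 -> 0 < a1 -> 0 <= C -> r1 <= 1 ->
  (forall a s t, 0 < a < a1 -> `|s - s0| < r1 -> `|t - c| < r1 -> cabs (Gb b phi0 a s t) <= C * a `^ k) ->
  p < 2 * k - 2 ->
  forall d tau ra rb, 0 < d < r1 -> bump c ra rb tau -> 0 < rb -> rb < R0 -> rb < r1 ->
  (@leb2 R).-integrable setT (EFin \o (coneV (Phi f tau) b r s0 d p : pl -> R)).
Proof.
move=> B0 BO R00 r0 s02 a10 C0 r11 HG pk.
have sum3 (u v : R) : u < r1 -> v <= 2 -> u + v <= 3 by move=> ? ?; lra.
have t0 := bump_test B0 BO; have [q Hq] := Phi_growth t0.
have test (c1 c2 : R) tau : bump c c1 c2 tau -> c2 < R0 -> test_fun Omega tau.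
  move=> Bt c2R; apply: (bump_test Bt) => x /= h; apply: BO => /=.
  by rewrite (le_trans h) // ltW // (lt_trans c2R).
(* [n] is the number of gains needed to reach [p'] from the range of [coneV_growth]. *)
suff H : forall n : nat, forall p', p' - n%:R <= - (2 * q%:R) - 4 -> p' < 2 * k - 2 ->
  forall d tau ra rb, 0 < d < r1 -> bump c ra rb tau -> 0 < rb -> rb < R0 -> rb < r1 ->
  (@leb2 R).-integrable setT (EFin \o (coneV (Phi f tau) b r s0 d p' : pl -> R)).
  pose n := archimedean.Num.Def.archi_bound (`|p| + (2 * q%:R) + 4).
  apply: (H n) => //; have n0 : 0 <= `|p| + (2 * q%:R) + 4 by rewrite !addr_ge0 // mulr_ge0.
  by have := archimedean.Num.Theory.archi_boundP n0; rewrite -/n; have := ler_norm p; lra.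
elim=> [|n IH] p' hp pk' d tau ra rb /andP[d0 dr] Bt rb0 rbR rbr; have tt := test _ _ _ Bt rbR.
  have [D D0 HD] := Hq tau tt (bump_mul B0 Bt (ltW rbR)).
  by apply: coneV_growth D0 HD _; [exact: (pgrowth_Phi f_dist tt)|move: hp; rewrite subr0].
(* Midpoints leave room for an intermediate cut-off [phi], equal to 1 on the support of [tau] and
   supported where [phi0] is 1, and for an intermediate cone. *)
pose m := Num.min R0 r1; have rbm : rb < m by rewrite lt_min rbR.
have [mR mr] : m <= R0 /\ m <= r1 by rewrite /m; split; rewrite ge_min lexx ?orbT.
pose r2 := (rb + m) / 2; pose r3 := (r2 + m) / 2; pose d' := (d + r1) / 2.
have [rbr2 r2m] : rb < r2 /\ r2 < m by rewrite !midf_lt.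
have [r23 r3m] : r2 < r3 /\ r3 < m by rewrite !midf_lt.
have [dd' d'r] : d < d' /\ d' < r1 by rewrite !midf_lt.
have [phi Bp] := generator_bumps hpsi c r23.
have r3R := lt_le_trans r3m mR; have r20 := lt_trans rb0 rbr2.
have tp := test _ _ _ Bp r3R.
have iV : (@leb2 R).-integrable setT (EFin \o (coneV (Phi f phi) b r s0 d' (p' - 1) : pl -> R)).
  have h1 : (p' - 1) - n%:R <= - (2 * q%:R) - 4 by move: hp; rewrite -[n.+1%:R]natr1 opprD addrA addrAC.
  have h2 : p' - 1 < 2 * k - 2 by rewrite (lt_trans _ pk') // gtrDl oppr_lt0.
  have h3 : 0 < d' < r1 by rewrite (lt_trans d0).
  by apply: (IH _ h1 h2 _ _ _ _ h3 Bp); rewrite ?(lt_trans r20) // (lt_le_trans r3m).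
have [C' C'0 HC'] := Gb_localize b k B0 BO R00 Bp (ltW r3R) r20 rbr2.
have pt := bump_mul Bp Bt (ltW rbr2).
apply: (@L2_gain _ _ _ _ _ _ hpsi _ _ f_dist b phi tau r s0 d d' p' (Num.min a1 1) (C + C') k) => //.
- by rewrite (le_trans (ltW d'r)).
- by rewrite lt_min a10 ltr01.
- exact: addr_ge0.
move=> a s t; rewrite lt_min => /andP[a0 /andP[aa1 al1]] ss tt0.
have tc : `|t - c| < rb by rewrite ltNge; apply/negP => h; move: tt0; rewrite (bump_0 Bt h) eqxx.
have sr := lt_trans ss d'r.
rewrite -[Gb _ _ _ _ _](subrK (Gb b phi0 a s t)) (le_trans (cabsD _ _)) // addrC mulrDl lerD //.
  by apply: HG => //; [rewrite a0|exact: lt_trans tc rbr].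
rewrite -cabsN opprB; apply: HC'; [by rewrite a0 ltW| |exact: ltW].
have gn := ler_normD (s - s0) s0; rewrite subrK in gn; apply: le_trans gn _.
exact: sum3 sr s02.
Qed.

End Bootstrap.

(** * Wavefront sets *)

Section ArgCones.
Context {R : realType}.
Local Notation P := (R * R)%type.
Local Notation pl := (measurableTypeR R * measurableTypeR R)%type.
Implicit Types (x y xi : P).

Definition cross x y : R := x.1 * y.2 - x.2 * y.1.

Lemma enorm_sqr x : enorm x ^+ 2 = x.1 ^+ 2 + x.2 ^+ 2.
Proof. by rewrite /enorm dot2E sqr_sqrtr -?expr2 // addr_ge0 ?sqr_ge0. Qed.

Lemma enorm_ge0 x : 0 <= enorm x. Proof. exact: sqrtr_ge0. Qed.

Lemma enorm_gt0 x : x != 0 -> 0 < enorm x.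
Proof. by move=> x0; apply: lt_le_trans (norm_le_enorm x); rewrite normr_gt0. Qed.

Lemma lagrange x y : dot2 x y ^+ 2 + cross x y ^+ 2 = (enorm x * enorm y) ^+ 2.
Proof. by rewrite exprMn !enorm_sqr dot2E /cross; ring. Qed.

Lemma Arg_polar x : x != 0 ->
  [/\ x.1 = enorm x * cos (Arg x), x.2 = enorm x * sin (Arg x) & `|Arg x| = acos (x.1 / enorm x)].
Proof.
move=> x0; have n0 := enorm_gt0 x0; set q := x.1 / enorm x.
have q2 : q ^+ 2 + (x.2 / enorm x) ^+ 2 = 1.
  by rewrite /q !exprMn -mulrDl -enorm_sqr exprVn mulfV // expf_neq0 // gt_eqF.
have q1 : -1 <= q <= 1.
  by rewrite -ler_norml -(@ler_pXn2r _ 2) ?nnegrE // expr1n real_normK ?num_real // -q2 lerDl sqr_ge0.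
have a0 := acos_ge0 q1.
have cq : cos (acos q) = q by apply: acosK; rewrite in_itv.
have sq : sin (acos q) = `|x.2| / enorm x.
  by rewrite sin_acos // -q2 addrAC subrr add0r sqrtr_sqr normrM normfV (gtr0_norm n0).
have e1 : enorm x * q = x.1 by rewrite /q mulrC divfK // gt_eqF.
have e2 : enorm x * (`|x.2| / enorm x) = `|x.2| by rewrite mulrC divfK // gt_eqF.
rewrite /Arg -/q; case: ifPn => h.
  by rewrite cq sq e1 e2 !ger0_norm.
have h' : x.2 < 0 by rewrite ltNge.
by rewrite cosN sinN cq sq e1 mulrN e2 normrN (ger0_norm a0) (ltr0_norm h') opprK.
Qed.

(** Removes [Arg] and the free representative of the angle: the angle with [xi0] is less than [eps]
    exactly when its cosine exceeds [cos eps]. *)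
Lemma coneE xi0 (eps : R) : xi0 != 0 -> 0 < eps < pi / 2 ->
  cone xi0 eps = [set xi | cos eps * (enorm xi0 * enorm xi) < dot2 xi0 xi].
Proof.
move=> x0 /andP[e0 e1]; have n0 := enorm_gt0 x0; have [p1 p2 _] := Arg_polar x0.
have epi : eps <= pi by have := pi_gt0 R; lra.
have ei : eps \in `[0, pi] by rewrite in_itv /= (ltW e0) epi.
have ce : 0 < cos eps by apply: cos_gt0_pihalf; have := pi_gt0 R; lra.
apply/seteqP; split => xi.
  move=> [r [th [r0 hth ->]]] /=.
  have -> : enorm (r * cos th, r * sin th) = r.
    apply/eqP; rewrite -(@eqrXn2 _ 2) ?enorm_ge0 ?(ltW r0) //; apply/eqP.
    by rewrite enorm_sqr /= !exprMn -mulrDr cos2Dsin2 mulr1.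
  have -> : dot2 xi0 (r * cos th, r * sin th) = cos `|th - Arg xi0| * (enorm xi0 * r).
    rewrite dot2E /= {1}p1 {1}p2; have -> : cos `|th - Arg xi0| = cos (th - Arg xi0) by case: ler0P => // _; rewrite cosN.
    by rewrite cosB; ring.
  rewrite ltr_pM2r ?mulr_gt0 // ltr_cos // in_itv /= normr_ge0 /=.
  by rewrite (le_trans (ltW hth)).
move=> /= h; have xi_0 : xi != 0.
  apply: contraTneq h => ->; rewrite -leNgt dot2E /= !mulr0 addr0 mulr_ge0 ?(ltW ce) // mulr_ge0 ?enorm_ge0 //.
have n1 := enorm_gt0 xi_0; have N0 : 0 < enorm xi0 * enorm xi by exact: mulr_gt0.
(* The complex number [conj xi0 * xi]; its argument is the angle from [xi0] to [xi]. *)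
pose w : P := (dot2 xi0 xi, cross xi0 xi).
have nw : enorm w = enorm xi0 * enorm xi.
  apply/eqP; rewrite -(@eqrXn2 _ 2) ?enorm_ge0 ?(ltW N0) //; apply/eqP.
  by rewrite enorm_sqr /= lagrange.
have w0 : w != 0 by apply: contraTneq N0 => w0; rewrite -nw w0 /enorm dot2E /= mulr0 addr0 sqrtr0 ltxx.
have [w1 w2 w3] := Arg_polar w0.
have n2 := enorm_sqr xi0; have n00 : enorm xi0 != 0 by rewrite gt_eqF.
exists (enorm xi), (Arg xi0 + Arg w); split => //.
  rewrite addrAC subrr add0r w3 nw /=.
  have q1 : -1 <= dot2 xi0 xi / (enorm xi0 * enorm xi) <= 1.
    rewrite -ler_norml normrM normfV (gtr0_norm N0) ler_pdivrMr // mul1r -(@ler_pXn2r _ 2) ?nnegrE ?(ltW N0) //.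
    by rewrite real_normK ?num_real // -lagrange lerDl sqr_ge0.
  have ai : acos (dot2 xi0 xi / (enorm xi0 * enorm xi)) \in `[0, pi] by rewrite in_itv /= acos_ge0 // acos_lepi.
  by rewrite -ltr_cos // acosK ?in_itv //= ltr_pdivlMr.
have m (u v : R) : enorm xi0 ^+ 2 * u = enorm xi0 ^+ 2 * v -> u = v by apply: mulfI; rewrite expf_neq0.
have w1' : enorm xi0 * (enorm xi * cos (Arg w)) = dot2 xi0 xi by rewrite mulrA -nw -w1.
have w2' : enorm xi0 * (enorm xi * sin (Arg w)) = cross xi0 xi by rewrite mulrA -nw -w2.
rewrite [LHS]surjective_pairing; congr (_, _); apply: m.
  rewrite cosD (_ : _ * (enorm xi * _) = (enorm xi0 * cos (Arg xi0)) * (enorm xi0 * (enorm xi * cos (Arg w))) -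
    (enorm xi0 * sin (Arg xi0)) * (enorm xi0 * (enorm xi * sin (Arg w)))); last by ring.
  by rewrite -p1 -p2 w1' w2' n2 dot2E /cross; ring.
rewrite sinD (_ : _ * (enorm xi * _) = (enorm xi0 * sin (Arg xi0)) * (enorm xi0 * (enorm xi * cos (Arg w))) +
    (enorm xi0 * cos (Arg xi0)) * (enorm xi0 * (enorm xi * sin (Arg w)))); last by ring.
by rewrite -p1 -p2 w1' w2' n2 dot2E /cross; ring.
Qed.

Lemma enorm_jb b x : enorm (jb b x) = enorm x.
Proof. by case: b => //; rewrite /enorm !dot2E /= addrC. Qed.

(* With [y = x (s0 + e)] the angle condition reads
   [cos eps * sqrt (1 + (s0 + e)^2) * sqrt (1 + s0^2) < 1 + s0 (s0 + e)], which holds at [e = 0]. *)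
Lemma scone_sub_cone b xi0 (eps : R) : 0 < eps < pi / 2 -> (jb b xi0).1 != 0 ->
  exists2 d : R, 0 < d & forall d', d' <= d ->
    scone b (jb b xi0).1 ((jb b xi0).2 / (jb b xi0).1) d' `<=` cone xi0 eps.
Proof.
move=> e01 r0; have /andP[e0 e1] := e01; set r := (jb b xi0).1 in r0 *; set s0 := _ / r.
have x0 : xi0 != 0 by apply: contraNneq r0 => E; rewrite /r E /jb; case: (b).
have ce1 : cos eps < 1.
  by rewrite -cos0 ltr_cos ?in_itv /= ?lexx ?pi_ge0 ?(ltW e0) //; have := pi_gt0 R; lra.
pose g (e : R) := 1 + s0 * (s0 + e) - cos eps * (Num.sqrt (1 + s0 ^+ 2) * Num.sqrt (1 + (s0 + e) ^+ 2)).
have g0 : 0 < g 0.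
  have q0 : 0 < 1 + s0 ^+ 2 by rewrite ltr_wpDr ?sqr_ge0.
  rewrite /g addr0 -!expr2 sqr_sqrtr ?(ltW q0) // -[X in X - _]mul1r -mulrBl mulr_gt0 // subr_gt0 //.
have cg : {for 0, continuous g}.
  have cl : (fun e : R => s0 + e) @ nbhs 0 --> s0 + 0 by apply: cvgD; [exact: cvg_cst|exact: cvg_id].
  apply: cvgB; first by apply: cvgD; [exact: cvg_cst|apply: cvgM => //; exact: cvg_cst].
  apply: cvgM; first exact: cvg_cst.
  apply: cvgM; first exact: cvg_cst.
  apply: (@continuous_comp _ _ _ (fun e : R => 1 + (s0 + e) ^+ 2) Num.sqrt); last exact: sqrt_continuous.
  by apply: cvgD; [exact: cvg_cst|rewrite expr2; under eq_fun do rewrite expr2; apply: cvgM].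
have /nbhs_ballP[d /= d0 hd] : \forall e \near (0 : R), 0 < g e.
  exact: (cvgr_gt (g 0) cg _ g0).
exists d => // d' d'd xi hxi; have sl := scone_slope hxi; rewrite coneE //=.
move: (hxi) => [rx _]; set x := (jb b xi).1 in sl rx; have x1 : x != 0 by apply: contraTneq rx => ->; rewrite mulr0 ltxx.
set e := (jb b xi).2 / x - s0 in sl.
have ge : 0 < g e by apply: hd; rewrite /ball /= sub0r normrN (lt_le_trans sl).
have j1 : jb b xi = (x, x * (s0 + e)).
  rewrite [LHS]surjective_pairing; congr (_, _).
  by rewrite /e addrC subrK mulrC divfK.
have j0 : jb b xi0 = (r, r * s0) by rewrite [LHS]surjective_pairing; congr (_, _); rewrite /s0 mulrC divfK.
have nE (y s : R) : enorm (y, y * s) = `|y| * Num.sqrt (1 + s ^+ 2).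
  by rewrite /enorm dot2E /= -sqrtr_sqr -sqrtrM ?sqr_ge0 //; congr Num.sqrt; ring.
rewrite -(enorm_jb b xi0) -(enorm_jb b xi) -[xi0 in dot2 xi0](jbK b) dot2_jb j0 j1 !nE dot2E /=.
have -> : r * x + r * s0 * (x * (s0 + e)) = `|r| * `|x| * (1 + s0 * (s0 + e)).
  by rewrite -normrM gtr0_norm //; ring.
have rx0 : 0 < `|r| * `|x| by rewrite mulr_gt0 ?normr_gt0.
have := mulr_gt0 rx0 ge; rewrite /g mulrBr subr_gt0; congr (_ < _); ring.
Qed.

(** The slope deviation is measured by the cross product, at most [sin eps] times the norms, while
    the dot product, at least [cos eps] times the norms, bounds the first coordinate from below. *)
Lemma cone_sub_scone b xi0 (d : R) : 0 < d -> (jb b xi0).1 != 0 ->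
  exists2 eps : R, 0 < eps < pi / 2 &
    cone xi0 eps `<=` scone b (jb b xi0).1 ((jb b xi0).2 / (jb b xi0).1) d.
Proof.
move=> d0 r0; set r := (jb b xi0).1 in r0 *; set s0 := _ / r.
have x0 : xi0 != 0 by apply: contraNneq r0 => E; rewrite /r E /jb; case: (b).
have q0 : 0 < 1 + s0 ^+ 2 by rewrite ltr_wpDr ?sqr_ge0.
(* [0 < g e] is the inequality that the two bounds require; [g 0 = d], so small angles satisfy
   it. *)
pose g (e : R) := d * (cos e - `|s0| * sin e) - sin e * (1 + s0 ^+ 2).
pose h (e : R) := cos e - `|s0| * sin e.
have ch : {for 0, continuous h}.
  by apply: cvgB; [exact: continuous_cos|apply: cvgM; [exact: cvg_cst|exact: continuous_sin]].
have cg : {for 0, continuous g}.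
  apply: cvgB; first by apply: cvgM; [exact: cvg_cst|exact: ch].
  by apply: cvgM; [exact: continuous_sin|exact: cvg_cst].
have h0 : 0 < h 0 by rewrite /h cos0 sin0 mulr0 subr0.
have g0 : 0 < g 0 by rewrite /g cos0 sin0 mulr0 subr0 mul0r subr0 mulr1.
have n1 : \forall e \near (0 : R), 0 < g e by exact: (cvgr_gt (g 0) cg _ g0).
have n2 : \forall e \near (0 : R), 0 < h e by exact: (cvgr_gt (h 0) ch _ h0).
have /nbhs_ballP[e1 /= e10 he] : \forall e \near (0 : R), 0 < g e /\ 0 < h e.
  by near=> e; split; near: e.
pose eps := Num.min (e1 / 2) (1 / 2); have eps0 : 0 < eps by rewrite lt_min !divr_gt0.
have eps1 : eps <= 1 / 2 by rewrite ge_min lexx orbT.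
have epi : eps < pi / 2 by have := pihalf_ge1 R; lra.
have e01 : 0 < eps < pi / 2 by rewrite eps0.
exists eps => // xi; rewrite coneE //=.
have [ge hse] : 0 < g eps /\ 0 < h eps.
  by apply: he; rewrite /ball /= sub0r normrN gtr0_norm // (@le_lt_trans _ _ (e1 / 2)) ?ge_min ?lexx //; lra.
have se : 0 < sin eps by apply: sin_gt0_pi; rewrite eps0 /=; have := pi_gt0 R; lra.
have ce : 0 < cos eps by apply: cos_gt0_pihalf; rewrite epi andbT; have := pi_gt0 R; lra.
set N := enorm xi0 * enorm xi => dN.
have N0' : 0 <= N by rewrite mulr_ge0 ?enorm_ge0.
have N0 : 0 < N.
  rewrite lt_neqAle N0' andbT; apply/eqP => E; move: dN; rewrite -E mulr0 => dN.
  have := lagrange xi0 xi; rewrite -/N -E expr0n /= => l; have := exprn_gt0 2 dN; have := sqr_ge0 (cross xi0 xi); lra.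
have cN : `|cross xi0 xi| < sin eps * N.
  have sN : 0 <= sin eps * N by rewrite mulr_ge0 // ltW.
  have cN : 0 <= cos eps * N by rewrite mulr_ge0 // ltW.
  rewrite -(@ltr_pXn2r _ 2) ?nnegrE // real_normK ?num_real // exprMn sin2cos2.
  have := lagrange xi0 xi; rewrite -/N => l.
  have : (cos eps * N) ^+ 2 < dot2 xi0 xi ^+ 2.
    by rewrite ltr_pXn2r ?nnegrE // ltW // (le_lt_trans _ dN).
  by rewrite exprMn; lra.
set x := (jb b xi).1; set y := (jb b xi).2.
have j0 : jb b xi0 = (r, r * s0) by rewrite [LHS]surjective_pairing; congr (_, _); rewrite /s0 mulrC divfK.
have jE : jb b xi = (x, y) by rewrite [LHS]surjective_pairing.
have dE : dot2 xi0 xi = r * x + r * s0 * y by rewrite -[xi0](jbK b) dot2_jb j0 jE dot2E.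
have crE : `|cross xi0 xi| = `|r * (y - s0 * x)|.
  have -> : xi0 = jb b (r, r * s0) by rewrite -j0 jbK.
  have -> : xi = jb b (x, y) by rewrite -jE jbK.
  rewrite /cross /jb; case: (b) => /=; last by congr `|_|; ring.
  by rewrite -normrN; congr `|_|; ring.
set c := r * (y - s0 * x) in crE.
have dE2 : dot2 xi0 xi = r * x * (1 + s0 ^+ 2) + s0 * c by rewrite dE /c; ring.
have sc : s0 * c <= `|s0| * (sin eps * N).
  rewrite (le_trans (ler_norm _)) // normrM -crE; apply: ler_wpM2l => //; exact: ltW.
have K : N * h eps < r * x * (1 + s0 ^+ 2).
  by move: dN; rewrite dE2 /h mulrBr; lra.
have rx : 0 < r * x by rewrite -(pmulr_lgt0 _ q0); apply: lt_trans K; exact: mulr_gt0.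
split => //; rewrite -/x -/y -(@ltr_pM2l _ `|r|) ?normr_gt0 // -normrM -/c -crE mulrCA -normrM (gtr0_norm rx).
rewrite -(ltr_pM2r q0); apply: (@lt_trans _ _ (sin eps * N * (1 + s0 ^+ 2))); first by rewrite ltr_pM2r.
have := mulr_gt0 N0 ge; rewrite /g -/(h eps) => k1.
have := ltr_pM2l d0 (N * h eps) (r * x * (1 + s0 ^+ 2)); rewrite K => k2.
have k3 : d * (N * h eps) < d * (r * x * (1 + s0 ^+ 2)) by rewrite k2.
rewrite -(mulrA d); apply: le_lt_trans k3; lra.
Unshelve. all: by end_near. Qed.

Lemma measurable_cone xi0 (eps : R) : xi0 != 0 -> 0 < eps < pi / 2 -> measurable (cone xi0 eps : set pl).
Proof.
move=> x0 e0; rewrite coneE //; apply: open_measurable_plane.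
have c2 : continuous (fun xi : P => dot2 xi0 xi).
  move=> z; apply: cvgD; apply: cvgM; try exact: cvg_cst; [exact: continuous_fst2|exact: continuous_snd2].
have ce : continuous (fun xi : P => enorm xi).
  move=> z; apply: (@continuous_comp _ _ _ (fun xi : P => dot2 xi xi) Num.sqrt); last exact: sqrt_continuous.
  by apply: cvgD; apply: cvgM; first [exact: continuous_fst2|exact: continuous_snd2].
rewrite (_ : [set xi | _] = (fun xi : P => dot2 xi0 xi - cos eps * (enorm xi0 * enorm xi)) @^-1` [set t | 0 < t]).
  apply: open_comp; last exact: open_gt.
  by move=> z _; apply: cvgB; [exact: c2|apply: cvgM; [exact: cvg_cst|apply: cvgM; [exact: cvg_cst|exact: ce]]].
by apply/seteqP; split => z /=; rewrite subr_gt0.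
Qed.

End ArgCones.

(** * Microlocal regularity in terms of the transform of a cut-off distribution *)

Section Microlocal.
Context {R : realType}.
Local Notation P := (R * R)%type.
Local Notation pl := (measurableTypeR R * measurableTypeR R)%type.
Variables (psi1 psi1h psi2 psi2h : R -> R[i]) (psi : P -> R[i]).
Hypothesis hpsi : shearlet_generator psi1 psi1h psi2 psi2h psi.
Variables (Omega : set P) (f : functional R).
Hypothesis Omega_open : open Omega.
Hypothesis f_dist : is_distribution Omega f.

Lemma fourier_is2_Phi phi : test_fun Omega phi -> fourier_is2 (mul_dist phi f) (Phi f phi).
Proof.
move=> tphi eta se; have := mul_dist_FT f_dist tphi (schwartz_rapid se); rewrite -/(FT eta) => ->.
by congr Cint; apply/funext => z; rewrite mulrC.
Qed.

Lemma fourier_is2_unique u (G G' : P -> R[i]) : Ccontinuous G -> Ccontinuous G' ->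
  fourier_is2 u G -> fourier_is2 u G' -> G = G'.
Proof.
move=> [c1 c2] [d1 d2] HG HG'.
have cD0 : Ccontinuous (fun x => G x - G' x).
  split => y.
    rewrite (_ : (fun x => _) = (fun x => Re (G x) - Re (G' x))); last by apply/funext => z; rewrite Re_add Re_opp.
    by apply: cvgB; [exact: c1|exact: d1].
  rewrite (_ : (fun x => _) = (fun x => Im (G x) - Im (G' x))); last by apply/funext => z; rewrite Im_add Im_opp.
  by apply: cvgB; [exact: c2|exact: d2].
apply/funext => x; apply/eqP; rewrite -subr_eq0; apply/eqP; move: x.
apply: (fundamental_lemma (generator_bumps hpsi) cD0) => h sh.
have ci (H : P -> R[i]) : Ccontinuous H -> cintable leb2 ((fun x => H x * h x) : pl -> R[i]).
  move=> cH; have [sh1 [r r0]] := sh; apply: rapid_cintable; apply: (@cpt_rapid _ _ r) => [|y /r0 ->]; last by rewrite mulr0.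
  by apply: Ccontinuous_mul => //; exact: smooth_Ccontinuous.
rewrite (_ : (fun x => _) = (fun x => G x * h x - G' x * h x)); last by apply/funext => y; ring.
have sh' := smooth_cpt_schwartz sh.
rewrite CintB; [|exact: (ci G)|exact: (ci G')].
by rewrite -(HG _ sh') -(HG' _ sh') subrr.
Qed.

(** The continuous function representing the Fourier transform is unique by the fundamental lemma,
    so it is [Phi f phi]. *)
Lemma microlocallyP Pr x0 xi0 : microlocally Omega f Pr x0 xi0 <->
  exists phi eps, [/\ cutoff Omega x0 phi, 0 < eps < pi / 2 & Pr (cone xi0 eps) (Phi f phi)].
Proof.
split=> [[phi [eps [G [cphi e0 cG HG PG]]]]|[phi [eps [cphi e0 PG]]]].
  have cP := Ccontinuous_Phi f_dist cphi.1; have HP := fourier_is2_Phi cphi.1.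
  by exists phi, eps; split => //; rewrite -(fourier_is2_unique cG cP HG HP).
exists phi, eps, (Phi f phi); split => //; first exact: (Ccontinuous_Phi f_dist cphi.1).
exact: (fourier_is2_Phi cphi.1).
Qed.

Lemma cutoff_box x0 phi : Omega x0 -> cutoff Omega x0 phi -> exists2 rho : R, 0 < rho &
  [set y | `|y - x0| <= rho] `<=` Omega /\ forall y, `|y - x0| <= rho -> phi y = 1.
Proof.
move=> Ox [_ /nbhs_normP[e /= e0 He]]; have [e' e'0 He'] := open_box Omega_open Ox.
exists (Num.min (e / 2) e'); first by rewrite lt_min divr_gt0.
split=> [y /= h|y h]; first by apply: He' => /=; rewrite (le_trans h) // ge_min lexx orbT.
apply: He => /=; rewrite distrC (le_lt_trans h) // (@le_lt_trans _ _ (e / 2)) ?ge_min ?lexx //; lra.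
Qed.

Lemma bump_cutoff x0 ra rb phi : bump x0 ra rb phi -> 0 < ra -> [set y | `|y - x0| <= rb] `<=` Omega ->
  cutoff Omega x0 phi.
Proof.
move=> B ra0 BO; split; first exact: (bump_test B BO).
by apply/nbhs_normP; exists ra => // y /= h; apply: (bump_1 B); rewrite distrC ltW.
Qed.

Lemma Cint_restrict (D : set pl) (h : P -> R[i]) : (forall x, ~ D x -> h x = 0) -> Cint leb2 D h = Cint leb2 setT h.
Proof.
move=> h0; rewrite /Cint /Rintegral; congr (fine _ +i* fine _);
  rewrite [LHS]integral_mkcond; apply: eq_integral => x _; rewrite patchE;
  by case: ifPn => // /negP; rewrite inE => /h0 ->.
Qed.

(** Covers the points outside the singular support, which the definition of [WF] excludes for all
    directions: there [tau f] is a test function, whose transform decays rapidly. *)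
Lemma rapid_Phi_regular x0 : Omega x0 -> ~ sing_supp Omega f x0 -> exists2 rho : R, 0 < rho &
  [set y | `|y - x0| <= rho] `<=` Omega /\
  forall ra rb tau, bump x0 ra rb tau -> rb <= rho -> rapid (Phi f tau).
Proof.
move=> Ox ns; have [phi cphi [g sg Hg]] : exists2 phi, cutoff Omega x0 phi &
        exists2 g, smooth_on Omega g &
          forall eta, test_fun Omega eta ->
            mul_dist phi f eta = Cint leb2 Omega (fun x => g x * eta x).
  by apply: contrapT => h; apply: ns.
have [rho rho0 [HO Hphi]] := cutoff_box Ox cphi; exists rho => //; split => // ra rb tau B rbr.
have BO : [set y | `|y - x0| <= rb] `<=` Omega by move=> y /= h; apply: HO; exact: le_trans h rbr.
have tt := bump_test B BO.
have tau0 x : ~ Omega x -> tau x = 0.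
  by move=> nO; apply: (bump_0 B); rewrite leNgt; apply/negP => h; apply: nO; apply: BO; exact: ltW.
have sgt : smooth_cpt (fun x => g x * tau x).
  split; last first.
    by have [_ [r Hr]] := bump_smooth_cpt B; exists r => x /Hr ->; rewrite mulr0.
  pose U := [set x : P | rb < `|x - x0|].
  have oU : open U.
    apply: (@open_comp _ _ (fun x : P => `|x - x0|) [set t | rb < t]); last exact: open_gt.
    move=> x _; apply: (@continuous_comp _ _ _ (fun x : P => x - x0) (fun x : P => `|x|)); last exact: norm_continuous.
    by apply: cvgB; [exact: cvg_id|exact: cvg_cst].
  have S1 : smooth_on Omega (fun x => g x * tau x).
    by apply: smooth_onM => //; apply: smooth_on_sub (bump_smooth B).
  (* [g] is only smooth on [Omega]; outside the box of radius [rb] the product vanishes, and the two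
     open sets cover the plane. *)
  have S2 : smooth_on U (fun x => g x * tau x).
    apply: (eq_smooth_on oU (g := fun=> 0)); last exact: smooth_on_cst.
    by move=> x /= h; rewrite (bump_0 B) ?mulr0 // ltW.
  move=> w x _; have [h|h] := leP `|x - x0| rb; [apply: S1; exact: BO|exact: S2].
rewrite (_ : Phi f tau = FT (fun x => g x * tau x)); first exact: FT_rapid.
apply/funext => xi; have [sew _] := smooth_ew xi.
have [te _] := test_funM tt sew.
rewrite /Phi (_ : (fun x => tau x * ew xi x) = (fun x => phi x * (tau x * ew xi x))); last first.
  apply/funext => x; rewrite mulrA; congr (_ * _); have [h|h] := leP rb `|x - x0|.
    by rewrite (bump_0 B) ?mulr0.
  by rewrite Hphi ?mul1r // (le_trans (ltW h)).
rewrite -/(mul_dist phi f _) Hg // Cint_restrict; last by move=> x /tau0 ->; rewrite mul0r mulr0.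
by rewrite FTE; congr Cint; apply/funext => x; rewrite mulrA ewC.
Qed.

(** The arbitrary cut-off of the definition is replaced by a real bump, at the cost of a smaller
    cone, so that the reality of [f] can be used. *)
Lemma not_WF_cone_rapid b x0 xi0 : Omega x0 -> (jb b xi0).1 != 0 -> ~ WF Omega f (x0, xi0) ->
  exists ra rb d : R, exists tau, [/\ bump x0 ra rb tau, 0 < ra < rb, [set y | `|y - x0| <= rb] `<=` Omega, 0 < d &
    cone_rapid (scone b (jb b xi0).1 ((jb b xi0).2 / (jb b xi0).1) d) (Phi f tau)].
Proof.
move=> Ox r0 nWF; have x0_ : xi0 != 0 by apply: contraNneq r0 => E; rewrite E /jb; case: (b).
have [ss|ns] := pselect (sing_supp Omega f x0); last first.
  have [rho rho0 [HO H]] := rapid_Phi_regular Ox ns.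
  have rr : rho / 2 < rho by lra.
  have [tau B] := generator_bumps hpsi x0 rr.
  exists (rho / 2), rho, 1, tau; split => //; first by rewrite rr divr_gt0.
  have [_ Hr] := H _ _ _ B (lexx _).
  by move=> n; have [C HC] := Hr n; exists `|C| => // xi _; rewrite (le_trans (HC xi)) // ler_norm.
have : microlocally Omega f rapid_decay x0 xi0 by apply: contrapT => h; apply: nWF.
move=> /microlocallyP[phi [eps [cphi e01 Hrd]]].
have [rho rho0 [HO Hphi]] := cutoff_box Ox cphi.
have [d d0 Hd] := scone_sub_cone e01 r0.
have rr : rho / 2 < rho by lra.
have [tau B] := generator_bumps hpsi x0 rr.
exists (rho / 2), rho, (d / 2), tau; split => //; [by rewrite rr divr_gt0|by rewrite divr_gt0|].
have dd : d / 2 < d by lra.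
have pt x : phi x * tau x = tau x.
  have [h|h] := leP rho `|x - x0|; first by rewrite (bump_0 B) ?mulr0.
  by rewrite Hphi ?mul1r // ltW.
apply: (cone_rapid_shrink f_dist cphi.1 (bump_smooth_cpt B) pt r0 _ dd); first by rewrite divr_gt0.
move=> n; have [C HC] := Hrd n; exists `|C| => // xi /(Hd d (lexx _)) hxi.
apply: le_trans (le_trans (HC xi hxi) (ler_norm C)); apply: ler_wpM2r; first exact: cabs_ge0.
by apply: ler_Xn; [exact/ltW/jnorm_gt0|rewrite lerD2l norm_le_enorm].
Qed.

Lemma cone_rapid_opp b r s d tau : real_valued Omega f -> test_fun Omega tau -> (forall x, Im (tau x) = 0) ->
  cone_rapid (scone b r s d) (Phi f tau) -> cone_rapid (scone b (- r) s d) (Phi f tau).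
Proof.
move=> fr tt tr H n; have [C C0 HC] := H n; exists C => // xi [h1 h2].
have := HC (- xi); rewrite normrN (Phi_conj f_dist) // cabsJ; apply.
have -> : scone b r s d (- xi) = (0 < r * - (jb b xi).1 /\ `|- (jb b xi).2 - s * - (jb b xi).1| < d * `|- (jb b xi).1|).
  by rewrite /scone /=; case: (b).
by rewrite mulrN -mulNr mulrN -opprD !normrN.
Qed.

End Microlocal.

(** * From regularity to shearlet decay, and the Sobolev inclusion *)

Section Characterization.
Context {R : realType}.
Local Notation P := (R * R)%type.
Local Notation pl := (measurableTypeR R * measurableTypeR R)%type.
Variables (psi1 psi1h psi2 psi2h : R -> R[i]) (psi : P -> R[i]).
Hypothesis hpsi : shearlet_generator psi1 psi1h psi2 psi2h psi.
Variables (Omega : set P) (f : functional R).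
Hypothesis Omega_open : open Omega.
Hypothesis f_dist : is_distribution Omega f.
Variable F : P -> functional R.
Hypothesis F_reading : shearlet_reading Omega f F.
Local Notation Gb := (Gb psi1h psi2h f).
Local Notation SHb := (SHb psi).

Definition Lambda (b : bool) : R -> set (P * P) :=
  if b then Lambda2 psi Omega F else Lambda1 psi Omega F.

Definition slope b (xi : P) : R := (jb b xi).2 / (jb b xi).1.

Lemma LambdaP b k x xi : Lambda b k (x, xi) <->
  [/\ Omega x, (jb b xi).1 != 0, -2 < slope b xi < 2 & decays (SHb b (F x)) k (slope b xi) x].
Proof.
rewrite /Lambda /slope; case: b; split.
- move=> [y [s [r [Oy s2 r0 [-> ->] H]]]] /=.
  by rewrite mulrAC mulfV // mul1r; split.
- case: xi => u v /= [Ox v0 s2 H]; exists x, (u / v), v; split => //.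
  by rewrite mulrC divfK.
- move=> [y [s [r [Oy s2 r0 [-> ->] H]]]] /=.
  by rewrite mulrAC mulfV // mul1r; split.
case: xi => u v /= [Ox v0 s2 H]; exists x, (v / u), u; split => //.
by rewrite mulrC divfK.
Qed.

Lemma Lambda_phase_space b k : Lambda b k `<=` phase_space Omega.
Proof.
move=> [x xi] /LambdaP[Ox r0 _ _]; split => //=.
by apply: contraNneq r0 => E; rewrite E /jb; case: (b).
Qed.

Lemma continuous_slope b (xi : P) : (jb b xi).1 != 0 -> {for xi, continuous (slope b)}.
Proof.
move=> r0; rewrite /slope; move: r0; case: b => /= r0.
  by apply: cvgM; [exact: continuous_fst2|apply: cvgV => //; exact: continuous_snd2].
by apply: cvgM; [exact: continuous_snd2|apply: cvgV => //; exact: continuous_fst2].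
Qed.

(** Rapid decay in the two opposite cones yields decay of every order for all nearby points and
    slopes at once, so a full neighbourhood lies in every [Lambda b k], as the interior requires. *)
Lemma not_WF_Lambda_infty : real_valued Omega f -> phase_space Omega `\` WF Omega f `<=`
  Lambda_infty (Lambda1 psi Omega F) `|` Lambda_infty (Lambda2 psi Omega F).
Proof.
move=> fr [x0 xi0] [[/= Ox xi00] nWF].
(* The transform is chosen by the larger coordinate of [xi0]; the slope is then at most 1 in
   absolute value, strictly inside the admissible range. *)
have [b r0 s2] : exists2 b, (jb b xi0).1 != 0 & -2 < slope b xi0 < 2.
  have [h|h] := leP `|xi0.1| `|xi0.2|.
    exists true; rewrite /jb /=.
      by apply: contraNneq xi00 => E; move: h; rewrite E normr0 normr_le0 => /eqP E1; rewrite [xi0]surjective_pairing E E1.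
    rewrite -ltr_norml normrM normfV; have h2 : 0 < `|xi0.2|.
      rewrite lt_neqAle normr_ge0 andbT eq_sym; apply: contraNneq xi00 => /eqP; rewrite normr_eq0 => /eqP E.
      by move: h; rewrite E normr0 normr_le0 => /eqP E1; rewrite [xi0]surjective_pairing E E1.
    by rewrite ltr_pdivrMr // (le_lt_trans h) // ltr_pMl // ltr1n.
  have h2 : 0 < `|xi0.1| by rewrite (le_lt_trans _ h).
  exists false; rewrite /jb /=; first by rewrite -normr_gt0.
  by rewrite -ltr_norml normrM normfV ltr_pdivrMr // (lt_trans h) // ltr_pMl // ltr1n.
suff H : Lambda_infty (Lambda b) (x0, xi0).
  by move: H; rewrite /Lambda; case: (b) => H; [right|left].
have [ra [rb [d [tau [B /andP[ra0 rab] BO d0 Hc]]]]] := not_WF_cone_rapid hpsi Omega_open f_dist Ox r0 nWF.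
have tt := bump_test B BO.
have Hc' := cone_rapid_opp f_dist fr tt (bump_real B) Hc.
have n1 : \forall x \near x0, `|x - x0| < ra.
  by apply/nbhs_normP; exists ra => // y /=; rewrite distrC.
have cs := continuous_slope r0.
have n2 : \forall xi \near xi0, `|slope b xi - slope b xi0| < d / 4.
  have d4 : 0 < d / 4 by rewrite divr_gt0.
  move/cvgrPdist_lt: (cs) => /(_ _ d4).
  by apply: filterS => y; rewrite distrC.
have n3 : \forall xi \near xi0, (-2 < slope b xi) && (slope b xi < 2).
  have /andP[s21 s22] := s2.
  have h1 : \forall xi \near xi0, -2 < slope b xi by exact: (cvgr_gt _ cs _ s21).
  have h2 : \forall xi \near xi0, slope b xi < 2 by exact: (cvgr_lt _ cs _ s22).
  by near=> xi; apply/andP; split; near: xi.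
have n4 : \forall xi \near xi0, (jb b xi).1 != 0.
  have cj : {for xi0, continuous (fun xi : P => `|(jb b xi).1|)}.
    apply: (@continuous_comp _ _ _ (fun xi : P => (jb b xi).1) (fun t : R => `|t|)); last exact: norm_continuous.
    by rewrite /jb; case: (b); [exact: continuous_snd2|exact: continuous_fst2].
  have j0 : 0 < `|(jb b xi0).1| by rewrite normr_gt0.
  have : \forall xi \near xi0, 0 < `|(jb b xi).1| by exact: (cvgr_gt _ cj _ j0).
  by apply: filterS => y; rewrite normr_gt0.
(* This neighbourhood does not depend on [k]. *)
have : \forall p \near (x0, xi0), [/\ `|p.1 - x0| < ra, `|slope b p.2 - slope b xi0| < d / 4,
    -2 < slope b p.2 < 2 & (jb b p.2).1 != 0].
  exists ([set x | `|x - x0| < ra], [set xi | [/\ `|slope b xi - slope b xi0| < d / 4, -2 < slope b xi < 2 & (jb b xi).1 != 0]]) => /=.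
    by split => //; near=> xi; split; near: xi.
  by move=> [x xi] /= [h1 [h2 h3 h4]].
rewrite /Lambda_infty /interior; apply: filterS => -[x xi] /= [h1 h2 h3 h4] k _.
apply/LambdaP; split => //; first by apply: BO => /=; rewrite ltW // (lt_trans h1).
apply/(decays_SHb_Gb hpsi f_dist F_reading _ _ B BO rab h1 h3).
exact: (cone_rapid_decays f_dist hpsi _ _ tt d0 Hc Hc' r0 h2).
Unshelve. all: by end_near. Qed.

Lemma decays_box b phi k s x : decays (Gb b phi) k s x -> exists r1 C : R, [/\ 0 < r1, 0 <= C &
  forall a s' t, 0 < a < r1 -> `|s' - s| < r1 -> `|t - x| < r1 -> cabs (Gb b phi a s' t) <= C * a `^ k].
Proof.
move=> [r0 [C [r00 C0 H]]]; exists (r0 / 2), C; split; [by rewrite divr_gt0|exact: ltW|].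
move=> a s' t /andP[a0 ar] sr tr; apply: H; [rewrite a0; lra|lra|].
by apply: le_lt_trans (enorm_le _) _; lra.
Qed.

(** The quotient of [1 + enorm xi ^+ 2] by [(1 + |xi|) ^+ 2] lies between 1/2 and 4, so powers of
    either sign are comparable. *)
Lemma japanese_enorm (m : R) : exists2 C : R, 0 <= C & forall xi : P,
  (1 + enorm xi ^+ 2) `^ m <= C * (1 + `|xi|) `^ (2 * m).
Proof.
exists ((1 / 2) `^ m + 4 `^ m); first by rewrite addr_ge0 ?powR_ge0.
move=> xi; have j0 := jnorm_gt0 xi; have n0 := normr_ge0 xi; set y := `|xi| in n0 j0 *.
have e1 : y <= enorm xi by exact: norm_le_enorm.
have e2 : enorm xi <= 2 * y by exact: enorm_le.
have e0 : 0 <= enorm xi by exact: enorm_ge0.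
have q1 : y ^+ 2 <= enorm xi ^+ 2 by apply: ler_Xn.
have q2 : enorm xi ^+ 2 <= (2 * y) ^+ 2 by apply: ler_Xn.
have j2 : 0 < (1 + y) ^+ 2 by rewrite exprn_gt0.
pose u := (1 + enorm xi ^+ 2) / (1 + y) ^+ 2.
have u1 : 1 / 2 <= u <= 4.
  rewrite ler_pdivlMr // ler_pdivrMr //; move: q2; rewrite exprMn => q2.
  by have := sqr_ge0 (1 - y); have := sqr_ge0 y; rewrite sqrrB sqrrD; move=> ? ?; apply/andP; split; lra.
have -> : 1 + enorm xi ^+ 2 = u * (1 + y) ^+ 2 by rewrite /u divfK // gt_eqF.
rewrite powRM ?(ltW j2) //; last by case/andP: u1 => ? _; lra.
rewrite -(powR_nat 2 j0) -powRrM; apply: ler_wpM2r; first exact: powR_ge0.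
by apply: powR_between => //; rewrite divr_gt0.
Qed.

Lemma sobolev_of_coneV b r s d m phi xi0 eps : test_fun Omega phi -> xi0 != 0 -> 0 < eps < pi / 2 ->
  cone xi0 eps `<=` scone b r s d ->
  (@leb2 R).-integrable setT (EFin \o (coneV (Phi f phi) b r s d (2 * m) : pl -> R)) ->
  sobolev_decay m (cone xi0 eps) (Phi f phi).
Proof.
move=> tphi x0 e0 sub iV; rewrite /sobolev_decay.
have [C C0 HC] := japanese_enorm m; have mc := measurable_cone x0 e0.
have iC := integrable_scale C iV; have fC := integrable_EFin_lty iC.
have [mP _] := pgrowth_Phi f_dist tphi.
apply: le_lt_trans fC; rewrite [leLHS]integral_mkcond; apply: ge0_le_integral => //.
- by move=> z _; apply: erestrict_ge0 => y _; rewrite lee_fin mulr_ge0 ?powR_ge0 ?sqr_ge0.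
- apply/(measurable_restrictT _ mc); apply: measurable_funTS.
  apply/measurable_EFinP; apply: measurable_funM; last by apply: measurable_funX; exact: cmeas_cabs.
  apply: (measurableT_comp (measurable_powR m)); apply: continuous_measurable_plane => z.
  apply: cvgD; first exact: cvg_cst.
  have ce : {for z, continuous (fun xi : P => enorm xi)}.
    apply: (@continuous_comp _ _ _ (fun xi : P => dot2 xi xi) Num.sqrt); last exact: sqrt_continuous.
    by apply: cvgD; apply: cvgM; first [exact: continuous_fst2|exact: continuous_snd2].
  by rewrite expr2; under eq_fun do rewrite expr2; apply: cvgM.
- by case/integrableP: iC.
move=> z _; rewrite patchE; case: ifPn => [/set_mem hz|_]; last by rewrite lee_fin mulr_ge0 ?coneV_ge0.
rewrite lee_fin /coneV indicE mem_set ?mul1r; last exact: sub.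
apply: le_trans (ler_wpM2r (sqr_ge0 _) (HC z)) _; rewrite -mulrA; apply: ler_wpM2l => //.
by rewrite lerDr omega_ge0.
Qed.

(** Sobolev decay of order [m] is the integrability of [coneV] with exponent [2 * m], once an
    angular cone is placed inside the slope cone. *)
Lemma Lambda_not_WFm b (m eps : R) : 0 < eps -> Lambda b (m + 1 + eps) `<=` phase_space Omega `\` WFm m Omega f.
Proof.
move=> e0 [x0 xi0] HL; split; first exact: Lambda_phase_space HL.
move=> [_ /= xi00]; apply; move/LambdaP: HL => [Ox r0 s2 Hd].
have [rho rho0 HO] := open_box Omega_open Ox.
have rr : rho / 2 < rho by lra.
have [phi B] := generator_bumps hpsi x0 rr.
have xc : `|x0 - x0| < rho / 2 by rewrite subrr normr0 divr_gt0.
move: Hd; move/(decays_SHb_Gb hpsi f_dist F_reading _ _ B HO rr xc s2) => /decays_box[r1 [C [r10 C0 HG]]].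
pose r2 := Num.min r1 1; have r20 : 0 < r2 by rewrite lt_min r10 ltr01.
have r21 : r2 <= r1 by rewrite ge_min lexx.
pose rb := Num.min (rho / 2) r2 / 2.
have m0 : 0 < Num.min (rho / 2) r2 by rewrite lt_min r20 divr_gt0.
have rb0 : 0 < rb by rewrite divr_gt0.
have rbm : rb < Num.min (rho / 2) r2 by rewrite /rb; lra.
have [rbR rbr] : rb < rho / 2 /\ rb < r2.
  by split; apply: lt_le_trans rbm _; rewrite ge_min lexx ?orbT.
have rb2 : rb / 2 < rb by lra.
have [tau Bt] := generator_bumps hpsi x0 rb2.
have s02 : `|slope b xi0| <= 2 by rewrite ler_norml; case/andP: s2 => ? ?; rewrite !ltW.
have d2 : 0 < r2 / 2 < r2 by apply/andP; split; lra.
(* The only use of [eps]: it makes the condition [p < 2 * k - 2] strict. *)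
have pk : 2 * m < 2 * (m + 1 + eps) - 2 by lra.
have r2le1 : r2 <= 1 by rewrite ge_min lexx orbT.
have HG2 a s t : 0 < a < r2 -> `|s - slope b xi0| < r2 -> `|t - x0| < r2 ->
    cabs (Gb b phi a s t) <= C * a `^ (m + 1 + eps).
  by move=> /andP[a0 ar] sr tr; apply: HG; [rewrite a0 (lt_le_trans ar)|exact: lt_le_trans sr _|exact: lt_le_trans tr _].
have iV := cone_L2_of_decay hpsi f_dist B HO rr r0 s02 r20 C0 r2le1 HG2 pk d2 Bt rb0 rbR rbr.
have tO : [set y | `|y - x0| <= rb] `<=` Omega.
  by move=> y /= h; apply: HO => /=; rewrite (le_trans h) // ltW // (lt_trans rbR).
have d0 : 0 < r2 / 2 by case/andP: d2.
have [eps' e'0 sub] := cone_sub_scone d0 r0.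
apply/(microlocallyP hpsi f_dist _ _ _); exists tau, eps'; split => //.
  by apply: (bump_cutoff Bt) => //; rewrite divr_gt0.
apply: (sobolev_of_coneV (bump_test Bt tO) xi00 e'0 sub); exact: iV.
Qed.

End Characterization.

(** * From decay of all orders to rapid decay *)

Section Converse.
Context {R : realType}.
Local Notation P := (R * R)%type.
Local Notation pl := (measurableTypeR R * measurableTypeR R)%type.
Variables (psi1 psi1h psi2 psi2h : R -> R[i]) (psi : P -> R[i]).
Hypothesis hpsi : shearlet_generator psi1 psi1h psi2 psi2h psi.
Variables (Omega : set P) (f : functional R).
Hypothesis Omega_open : open Omega.
Hypothesis f_dist : is_distribution Omega f.
Variable F : P -> functional R.
Hypothesis F_reading : shearlet_reading Omega f F.
Local Notation Gb := (Gb psi1h psi2h f).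
Local Notation Lambda := (Lambda psi Omega F).

(** Local constants and scale ranges are made uniform by the near-covering form of compactness on
    the box of slopes and points. *)
Lemma compact_decay (G : R -> R -> P -> R[i]) (k s0 r1 : R) (x0 : P) :
  (forall s x, `|s - s0| <= r1 -> `|x - x0| <= r1 -> exists r C : R, [/\ 0 < r, 0 <= C &
    forall a s' t, 0 < a < r -> `|s' - s| < r -> `|t - x| < r -> cabs (G a s' t) <= C * a `^ k]) ->
  exists a1 C : R, [/\ 0 < a1, 0 <= C &
    forall a s t, 0 < a < a1 -> `|s - s0| <= r1 -> `|t - x0| <= r1 -> cabs (G a s t) <= C * a `^ k].
Proof.
move=> H; pose K := `[s0 - r1, s0 + r1]%classic `*` [set x : P | `|x - x0| <= r1].
have cK : compact K.
  apply: compact_setX; first exact: segment_compact.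
  apply: (@subclosed_compact _ _ [set x : P | `|x| <= r1 + `|x0|]); [exact: closed_box|exact: compact_box|].
  by move=> x /= h; have := ler_normD (x - x0) x0; rewrite subrK; lra.
(* One parameter [M] bounds both the constant and the inverse of the scale range, so that the
   property holds for all large [M]. *)
pose Q (M : R) (st : R * P) := forall a, 0 < a -> a * M < 1 -> cabs (G a st.1 st.2) <= M * a `^ k.
have : \forall M \near +oo, K `<=` Q M.
  apply: (proj1 (compact_near_coveringP K) cK) => -[s x] [/=].
  rewrite in_itv /= -ler_distlC distrC => hs hx.
  have [r [C [r0 C0 Hr]]] := H s x hs hx.
  exists ([set st : R * P | `|st.1 - s| < r /\ `|st.2 - x| < r], [set M : R | C <= M /\ r^-1 <= M]) => /=.
    split; last first.
      by near=> M; split; near: M; apply: nbhs_pinfty_ge; rewrite num_real.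
    exists ([set s' | `|s' - s| < r], [set t | `|t - x| < r]) => /=.
      split; first by apply/nbhs_ballP; exists r => // y; rewrite /ball /= distrC.
      have nx (x' : P) : \forall t \near x', `|t - x'| < r by apply/nbhs_normP; exists r => // y /=; rewrite distrC.
      exact: (nx x).
    by move=> [u v].
  move=> [[s' t] M] /= [[h1 h2] [h3 h4]] a a0 aM.
  apply: le_trans (ler_wpM2r (powR_ge0 _ _) h3); apply: Hr => //; rewrite a0 /=.
  have M0 : 0 < M by apply: lt_le_trans h4; rewrite invr_gt0.
  have := ler_wpM2l (ltW a0) h4 => h; have : a / r < 1 by exact: le_lt_trans h aM.
  by rewrite ltr_pdivrMr // mul1r.
move=> [M0 [_ HM]]; pose M := Num.max M0 0 + 1.
have M1 : M0 < M by rewrite /M ltr_pwDr // le_max lexx.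
have Mp : 0 < M by rewrite /M ltr_wpDl // le_max lexx orbT.
exists M^-1, M; split; [by rewrite invr_gt0|exact: ltW|].
move=> a s t /andP[a0 aM] hs ht; apply: (HM M M1 (s, t)) => //.
  by split => //=; rewrite in_itv /= -ler_distlC distrC.
by rewrite -ltr_pdivlMr // mul1r.
Unshelve. all: by end_near. Qed.

(** The neighbourhood given by the interior serves every [k]; only the constant and the scale range
    depend on [k]. *)
Lemma Lambda_infty_uniform b x0 xi0 R0 R0' phi : Lambda_infty (Lambda b) (x0, xi0) ->
  bump x0 R0 R0' phi -> [set y | `|y - x0| <= R0'] `<=` Omega -> 0 < R0 -> R0 < R0' ->
  exists2 r1 : R, 0 < r1 <= 1 & forall k : nat, (0 < k)%N -> exists a1 C : R, [/\ 0 < a1, 0 <= C &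
    forall a s t, 0 < a < a1 -> `|s - slope b xi0| <= r1 -> `|t - x0| <= r1 ->
      cabs (Gb b phi a s t) <= C * a `^ k%:R].
Proof.
move=> HL B BO R00 RR; have HL1 := interior_subset HL 1%N isT.
move/LambdaP: HL1 => [_ r0 s2 _].
move: HL; rewrite /Lambda_infty /interior => -[[U V] /= [nU nV] UV].
move: nU nV => /nbhs_normP[e1 /= e10 HU] /nbhs_normP[e2 /= e20 HV].
pose r := (jb b xi0).1; set s0 := slope b xi0 in s2 *.
have r10 : 0 < `|r| + 1 by rewrite ltr_wpDl.
(* The entries keep [x] where [phi] is 1, [x] in [U], and the direction of slope [s] in [V], where a
   change of slope is multiplied by [|r|]. *)
pose r1 := Num.min (Num.min 1 (R0 / 2)) (Num.min (e1 / 2) (e2 / (2 * (`|r| + 1)))).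
have r1_gt0 : 0 < r1 by rewrite !lt_min ltr01 !divr_gt0 // mulr_gt0.
have [l1 l2 l3 l4] : [/\ r1 <= 1, r1 <= R0 / 2, r1 <= e1 / 2 & r1 <= e2 / (2 * (`|r| + 1))].
  by split; rewrite !ge_min lexx ?orbT.
exists r1; first by rewrite r1_gt0.
move=> k k0; apply: (compact_decay (G := Gb b phi)) => s x hs hx; apply: decays_box.
(* Slopes near that of [xi0] are realized with the first coordinate [r] of [jb b xi0] kept fixed. *)
have xi_norm : `|xi0 - jb b (r, r * s)| < e2.
  have -> : xi0 - jb b (r, r * s) = jb b (0, r * (s0 - s)).
    have rs0 : r * s0 = (jb b xi0).2 by rewrite /s0 /slope mulrC divfK.
    rewrite -[xi0](jbK b) -jbB -[jb b xi0 - _]/((jb b xi0).1 - r, (jb b xi0).2 - r * s).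
    by rewrite subrr mulrBr rs0.
  rewrite jb_norm norm_plane /= normr0 max_r // normrM distrC.
  apply: (@le_lt_trans _ _ (`|r| * (e2 / (2 * (`|r| + 1))))); first by rewrite ler_wpM2l // (le_trans hs).
  rewrite mulrA ltr_pdivrMr ?mulr_gt0 // mulrC ltr_pM2l //; have := normr_ge0 r; lra.
have xU : U x by apply: HU => /=; rewrite distrC; lra.
have := UV (x, jb b (r, r * s)) (conj xU (HV _ xi_norm)) k k0; move/LambdaP => [_ _].
have -> : slope b (jb b (r, r * s)) = s by rewrite /slope jbK /= mulrAC mulfV // mul1r.
move=> s22; have hxR : `|x - x0| < R0 by lra.
by move/(decays_SHb_Gb hpsi f_dist F_reading _ _ B BO RR hxR s22).
Qed.

Lemma Lambda_infty_not_WF b : Lambda_infty (Lambda b) `<=` phase_space Omega `\` WF Omega f.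
Proof.
move=> [x0 xi0] HL; have HL1 := interior_subset HL 1%N isT.
split; first exact: Lambda_phase_space HL1.
move=> [_ /= xi00]; apply; move/LambdaP: HL1 => [Ox r0 s2 _].
have [rho rho0 HO] := open_box Omega_open Ox.
have rr : rho / 2 < rho by lra.
have rho20 : 0 < rho / 2 by lra.
have [phi B] := generator_bumps hpsi x0 rr.
have [r2 /andP[r20 r2le1] unif] := Lambda_infty_uniform HL B HO rho20 rr.
pose m := Num.min (rho / 2) r2; pose rb := m / 2.
have m0 : 0 < m by rewrite lt_min r20 divr_gt0.
have rb0 : 0 < rb by rewrite divr_gt0.
have rbm : rb < m by rewrite /rb; lra.
have [rbR rbr] : rb < rho / 2 /\ rb < r2.
  by split; apply: lt_le_trans rbm _; rewrite ge_min lexx ?orbT.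
have rb2 : rb / 2 < rb by lra.
have [tau Bt] := generator_bumps hpsi x0 rb2.
(* A second, smaller cut-off, spent on the convolution that turns L^2 bounds into pointwise ones. *)
have rb4 : rb / 4 < rb / 2 by lra.
have [tau' Bt'] := generator_bumps hpsi x0 rb4.
have s02 : `|slope b xi0| <= 2 by rewrite ler_norml; case/andP: s2 => ? ?; rewrite !ltW.
have d2 : 0 < r2 / 2 < r2 by apply/andP; split; lra.
have iV n : (@leb2 R).-integrable setT (EFin \o (coneV (Phi f tau) b (jb b xi0).1 (slope b xi0) (r2 / 2) n%:R : pl -> R)).
  (* [k = n + 2] is positive and satisfies [n < 2 * k - 2]. *)
  have [//|a1 [C [a10 C0 HG]]] := unif n.+2.
  have pk : n%:R < 2 * n.+2%:R - 2 :> R.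
    by rewrite -addn2 natrD; have : (0 : R) <= n%:R by []; lra.
  have HG2 a s t : 0 < a < a1 -> `|s - slope b xi0| < r2 -> `|t - x0| < r2 ->
      cabs (Gb b phi a s t) <= C * a `^ n.+2%:R by move=> ? ? ?; apply: HG => //; exact: ltW.
  exact: (cone_L2_of_decay hpsi f_dist B HO rr r0 s02 a10 C0 r2le1 HG2 pk d2 Bt rb0 rbR rbr).
have tO : [set y | `|y - x0| <= rb] `<=` Omega.
  by move=> y /= h; apply: HO => /=; rewrite (le_trans h) // ltW // (lt_trans rbR).
have tO' : [set y | `|y - x0| <= rb / 2] `<=` Omega.
  by move=> y /= h; apply: tO => /=; rewrite (le_trans h) // ltW.
have d40 : 0 < r2 / 4 by lra.
have d42 : r2 / 4 < r2 / 2 by lra.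
have Hc := cone_rapid_of_L2 f_dist (bump_test Bt tO) (bump_smooth_cpt Bt') (bump_mul Bt Bt' (lexx _)) r0 d40 d42 iV.
have [eps' e'0 sub] := cone_sub_scone d40 r0.
apply/(microlocallyP hpsi f_dist _ _ _); exists tau', eps'; split => //.
  by apply: (bump_cutoff Bt') => //; rewrite divr_gt0.
(* The factor [2 ^+ N] passes from the maximum norm to the Euclidean norm of [rapid_decay]. *)
move=> N; have [C C0 HC] := Hc N; exists (2 ^+ N * C) => xi /sub hxi.
apply: le_trans (ler_wpM2l _ (HC xi hxi)); last exact: exprn_ge0.
rewrite mulrA -exprMn; apply: ler_wpM2r; first exact: cabs_ge0.
apply: ler_Xn; first by rewrite addr_ge0 ?enorm_ge0.
by have := enorm_le xi; lra.
Qed.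

End Converse.

Theorem theorem4 (R : realType)
    (psi1 psi1h psi2 psi2h : R -> R[i]) (psi : plane R -> R[i])
    (hpsi : shearlet_generator psi1 psi1h psi2 psi2h psi)
    (Omega : set (plane R)) (Omega_open : open Omega)
    (Omega_nonempty : Omega !=set0)
    (f : functional R) (f_dist : is_distribution Omega f)
    (f_real : real_valued Omega f)
    (F : plane R -> functional R) (F_reading : shearlet_reading Omega f F) :
  (forall m eps : R, 0 < eps ->
     Lambda1 psi Omega F (m + 1 + eps) `|` Lambda2 psi Omega F (m + 1 + eps)
       `<=` phase_space Omega `\` WFm m Omega f) /\
  phase_space Omega `\` WF Omega f =
    Lambda_infty (Lambda1 psi Omega F) `|` Lambda_infty (Lambda2 psi Omega F).
Proof.
split=> [m eps e0 p [H|H]|].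
- exact: (Lambda_not_WFm hpsi Omega_open f_dist F_reading (b := false) e0 H).
- exact: (Lambda_not_WFm hpsi Omega_open f_dist F_reading (b := true) e0 H).
apply/seteqP; split=> p.
  exact: (not_WF_Lambda_infty hpsi Omega_open f_dist F_reading f_real).
move=> [H|H].
- exact: (Lambda_infty_not_WF hpsi Omega_open f_dist F_reading (b := false) H).
- exact: (Lambda_infty_not_WF hpsi Omega_open f_dist F_reading (b := true) H).
Qed.
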